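(* For any $p\in[0,1]$, given a directed unweighted graph on $n$ vertices with shortest-path distances $D[u,v]$, one can compute for all pairs $u,v$ an estimate $D'[u,v]$ with $D[u,v]\le D'[u,v]\le D[u,v]+D[u,v]^p$ in time $\tilde{O}\left(\max_{1\le \ell\le n} \mathcal{M}^\star(n,n/\ell,n\mid \ell^{1-p})\right)$.
   Context: Word-RAM model with $O(\log n)$-bit words. $\mathcal{M}^\star(n_1,n_2,n_3\mid M)$ denotes the (best) running time for computing the Min-Plus product $C[i,j]=\min_k(A[i,k]+B[k,j])$ of an $n_1\times n_2$ matrix $A$ and an $n_2\times n_3$ matrix $B$ whose integer entries lie in $\{0,\dots,M\}$. $\tilde{O}$ hides polylogarithmic factors. *)

(* Defs.v *)
From HB Require Import structures.
From mathcomp Require Import all_boot all_order all_algebra.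
From mathcomp Require Import reals exp.

Set Implicit Arguments.
Unset Strict Implicit.
Unset Printing Implicit Defensive.

(** * Word RAM

   A program is a structured program over finitely many registers and a
   random-access memory; every executed instruction or test costs one step.
   Cells hold natural numbers, and [exec] requires every value produced and
   every address used to be smaller than 2 ^ w, where w is the word length: a
   run that overflows a word is not a run.  (Wrap-around arithmetic can be
   programmed explicitly.) *)

Inductive binop :=
  | Add | Sub | Mul | Div | Mod
  | BitAnd | BitOr | BitXor | ShiftL | ShiftR
  | Less | Equal.

(* [Sub] is truncated, division by 0 gives 0, comparisons give 0 or 1. *)
Definition binop_eval (o : binop) (a b : nat) : nat :=
  match o with
  | Add => a + b
  | Sub => a - b
  | Mul => a * b
  | Div => a %/ b
  | Mod => a %% b
  | BitAnd => Nat.land a b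
  | BitOr => Nat.lor a b
  | BitXor => Nat.lxor a b
  | ShiftL => a * 2 ^ b
  | ShiftR => a %/ 2 ^ b
  | Less => a < b
  | Equal => a == b
  end.

Inductive program :=
  | Skip
  | Const (x a : nat)                (* r_x := a *)
  | Op (o : binop) (x y z : nat)     (* r_x := r_y o r_z *)
  | Read (x y : nat)                 (* r_x := memory[r_y] *)
  | Write (x y : nat)                (* memory[r_x] := r_y *)
  | Seq (c1 c2 : program)
  | If (x : nat) (c1 c2 : program)   (* tests r_x <> 0 *)
  | While (x : nat) (c : program).   (* tests r_x <> 0 *)

Record state := State { reg : nat -> nat; memory : nat -> nat }.

Definition update (f : nat -> nat) (x a : nat) : nat -> nat :=
  fun y => if y == x then a else f y.

Definition set_reg (s : state) (x a : nat) : state :=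
  State (update (reg s) x a) (memory s).

Definition set_mem (s : state) (x a : nat) : state :=
  State (reg s) (update (memory s) x a).

(* [exec w c s t s']: with words of w bits, the program c started in state s
   halts in state s' after t steps. *)
Inductive exec (w : nat) : program -> state -> nat -> state -> Prop :=
  | exec_skip s :
      exec w Skip s 1 s
  | exec_const s x a :
      a < 2 ^ w ->
      exec w (Const x a) s 1 (set_reg s x a)
  | exec_op s o x y z :
      binop_eval o (reg s y) (reg s z) < 2 ^ w ->
      exec w (Op o x y z) s 1
        (set_reg s x (binop_eval o (reg s y) (reg s z)))
  | exec_read s x y :
      reg s y < 2 ^ w -> memory s (reg s y) < 2 ^ w ->
      exec w (Read x y) s 1 (set_reg s x (memory s (reg s y)))
  | exec_write s x y :
      reg s x < 2 ^ w -> reg s y < 2 ^ w ->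
      exec w (Write x y) s 1 (set_mem s (reg s x) (reg s y))
  | exec_seq s s1 s2 c1 c2 t1 t2 :
      exec w c1 s t1 s1 -> exec w c2 s1 t2 s2 ->
      exec w (Seq c1 c2) s (t1 + t2) s2
  | exec_if_true s s' x c1 c2 t :
      reg s x != 0 -> exec w c1 s t s' ->
      exec w (If x c1 c2) s t.+1 s'
  | exec_if_false s s' x c1 c2 t :
      reg s x = 0 -> exec w c2 s t s' ->
      exec w (If x c1 c2) s t.+1 s'
  | exec_while_true s s1 s2 x c t1 t2 :
      reg s x != 0 -> exec w c s t1 s1 -> exec w (While x c) s1 t2 s2 ->
      exec w (While x c) s (t1 + t2).+1 s2
  | exec_while_false s x c :
      reg s x = 0 ->
      exec w (While x c) s 1 s.

(* All registers and cells beyond the input contain 0. *)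
Definition initial (regs data : seq nat) : state :=
  State (nth 0 regs) (nth 0 data).

Definition row_major (m n : nat) (A : 'M[nat]_(m, n)) : seq nat :=
  [seq A i j | i <- enum 'I_m, j <- enum 'I_n].

(* c * (floor(log2 N) + 1): words of O(log N) bits. *)
Definition word_length (c N : nat) : nat := c * (trunc_log 2 N).+1.

(** * Soft O *)

(* The factor (floor(log2 n) + 1) ^ k is a polylogarithm that does not vanish
   at n = 1. *)
Definition soft_bigO (f g : nat -> nat) : Prop :=
  exists C k : nat,
    forall n : nat, 0 < n -> f n <= C * (trunc_log 2 n).+1 ^ k * g n.

(** * Min-Plus product *)

Definition is_minplus (n1 n2 n3 : nat)
    (A : 'M[nat]_(n1, n2)) (B : 'M[nat]_(n2, n3)) (C : 'M[nat]_(n1, n3)) :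
    Prop :=
  forall i j, (exists k, C i j = A i k + B k j) /\
              (forall k, C i j <= A i k + B k j).

Definition entries_le (m n : nat) (A : 'M[nat]_(m, n)) (M : nat) : Prop :=
  forall i j, A i j <= M.

(* P computes Min-Plus products, and T n1 n2 n3 M bounds its running time on
   inputs of dimensions n1 * n2 and n2 * n3 with entries in {0, ..., M}.
   P receives n1, n2, n3 in registers 0, 1, 2 and A, B (row-major,
   consecutively) in memory from address 0; it leaves the product, row-major,
   right after B.  M is not part of the input (it can be replaced by the
   largest entry, found while reading the input), so the worst-case running
   time is nondecreasing in M. *)
Definition minplus_in_time (P : program) (T : nat -> nat -> nat -> nat -> nat) :
    Prop :=
  exists c : nat,
    forall (n1 n2 n3 M : nat) (A : 'M[nat]_(n1, n2)) (B : 'M[nat]_(n2, n3)),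
      0 < n1 -> 0 < n2 -> 0 < n3 -> entries_le A M -> entries_le B M ->
      exists (t : nat) (s : state) (C : 'M[nat]_(n1, n3)),
        [/\ exec (word_length c (n1 + n2 + n3 + M)) P
              (initial [:: n1; n2; n3] (row_major A ++ row_major B)) t s,
            t <= T n1 n2 n3 M,
            is_minplus A B C &
            forall (i : 'I_n1) (j : 'I_n3),
              memory s (n1 * n2 + n2 * n3 + i * n3 + j) = C i j].

(** * Approximate all-pairs shortest paths *)

Definition walk (n : nat) (e : rel 'I_n) (u v : 'I_n) (k : nat) : bool :=
  [exists q : k.-tuple 'I_n, path e u q && (last u q == v)].

Lemma connect_walk (n : nat) (e : rel 'I_n) (u v : 'I_n) :
  connect e u v -> exists k, walk e u v k.
Proof.
case/connectP => q eq ->; exists (size q).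
by apply/existsP; exists (in_tuple q); rewrite /= eq eqxx.
Qed.

(* None stands for an infinite distance. *)
Definition dist (n : nat) (e : rel 'I_n) (u v : 'I_n) : option nat :=
  match @idP (connect e u v) with
  | ReflectT h => Some (ex_minn (connect_walk h))
  | ReflectF _ => None
  end.

Definition adjacency (n : nat) (e : rel 'I_n) : 'M[nat]_n :=
  (\matrix_(i, j) nat_of_bool (e i j))%R.

(* D <= D' <= D + D ^ p in the extended reals; 0 `^ 0 = 1. *)
Definition good_estimate (R : realType) (p : R) (d d' : option nat) : Prop :=
  match d, d' with
  | Some a, Some b => a <= b /\ (b%:R <= a%:R + a%:R `^ p :> R)%R
  | None, None => True
  | _, _ => False
  end.

Definition encode (d : option nat) : nat := if d is Some a then a.+1 else 0.

(* Q estimates the distances of every directed graph on n vertices within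
   F n steps.  It receives n and the integer part of p * n in registers 0
   and 1, and the adjacency matrix (row-major) in memory from address 0; it
   leaves the encoded estimates, row-major, right after it.  The word
   floor(p * n) gives the real parameter p to the precision of a word, as a
   program contains only finitely many constants and p need not be
   computable. *)
Definition approx_apsp_in_time (R : realType) (p : R) (Q : program)
    (F : nat -> nat) : Prop :=
  exists c : nat,
    forall (n : nat) (e : rel 'I_n), 0 < n ->
      exists (t : nat) (s : state) (D' : 'I_n -> 'I_n -> option nat),
        [/\ exec (word_length c n) Q
              (initial [:: n; Num.truncn (p * n%:R)%R]
                       (row_major (adjacency e))) t s,
            t <= F n,
            forall u v, good_estimate p (dist e u v) (D' u v) &
            forall u v : 'I_n, memory s (n * n + u * n + v) = encode (D' u v)].

(* Main.v *)
(* For every scale 2 ^ i, a set S_i of about n / 2 ^ i sources meets every shortest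
   path of length at least 2 ^ (i + 1) within its first 2 ^ i - 1 steps. The
   distances below 2 ^ (i + 2) from and to S_i are found exactly by doubling, with
   boolean products (Min-Plus products with l = 1). For a path of length D in
   [2 ^ (i + 1), 2 ^ (i + 2)), D is then a Min-Plus product, through S_i, of the
   lengths of two legs. Rounding the legs up to multiples of 2 ^ (e - 1), where
   e = floor (i * floor (p n) / n), costs less than 2 ^ e <= D ^ p, and the rounded
   legs are cut into 65 windows of about 2 ^ (i (1 - p)) values, so that the entries
   are at most l ^ (1 - p) for l = 2 ^ i; the sources are taken in blocks of n / l.

   S_(i+1) hits segments of length 2 ^ i between nearby sources; everything is
   deterministic. The vertices of the segments are witnesses of boolean products.
   A witness is read off bit by bit when it is isolated among the candidates by its
   residue modulo a prime of polylogarithmic size; the other pairs have many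
   candidates, so that few residue classes meet all of them, and restricting the
   list of candidates to these classes halves it.

   The claimed bound is at least n ^ 2, as on matrices of ones the given program has
   to write n ^ 2 cells; this pays for reading, copying and padding matrices. *)

Require Import Defs.
From mathcomp Require Import all_boot all_order all_algebra.
From mathcomp Require Import reals exp.
From mathcomp Require Import zify.
From mathcomp Require boolp.
From Stdlib Require PeanoNat.

Set Implicit Arguments.
Unset Strict Implicit.
Unset Printing Implicit Defensive.

(** * Runs of the word RAM *)

(** [Mstar] is known only to bound the running time of [P], so its values at different arguments
    cannot be compared: every call must have exactly one of the shapes [n], [n %/ l], [n] with the
    entry bound belonging to [l]. This is why larger boolean products are cut into [n] by [n]
    batches. [P] is a black box that expects zero registers and zero memory and may leave anything
    behind. It runs relocated in a window of addresses; each call gets a new window, since clearing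
    an old one would take longer than the claimed time. The constant 65 is 64 + 1. With [e] in place
    of [i p], the exponent is known up to 2, which costs a factor 4; a value outside every window
    must be representable, which costs 2; two legs are rounded, so the unit is halved, which costs
    2; legs are shorter than [4 * 2 ^ i], which costs 4. Rounding up may enter one further window.
    Values are bounded by one cap, a power of [n + 1] with a huge exponent, and running times by a
    power of the logarithm times the claimed maximum; no attempt is made to keep these exponents
    small. *)

Definition runs (w : nat) (c : program) (s : state) (T : nat)
    (Q : state -> Prop) : Prop :=
  exists t s', [/\ exec w c s t s', t <= T & Q s'].

Lemma runs_weaken w c s T T' (Q Q' : state -> Prop) :
  runs w c s T Q -> T <= T' -> (forall s', Q s' -> Q' s') -> runs w c s T' Q'.
Proof.
case=> t [s' [h1 h2 h3]] hT hQ; exists t, s'; split=> //; last exact: hQ.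
exact: leq_trans h2 hT.
Qed.

Lemma runs_seq w c1 c2 s T1 T2 (Q1 Q : state -> Prop) :
  runs w c1 s T1 Q1 -> (forall s1, Q1 s1 -> runs w c2 s1 T2 Q) ->
  runs w (Seq c1 c2) s (T1 + T2) Q.
Proof.
case=> t1 [s1 [h1 ht1 hq1]] /(_ _ hq1) [t2 [s2 [h2 ht2 hq2]]].
exists (t1 + t2), s2; split=> //; [exact: exec_seq h1 h2 | exact: leq_add].
Qed.

Lemma runs_const w s x a (Q : state -> Prop) :
  a < 2 ^ w -> Q (set_reg s x a) -> runs w (Const x a) s 1 Q.
Proof. by move=> h q; exists 1, (set_reg s x a); split=> //; constructor. Qed.

Lemma runs_op w s o x y z (Q : state -> Prop) :
  binop_eval o (reg s y) (reg s z) < 2 ^ w ->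
  Q (set_reg s x (binop_eval o (reg s y) (reg s z))) ->
  runs w (Op o x y z) s 1 Q.
Proof.
move=> h q; exists 1, (set_reg s x (binop_eval o (reg s y) (reg s z))).
by split=> //; constructor.
Qed.

(** There is no copy instruction. The bitwise conjunction of a word with itself copies it without a
    scratch register and without any risk of overflow. *)
Definition Move (x y : nat) : program := Op BitAnd x y y.

Lemma runs_move w s x y (Q : state -> Prop) :
  reg s y < 2 ^ w -> Q (set_reg s x (reg s y)) -> runs w (Move x y) s 1 Q.
Proof.
by move=> h q; apply: runs_op; rewrite /= PeanoNat.Nat.land_diag.
Qed.

Lemma runs_read w s x y (Q : state -> Prop) :
  reg s y < 2 ^ w -> memory s (reg s y) < 2 ^ w ->
  Q (set_reg s x (memory s (reg s y))) -> runs w (Read x y) s 1 Q.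
Proof.
move=> h1 h2 q; exists 1, (set_reg s x (memory s (reg s y))).
by split=> //; constructor.
Qed.

Lemma runs_write w s x y (Q : state -> Prop) :
  reg s x < 2 ^ w -> reg s y < 2 ^ w ->
  Q (set_mem s (reg s x) (reg s y)) -> runs w (Write x y) s 1 Q.
Proof.
move=> h1 h2 q; exists 1, (set_mem s (reg s x) (reg s y)).
by split=> //; constructor.
Qed.

Lemma runs_skip w s (Q : state -> Prop) : Q s -> runs w Skip s 1 Q.
Proof. by move=> q; exists 1, s; split=> //; constructor. Qed.

Lemma runs_if w s x c1 c2 T (Q : state -> Prop) :
  (reg s x != 0 -> runs w c1 s T Q) -> (reg s x = 0 -> runs w c2 s T Q) ->
  runs w (If x c1 c2) s T.+1 Q.
Proof.
move=> h1 h2; case: (reg s x =P 0) => [h|/eqP h].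
  have [t [s' [he ht hq]]] := h2 h.
  by exists t.+1, s'; split=> //; apply: exec_if_false.
have [t [s' [he ht hq]]] := h1 h.
by exists t.+1, s'; split=> //; apply: exec_if_true.
Qed.

(** * A language with arrays, bounded loops and calls of a given program *)

(** Each of these operations has a value polynomial in its operands, so that the value of a fixed
    expression stays below a fixed power of the cap; a left shift would break this. *)
Inductive bop := BAdd | BSub | BMul | BDiv | BMod | BLt | BEq.

Definition binop_of (o : bop) : binop :=
  match o with
  | BAdd => Defs.Add | BSub => Defs.Sub | BMul => Defs.Mul | BDiv => Defs.Div | BMod => Defs.Mod
  | BLt => Less | BEq => Equal
  end.

Inductive expr :=
  | EVar (x : nat)
  | ENum (a : nat)
  | EBin (o : bop) (e1 e2 : expr)
  | EArr (a : nat) (e1 e2 e3 : expr).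

(* [pm] is the private memory of the called program. *)
Record mstate := MState {
  vr : nat -> nat;
  ar : nat -> nat -> nat -> nat -> nat;
  pm : nat -> nat }.

Fixpoint ev (e : expr) (s : mstate) : nat :=
  match e with
  | EVar x => vr s x
  | ENum a => a
  | EBin o e1 e2 => binop_eval (binop_of o) (ev e1 s) (ev e2 s)
  | EArr a e1 e2 e3 => ar s a (ev e1 s) (ev e2 s) (ev e3 s)
  end.

Inductive cmd :=
  | Nop
  | Asg (x : nat) (e : expr)
  | Sto (a : nat) (e1 e2 e3 e : expr)
  | Then (c1 c2 : cmd)
  | Ife (e : expr) (c1 c2 : cmd)
  | For (x y : nat) (c : cmd)        (* for r_x := 0, ..., r_y - 1 *)
  | Fresh
  | Poke (e1 e2 : expr)
  | Peek (x : nat) (e : expr)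
  | RunP (x y z : nat).              (* with r_x, r_y, r_z in registers 0, 1, 2 *)

Definition setv (s : mstate) (x v : nat) : mstate :=
  MState (update (vr s) x v) (ar s) (pm s).

Definition upd4 (f : nat -> nat -> nat -> nat -> nat) (a i j k v : nat) :=
  fun a' i' j' k' =>
    if [&& a' == a, i' == i, j' == j & k' == k] then v else f a' i' j' k'.

Definition seta (s : mstate) (a i j k v : nat) : mstate :=
  MState (vr s) (upd4 (ar s) a i j k v) (pm s).

Definition setp (s : mstate) (f : nat -> nat) : mstate :=
  MState (vr s) (ar s) f.

Fixpoint loop (f : nat -> mstate -> nat -> mstate -> Prop) (k m : nat)
    (s : mstate) (t : nat) (s' : mstate) : Prop :=
  if m is m'.+1 then
    exists t1 s1 t2, [/\ f k s t1 s1, loop f k.+1 m' s1 t2 s' & t = (t1 + t2).+1]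
  else s' = s /\ t = 1.

Section Language.

Variables (P : program) (C WP : nat).

(** Every stored value is cut off at [C]. Well-formedness is then preserved by all commands and
    overflow is excluded once and for all; the Hoare rules later show that the cap does not act on
    values that matter. [WP] bounds the addresses which the called program can use. *)
Fixpoint mexec (c : cmd) (s : mstate) (t : nat) (s' : mstate) : Prop :=
  match c with
  | Nop => s' = s /\ t = 1
  | Asg x e => s' = setv s x (minn (ev e s) C) /\ t = 1
  | Sto a e1 e2 e3 e =>
      s' = seta s a (ev e1 s) (ev e2 s) (ev e3 s) (minn (ev e s) C) /\ t = 1
  | Then c1 c2 =>
      exists t1 s1 t2, [/\ mexec c1 s t1 s1, mexec c2 s1 t2 s' & t = t1 + t2]
  | Ife e c1 c2 =>
      exists t1, t = t1.+1 /\
        if ev e s != 0 then mexec c1 s t1 s' else mexec c2 s t1 s'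
  | For x y c => loop (fun k s => mexec c (setv s x k)) 0 (vr s y) s t s'
  | Fresh => s' = setp s (fun _ => 0) /\ t = 1
  | Poke e1 e2 => s' = setp s (update (pm s) (ev e1 s) (minn (ev e2 s) C)) /\ t = 1
  | Peek x e => s' = setv s x (minn (pm s (ev e s)) C) /\ t = 1
  | RunP x y z =>
      exists w t1 st,
        [/\ 2 ^ w <= WP,
            exec w P (State (nth 0 [:: vr s x; vr s y; vr s z]) (pm s)) t1 st,
            s' = setp s (memory st) & t = t1.+1]
  end.

Definition wf (s : mstate) : Prop :=
  (forall x, vr s x <= C) /\ (forall a i j k, ar s a i j k <= C).

Lemma wf_setv s x v : wf s -> v <= C -> wf (setv s x v).
Proof. by case=> h1 h2 hv; split=> //= y; rewrite /update; case: eqP. Qed.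

Lemma wf_seta s a i j k v : wf s -> v <= C -> wf (seta s a i j k v).
Proof.
by case=> h1 h2 hv; split=> //= a' i' j' k'; rewrite /upd4; case: ifP.
Qed.

Lemma mexec_wf c s t s' : wf s -> mexec c s t s' -> wf s'.
Proof.
move=> hs; elim: c s t s' hs =>
  [|x e|a e1 e2 e3 e|c1 IH1 c2 IH2|e c1 IH1 c2 IH2|x y c IH| |e1 e2|x e|x y z] s t s' hs /=.
- by case=> ->.
- by case=> -> _; apply: wf_setv => //; rewrite geq_minr.
- by case=> -> _; apply: wf_seta => //; rewrite geq_minr.
- by case=> t1 [s1 [t2 [h1 h2 _]]]; apply: IH2 h2; apply: IH1 h1.
- by case=> t1 [_]; case: ifP => _; [apply: IH1 | apply: IH2].
- have : 0 + vr s y <= C by rewrite add0n; case: hs.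
  move: (vr s y) => m; elim: m 0 s t hs => [|m IHm] k s t hs hk /=; first by case=> ->.
  case=> t1 [s1 [t2 [h1 h2 _]]].
  apply: IHm h2; last by rewrite addSnnS.
  apply: IH h1; apply: wf_setv => //; apply: leq_trans hk; exact: leq_addr.
- by case=> -> _.
- by case=> -> _.
- by case=> -> _; apply: wf_setv => //; rewrite geq_minr.
- by case=> w [t1 [st [_ _ -> _]]].
Qed.

End Language.

(** * Compilation *)

(** Registers are separated by residue modulo 3: variables of the language, registers of the called
    program, temporaries. Temporaries 0 to 3 hold the cap, the base of the array addresses, the
    offset of the private memory and its size; temporary 4 serves the relocated program, and the
    evaluation stack starts at 5. *)
Definition rV (x : nat) := 3 * x.
Definition rP (x : nat) := 3 * x + 1.
Definition rT (x : nat) := 3 * x + 2.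

Lemma update_same f x a : update f x a x = a.
Proof. by rewrite /update eqxx. Qed.

Lemma update_other f x y a : y != x -> update f x a y = f y.
Proof. by rewrite /update => /negbTE ->. Qed.

Ltac reg_neq :=
  match goal with H : is_true _ |- _ => idtac | _ => idtac end;
  rewrite /rV /rP /rT; lia.

(** * Relocation of the called program into its own registers and a window of memory *)

Fixpoint rename (c : program) : program :=
  match c with
  | Skip => Skip
  | Const x a => Const (rP x) a
  | Op o x y z => Op o (rP x) (rP y) (rP z)
  | Read x y => Seq (Op Defs.Add (rT 4) (rT 2) (rP y)) (Read (rP x) (rT 4))
  | Write x y => Seq (Op Defs.Add (rT 4) (rT 2) (rP x)) (Write (rT 4) (rP y))
  | Seq c1 c2 => Seq (rename c1) (rename c2)
  | If x c1 c2 => If (rP x) (rename c1) (rename c2)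
  | While x c => While (rP x) (rename c)
  end.

Fixpoint regs_below (N : nat) (c : program) : bool :=
  match c with
  | Skip => true
  | Const x a => x < N
  | Op o x y z => [&& x < N, y < N & z < N]
  | Read x y | Write x y => (x < N) && (y < N)
  | Seq c1 c2 => regs_below N c1 && regs_below N c2
  | If x c1 c2 => [&& x < N, regs_below N c1 & regs_below N c2]
  | While x c => (x < N) && regs_below N c
  end.

Lemma regs_below_leq M N c : M <= N -> regs_below M c -> regs_below N c.
Proof.
move=> h; elim: c => //=; try by [move=> *; lia];
  by move=> *; do ?[match goal with
    H : is_true (_ && _) |- _ => case/andP: H => ? ? end]; apply/and3P || apply/andP;
    split; try lia; auto; apply/andP; split; auto.
Qed.

Lemma regs_below_ex c : exists N, regs_below N c.
Proof.
elim: c => [|x a|o x y z|x y|x y|c1 [N1 h1] c2 [N2 h2]|x c1 [N1 h1] c2 [N2 h2]|x c [N h]] /=.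
- by exists 0.
- by exists x.+1.
- by exists (x + y + z).+1; lia.
- by exists (x + y).+1; lia.
- by exists (x + y).+1; lia.
- exists (N1 + N2); rewrite (regs_below_leq _ h1) ?leq_addr //.
  by rewrite (regs_below_leq _ h2) ?leq_addl.
- exists (N1 + N2 + x.+1).
  rewrite (regs_below_leq _ h1) ?(regs_below_leq _ h2); lia.
- by exists (N + x.+1); rewrite (regs_below_leq _ h) ?leq_addr // andbT; lia.
Qed.

Section Rename.

Variables (N off Zp : nat).

Definition sim (s st : state) : Prop :=
  [/\ forall x, x < N -> reg st (rP x) = reg s x,
      forall k, k < Zp -> memory st (off + k) = memory s k &
      reg st (rT 2) = off].

Definition outside (st st' : state) : Prop :=
  (forall y, y != rT 4 -> (forall x, y != rP x) -> reg st' y = reg st y) /\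
  (forall k, ~~ (off <= k < off + Zp) -> memory st' k = memory st k).

Lemma sim_set_reg s st x a :
  sim s st -> sim (set_reg s x a) (set_reg st (rP x) a).
Proof.
case=> h1 h2 h3; split=> //=.
  move=> y hy; rewrite /update h1 //; congr (if _ then _ else _).
  by rewrite /rP; lia.
by rewrite update_other // /rT /rP; lia.
Qed.

(** A memory access becomes two instructions, whence the factor 2. The rules of [exec] themselves
    bound every address by [2 ^ w <= Zp], so the relocated run cannot leave its window. *)
Lemma rename_exec w w' c s t s' st :
  exec w c s t s' -> regs_below N c -> w <= w' -> 2 ^ w <= Zp ->
  off + Zp <= 2 ^ w' -> sim s st ->
  runs w' (rename c) st (2 * t) (fun st' => sim s' st' /\ outside st st').
Proof.
move=> he hN hw hZ hoff; have W a : a < 2 ^ w -> a < 2 ^ w'.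
  by move=> h; apply: leq_trans h _; rewrite leq_exp2l.
elim: he st hN => {c s t s'} /=.
- by move=> s st _ hs; exists 1, st; split=> //; constructor.
- move=> s x a ha st hx hs; exists 1, (set_reg st (rP x) a).
  split=> //; first by constructor; apply: W.
  split; first exact: sim_set_reg.
  by split=> // y _ /(_ x) hy /=; rewrite update_other.
- move=> s o x y z ho st /and3P[hx hy hz] hs; have [h1 h2 h3] := hs.
  exists 1, (set_reg st (rP x) (binop_eval o (reg s y) (reg s z))).
  rewrite -!h1 // in ho *; split=> //; first by constructor; apply: W.
  split; first exact: sim_set_reg.
  by split=> // r _ /(_ x) hr /=; rewrite update_other.
- move=> s x y hy hm st /andP[hx hy'] hs; have [h1 h2 h3] := hs.
  apply: (runs_weaken (T := 1 + 1) (Q := fun st' =>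
    st' = set_reg (set_reg st (rT 4) (off + reg s y)) (rP x) (memory s (reg s y)))) => //.
    apply: (runs_seq (Q1 := fun st' => st' = set_reg st (rT 4) (off + reg s y))).
      apply: runs_op; rewrite /= h3 h1 //; apply: leq_trans hoff.
      by rewrite ltn_add2l; apply: leq_trans hZ.
    have hyZ : reg s y < Zp by apply: leq_trans hZ.
    move=> _ ->; apply: runs_read; rewrite /= update_same ?(h2 _ hyZ) //.
      by apply: leq_trans hoff; rewrite ltn_add2l.
    exact: W.
  move=> _ ->; split.
    apply: sim_set_reg; split=> //.
    by move=> z hz; rewrite [reg _ _]update_other ?h1 // /rP /rT; lia.
  by split=> // r hr /(_ x) hr' /=; rewrite !update_other.
- move=> s x y hx hy st /andP[hx' hy'] hs; have [h1 h2 h3] := hs.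
  apply: (runs_weaken (T := 1 + 1) (Q := fun st' =>
    st' = set_mem (set_reg st (rT 4) (off + reg s x)) (off + reg s x) (reg s y))) => //.
    apply: (runs_seq (Q1 := fun st' => st' = set_reg st (rT 4) (off + reg s x))).
      apply: runs_op; rewrite /= h3 h1 //; apply: leq_trans hoff.
      by rewrite ltn_add2l; apply: leq_trans hZ.
    move=> _ ->; have e : reg (set_reg st (rT 4) (off + reg s x)) (rP y) = reg s y.
      by rewrite /= update_other ?h1 // /rP /rT; lia.
    apply: runs_write; rewrite ?e ?[reg _ (rT 4)]update_same //.
    + by apply: leq_trans hoff; rewrite ltn_add2l; apply: leq_trans hZ.
    + by apply: W.
  have hxZ : reg s x < Zp by apply: leq_trans hZ.
  move=> _ ->; split.
    split=> /=.
    + by move=> z hz; rewrite update_other ?h1 // /rP /rT; lia.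
    + by move=> k hk; rewrite /update eqn_add2l h2.
    + by [].
  split=> [r hr _|k hk] /=; rewrite update_other //.
  by apply: contraNneq hk => ->; rewrite leq_addr ltn_add2l hxZ.
- move=> s s1 s2 c1 c2 t1 t2 _ IH1 _ IH2 st /andP[hc1 hc2] hs.
  rewrite mulnDr; apply: runs_seq (IH1 _ hc1 hs) _ => st1 [hs1 [o1 o2]].
  apply: runs_weaken (IH2 _ hc2 hs1) _ _ => // st2 [hs2 [o3 o4]]; split=> //.
  by split=> [y hy hy'|k hk]; [rewrite o3 ?o1 | rewrite o4 ?o2].
- move=> s s' x c1 c2 t hx _ IH st /and3P[hxN hc1 hc2] hs.
  apply: (runs_weaken (T := (2 * t).+1)); [|lia|by move=> ? h; exact: h].
  by apply: runs_if => h; [apply: IH | move: hx; case: hs h => -> // _ _ ->].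
- move=> s s' x c1 c2 t hx _ IH st /and3P[hxN hc1 hc2] hs.
  apply: (runs_weaken (T := (2 * t).+1)); [|lia|by move=> ? h; exact: h].
  by apply: runs_if => h; [move: h; case: hs => -> //; rewrite hx | apply: IH].
- move=> s s1 s2 x c t1 t2 hx _ IH1 _ IH2 st hc hs; have /andP[hxN hc'] := hc.
  have [u1 [st1 [e1 hu1 [hs1 [o1 o2]]]]] := IH1 _ hc' hs.
  have [u2 [st2 [e2 hu2 [hs2 [o3 o4]]]]] := IH2 _ hc hs1.
  exists (u1 + u2).+1, st2; split; [| lia |].
    by apply: exec_while_true e1 e2; case: hs => ->.
  split=> //.
  by split=> [y hy hy'|k hk]; [rewrite o3 ?o1 | rewrite o4 ?o2].
- move=> s x c hx st /andP[hxN hc] hs; exists 1, st; split=> //.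
  by apply: exec_while_false; case: hs => ->.
Qed.

End Rename.

(** Exponent of the cap in [ev_bound]. A numeral [a] counts [a.+1] because [a < C ^ a] as soon as
    [C] is at least 2. *)
Fixpoint weight (e : expr) : nat :=
  match e with
  | EVar _ => 1
  | ENum a => a.+1
  | EBin _ e1 e2 => weight e1 + weight e2 + 1
  | EArr _ e1 e2 e3 => weight e1 + weight e2 + weight e3 + 1
  end.

Fixpoint arrays (e : expr) : nat :=
  match e with
  | EVar _ | ENum _ => 0
  | EBin _ e1 e2 => arrays e1 + arrays e2
  | EArr a e1 e2 e3 => a.+1 + arrays e1 + arrays e2 + arrays e3
  end.

Fixpoint esteps (e : expr) : nat :=
  match e with
  | EVar _ | ENum _ => 1
  | EBin _ e1 e2 => esteps e1 + (esteps e2 + 1)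
  | EArr _ e1 e2 e3 => esteps e1 + (esteps e2 + (esteps e3 + 8))
  end.

Lemma ev_bound C e s : 1 < C -> wf C s -> ev e s <= C ^ weight e.
Proof.
move=> hC hs; have hp k : 0 < C ^ k by rewrite expn_gt0 ltnW.
elim: e => [x|a|o e1 IH1 e2 IH2|a e1 _ e2 _ e3 _] /=.
- by rewrite expn1; case: hs.
- by apply: leq_trans (ltnW (ltn_expl a hC)) _; rewrite leq_exp2l.
- rewrite !expnD expn1.
  have h1 : ev e1 s <= C ^ weight e1 * C ^ weight e2.
    by apply: leq_trans IH1 _; rewrite leq_pmulr.
  have h2 : ev e2 s <= C ^ weight e1 * C ^ weight e2.
    by apply: leq_trans IH2 _; rewrite leq_pmull.
  have h3 := leq_mul IH1 IH2; have h4 := hp (weight e1); have h5 := hp (weight e2).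
  have h6 : C ^ weight e1 * C ^ weight e2 * 2 <= C ^ weight e1 * C ^ weight e2 * C.
    by rewrite leq_mul2l hC orbT.
  have h7 : 0 < C ^ weight e1 * C ^ weight e2 by rewrite muln_gt0 h4 h5.
  case: o => /=.
  + by lia.
  + by lia.
  + by lia.
  + by have := leq_div (ev e1 s) (ev e2 s); lia.
  + by have := leq_mod (ev e1 s) (ev e2 s); lia.
  + by case: (_ < _); lia.
  + by case: (_ == _); lia.
- apply: leq_trans (_ : C <= _); first by case: hs.
  by rewrite -[X in X <= _]expn1 leq_exp2l // addn1.
Qed.

Fixpoint cweight (c : cmd) : nat :=
  match c with
  | Nop | Fresh | RunP _ _ _ => 0
  | Asg _ e | Peek _ e => weight e
  | Sto _ e1 e2 e3 e => weight e1 + weight e2 + weight e3 + weight e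
  | Then c1 c2 => cweight c1 + cweight c2
  | Ife e c1 c2 => weight e + cweight c1 + cweight c2
  | For _ _ c => cweight c
  | Poke e1 e2 => weight e1 + weight e2
  end.

Fixpoint carrays (c : cmd) : nat :=
  match c with
  | Nop | Fresh | RunP _ _ _ => 0
  | Asg _ e | Peek _ e => arrays e
  | Sto a e1 e2 e3 e => a.+1 + arrays e1 + arrays e2 + arrays e3 + arrays e
  | Then c1 c2 => carrays c1 + carrays c2
  | Ife e c1 c2 => arrays e + carrays c1 + carrays c2
  | For _ _ c => carrays c
  | Poke e1 e2 => arrays e1 + arrays e2
  end.

(* The private memory is cleared at most [C ^ fresh c] times, each time by
   moving it to an untouched region. *)
Fixpoint fresh (c : cmd) : nat :=
  match c with
  | Then c1 c2 | Ife _ c1 c2 => fresh c1 + fresh c2 + 1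
  | For _ _ c => fresh c + 1
  | _ => 0
  end.

Definition caddr (a d : nat) : program :=
  Seq (Const (rT d.+3) a)
  (Seq (Op Mul (rT d.+3) (rT d.+3) (rT 1))
  (Seq (Op Defs.Add (rT d.+3) (rT d.+3) (rT d))
  (Seq (Op Mul (rT d.+3) (rT d.+3) (rT 1))
  (Seq (Op Defs.Add (rT d.+3) (rT d.+3) (rT d.+1))
  (Seq (Op Mul (rT d.+3) (rT d.+3) (rT 1))
       (Op Defs.Add (rT d.+3) (rT d.+3) (rT d.+2))))))).

Fixpoint cexpr (e : expr) (d : nat) : program :=
  match e with
  | EVar x => Move (rT d) (rV x)
  | ENum a => Const (rT d) a
  | EBin o e1 e2 =>
      Seq (cexpr e1 d) (Seq (cexpr e2 d.+1)
        (Op (binop_of o) (rT d) (rT d) (rT d.+1)))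
  | EArr a e1 e2 e3 =>
      Seq (cexpr e1 d) (Seq (cexpr e2 d.+1) (Seq (cexpr e3 d.+2)
        (Seq (caddr a d) (Read (rT d) (rT d.+3)))))
  end.

Definition ccap (d : nat) : program :=
  Seq (Op Less (rT d.+1) (rT 0) (rT d))
      (If (rT d.+1) (Move (rT d) (rT 0)) Skip).

Fixpoint cclear (N : nat) : program :=
  if N is M.+1 then Seq (cclear M) (Const (rP M) 0) else Skip.

Section Compile.

Variables (P : program) (NP : nat).

Fixpoint ccmd (c : cmd) (d : nat) : program :=
  match c with
  | Nop => Skip
  | Asg x e => Seq (cexpr e d) (Seq (ccap d) (Move (rV x) (rT d)))
  | Sto a e1 e2 e3 e =>
      Seq (cexpr e1 d) (Seq (cexpr e2 d.+1) (Seq (cexpr e3 d.+2)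
      (Seq (cexpr e d.+4) (Seq (ccap d.+4)
      (Seq (caddr a d) (Write (rT d.+3) (rT d.+4)))))))
  | Then c1 c2 => Seq (ccmd c1 d) (ccmd c2 d)
  | Ife e c1 c2 => Seq (cexpr e d) (If (rT d) (ccmd c1 d) (ccmd c2 d))
  | For x y c =>
      Seq (Const (rT d) 0) (Seq (Move (rT d.+1) (rV y))
      (Seq (Op Less (rT d.+2) (rT d) (rT d.+1))
      (While (rT d.+2)
        (Seq (Move (rV x) (rT d)) (Seq (ccmd c d.+2)
        (Seq (Const (rT d.+2) 1) (Seq (Op Defs.Add (rT d) (rT d) (rT d.+2))
             (Op Less (rT d.+2) (rT d) (rT d.+1)))))))))
  | Fresh => Op Defs.Add (rT 2) (rT 2) (rT 3)
  | Poke e1 e2 =>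
      Seq (cexpr e2 d) (Seq (ccap d) (Seq (cexpr e1 d.+1)
      (Seq (Op Defs.Add (rT d.+1) (rT d.+1) (rT 2)) (Write (rT d.+1) (rT d)))))
  | Peek x e =>
      Seq (cexpr e d) (Seq (Op Defs.Add (rT d) (rT d) (rT 2))
      (Seq (Read (rT d) (rT d)) (Seq (ccap d) (Move (rV x) (rT d)))))
  | RunP x y z =>
      Seq (cclear NP) (Seq (Move (rP 0) (rV x)) (Seq (Move (rP 1) (rV y))
      (Seq (Move (rP 2) (rV z)) (rename P))))
  end.

Fixpoint csteps (c : cmd) : nat :=
  match c with
  | Nop | Fresh => 1
  | Asg _ e => esteps e + 4
  | Sto _ e1 e2 e3 e => esteps e + esteps e1 + esteps e2 + esteps e3 + 11
  | Then c1 c2 => csteps c1 + csteps c2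
  | Ife e c1 c2 => esteps e + csteps c1 + csteps c2 + 1
  | For _ _ c => csteps c + 8
  | Poke e1 e2 => esteps e1 + esteps e2 + 5
  | Peek _ e => esteps e + 6
  | RunP _ _ _ => NP + 6
  end.

(** * Correctness of the generated code *)

Variables (w C Z Zp NA Kz WP : nat).
Hypotheses (hC : 1 < C) (hKz : 0 < Kz) (hZ : Z = C ^ Kz) (hNA : NA * Z ^ 3 + Z < 2 ^ w)
  (hZp : Z <= Zp) (hWP : WP <= Zp) (hP : regs_below NP P) (hNP : 2 < NP).

(** Digits in base [Z]. Since [Z] exceeds the value of every expression of the command, any index is
    a legal digit, so arrays need no declared bounds and distinct cells never collide. *)
Definition addr (a i j k : nat) := ((a * Z + i) * Z + j) * Z + k.

Lemma addr_lt a i j k : a < NA -> i < Z -> j < Z -> k < Z ->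
  addr a i j k < NA * Z ^ 3.
Proof.
move=> ha hi hj hk; rewrite /addr.
have lin b c D : b < D -> c < Z -> b * Z + c < D * Z.
  by move=> hb hc; apply: (@leq_trans (b.+1 * Z)); rewrite ?leq_mul2r ?hb ?orbT // mulSn addnC ltn_add2r.
by rewrite !expnS expn0 muln1 !mulnA; do 3 apply: (lin) => //.
Qed.

Lemma addr_inj a i j k a' i' j' k' :
  i < Z -> j < Z -> k < Z -> i' < Z -> j' < Z -> k' < Z ->
  (addr a i j k == addr a' i' j' k') = [&& a == a', i == i', j == j' & k == k'].
Proof.
have lin b c b' c' : c < Z -> c' < Z -> (b * Z + c == b' * Z + c') = (b == b') && (c == c').
  move=> h h'; apply/eqP/andP => [e|[/eqP-> /eqP->] //].
  have hz : 0 < Z by apply: leq_trans h.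
  have := congr1 (fun x => x %/ Z) e; have := congr1 (fun x => x %% Z) e.
  by rewrite !modnMDl !divnMDl // !modn_small // !divn_small // !addn0 => -> ->.
by move=> *; rewrite /addr !lin // -!andbA.
Qed.

Definition RepR (off : nat) (s : mstate) (st : state) : Prop :=
  [/\ forall x, reg st (rV x) = vr s x,
      reg st (rT 0) = C, reg st (rT 1) = Z, reg st (rT 2) = off
    & reg st (rT 3) = Zp].

(** The third clause is what makes [Fresh] a single addition: everything behind the current window
    has never been written, so the next window is already zero. *)
Definition RepM (off : nat) (s : mstate) (m : nat -> nat) : Prop :=
  [/\ forall a i j k, a < NA -> i < Z -> j < Z -> k < Z ->
        m (addr a i j k) = ar s a i j k,
      forall k, k < Zp -> m (off + k) = pm s k,
      forall k, off + Zp <= k -> m k = 0,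
      NA * Z ^ 3 <= off
    & forall k, m k < 2 ^ w].

Definition agree (d : nat) (st st' : state) : Prop :=
  forall y, (forall i, d <= i -> y != rT i) -> reg st' y = reg st y.

Lemma agree_trans d st st' st'' :
  agree d st st' -> agree d st' st'' -> agree d st st''.
Proof. by move=> h1 h2 y hy; rewrite h2 ?h1. Qed.

Lemma agree_leq d d' st st' : d <= d' -> agree d' st st' -> agree d st st'.
Proof. by move=> hd h y hy; apply: h => i hi; apply: hy; apply: leq_trans hi. Qed.

Lemma agreeT d i st st' : agree d st st' -> i < d -> reg st' (rT i) = reg st (rT i).
Proof. by move=> h hi; apply: h => j hj; rewrite /rT; lia. Qed.

Lemma agree_set d i st a : d <= i -> agree d st (set_reg st (rT i) a).
Proof. by move=> hi y hy /=; rewrite update_other // hy. Qed.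

Lemma agree_RepR d off s st st' :
  4 < d -> agree d st st' -> RepR off s st -> RepR off s st'.
Proof.
move=> hd h [h1 h2 h3 h4 h5]; split; rewrite ?(agreeT h) //; try by lia.
by move=> x; rewrite h ?h1 // => i _; rewrite /rT /rV; lia.
Qed.

Lemma evZ e s : wf C s -> weight e < Kz -> ev e s < Z.
Proof.
by move=> hs he; apply: leq_ltn_trans (ev_bound e hC hs) _; rewrite hZ ltn_exp2l.
Qed.

Lemma Zw a : a < Z -> a < 2 ^ w.
Proof. by move=> h; apply: leq_trans h _; move: hNA; lia. Qed.

Lemma caddr_ok a d st (Q : state -> Prop) : 4 < d ->
  a < NA -> reg st (rT d) < Z -> reg st (rT d.+1) < Z -> reg st (rT d.+2) < Z ->
  reg st (rT 1) = Z ->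
  (forall st', (forall y, y != rT d.+3 -> reg st' y = reg st y) ->
     memory st' = memory st ->
     reg st' (rT d.+3) = addr a (reg st (rT d)) (reg st (rT d.+1)) (reg st (rT d.+2)) ->
     Q st') ->
  runs w (caddr a d) st 7 Q.
Proof.
move=> hd ha hi hj hk hz HQ.
set i := reg st (rT d) in hi HQ; set j := reg st (rT d.+1) in hj HQ.
set k := reg st (rT d.+2) in hk HQ.
have hA : addr a i j k < 2 ^ w by have := addr_lt ha hi hj hk; move: hNA; lia.
have Z0 : 0 < Z by apply: leq_ltn_trans hi.
have b3 : ((a * Z + i) * Z + j) * Z < 2 ^ w by move: hA; rewrite /addr; lia.
have b2 : (a * Z + i) * Z + j < 2 ^ w.
  by apply: leq_ltn_trans b3; rewrite leq_pmulr.
have b1 : (a * Z + i) * Z < 2 ^ w by lia.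
have b0 : a * Z + i < 2 ^ w by apply: leq_ltn_trans b1; rewrite leq_pmulr.
have bb : a * Z < 2 ^ w by lia.
have ba : a < 2 ^ w by apply: leq_ltn_trans bb; rewrite leq_pmulr.
have ne m : m < d.+3 -> rT m != rT d.+3 by rewrite /rT; lia.
pose S v := fun st' : state => [/\ forall y, y != rT d.+3 -> reg st' y = reg st y, memory st' = memory st & reg st' (rT d.+3) = v].
have step o v m st1 : S v st1 -> m < d.+3 ->
    binop_eval o v (reg st (rT m)) < 2 ^ w ->
    runs w (Op o (rT d.+3) (rT d.+3) (rT m)) st1 1 (S (binop_eval o v (reg st (rT m)))).
  move=> [h1 h2 h3] hm hv; have e := h1 _ (ne _ hm).
  apply: runs_op; rewrite h3 e //; split=> //; last exact: update_same.
  by move=> y hy /=; rewrite update_other ?h1.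
apply: (runs_seq (T1 := 1) (T2 := 6) (Q1 := S a)).
  apply: runs_const => //; split=> //; last exact: update_same.
  by move=> y hy /=; rewrite update_other.
move=> st1 h1; apply: (runs_seq (T1 := 1) (T2 := 5)).
  by apply: step h1 _ _; [lia | rewrite hz].
rewrite /= hz => st2 h2; apply: (runs_seq (T1 := 1) (T2 := 4)).
  by apply: step h2 _ _; [lia |].
rewrite /= -/i => st3 h3; apply: (runs_seq (T1 := 1) (T2 := 3)).
  by apply: step h3 _ _; [lia | rewrite hz].
rewrite /= hz => st4 h4; apply: (runs_seq (T1 := 1) (T2 := 2)).
  by apply: step h4 _ _; [lia |].
rewrite /= -/j => st5 h5; apply: (runs_seq (T1 := 1) (T2 := 1)).
  by apply: step h5 _ _; [lia | rewrite hz].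
rewrite /= hz => st6 h6.
by apply: runs_weaken (step _ _ _ _ h6 _ _) _ _ => // st7 [? ? ?]; apply: HQ.
Qed.

Lemma cexpr_ok e d off s st (Q : state -> Prop) :
  4 < d -> wf C s -> RepR off s st -> RepM off s (memory st) ->
  weight e < Kz -> arrays e <= NA ->
  (forall st', agree d st st' -> memory st' = memory st ->
     reg st' (rT d) = ev e s -> Q st') ->
  runs w (cexpr e d) st (esteps e) Q.
Proof.
move=> + hs; elim: e d st Q => [x|a|o e1 IH1 e2 IH2|a e1 IH1 e2 IH2 e3 IH3] d st Q hd hR hM he hA HQ.
- have hv : reg st (rV x) < 2 ^ w by case: hR => -> _ _ _ _; apply/Zw/(evZ hs he).
  apply: runs_move => //; apply: HQ => //; first exact: agree_set.
  by rewrite [LHS]update_same; case: hR => ->.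
- have hv : a < 2 ^ w by apply/Zw/(evZ hs he).
  apply: runs_const => //; apply: HQ => //; first exact: agree_set.
  exact: update_same.
- have /= he' := he; rewrite /= in hA.
  apply: (@runs_seq _ _ _ _ _ _ (fun st' => [/\ agree d st st', memory st' = memory st & reg st' (rT d) = ev e1 s])).
    by apply: IH1 => //; lia.
  move=> st1 [a1 m1 r1].
  apply: (@runs_seq _ _ _ _ _ _ (fun st' => [/\ agree d.+1 st1 st', memory st' = memory st & reg st' (rT d.+1) = ev e2 s])).
    apply: IH2; rewrite ?m1 //; try lia.
    by apply: agree_RepR a1 hR.
  move=> st2 [a2 m2 r2]; have r1' : reg st2 (rT d) = ev e1 s by rewrite (agreeT a2).
  apply: runs_op; rewrite r1' r2; first by apply/Zw/(evZ hs he).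
  apply: HQ => //; last exact: update_same.
  apply: agree_trans a1 (agree_trans _ (agree_set _ _ (leqnn d))).
  by apply: agree_leq a2.
- have /= he' := he; rewrite /= in hA.
  apply: (@runs_seq _ _ _ _ _ _ (fun st' => [/\ agree d st st', memory st' = memory st & reg st' (rT d) = ev e1 s])).
    by apply: IH1 => //; lia.
  move=> st1 [a1 m1 r1].
  apply: (@runs_seq _ _ _ _ _ _ (fun st' => [/\ agree d.+1 st1 st', memory st' = memory st & reg st' (rT d.+1) = ev e2 s])).
    apply: IH2; rewrite ?m1 //; try lia.
    by apply: agree_RepR a1 hR.
  move=> st2 [a2 m2 r2].
  have a12 : agree d st st2 by apply: agree_trans a1 (agree_leq _ a2).
  apply: (@runs_seq _ _ _ _ _ _ (fun st' => [/\ agree d.+2 st2 st', memory st' = memory st & reg st' (rT d.+2) = ev e3 s])).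
    apply: IH3; rewrite ?m2 //; try lia.
    by apply: agree_RepR a12 hR.
  move=> st3 [a3 m3 r3].
  have a13 : agree d st st3 by apply: agree_trans a12 (agree_leq _ a3); lia.
  have r1' : reg st3 (rT d) = ev e1 s by rewrite (agreeT a3) // (agreeT a2).
  have r2' : reg st3 (rT d.+1) = ev e2 s by rewrite (agreeT a3).
  have z1 : ev e1 s < Z by apply: evZ => //; lia.
  have z2 : ev e2 s < Z by apply: evZ => //; lia.
  have z3 : ev e3 s < Z by apply: evZ => //; lia.
  apply: (@runs_seq _ _ _ _ 7 1 (fun st' => [/\ agree d.+3 st3 st', memory st' = memory st & reg st' (rT d.+3) = addr a (ev e1 s) (ev e2 s) (ev e3 s)])).
    apply: caddr_ok; rewrite ?r1' ?r2' ?r3 //; try lia.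
      by case: (agree_RepR hd a13 hR).
    move=> st4 h1 h2 h3; split=> //; last by rewrite h2.
    by move=> y hy; apply: h1; apply: hy.
  move=> st4 [a4 m4 r4].
  have hv := addr_lt (_ : a < NA) z1 z2 z3.
  have hm : memory st4 (addr a (ev e1 s) (ev e2 s) (ev e3 s)) = ar s a (ev e1 s) (ev e2 s) (ev e3 s).
    by rewrite m4; case: hM => -> //; lia.
  apply: runs_read; rewrite ?r4 ?hm.
  + by have := hv ltac:(lia); move: hNA; lia.
  + by apply/Zw/(evZ (e := EArr a e1 e2 e3) hs he).
  apply: HQ; [|by rewrite /= m4|exact: update_same].
  apply: agree_trans (agree_set _ _ (leqnn d)).
  by apply: agree_trans a13 (agree_leq _ a4); lia.
Qed.

Lemma ccap_ok d off s st (Q : state -> Prop) :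
  4 < d -> RepR off s st -> reg st (rT d) < 2 ^ w ->
  (forall st', agree d st st' -> memory st' = memory st ->
     reg st' (rT d) = minn (reg st (rT d)) C -> Q st') ->
  runs w (ccap d) st 3 Q.
Proof.
move=> hd hR hv HQ; set v := reg st (rT d) in hv HQ.
have hc : C < 2 ^ w.
  apply: (@leq_ltn_trans Z); first by rewrite hZ -{1}[C]expn1 leq_exp2l.
  by move: hNA; lia.
case: hR => _ h0 _ _ _.
apply: (@runs_seq _ _ _ _ 1 2 (fun st' => [/\ agree d.+1 st st', memory st' = memory st & reg st' (rT d.+1) = (C < v)])).
  apply: runs_op; rewrite h0 -/v /=; first by case: (C < v); move: hc hC; lia.
  split=> //; [exact: agree_set | exact: update_same].
move=> st1 [a1 m1 r1].
have a1' : agree d st st1 by apply: agree_leq a1.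
apply: (runs_if (T := 1)); rewrite r1.
  rewrite eqb0 negbK => hlt; apply: runs_move; first by rewrite (agreeT a1) ?h0 //; lia.
  apply: HQ => //; first exact: agree_trans a1' (agree_set _ _ (leqnn d)).
  by rewrite [LHS]update_same (agreeT a1) ?h0; lia.
move/eqP; rewrite eqb0 -leqNgt => hle; apply: runs_skip; apply: HQ => //.
by rewrite (agreeT a1) // -/v; lia.
Qed.

Lemma runs_memory c st T (Q : state -> Prop) :
  (forall k, memory st k < 2 ^ w) -> runs w c st T Q ->
  runs w c st T (fun st' => Q st' /\ forall k, memory st' k < 2 ^ w).
Proof.
move=> hm [t [st' [he ht hq]]]; exists t, st'; split=> //; split=> //.
elim: he hm => {c st t st' ht hq T Q} //=; try by move=> *; auto.
by move=> s x y hx hy hs k; rewrite /update; case: eqP.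
Qed.

Lemma cclear_ok N st :
  runs w (cclear N) st N.+1 (fun st' =>
    [/\ forall x, x < N -> reg st' (rP x) = 0,
        forall y, (forall x, y != rP x) -> reg st' y = reg st y
      & memory st' = memory st]).
Proof.
elim: N => [|N IH] /=; first by apply: runs_skip.
rewrite -addn1; apply: runs_seq IH _ => st1 [h1 h2 h3].
apply: runs_const; first by rewrite expn_gt0.
split=> //=.
  move=> x; rewrite ltnS leq_eqVlt => /orP[/eqP->|hx]; first exact: update_same.
  by rewrite update_other ?h1 // /rP; lia.
by move=> y hy; rewrite update_other ?h2.
Qed.

(** A loop runs at most [C] times, so the number of windows consumed by a command is at most a fixed
    power of [C], and addresses remain polynomial in [n]. *)
Definition post (d off : nat) (c : cmd) (st : state) (s' : mstate)
    (st' : state) : Prop :=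
  [/\ forall i, 4 < i < d -> reg st' (rT i) = reg st (rT i)
    & exists off', [/\ RepR off' s' st', RepM off' s' (memory st')
                     & off' <= off + C ^ fresh c * Zp]].

Lemma agree_keeps d st st' : agree d st st' ->
  forall i, 4 < i < d -> reg st' (rT i) = reg st (rT i).
Proof. by move=> h i hi; apply: (agreeT h); lia. Qed.

Lemma RepR_setv off s st x v : RepR off s st ->
  RepR off (setv s x v) (set_reg st (rV x) v).
Proof.
case=> h1 h2 h3 h4 h5; split=> /=; try by rewrite update_other // /rV /rT; lia.
by move=> y; rewrite /update h1 /rV; congr (if _ then _ else _); lia.
Qed.

Lemma RepM_write off s m a i j k v :
  RepM off s m -> a < NA -> i < Z -> j < Z -> k < Z -> v < 2 ^ w ->
  RepM off (seta s a i j k v) (update m (addr a i j k) v).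
Proof.
move=> [h1 h2 h3 h4 h5] ha hi hj hk hv.
have hlt := addr_lt ha hi hj hk.
split=> //.
- move=> a' i' j' k' ? ? ? ?; rewrite /= /upd4 /update addr_inj // h1 //.
- by move=> k' ?; rewrite update_other ?h2 //; apply/eqP=> e; lia.
- by move=> k' ?; rewrite update_other ?h3 //; apply/eqP=> e; lia.
- by move=> k'; rewrite /update; case: eqP.
Qed.

Lemma Cw v : minn v C < 2 ^ w.
Proof.
apply: (@leq_ltn_trans Z); last by move: hNA; lia.
by apply: leq_trans (geq_minr _ _) _; rewrite hZ -{1}[C]expn1 leq_exp2l.
Qed.

Lemma expn_addl a b : C ^ a + C ^ b <= C ^ (a + b + 1).
Proof.
rewrite !expnD expn1.
have [h1 h2] : 0 < C ^ a /\ 0 < C ^ b by rewrite !expn_gt0 ltnW.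
by apply: (@leq_trans (C ^ a * C ^ b * 2)); [nia | rewrite leq_mul2l hC orbT].
Qed.

Lemma ccmd_ok c d off s t s' st :
  4 < d -> wf C s -> mexec P C WP c s t s' ->
  RepR off s st -> RepM off s (memory st) ->
  cweight c < Kz -> carrays c <= NA ->
  off + (C ^ fresh c).+1 * Zp < 2 ^ w ->
  runs w (ccmd c d) st (csteps c * t) (post d off c st s').
Proof.
move=> + hs; elim: c d off s t s' st hs =>
  [|x e|a e1 e2 e3 e|c1 IH1 c2 IH2|e c1 IH1 c2 IH2|x y c IH| |e1 e2|x e|x y z]
  d off s t s' st hs hd /=.
- case=> -> -> hR hM _ _ hoff; apply: runs_skip; split=> //.
  by exists off; split=> //; rewrite leq_addr.
- case=> -> -> hR hM he hA hoff; rewrite muln1.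
  apply: (@runs_seq _ _ _ _ _ 4 (fun st' => [/\ agree d st st', memory st' = memory st & reg st' (rT d) = ev e s])).
    by apply: (cexpr_ok hd hs hR).
  move=> st1 [a1 m1 r1]; have R1 := agree_RepR hd a1 hR.
  apply: (@runs_seq _ _ _ _ 3 1 (fun st' => [/\ agree d st1 st', memory st' = memory st & reg st' (rT d) = minn (ev e s) C])).
    apply: (ccap_ok hd R1); rewrite ?r1 ?m1 //.
    by apply/Zw/(evZ hs).
  move=> st2 [a2 m2 r2]; have R2 := agree_RepR hd a2 R1.
  apply: runs_move; rewrite r2; first exact: Cw.
  split=> [i hi|]; first rewrite /= update_other ?(agree_keeps a2) ?(agree_keeps a1) //.
    by rewrite /rT /rV; lia.
  exists off; split; rewrite ?leq_addr //; first exact: RepR_setv.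
  by rewrite /= m2.
- case=> -> -> hR hM he hA hoff; rewrite muln1.
  have z1 : ev e1 s < Z by apply: evZ => //; lia.
  have z2 : ev e2 s < Z by apply: evZ => //; lia.
  have z3 : ev e3 s < Z by apply: evZ => //; lia.
  apply: (@runs_weaken _ _ _ (esteps e1 + (esteps e2 + (esteps e3 + (esteps e + (3 + (7 + 1)))))) _
    (post d off (Sto a e1 e2 e3 e) st (seta s a (ev e1 s) (ev e2 s) (ev e3 s) (minn (ev e s) C)))) => //; last by lia.
  have stp d0 st0 ei c T (Q : state -> Prop) : agree d st st0 -> memory st0 = memory st -> d <= d0 ->
      weight ei < Kz -> arrays ei <= NA ->
      (forall st', agree d st st' -> agree d0 st0 st' -> memory st' = memory st -> reg st' (rT d0) = ev ei s -> runs w c st' T Q) ->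
      runs w (Seq (cexpr ei d0) c) st0 (esteps ei + T) Q.
    move=> ha hm hd0 hw har HQ.
    apply: (@runs_seq _ _ _ _ _ _ (fun st' => [/\ agree d st st', agree d0 st0 st', memory st' = memory st & reg st' (rT d0) = ev ei s])); last by move=> st' [*]; apply: HQ.
    apply: (cexpr_ok _ hs (agree_RepR hd ha hR)); rewrite ?hm //; first by lia.
    move=> st' h1 h2 h3; split; rewrite ?h2 //.
    by apply: agree_trans ha (agree_leq _ h1).
  apply: (stp) => //; try lia; move=> st1 a1 _ m1 r1.
  apply: (stp) => //; try lia; move=> st2 a2 b2 m2 r2.
  apply: (stp) => //; try lia; move=> st3 a3 b3 m3 r3.
  apply: (stp) => //; try lia; move=> st4 a4 b4 m4 r4.
  have R4 := agree_RepR hd a4 hR.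
  apply: (@runs_seq _ _ _ _ 3 _ (fun st' => [/\ agree d.+4 st4 st', memory st' = memory st & reg st' (rT d.+4) = minn (ev e s) C])).
    apply: (ccap_ok _ R4); rewrite ?r4 ?m4 //; try lia.
    by apply/Zw/(evZ hs); lia.
  move=> st5 [a5 m5 r5].
  have a5' : agree d st st5 by apply: agree_trans a4 (agree_leq _ a5); lia.
  have R5 := agree_RepR hd a5' hR.
  have q1 : reg st5 (rT d) = ev e1 s by rewrite (agreeT a5) ?(agreeT b4) ?(agreeT b3) ?(agreeT b2); lia.
  have q2 : reg st5 (rT d.+1) = ev e2 s by rewrite (agreeT a5) ?(agreeT b4) ?(agreeT b3); lia.
  have q3 : reg st5 (rT d.+2) = ev e3 s by rewrite (agreeT a5) ?(agreeT b4); lia.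
  apply: (@runs_seq _ _ _ _ 7 1 (fun st' => [/\ agree d st st', memory st' = memory st, reg st' (rT d.+4) = minn (ev e s) C & reg st' (rT d.+3) = addr a (ev e1 s) (ev e2 s) (ev e3 s)])).
    apply: caddr_ok; rewrite ?q1 ?q2 ?q3 //; try lia.
      by case: R5.
    move=> st6 h1 h2 h3; split=> //; rewrite ?h2 ?(h1 (rT d.+4)) //.
      by apply: agree_trans a5' _ => y hy; apply: h1; apply: hy; lia.
    by rewrite /rT; lia.
  move=> st6 [a6 m6 r6 r6'].
  have hlt : addr a (ev e1 s) (ev e2 s) (ev e3 s) < 2 ^ w.
    by have := addr_lt (_ : a < NA) z1 z2 z3; move: hNA; lia.
  apply: runs_write; rewrite ?r6 ?r6' //; first exact: Cw.
  split; first exact: (agree_keeps a6).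
  exists off; split; rewrite ?leq_addr //.
    by case: (agree_RepR hd a6 hR).
  by rewrite /= m6; apply: RepM_write => //; [lia | exact: Cw].
- case=> t1 [s1 [t2 [e1 e2 ->]]] hR hM he hA hoff; rewrite mulnDr.
  have hf := expn_addl (fresh c1) (fresh c2).
  have hf' : (C ^ fresh c1 + C ^ fresh c2) * Zp <= C ^ (fresh c1 + fresh c2 + 1) * Zp by rewrite leq_mul2r hf orbT.
  apply: (@runs_weaken _ _ _ (csteps c1 * t1 + csteps c2 * t2) _ (post d off (Then c1 c2) st s')) => //; last by nia.
  apply: runs_seq (IH1 _ _ _ _ _ _ hs hd e1 hR hM _ _ _) _; try lia.
  move=> st1 [k1 [off1 [R1 M1 o1]]].
  have hs1 := mexec_wf hs e1.
  apply: runs_weaken (IH2 _ _ _ _ _ _ hs1 hd e2 R1 M1 _ _ _) _ _ => //; try lia.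
  move=> st2 [k2 [off2 [R2 M2 o2]]]; split; first by move=> i hi; rewrite k2 ?k1.
  by exists off2; split=> //=; lia.
- case=> t1 [-> h] hR hM he hA hoff.
  have hf := expn_addl (fresh c1) (fresh c2).
  have hf' : (C ^ fresh c1 + C ^ fresh c2) * Zp <= C ^ (fresh c1 + fresh c2 + 1) * Zp by rewrite leq_mul2r hf orbT.
  apply: (@runs_weaken _ _ _ (esteps e + ((csteps c1 + csteps c2) * t1).+1) _ (post d off (Ife e c1 c2) st s')) => //; last by nia.
  apply: (@runs_seq _ _ _ _ _ _ (fun st' => [/\ agree d st st', memory st' = memory st & reg st' (rT d) = ev e s])).
    by apply: (cexpr_ok hd hs hR) => //; lia.
  move=> st1 [a1 m1 r1]; have R1 := agree_RepR hd a1 hR.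
  apply: runs_if; rewrite r1 => hb.
    rewrite hb in h.
    apply: runs_weaken (IH1 _ _ _ _ _ _ hs hd h R1 _ _ _ _) _ _; rewrite ?m1 //; try lia.
    move=> st2 [k2 [off2 [R2 M2 o2]]]; split; first by move=> i hi; rewrite k2 // (agree_keeps a1).
    by exists off2; split=> //=; lia.
  rewrite hb eqxx in h.
  apply: runs_weaken (IH2 _ _ _ _ _ _ hs hd h R1 _ _ _ _) _ _; rewrite ?m1 //; try lia.
  move=> st2 [k2 [off2 [R2 M2 o2]]]; split; first by move=> i hi; rewrite k2 // (agree_keeps a1).
  by exists off2; split=> //=; lia.
- move=> h hR hM he hA hoff.
  have hmC : vr s y <= C by case: hs.
  have CZ : C < Z \/ C = Z.
    have : C <= Z by rewrite hZ -{1}[C]expn1 leq_exp2l.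
    by rewrite leq_eqVlt => /orP[/eqP|]; auto.
  have hmw : vr s y < 2 ^ w by apply: (@leq_ltn_trans Z); [case: CZ; lia | move: hNA; lia].
  (* The positivity of [t] is carried along because it pays for the three instructions in front of
     the compiled loop. The windows allotted to the loop are spent one iteration at a time. *)
  have main M : M <= C -> forall m k s t st off, k + m = M -> wf C s ->
      loop (fun k s => mexec P C WP c (setv s x k)) k m s t s' ->
      RepR off s st -> RepM off s (memory st) ->
      reg st (rT d) = k -> reg st (rT d.+1) = M -> reg st (rT d.+2) = (k < M) ->
      off + (m * C ^ fresh c).+1 * Zp < 2 ^ w ->
      0 < t /\
      runs w (While (rT d.+2)
        (Seq (Move (rV x) (rT d)) (Seq (ccmd c d.+2)
        (Seq (Const (rT d.+2) 1) (Seq (Op Defs.Add (rT d) (rT d) (rT d.+2))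
             (Op Less (rT d.+2) (rT d) (rT d.+1))))))) st ((csteps c + 5) * t)
        (fun st' => (forall i, 4 < i < d -> reg st' (rT i) = reg st (rT i)) /\
          exists off', [/\ RepR off' s' st', RepM off' s' (memory st') &
             off' <= off + m * C ^ fresh c * Zp]).
    move=> hMC; elim=> [|m IHm] k s0 t0 st0 off0.
      rewrite addn0 => -> hs0 [-> ->] R0 M0 r0 r1 r2 ho; split=> //.
      exists 1, st0; split; [|lia|].
        by apply: exec_while_false; rewrite r2 ltnn.
      by split=> //; exists off0; split=> //; lia.
    move=> hkm hs0 [t1 [s1 [t2 [e1 e2 ->]]]] R0 M0 r0 r1 r2 ho; split=> //.
    have hkC : k <= C by lia.
    have hkw : k < 2 ^ w by apply: (@leq_ltn_trans Z); [case: CZ; lia | move: hNA; lia].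
    have hMw : M < 2 ^ w by apply: (@leq_ltn_trans Z); [case: CZ; lia | move: hNA; lia].
    have hk1w : k.+1 < 2 ^ w by lia.
    have hs0' : wf C (setv s0 x k) by apply: wf_setv.
    have hs1 := mexec_wf hs0' e1.
    set body := Seq (Move _ _) _.
    have : runs w body st0 (1 + (csteps c * t1 + (1 + (1 + 1)))) (fun st' =>
        [/\ forall i, 4 < i < d -> reg st' (rT i) = reg st0 (rT i),
            reg st' (rT d) = k.+1, reg st' (rT d.+1) = M, reg st' (rT d.+2) = (k.+1 < M) &
            exists off', [/\ RepR off' s1 st', RepM off' s1 (memory st') &
             off' <= off0 + C ^ fresh c * Zp]]).
      apply: (@runs_seq _ _ _ _ _ _ (fun st' => st' = set_reg st0 (rV x) k)).
        by apply: runs_move; rewrite r0.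
      move=> _ ->.
      have R0' := RepR_setv x k R0.
      have hb : runs w (ccmd c d.+2) (set_reg st0 (rV x) k) (csteps c * t1)
         (post d.+2 off0 c (set_reg st0 (rV x) k) s1).
        by apply: IH hs0' _ e1 R0' M0 _ _ _; lia.
      apply: runs_seq hb _ => st1 [k1 [off1 [R1 M1 o1]]].
      have q0 : reg st1 (rT d) = k.
        by rewrite k1 /= ?update_other ?r0 // /rT /rV; lia.
      have q1 : reg st1 (rT d.+1) = M.
        by rewrite k1 /= ?update_other ?r1 // /rT /rV; lia.
      have n01 : rT d != rT d.+2 by rewrite /rT; lia.
      have n12 : rT d.+1 != rT d.+2 by rewrite /rT; lia.
      have n10 : rT d.+1 != rT d by rewrite /rT; lia.
      have n20 : rT d.+2 != rT d by rewrite /rT; lia.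
      apply: (@runs_seq _ _ _ _ 1 _ (fun st' => st' = set_reg st1 (rT d.+2) 1)).
        by apply: runs_const => //; lia.
      move=> _ ->.
      apply: (@runs_seq _ _ _ _ 1 1 (fun st' => st' = set_reg (set_reg st1 (rT d.+2) 1) (rT d) k.+1)).
        by apply: runs_op; rewrite /= update_same update_other // q0 addn1.
      move=> _ ->.
      set st2 := set_reg (set_reg _ _ _) _ _.
      have p0 : reg st2 (rT d) = k.+1 by rewrite /= update_same.
      have p1 : reg st2 (rT d.+1) = M by rewrite /= !update_other.
      apply: runs_op; rewrite p0 p1 -[binop_eval _ _ _]/(nat_of_bool (k.+1 < M)).
        by case: (_ < M); lia.
      have ag : agree d st1 (set_reg st2 (rT d.+2) (k.+1 < M)).
        by apply: agree_trans (agree_trans (agree_set _ _ _) (agree_set _ _ _)) (agree_set _ _ _); lia.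
      split.
      + move=> i hi; rewrite (agree_keeps ag) // k1; last by lia.
        by rewrite /= update_other // /rT /rV; lia.
      + by rewrite [LHS]update_other.
      + by rewrite [LHS]update_other.
      + by rewrite [LHS]update_same.
      + by exists off1; split=> //; apply: agree_RepR ag R1.
    case=> u1 [st1 [x1 hu1 [k1 q0 q1 q2 [off1 [R1 M1 o1]]]]].
    have hkm' : k.+1 + m = M by lia.
    have ho' : off1 + (m * C ^ fresh c).+1 * Zp < 2 ^ w.
      by move: ho o1; rewrite !mulSn !mulnDl; lia.
    have [ht2 [u2 [st2 [x2 hu2 [k2 [off2 [R2 M2 o2]]]]]]] :=
      IHm k.+1 s1 t2 st1 off1 hkm' hs1 e2 R1 M1 q0 q1 q2 ho'.
    exists (u1 + u2).+1, st2; split.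
    + by apply: exec_while_true x1 x2; rewrite r2 (_ : k < M) //; lia.
    + by nia.
    + split; first by move=> i hi; rewrite k2 ?k1.
      by exists off2; split=> //; rewrite mulSn mulnDl; lia.
  have hmf : vr s y * C ^ fresh c * Zp <= C ^ (fresh c + 1) * Zp.
    by rewrite addn1 expnS !leq_mul2r hmC !orbT.
  have n01 : rT d.+1 != rT d by rewrite /rT; lia.
  set st3 := set_reg (set_reg (set_reg st (rT d) 0) (rT d.+1) (vr s y)) (rT d.+2) (0 < vr s y).
  have ag : agree d st st3.
    by apply: agree_trans (agree_trans (agree_set _ _ _) (agree_set _ _ _)) (agree_set _ _ _); lia.
  have n02 : rT d != rT d.+2 by rewrite /rT; lia.
  have n10 : rT d != rT d.+1 by rewrite /rT; lia.
  have n12 : rT d.+1 != rT d.+2 by rewrite /rT; lia.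
  have p0 : reg st3 (rT d) = 0.
    by rewrite [LHS]update_other // [LHS]update_other // [LHS]update_same.
  have p1 : reg st3 (rT d.+1) = vr s y.
    by rewrite [LHS]update_other // [LHS]update_same.
  have p2 : reg st3 (rT d.+2) = (0 < vr s y) by rewrite [LHS]update_same.
  have ho : off + (vr s y * C ^ fresh c).+1 * Zp < 2 ^ w.
    by move: hoff hmf; rewrite !mulSn; lia.
  have [ht hr] := main (vr s y) hmC (vr s y) 0 s t st3 off erefl hs h (agree_RepR hd ag hR) hM p0 p1 p2 ho.
  apply: (@runs_weaken _ _ _ (1 + (1 + (1 + (csteps c + 5) * t))) _ (post d off (For x y c) st s')) => //; last by nia.
  apply: (@runs_seq _ _ _ _ 1 _ (fun st' => st' = set_reg st (rT d) 0)).
    by apply: runs_const => //; rewrite expn_gt0.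
  move=> _ ->.
  apply: (@runs_seq _ _ _ _ 1 _ (fun st' => st' = set_reg (set_reg st (rT d) 0) (rT d.+1) (vr s y))).
    have e : reg (set_reg st (rT d) 0) (rV y) = vr s y.
      by rewrite /= update_other; [case: hR | rewrite /rV /rT; lia].
    by apply: runs_move; rewrite e.
  move=> _ ->.
  apply: (@runs_seq _ _ _ _ 1 _ (fun st' => st' = st3)).
    have e1 : reg (set_reg (set_reg st (rT d) 0) (rT d.+1) (vr s y)) (rT d) = 0.
      by rewrite /= update_other ?update_same // eq_sym.
    have e2 : reg (set_reg (set_reg st (rT d) 0) (rT d.+1) (vr s y)) (rT d.+1) = vr s y.
      by rewrite /= update_same.
    apply: runs_op; rewrite e1 e2 /=; last by [].
    by case: (0 < vr s y); lia.
  move=> _ ->.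
  apply: runs_weaken hr _ _ => // st4 [k4 [off4 [R4 M4 o4]]].
  split; first by move=> i hi; rewrite k4 // (agree_keeps ag).
  by exists off4; split=> //=; lia.
- case=> -> -> hR hM _ _ hoff.
  case: hR => h1 h2 h3 h4 h5; case: hM => q1 q2 q3 q4 q5.
  have hlt : off + Zp < 2 ^ w by move: hoff; rewrite expn0; lia.
  apply: runs_op; rewrite h4 h5 //; split.
    by move=> i hi; rewrite /= update_other // /rT; lia.
  exists (off + Zp); split; last by rewrite expn0 mul1n.
    by split=> //= *; rewrite update_other // /rT /rV; lia.
  split=> //=; first by move=> k hk; rewrite q3 //; lia.
  - by move=> k hk; rewrite q3 //; lia.
  - by lia.
- case=> -> -> hR hM he hA hoff; rewrite muln1.
  have z1 : ev e1 s < Z by apply: evZ => //; lia.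
  apply: (@runs_weaken _ _ _ (esteps e2 + (3 + (esteps e1 + (1 + 1)))) _
    (post d off (Poke e1 e2) st (setp s (update (pm s) (ev e1 s) (minn (ev e2 s) C))))) => //; last by lia.
  apply: (@runs_seq _ _ _ _ _ _ (fun st' => [/\ agree d st st', memory st' = memory st & reg st' (rT d) = ev e2 s])).
    by apply: (cexpr_ok hd hs hR) => //; lia.
  move=> st1 [a1 m1 r1]; have R1 := agree_RepR hd a1 hR.
  apply: (@runs_seq _ _ _ _ 3 _ (fun st' => [/\ agree d st st', memory st' = memory st & reg st' (rT d) = minn (ev e2 s) C])).
    apply: (ccap_ok hd R1); rewrite ?r1 ?m1 //.
      by apply/Zw/(evZ hs); lia.
    by move=> st2 a2 m2 r2; split=> //; exact: agree_trans a1 a2.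
  move=> st2 [a2 m2 r2]; have R2 := agree_RepR hd a2 hR.
  apply: (@runs_seq _ _ _ _ _ _ (fun st' => [/\ agree d st st', memory st' = memory st, reg st' (rT d) = minn (ev e2 s) C & reg st' (rT d.+1) = ev e1 s])).
    apply: (cexpr_ok _ hs R2); rewrite ?m2 //; try lia.
    move=> st3 a3 m3 r3; split=> //; first by apply: agree_trans a2 (agree_leq _ a3).
    by rewrite (agreeT a3).
  move=> st3 [a3 m3 r3 r3']; have R3 := agree_RepR hd a3 hR.
  have h2 : reg st3 (rT 2) = off by case: R3.
  have hlt : ev e1 s + off < 2 ^ w by move: hoff; rewrite mulSn; lia.
  have n01 : rT d != rT d.+1 by rewrite /rT; lia.
  apply: (@runs_seq _ _ _ _ 1 1 (fun st' => st' = set_reg st3 (rT d.+1) (ev e1 s + off))).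
    by apply: runs_op; rewrite /= r3' h2.
  move=> _ ->.
  have p0 : reg (set_reg st3 (rT d.+1) (ev e1 s + off)) (rT d) = minn (ev e2 s) C.
    by rewrite /= update_other.
  have p1 : reg (set_reg st3 (rT d.+1) (ev e1 s + off)) (rT d.+1) = ev e1 s + off.
    by rewrite /= update_same.
  apply: runs_write; rewrite ?p0 ?p1 //; first exact: Cw.
  have ag : agree d st (set_reg st3 (rT d.+1) (ev e1 s + off)).
    by apply: agree_trans a3 (agree_set _ _ _); lia.
  split; first exact: (agree_keeps ag).
  exists off; split; rewrite ?leq_addr //.
    by case: (agree_RepR hd ag hR).
  rewrite /= m3; case: hM => q1 q2 q3 q4 q5; split=> //=.
  + move=> a' i' j' k' b1 b2 b3 b4; rewrite update_other ?q1 //.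
    by apply/eqP=> e; have := addr_lt b1 b2 b3 b4; lia.
  + by move=> k hk; rewrite /update [ev e1 s + off]addnC eqn_add2l q2.
  + by move=> k hk; rewrite update_other ?q3 //; apply/eqP; lia.
  + by move=> k; rewrite /update; case: eqP => // _; exact: Cw.
- case=> -> -> hR hM he hA hoff; rewrite muln1.
  have z1 : ev e s < Z by apply: evZ => //; lia.
  apply: (@runs_weaken _ _ _ (esteps e + (1 + (1 + (3 + 1)))) _
    (post d off (Peek x e) st (setv s x (minn (pm s (ev e s)) C)))) => //.
  apply: (@runs_seq _ _ _ _ _ _ (fun st' => [/\ agree d st st', memory st' = memory st & reg st' (rT d) = ev e s])).
    by apply: (cexpr_ok hd hs hR) => //; lia.
  move=> st1 [a1 m1 r1]; have R1 := agree_RepR hd a1 hR.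
  have h2 : reg st1 (rT 2) = off by case: R1.
  have hlt : ev e s + off < 2 ^ w by move: hoff; rewrite mulSn; lia.
  apply: (@runs_seq _ _ _ _ 1 _ (fun st' => st' = set_reg st1 (rT d) (ev e s + off))).
    by apply: runs_op; rewrite /= r1 h2.
  move=> _ ->.
  have hm : memory st1 (ev e s + off) = pm s (ev e s).
    by rewrite m1 addnC; case: hM => _ -> //; lia.
  have hmw : pm s (ev e s) < 2 ^ w by rewrite -hm m1; case: hM.
  apply: (@runs_seq _ _ _ _ 1 _ (fun st' => [/\ agree d st st', memory st' = memory st & reg st' (rT d) = pm s (ev e s)])).
    have p0 : reg (set_reg st1 (rT d) (ev e s + off)) (rT d) = ev e s + off by rewrite /= update_same.
    apply: runs_read; rewrite p0 //= ?hm //; split=> //; last by rewrite /= update_same.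
    by apply: agree_trans (agree_trans a1 (agree_set _ _ _)) (agree_set _ _ _).
  move=> st2 [a2 m2 r2]; have R2 := agree_RepR hd a2 hR.
  apply: (@runs_seq _ _ _ _ 3 1 (fun st' => [/\ agree d st st', memory st' = memory st & reg st' (rT d) = minn (pm s (ev e s)) C])).
    apply: (ccap_ok hd R2); rewrite ?r2 ?m2 //.
    by move=> st3 a3 m3 r3; split=> //; exact: agree_trans a2 a3.
  move=> st3 [a3 m3 r3]; have R3 := agree_RepR hd a3 hR.
  apply: runs_move; rewrite r3; first exact: Cw.
  split=> [i hi|]; first rewrite /= update_other ?(agree_keeps a3) //.
    by rewrite /rT /rV; lia.
  exists off; split; rewrite ?leq_addr //; first exact: RepR_setv.
  by rewrite /= m3.
- case=> w' [t1 [st1 [hw' he -> ->]]] hR hM _ _ hoff.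
  have hww : w' <= w.
    rewrite leqNgt; apply/negP => hlt.
    have : 2 ^ w < 2 ^ w' by rewrite ltn_exp2l.
    by move: hoff; rewrite expn0; lia.
  apply: (@runs_weaken _ _ _ (NP.+1 + (1 + (1 + (1 + 2 * t1)))) _ (post d off (RunP x y z) st (setp s (memory st1)))) => //; last by nia.
  apply: runs_seq (cclear_ok NP st) _ => st2 [c1 c2 c3].
  have [h1 h2 h3 h4 h5] := hR.
  have vw v : vr s v < 2 ^ w.
    by have := Cw (vr s v); have /minn_idPl -> : vr s v <= C by case: hs.
  have nVP v x' : rV v != rP x' by rewrite /rV /rP; lia.
  apply: (@runs_seq _ _ _ _ 1 _ (fun st' => st' = set_reg st2 (rP 0) (vr s x))).
    by apply: runs_move; rewrite c2 // h1.
  move=> _ ->.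
  apply: (@runs_seq _ _ _ _ 1 _ (fun st' => st' = set_reg (set_reg st2 (rP 0) (vr s x)) (rP 1) (vr s y))).
    by apply: runs_move; rewrite /= update_other // c2 // h1.
  move=> _ ->.
  apply: (@runs_seq _ _ _ _ 1 _ (fun st' => st' = set_reg (set_reg (set_reg st2 (rP 0) (vr s x)) (rP 1) (vr s y)) (rP 2) (vr s z))).
    by apply: runs_move; rewrite /= !update_other // c2 // h1.
  move=> _ ->; set st3 := set_reg _ _ _.
  have m3 : memory st3 = memory st2 by [].
  have hsim : sim NP off Zp (State (nth 0 [:: vr s x; vr s y; vr s z]) (pm s)) st3.
    split.
    - case=> [|[|[|v]]] hv; [by []|by []|by []|].
      rewrite [LHS]update_other; last by rewrite /rP; lia.
      rewrite [LHS]update_other; last by rewrite /rP; lia.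
      rewrite [LHS]update_other; last by rewrite /rP; lia.
      by rewrite c1 //= nth_nil.
    - by move=> k hk /=; rewrite c3; case: hM => _ ->.
    - by rewrite /st3 /= !update_other // c2 // => v; rewrite /rT /rP; lia.
  have ho : off + Zp <= 2 ^ w by move: hoff; rewrite expn0; lia.
  have hZw : 2 ^ w' <= Zp by apply: leq_trans hWP.
  have hm3 k : memory st3 k < 2 ^ w by rewrite m3 c3; case: hM.
  apply: runs_weaken (runs_memory hm3 (rename_exec he hP hww hZw ho hsim)) (leqnn _) _.
  move=> st4 [[[s1 s2 s3] [o1 o2]] hm4].
  have keep v : v != 4 -> reg st4 (rT v) = reg st (rT v).
    move=> hv; rewrite o1; [|by rewrite /rT; lia|by move=> x'; rewrite /rT /rP; lia].
    by rewrite /st3 /= !update_other ?c2 // => *; rewrite /rT /rP; lia.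
  split; first by move=> i hi; apply: keep; lia.
  exists off; split; rewrite ?leq_addr //.
    split=> /=; rewrite ?keep // => v.
    rewrite o1; [|by rewrite /rV /rT; lia|by move=> *].
    by rewrite /st3 /= !update_other // c2.
  case: hM => q1 q2 q3 q4 q5; split=> //=.
  + move=> a' i' j' k' b1 b2 b3 b4; rewrite o2 ?m3 ?c3 ?q1 //.
    by have := addr_lt b1 b2 b3 b4; lia.
  + by move=> k hk; rewrite o2 ?m3 ?c3 ?q3 //; lia.
Qed.

End Compile.

(** * The compiled program computes its own constants *)

Fixpoint cpow (r k : nat) : program :=
  if k is l.+1 then Seq (cpow r l) (Op Mul r r (rT 5)) else Const r 1.

Lemma cpow_ok w r k x st : reg st (rT 5) = x -> r != rT 5 -> 0 < x ->
  x ^ k < 2 ^ w ->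
  runs w (cpow r k) st k.+1 (fun st' => [/\ reg st' r = x ^ k,
    forall y, y != r -> reg st' y = reg st y & memory st' = memory st]).
Proof.
move=> hx hr x0; elim: k => [|k IH] hk /=.
  apply: runs_const; first by move: hk; rewrite expn0.
  by split=> //=; [rewrite update_same | move=> y hy; rewrite update_other].
rewrite -(addn1 k.+1); apply: runs_seq (IH _) _.
  by apply: leq_ltn_trans hk; rewrite leq_pexp2l.
move=> st1 [h1 h2 h3]; have e : reg st1 (rT 5) = x by rewrite h2 // eq_sym.
apply: runs_op; rewrite /= h1 e -expnSr //; split=> //=; first exact: update_same.
by move=> y hy; rewrite update_other ?h2.
Qed.

Definition start (n a : nat) (data : seq nat) : mstate :=
  MState (nth 0 [:: n; a])
    (fun b i j k => if [&& b == 0, i == 0 & j == 0] then nth 0 data k else 0)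
    (fun=> 0).

Lemma word_length_ge c n : n.+1 ^ c <= 2 ^ word_length c n.
Proof.
rewrite /word_length mulnC expnM; case: c => [|c] //.
by rewrite leq_exp2r // trunc_log_ltn.
Qed.

(** All sizes which the code depends on are powers of [n.+1 >= 2] whose exponents depend only on the
    command. Hence one multiple of the logarithm suffices as word length, and the code can compute
    the cap, the base and the window size from [n]. *)
Lemma compile_cmd (P : program) (c : cmd) (K Kp : nat) : 0 < K ->
  exists (Q : program) (cw T : nat), forall n a data t s',
    0 < n -> a <= n -> size data <= n * n -> (forall k, nth 0 data k <= 1) ->
    mexec P (n.+1 ^ K) (n.+1 ^ Kp) c (start n a data) t s' ->
    runs (word_length cw n) Q (initial [:: n; a] data) (T * t.+1)
      (fun st => forall k, k < n * n * 2 -> memory st k = ar s' 0 0 0 k).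
Proof.
move=> K0; have [NP0 hNP0] := regs_below_ex P.
pose NP := NP0 + 3; have hNP : regs_below NP P by apply: regs_below_leq hNP0; rewrite leq_addr.
(* [Z = C ^ Kz] has to exceed all values of expressions and also [n * n * 2], the length of input
   and output together, whence the 3. In [cw] the exponents for the arrays and for the windows are
   added up; its last 3 turns a sum of two powers into a single one. *)
pose Kz := cweight c + 3; pose NA := carrays c + 1.
pose cw := NA + 3 * (K * Kz) + (K * fresh c + 1 + (K * Kz + Kp)) + 3.
(* Register 0 already is variable 0. The second input lies in register 1, which belongs to the
   called program, and is moved to variable 1. *)
exists (Seq (Move (rV 1) 1) (Seq (Const (rT 5) 1) (Seq (Op Defs.Add (rT 5) (rT 5) (rV 0))
  (Seq (cpow (rT 0) K) (Seq (cpow (rT 1) (K * Kz)) (Seq (cpow (rT 3) (K * Kz + Kp))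
  (Seq (Const (rT 2) NA) (Seq (Op Mul (rT 2) (rT 2) (rT 1)) (Seq (Op Mul (rT 2) (rT 2) (rT 1))
  (Seq (Op Mul (rT 2) (rT 2) (rT 1)) (ccmd P NP c 5))))))))))), cw.
exists (csteps NP c + (11 + K + K * Kz + (K * Kz + Kp))) => n a data t s' n0 ha hsz hd he.
set w := word_length cw n.
pose x := n.+1; pose C := x ^ K; pose Z := x ^ (K * Kz); pose Zp := x ^ (K * Kz + Kp).
have hw : x ^ cw <= 2 ^ w by apply: word_length_ge.
have x1 : 1 < x by [].
have xp k : 0 < x ^ k by rewrite expn_gt0.
have C1 : 1 < C by rewrite -(exp1n K) ltn_exp2r.
have hZ : Z = C ^ Kz by rewrite /Z /C expnM.
have hNA : NA <= x ^ NA by apply: ltnW; apply: ltn_expl.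
have hZ3 : Z ^ 3 = x ^ (3 * (K * Kz)) by rewrite /Z -expnM mulnC.
have Z1 : 1 < Z.
  by rewrite hZ -(exp1n Kz) ltn_exp2r // /Kz addn3.
have hT : NA * Z ^ 3 <= x ^ (NA + 3 * (K * Kz)).
  by rewrite hZ3 expnD leq_mul2r hNA orbT.
have hF : (C ^ fresh c).+1 * Zp <= x ^ (K * fresh c + 1 + (K * Kz + Kp)).
  rewrite expnD leq_mul2r; apply/orP; right; rewrite /C -expnM expnD expn1.
  by apply: (@leq_trans (x ^ (K * fresh c) * 2)); [have := xp (K * fresh c); lia | rewrite leq_mul2l x1 orbT].
have big u v : u <= NA + 3 * (K * Kz) -> v <= K * fresh c + 1 + (K * Kz + Kp) ->
    x ^ u + x ^ v < 2 ^ w.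
  move=> hu hv; apply: leq_trans hw.
  rewrite /cw expnD; set m := NA + _ + _.
  have hum : x ^ u <= x ^ m by rewrite leq_exp2l // /m; lia.
  have hvm : x ^ v <= x ^ m by rewrite leq_exp2l // /m; lia.
  have : 8 <= x ^ 3 by rewrite (@leq_exp2r 2 x 3).
  by have := xp m; nia.
have hTw : NA * Z ^ 3 + (C ^ fresh c).+1 * Zp < 2 ^ w.
  by apply: leq_ltn_trans (big _ _ (leqnn _) (leqnn _)); apply: leq_add.
have hZZp : Z <= Zp by rewrite /Z /Zp leq_exp2l // leq_addr.
have hZp1 : Zp < 2 ^ w by move: hTw; rewrite mulSn; lia.
have hZw : Z < 2 ^ w by apply: leq_ltn_trans hZp1.
have hCw : C < 2 ^ w.
  by apply: leq_ltn_trans hZw; rewrite /C /Z leq_exp2l // leq_pmulr // /Kz addn3.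
have hxw : x < 2 ^ w.
  by apply: leq_ltn_trans hCw; rewrite -[X in X <= _]expn1 leq_exp2l.
have hTOP : NA * Z ^ 3 < 2 ^ w by lia.
have hZn : n * n * 2 <= Z.
  apply: (@leq_trans (x ^ 3)).
    have : n * n * 2 <= x * x * x by apply: leq_mul => //; apply: leq_mul.
    by rewrite !expnS expn0 muln1 mulnA.
  rewrite leq_exp2l //; apply: (@leq_trans Kz); first by rewrite /Kz leq_addl.
  exact: leq_pmull.
set st0 := initial _ _.
apply: (@runs_weaken _ _ _ (1 + (1 + (1 + (K.+1 + ((K * Kz).+1 + ((K * Kz + Kp).+1 + (1 + (1 + (1 + (1 + csteps NP c * t)))))))))) _
  (fun st => forall k, k < n * n * 2 -> memory st k = ar s' 0 0 0 k)) => //; last first.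
  by rewrite mulnS mulnDl; lia.
apply: (@runs_seq _ _ _ _ 1 _ (fun st => [/\ memory st = nth 0 data &
    forall v, reg st (rV v) = nth 0 [:: n; a] v])).
  apply: runs_move; first by apply: leq_ltn_trans hxw; apply: leqW.
  split=> // -[|[|v]] //=; rewrite update_other; last by rewrite /rV; lia.
  by rewrite !nth_default //= /rV; lia.
move=> st1 [m1 r1].
apply: (@runs_seq _ _ _ _ 1 _ (fun st => [/\ memory st = nth 0 data,
    forall v, reg st (rV v) = nth 0 [:: n; a] v & reg st (rT 5) = 1])).
  apply: runs_const; first by lia.
  by split=> //= v; rewrite update_other ?r1 // /rV /rT; lia.
move=> st2 [m2 r2 q2].
apply: (@runs_seq _ _ _ _ 1 _ (fun st => [/\ memory st = nth 0 data,
    forall v, reg st (rV v) = nth 0 [:: n; a] v & reg st (rT 5) = x])).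
  by apply: runs_op; rewrite /= q2 r2 //=; split=> //= v; rewrite update_other ?r2 // /rV /rT; lia.
move=> st3 [m3 r3 q3].
apply: runs_seq (cpow_ok q3 _ _ hCw) _ => // st4 [p4 o4 m4].
have q4 : reg st4 (rT 5) = x by rewrite o4.
apply: runs_seq (cpow_ok q4 _ _ hZw) _ => // st5 [p5 o5 m5].
have q5 : reg st5 (rT 5) = x by rewrite o5.
apply: runs_seq (cpow_ok q5 _ _ hZp1) _ => // st6 [p6 o6 m6].
have hz6 : reg st6 (rT 1) = Z by rewrite o6.
have Z0 : 0 < Z by lia.
have hNw : NA < 2 ^ w.
  by apply: leq_ltn_trans hTOP; rewrite leq_pmulr // expn_gt0 Z0.
have e3 : NA * Z ^ 3 = NA * Z * Z * Z by rewrite !expnS expn0 muln1 !mulnA.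
have b1 : NA * Z < 2 ^ w by apply: leq_ltn_trans hTOP; rewrite e3 -!mulnA leq_mul2l leq_pmulr ?muln_gt0 ?Z0 ?orbT.
have b2 : NA * Z * Z < 2 ^ w by apply: leq_ltn_trans hTOP; rewrite e3 leq_pmulr.
pose S v := fun st : state => [/\ memory st = memory st6, reg st (rT 2) = v & forall y, y != rT 2 -> reg st y = reg st6 y].
apply: (@runs_seq _ _ _ _ 1 _ (S NA)).
  by apply: runs_const => //; split=> //= y hy; rewrite update_other.
have stp v st : S v st -> v * Z < 2 ^ w -> runs w (Op Mul (rT 2) (rT 2) (rT 1)) st 1 (S (v * Z)).
  move=> [h1 h2 h3] hv; have e : reg st (rT 1) = Z by rewrite h3.
  by apply: runs_op; rewrite h2 e //=; split=> //= y hy; rewrite update_other ?h3.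
move=> st7 h7; apply: (runs_seq (stp _ _ h7 b1)) => {h7} st7 h7.
apply: (runs_seq (stp _ _ h7 b2)) => {h7} st7 h7.
have b3 : NA * Z * Z * Z < 2 ^ w by rewrite -e3.
apply: (runs_seq (stp _ _ h7 b3)) => {h7} st8 [m8 q8 o8].
have hm : memory st8 = nth 0 data by rewrite m8 m6 m5 m4.
have hwf : wf C (start n a data).
  split=> [v|b i j k] /=.
    have hn : n <= C by apply: (@leq_trans x) => //; rewrite -[X in X <= _]expn1 leq_exp2l.
    by case: v => [|[|v]] //=; rewrite ?nth_nil //; apply: leq_trans hn.
  by case: ifP => // _; apply: leq_trans (hd k) _; exact: ltnW.
have hNA' : NA * Z ^ 3 + Z < 2 ^ w.
  by apply: leq_ltn_trans hTw; rewrite leq_add2l mulSn; apply: leq_trans hZZp _; rewrite leq_addr.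
have hR : RepR C Z Zp (NA * Z ^ 3) (start n a data) st8.
  have nVT v i : rV v != rT i by rewrite /rV /rT; lia.
  by split=> [v||||]; [rewrite o8 ?o6 ?o5 ?o4 ?r3 | rewrite o8 ?o6 ?o5 | rewrite o8 ?o6
    | rewrite q8 e3 | rewrite o8].
have hbig k : Z <= k -> nth 0 data k = 0.
  by move=> hk; rewrite nth_default //; apply: leq_trans hsz _; apply: leq_trans hk; lia.
have hZtop : Z <= NA * Z ^ 3.
  by rewrite e3 leq_pmull // !muln_gt0 Z0 /NA addn1.
have hM : RepM w Z Zp NA (NA * Z ^ 3) (start n a data) (memory st8).
  rewrite hm; split=> //.
  - move=> b i j k hb hi hj hk /=; rewrite /addr.
    case: ifP => [/and3P[/eqP-> /eqP-> /eqP->] //|hne].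
    apply: hbig; apply: leq_trans (leq_addr _ _).
    rewrite leq_pmull //; case: b hne hb => [|b] /=; last by lia.
    by case: i hi => [|i] /=; case: j hj => [|j] //=; lia.
  - by move=> k hk /=; apply: hbig; lia.
  - by move=> k hk /=; apply: hbig; lia.
  - by move=> k; apply: leq_ltn_trans (hd k) _; lia.
have hK : cweight c < Kz by rewrite /Kz; lia.
have hA : carrays c <= NA by rewrite /NA; lia.
have Kz0 : 0 < Kz by rewrite /Kz addn3.
have hWP : x ^ Kp <= Zp by rewrite /Zp leq_exp2l // leq_addl.
have hNP2 : 2 < NP by rewrite /NP; lia.
apply: runs_weaken (ccmd_ok C1 Kz0 hZ hNA' hZZp hWP hNP hNP2 (leqnn 5) hwf he hR hM hK hA hTw) _ _ => //.
move=> st9 [_ [off' [_ [q _ _ _ _] _]]] k hk.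
by have := q 0 0 0 k; rewrite /addr !mul0n !add0n => -> //; lia.
Qed.

(** * Hoare triples with running times *)

Fixpoint mv (c : cmd) : seq nat :=
  match c with
  | Asg x _ | Peek x _ => [:: x]
  | Then c1 c2 | Ife _ c1 c2 => mv c1 ++ mv c2
  | For x _ c => x :: mv c
  | _ => [::]
  end.

Fixpoint ma (c : cmd) : seq nat :=
  match c with
  | Sto a _ _ _ _ => [:: a]
  | Then c1 c2 | Ife _ c1 c2 => ma c1 ++ ma c2
  | For _ _ c => ma c
  | _ => [::]
  end.

(** The sets of modified variables and arrays are read off the syntax, so every triple carries a
    frame condition whose side conditions are decided by computation. The private memory is
    deliberately not framed. *)
Definition frame (vs bs : seq nat) (s s' : mstate) : Prop :=
  (forall x, x \notin vs -> vr s' x = vr s x) /\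
  (forall a, a \notin bs -> forall i j k, ar s' a i j k = ar s a i j k).

Lemma frv vs bs s s' (h : frame vs bs s s') x : x \notin vs -> vr s' x = vr s x.
Proof. by case: h => h _; apply: h. Qed.

Lemma fra vs bs s s' (h : frame vs bs s s') a : a \notin bs ->
  forall i j k, ar s' a i j k = ar s a i j k.
Proof. by case: h => _ h; apply: h. Qed.

Lemma frame_refl vs bs s : frame vs bs s s. Proof. by []. Qed.

Lemma frame_trans vs bs s1 s2 s3 :
  frame vs bs s1 s2 -> frame vs bs s2 s3 -> frame vs bs s1 s3.
Proof.
by move=> [h1 h2] [h3 h4]; split=> [x hx|a ha i j k]; [rewrite h3 ?h1 | rewrite h4 ?h2].
Qed.

Lemma frame_sub vs bs vs' bs' s s' : {subset vs <= vs'} -> {subset bs <= bs'} ->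
  frame vs bs s s' -> frame vs' bs' s s'.
Proof.
move=> hv ha [h1 h2]; split=> [x hx|a hb i j k]; [apply: h1 | apply: h2].
  by apply: contra hx; apply: hv.
by apply: contra hb; apply: ha.
Qed.

Lemma frame_all vs bs vs' bs' s s' : all (mem vs') vs -> all (mem bs') bs ->
  frame vs bs s s' -> frame vs' bs' s s'.
Proof. by move=> /allP h1 /allP h2; apply: frame_sub. Qed.

Lemma frame_setv s x v : frame [:: x] [::] s (setv s x v).
Proof. by split=> // y; rewrite inE => hy; rewrite /= update_other. Qed.

Lemma frame1 x vs bs s s' : x \in vs -> frame [:: x] [::] s s' -> frame vs bs s s'.
Proof. by move=> hx; apply: frame_sub => // z; rewrite inE => /eqP->. Qed.

Section Hoare.

Variables (P : program) (C WP : nat).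

Notation mexec := (mexec P C WP).
Notation wf := (wf C).

Lemma mexec_frame c s t s' : mexec c s t s' -> frame (mv c) (ma c) s s'.
Proof.
elim: c s t s' =>
  [|x e|a e1 e2 e3 e|c1 IH1 c2 IH2|e c1 IH1 c2 IH2|x y c IH| |e1 e2|x e|x y z] s t s' /=.
- by case=> ->.
- by case=> -> _; apply: frame_setv.
- case=> -> _; split=> //= b; rewrite inE => hb i j k.
  by rewrite /upd4 (negbTE hb).
- case=> t1 [s1 [t2 [/IH1 h1 /IH2 h2 _]]].
  apply: (@frame_trans _ _ _ s1).
    by apply: frame_sub h1 => x hx; rewrite mem_cat hx.
  by apply: frame_sub h2 => x hx; rewrite mem_cat hx orbT.
- case=> t1 [_]; case: ifP => _ => [/IH1|/IH2]; apply: frame_sub => z hz;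
    by rewrite mem_cat hz ?orbT.
- move: (vr s y) => m; elim: m 0 s t => [|m IHm] k s t /=; first by case=> ->.
  case=> t1 [s1 [t2 [/IH h1 /IHm h2 _]]].
  apply: frame_trans h2; apply: (@frame_trans _ _ _ (setv s x k)).
    by apply: frame1 (frame_setv s x k); rewrite mem_head.
  by apply: frame_sub h1 => z hz //; rewrite inE hz orbT.
- by case=> ->.
- by case=> ->.
- by case=> -> _; apply: frame_setv.
- by case=> w [t1 [st [_ _ -> _]]].
Qed.

Definition hoare (c : cmd) (s : mstate) (T : nat) (Q : mstate -> Prop) : Prop :=
  wf s -> exists t s', [/\ mexec c s t s', t <= T & Q s'].

Lemma hoare_out c s T Q : hoare c s T Q ->
  hoare c s T (fun s' => [/\ wf s', frame (mv c) (ma c) s s' & Q s']).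
Proof.
move=> h hs; have [t [s' [h1 h2 h3]]] := h hs.
exists t, s'; split=> //; split=> //; [exact: mexec_wf hs h1 | exact: mexec_frame h1].
Qed.

Lemma hoare_weaken c s T T' (Q Q' : mstate -> Prop) :
  hoare c s T Q -> T <= T' ->
  (forall s', wf s' -> frame (mv c) (ma c) s s' -> Q s' -> Q' s') ->
  hoare c s T' Q'.
Proof.
move/hoare_out=> h hT hQ hs; have [t [s' [h1 h2 [h3 h4 h5]]]] := h hs.
by exists t, s'; split=> //; [exact: leq_trans hT | exact: hQ].
Qed.

Lemma hoare_nop s (Q : mstate -> Prop) : Q s -> hoare Nop s 1 Q.
Proof. by move=> hQ hs; exists 1, s. Qed.

Lemma hoare_asg x e s (Q : mstate -> Prop) :
  (wf s -> ev e s <= C) ->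
  (forall s', frame [:: x] [::] s s' -> vr s' x = ev e s -> Q s') ->
  hoare (Asg x e) s 1 Q.
Proof.
move=> he hQ hs; exists 1, (setv s x (ev e s)); split=> //.
  by split=> //; congr setv; apply/esym/minn_idPl; apply: he.
by apply: hQ; [exact: frame_setv | rewrite /= update_same].
Qed.

Lemma hoare_sto a e1 e2 e3 e s (Q : mstate -> Prop) :
  (wf s -> ev e s <= C) ->
  (forall s', frame [::] [:: a] s s' -> pm s' = pm s ->
     (forall i j k, ar s' a i j k =
        if [&& i == ev e1 s, j == ev e2 s & k == ev e3 s] then ev e s
        else ar s a i j k) -> Q s') ->
  hoare (Sto a e1 e2 e3 e) s 1 Q.
Proof.
move=> he hQ hs; exists 1, (seta s a (ev e1 s) (ev e2 s) (ev e3 s) (ev e s)).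
split=> //; first by split=> //; congr seta; apply/esym/minn_idPl; apply: he.
apply: hQ => [||i j k /=] //; last by rewrite /upd4 eqxx.
by split=> //= b; rewrite inE /upd4 => /negbTE->.
Qed.

Lemma hoare_then c1 c2 s T1 T2 (Q1 Q : mstate -> Prop) :
  hoare c1 s T1 Q1 ->
  (forall s1, wf s1 -> frame (mv c1) (ma c1) s s1 -> Q1 s1 -> hoare c2 s1 T2 Q) ->
  hoare (Then c1 c2) s (T1 + T2) Q.
Proof.
move/hoare_out=> h1 h2 hs; have [t1 [s1 [e1 l1 [w1 f1 q1]]]] := h1 hs.
have [t2 [s2 [e2 l2 q2]]] := h2 _ w1 f1 q1 w1.
by exists (t1 + t2), s2; split; [exists t1, s1, t2 | exact: leq_add |].
Qed.

Lemma hoare_if e c1 c2 s T (Q : mstate -> Prop) :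
  (ev e s != 0 -> hoare c1 s T Q) -> (ev e s = 0 -> hoare c2 s T Q) ->
  hoare (Ife e c1 c2) s T.+1 Q.
Proof.
move=> h1 h2 hs; case: (ev e s =P 0) => [he|/eqP he].
  have [t [s' [x1 x2 x3]]] := h2 he hs.
  by exists t.+1, s'; split=> //; exists t; rewrite he.
have [t [s' [x1 x2 x3]]] := h1 he hs.
by exists t.+1, s'; split=> //; exists t; rewrite he.
Qed.

(** A separate cost for each iteration is needed in the hitting set loop, where the cost of an
    element is its degree and only the sum of the degrees is small. *)
Lemma hoare_for_sum (I : nat -> mstate -> Prop) (T : nat -> nat) x y c s
    (Q : mstate -> Prop) :
  I 0 s ->
  (forall k s' s'', k < vr s y -> wf s'' -> frame (x :: mv c) (ma c) s s' ->
     I k s' -> frame [:: x] [::] s' s'' -> pm s'' = pm s' -> vr s'' x = k ->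
     hoare c s'' (T k) (I k.+1)) ->
  (forall s', wf s' -> frame (x :: mv c) (ma c) s s' -> I (vr s y) s' -> Q s') ->
  hoare (For x y c) s (\sum_(k < vr s y) (T k).+1).+1 Q.
Proof.
move=> h0 hstep hQ hs.
suff main m k s0 : k + m = vr s y -> wf s0 -> frame (x :: mv c) (ma c) s s0 ->
    I k s0 -> exists t s', [/\ loop (fun k s => mexec c (setv s x k)) k m s0 t s',
      t <= (\sum_(k <= j < k + m) (T j).+1).+1, wf s',
      frame (x :: mv c) (ma c) s s' & I (vr s y) s'].
  have [t [s' [h1 h2 h3 h4 h5]]] := main _ 0 s (add0n _) hs (frame_refl _ _ _) h0.
  exists t, s'; split=> //; last exact: hQ.
  by move: h2; rewrite add0n big_mkord.
elim: m k s0 => [|m IH] k s0 hk hs0 hf hI.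
  by exists 1, s0; split=> //; move: hk hI; rewrite addn0 => ->.
have hkC : k <= C by case: hs => h _; apply: leq_trans (h y); rewrite -hk leq_addr.
have hklt : k < vr s y by rewrite -hk addnS ltnS leq_addr.
have w0 : wf (setv s0 x k) by apply: wf_setv.
have h1 := hstep k s0 (setv s0 x k) hklt w0 hf hI (frame_setv _ _ _) erefl.
have [|//|] := hoare_out (h1 _); first by rewrite /= update_same.
move=> t1 [s1 [e1 l1 [w1 f1 q1]]].
have hf1 : frame (x :: mv c) (ma c) s s1.
  apply: frame_trans hf _; apply: (@frame_trans _ _ _ (setv s0 x k)).
    by apply: frame1 (frame_setv s0 x k); rewrite mem_head.
  by apply: frame_sub f1 => z hz //; rewrite inE hz orbT.
have [t2 [s2 [e2 l2 w2 f2 q2]]] := IH k.+1 s1 (etrans (addSnnS _ _) hk) w1 hf1 q1.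
exists (t1 + t2).+1, s2; split=> //; first by exists t1, s1, t2.
rewrite big_ltn; last by rewrite -addSnnS leq_addr.
by move: l2; rewrite addSnnS; lia.
Qed.

Lemma hoare_for (I : nat -> mstate -> Prop) (T : nat) x y c s
    (Q : mstate -> Prop) :
  I 0 s ->
  (forall k s' s'', k < vr s y -> wf s'' -> frame (x :: mv c) (ma c) s s' ->
     I k s' -> frame [:: x] [::] s' s'' -> pm s'' = pm s' -> vr s'' x = k ->
     hoare c s'' T (I k.+1)) ->
  (forall s', wf s' -> frame (x :: mv c) (ma c) s s' -> I (vr s y) s' -> Q s') ->
  hoare (For x y c) s (vr s y * T.+1).+1 Q.
Proof.
move=> h0 h1 h2.
have := hoare_for_sum (T := fun=> T) h0 h1 h2.
by rewrite sum_nat_const card_ord.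
Qed.

(* The expression may read the cell which it replaces. *)
Definition Map3 a x y z bx bY bz e :=
  For x bx (For y bY (For z bz (Sto a (EVar x) (EVar y) (EVar z) e))).

(** The cells already replaced are the triples lexicographically before the current one, as
    described by [A1], [A2] and [A3]. The current cell is the only cell of [a] about which the
    expression may assume anything: it still holds its old value. *)
Lemma hoare_map3 (f : nat -> nat -> nat -> nat) a x y z bx bY bz e s T
    (Q : mstate -> Prop) :
  uniq [:: x; y; z] -> bY \notin [:: x; y; z] -> bz \notin [:: x; y; z] ->
  (forall i j k s', i < vr s bx -> j < vr s bY -> k < vr s bz -> wf s' ->
     frame [:: x; y; z] [:: a] s s' -> vr s' x = i -> vr s' y = j -> vr s' z = k ->
     ar s' a i j k = ar s a i j k -> ev e s' = f i j k /\ f i j k <= C) ->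
  4 * (vr s bx).+1 * (vr s bY).+1 * (vr s bz).+1 <= T ->
  (forall s', wf s' -> frame [:: x; y; z] [:: a] s s' ->
     (forall i j k, ar s' a i j k =
        if [&& i < vr s bx, j < vr s bY & k < vr s bz] then f i j k
        else ar s a i j k) -> Q s') ->
  hoare (Map3 a x y z bx bY bz e) s T Q.
Proof.
rewrite /= !inE !negb_or andbT => /andP[/andP[xy xz] yz] hbY hbz he hT hQ.
have nbY : bY \notin [:: x; y; z] by rewrite !inE !negb_or.
have nbz : bz \notin [:: x; y; z] by rewrite !inE !negb_or.
set nx := vr s bx in he hT hQ *; set ny := vr s bY in he hT hQ *.
set nz := vr s bz in he hT hQ *.
pose don (A : nat -> nat -> nat -> bool) s' := frame [:: x; y; z] [:: a] s s' /\
  forall i j k, ar s' a i j k = if A i j k then f i j k else ar s a i j k.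
pose A1 i0 i j k := [&& i < i0, j < ny & k < nz].
pose A2 i0 j0 i j k := A1 i0 i j k || [&& i == i0, j < j0 & k < nz].
pose A3 i0 j0 k0 i j k := A2 i0 j0 i j k || [&& i == i0, j == j0 & k < k0].
have ext A B s' : (forall i j k, A i j k = B i j k) -> don A s' -> don B s'.
  by move=> h [hf hA]; split=> // i j k; rewrite -h hA.
have mov A v s1 s2 : v \in [:: x; y; z] -> frame [:: v] [::] s1 s2 -> don A s1 -> don A s2.
  move=> hv h12 [f1 h1]; split; first exact: frame_trans f1 (frame1 _ hv h12).
  by move=> i j k; rewrite (fra h12).
have hx : x \in [:: x; y; z] by rewrite !inE eqxx.
have hy : y \in [:: x; y; z] by rewrite !inE eqxx orbT.
have hz : z \in [:: x; y; z] by rewrite !inE eqxx !orbT.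
apply: (hoare_weaken (T := (nx * (ny * (nz * 2).+1.+1).+1.+1).+1)
  (Q := don (A1 nx))); last 2 first.
- by move: hT; rewrite -/nx; nia.
- by move=> s' w' _ [h1 h2]; apply: hQ.
apply: (hoare_for (I := fun i => don (A1 i))) => //.
move=> i s1 s2 hi _ _ d1 f12 _ vx.
have {d1} d2 := mov _ _ _ _ hx f12 d1.
have eY : vr s2 bY = ny by case: d2 => h _; rewrite (frv h).
rewrite -eY.
apply: (hoare_for (I := fun j s' => don (A2 i j) s' /\ vr s' x = i)).
- by split=> //; apply: ext d2 => i' j' k'; rewrite /A2 ltn0 andbF orbF.
- move=> j s3 s4; rewrite eY => hj _ _ [d3 vx3] f34 _ vy.
  have {d3} d4 := mov _ _ _ _ hy f34 d3.
  have vx4 : vr s4 x = i by rewrite (frv f34) // inE.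
  have eZ : vr s4 bz = nz by case: d4 => h _; rewrite (frv h).
  rewrite -eZ.
  apply: (hoare_for (I := fun k s' => [/\ don (A3 i j k) s', vr s' x = i & vr s' y = j])).
  + by split=> //; apply: ext d4 => i' j' k'; rewrite /A3 ltn0 !andbF orbF.
  + move=> k s5 s6; rewrite eZ => hk w6 _ [d5 vx5 vy5] f56 _ vz.
    have {d5} [f6 d6] := mov _ _ _ _ hz f56 d5.
    have vx6 : vr s6 x = i by rewrite (frv f56) // inE.
    have vy6 : vr s6 y = j by rewrite (frv f56) // inE.
    have own : ar s6 a i j k = ar s a i j k.
      by rewrite d6 /A3 /A2 /A1 !eqxx !ltnn !andbF.
    have [ee le] := he i j k s6 hi hj hk w6 f6 vx6 vy6 vz own.
    apply: hoare_sto; rewrite ee // => s7 f7 _ h7.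
    split; [split|by rewrite (frv f7)|by rewrite (frv f7)].
      apply: frame_trans f6 _; apply: frame_sub f7 => w //.
    move=> i' j' k'; rewrite h7 /= vx6 vy6 vz d6 /A3.
    have [->|ni] := eqVneq i' i; have [->|nj] := eqVneq j' j;
      have [->|nk] := eqVneq k' k; rewrite /= ?orbF ?ltnSn ?orbT //.
    by rewrite ltnS [in RHS]leq_eqVlt (negbTE nk).
  + move=> s7 _ _; rewrite eZ => -[d7 vx7 vy7]; split=> //.
    apply: ext d7 => i' j' k'; rewrite /A3 /A2 -orbA; congr (_ || _).
    by case: (i' == i) => //=; rewrite -andb_orl orbC -leq_eqVlt.
- move=> s7 _ _; rewrite eY => -[d7 vx7]; apply: ext d7 => i' j' k'.
  by rewrite /A2 /A1 -andb_orl orbC -leq_eqVlt.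
Qed.

Lemma hoare_poke2 (f : nat -> nat -> nat) b x y bx bY e1 e2 s T
    (Q : mstate -> Prop) :
  x != y -> bY \notin [:: x; y] ->
  (forall i j s', i < vr s bx -> j < vr s bY -> wf s' ->
     frame [:: x; y] [::] s s' -> vr s' x = i -> vr s' y = j ->
     [/\ ev e1 s' = b + i * vr s bY + j, ev e2 s' = f i j & f i j <= C]) ->
  4 * (vr s bx).+1 * (vr s bY).+1 <= T ->
  (forall s', wf s' -> frame [:: x; y] [::] s s' ->
     (forall i j, i < vr s bx -> j < vr s bY ->
        pm s' (b + i * vr s bY + j) = f i j) ->
     (forall k, ~~ (b <= k < b + vr s bx * vr s bY) -> pm s' k = pm s k) -> Q s') ->
  hoare (For x bx (For y bY (Poke e1 e2))) s T Q.
Proof.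
move=> xy hbY he hT hQ.
set nx := vr s bx in he hT hQ *; set ny := vr s bY in he hT hQ *.
pose don (m : nat) s' := frame [:: x; y] [::] s s' /\
  forall k, pm s' k = if b <= k < b + m then f ((k - b) %/ ny) ((k - b) %% ny) else pm s k.
have mov m v s1 s2 : v \in [:: x; y] -> frame [:: v] [::] s1 s2 -> pm s2 = pm s1 ->
    don m s1 -> don m s2.
  move=> hv h12 e12 [f1 h1]; split; first exact: frame_trans f1 (frame1 _ hv h12).
  by move=> k; rewrite e12.
have hx : x \in [:: x; y] by rewrite !inE eqxx.
have hy : y \in [:: x; y] by rewrite !inE eqxx orbT.
have xny : x != y by [].
apply: (hoare_weaken (T := (nx * (ny * 2).+1.+1).+1) (Q := don (nx * ny))); last 2 first.
- by move: hT; rewrite -/nx; nia.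
- move=> s' w' _ [h1 h2]; apply: hQ => // [i j hi hj|k hk].
    rewrite h2 -addnA leq_addr ltn_add2l addKn divnMDl ?modnMDl ?divn_small ?modn_small ?addn0 //; last by lia.
    by rewrite (_ : _ < _) //; nia.
  by rewrite h2 (negbTE hk).
apply: (hoare_for (I := fun i => don (i * ny))); last by [].
  by split; [exact: frame_refl | move=> k; rewrite mul0n addn0; case: ifP => //; lia].
move=> i s1 s2 hi _ _ d1 f12 e12 vx.
have {d1} d2 := mov _ _ _ _ hx f12 e12 d1.
have eY : vr s2 bY = ny by case: d2 => h _; rewrite (frv h).
rewrite -[in (ny * 2)%N]eY.
apply: (hoare_for (I := fun j s' => don (i * ny + j) s' /\ vr s' x = i)).
- by rewrite addn0.
- move=> j s3 s4; rewrite eY => hj w4 _ [d3 vx3] f34 e34 vy.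
  have {d3} [f4 d4] := mov _ _ _ _ hy f34 e34 d3.
  have vx4 : vr s4 x = i by rewrite (frv f34) // inE.
  have [h1 h2 h3] := he i j s4 hi hj w4 f4 vx4 vy.
  move=> _; exists 1, (setp s4 (update (pm s4) (ev e1 s4) (minn (ev e2 s4) C))).
  split=> //; split=> //; split=> // k /=.
  rewrite h1 h2 (minn_idPl h3) /update d4 !addnS.
  have [->|nk] := eqVneq k (b + i * ny + j).
    rewrite -addnA leq_addr ltnS leqnn addKn divnMDl ?modnMDl ?divn_small ?modn_small ?addn0 //.
    by lia.
  rewrite -/ny ltnS [in RHS](leq_eqVlt k) addnA (negbTE nk) //.
- move=> s7 _ _; rewrite eY => -[d7 _]; by rewrite mulSn addnC.
Qed.

Lemma hoare_peek x e s (Q : mstate -> Prop) :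
  pm s (ev e s) <= C ->
  (forall s', frame [:: x] [::] s s' -> pm s' = pm s -> vr s' x = pm s (ev e s) -> Q s') ->
  hoare (Peek x e) s 1 Q.
Proof.
move=> he hQ hs; exists 1, (setv s x (pm s (ev e s))); split=> //.
  by split=> //; congr setv; apply/esym/minn_idPl.
by apply: hQ; [exact: frame_setv | | rewrite /= update_same].
Qed.

End Hoare.

(** * Boolean products through Min-Plus products *)

Notation "a '+^' b" := (EBin BAdd a b) (at level 50, left associativity).
Notation "a '-^' b" := (EBin BSub a b) (at level 50, left associativity).
Notation "a '*^' b" := (EBin BMul a b) (at level 40, left associativity).
Notation "a '/^' b" := (EBin BDiv a b) (at level 40, left associativity).
Notation "a '%^' b" := (EBin BMod a b) (at level 40, left associativity).
Notation "a '<^' b" := (EBin BLt a b) (at level 70, no associativity).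
Notation "a '=^' b" := (EBin BEq a b) (at level 70, no associativity).
Notation "c1 ;; c2" := (Then c1 c2) (at level 90, right associativity).

Notation vn := 0.
Notation vpn := 1.
Notation vlam := 2.
Notation vone := 3.

(* Arrays are numbered; the cell (0, 0, k) of [aIO] is the cell k of the memory
   of the compiled program. *)
Notation aIO := 0.
Notation aA := 1.
Notation aB := 2.
Notation aC := 3.
Notation aBig := 4.

Definition is_min (k : nat) (f : nat -> nat) (c : nat) : Prop :=
  (exists2 y, y < k & c = f y) /\ forall y, y < k -> c <= f y.

(** A fresh window with both matrices written one after the other is exactly the initial memory in
    which [P] is specified; zeros behind the input are part of that specification. *)
Definition MP (vk : nat) : cmd :=
  Fresh ;;
  For 10 vn (For 11 vk (Poke (ENum 0 +^ EVar 10 *^ EVar vk +^ EVar 11)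
    (EArr aA (ENum 0) (EVar 10) (EVar 11)))) ;;
  For 10 vk (For 11 vn (Poke (EVar vn *^ EVar vk +^ EVar 10 *^ EVar vn +^ EVar 11)
    (EArr aB (ENum 0) (EVar 10) (EVar 11)))) ;;
  RunP vn vk vn ;;
  For 10 vn (For 11 vn (
    Peek 12 (EVar vn *^ EVar vk +^ EVar vk *^ EVar vn +^ (EVar 10 *^ EVar vn +^ EVar 11)) ;;
    Sto aC (ENum 0) (EVar 10) (EVar 11) (EVar 12))).

(* The loops of [Map3] use the variables 20, 21 and 22. *)
Definition Fill a bx bY bz e := Map3 a 20 21 22 bx bY bz e.

(* The boolean product of an NR * n and an n * NC matrix, in n * n batches; for
   Min-Plus, 0 stands for true and 1 for false. *)
Definition BigBP (vNR vNC : nat) (EA EB : expr -> expr -> expr) : cmd :=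
  Asg 13 (EVar vNC /^ EVar vn +^ ENum 1) ;;
  Asg 14 ((EVar vNR /^ EVar vn +^ ENum 1) *^ EVar 13) ;;
  For 15 14 (
    Fill aA vone vn vn (EA (EVar 15 /^ EVar 13 *^ EVar vn +^ EVar 21) (EVar 22) =^ ENum 0) ;;
    Fill aB vone vn vn (EB (EVar 21) (EVar 15 %^ EVar 13 *^ EVar vn +^ EVar 22) =^ ENum 0) ;;
    MP vn ;;
    Fill aBig vone vNR vNC
      (EArr aBig (EVar 20) (EVar 21) (EVar 22) *^
       ((EVar 21 /^ EVar vn *^ EVar 13 +^ EVar 22 /^ EVar vn =^ EVar 15) =^ ENum 0) +^
       (EVar 21 /^ EVar vn *^ EVar 13 +^ EVar 22 /^ EVar vn =^ EVar 15) *^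
       (EArr aC (ENum 0) (EVar 21 %^ EVar vn) (EVar 22 %^ EVar vn) =^ ENum 0))).

(* A constant, so that exponents such as 800 are never unfolded. *)
Definition xpow (n k : nat) : nat := n.+1 ^ k.

Lemma xpow_mul n i j a b : a <= xpow n i -> b <= xpow n j -> a * b <= xpow n (i + j).
Proof. by rewrite /xpow expnD; apply: leq_mul. Qed.

Lemma xpow_gt0 n i : 0 < xpow n i. Proof. by rewrite /xpow expn_gt0. Qed.

Lemma xpow_leq n i j a : i <= j -> a <= xpow n i -> a <= xpow n j.
Proof. by move=> hij h; apply: leq_trans h _; rewrite /xpow leq_pexp2l. Qed.

Lemma xpow_add n i j a b : 0 < n ->
  a <= xpow n i -> b <= xpow n j -> a + b <= xpow n (i + j + 1).
Proof.
move=> n0 ha hb; have h1 := xpow_gt0 n i; have h2 := xpow_gt0 n j.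
rewrite /xpow !expnD expn1 -!/(xpow _ _).
apply: (@leq_trans (xpow n i * xpow n j * 2)); last by rewrite leq_mul2l ltnS n0 orbT.
by nia.
Qed.

Section Algorithm.

Variables (P : program) (n C WP G : nat) (allowed : nat -> nat -> Prop).

Hypotheses (n0 : 0 < n) (hG : n * n <= G) (KC : nat)
  (hKC : 2000 <= KC) (hC : n.+1 ^ KC <= C)
  (hP : forall k M m (f g : nat -> nat -> nat), allowed k M -> 0 < k ->
    (forall i y, i < n -> y < k -> m (i * k + y) = f i y /\ f i y <= M) ->
    (forall y j, y < k -> j < n -> m (n * k + y * n + j) = g y j /\ g y j <= M) ->
    (forall x, n * k + k * n <= x -> m x = 0) ->
    exists w t st, [/\ 2 ^ w <= WP, exec w P (State (nth 0 [:: n; k; n]) m) t st,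
      t <= G & forall i j, i < n -> j < n ->
        is_min k (fun y => f i y + g y j) (memory st (n * k + k * n + (i * n + j)))]).

Notation hoare := (hoare P C WP).
Notation wf := (wf C).

Lemma powC k a : k <= KC -> a <= xpow n k -> a <= C.
Proof.
move=> hk ha; apply: leq_trans ha _; apply: leq_trans hC.
by rewrite leq_pexp2l.
Qed.

Lemma leqC c : c <= 1000 -> c <= C.
Proof.
move=> hc; apply: (@powC 1000) => //; first by lia.
rewrite /xpow; apply: leq_trans hc _; apply: ltnW; apply: (leq_trans (ltn_expl 1000 (isT : 1 < 2))).
by rewrite leq_exp2r.
Qed.

(** The bound [M <= n] keeps the entries of the product below [2 * n <= C], so that the cap does not
    falsify them when they are read back. *)
Lemma hoare_MP vk k M (f g : nat -> nat -> nat) s (Q : mstate -> Prop) :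
  vk \notin [:: 10; 11; 12] -> vr s vn = n -> vr s vk = k -> 0 < k <= n -> M <= n ->
  allowed k M ->
  (forall i y, i < n -> y < k -> ar s aA 0 i y = f i y /\ f i y <= M) ->
  (forall y j, y < k -> j < n -> ar s aB 0 y j = g y j /\ g y j <= M) ->
  (forall s', wf s' -> frame [:: 10; 11; 12] [:: aC] s s' ->
     (forall i j, i < n -> j < n ->
        is_min k (fun y => f i y + g y j) (ar s' aC 0 i j)) -> Q s') ->
  hoare (MP vk) s (60 * G) Q.
Proof.
move=> hvk hn hk /andP[k0 kn] hMn hall hf hg hQ.
have G0 : 0 < n * n by rewrite muln_gt0 n0.
have h2 : 2 * n <= C.
  apply: (@powC 2); first by lia.
  by rewrite /xpow !expnS expn0 muln1; nia.
have kf vs s' : frame vs [::] s s' -> vk \notin vs -> vr s' vk = k.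
  by move=> h1 h3; rewrite (frv h1).
have hvk2 : vk \notin [:: 10; 11].
  by move: hvk; rewrite !inE !negb_or => /and3P[-> -> _].
apply: (hoare_weaken (Q := Q) (T := 1 + (16 * n * n + (16 * n * n + (G.+1 + 20 * n * n))))); last 2 first.
- by move: hG G0; rewrite -!mulnA; lia.
- by [].
apply: (hoare_then (Q1 := fun s' => s' = setp s (fun=> 0))).
  by move=> hs; exists 1, (setp s (fun=> 0)).
move=> _s w1 _ es; move: w1; rewrite es => {_s es}; set s1 := setp _ _ => w1.
apply: (hoare_then (Q1 := fun s' => frame [:: 10; 11] [::] s s' /\
   (forall i j, i < n -> j < k -> pm s' (i * k + j) = f i j) /\
   (forall x, n * k <= x -> pm s' x = 0))).
  apply: (@hoare_poke2 P C WP f 0) => //=.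
  - rewrite hn hk => i j s' hi hj w' fr -> ->; rewrite (frv fr) // hk (fra fr) //=.
    by have [-> h] := hf i j hi hj; split=> //; lia.
  - by rewrite hn hk; nia.
  - rewrite hn hk => s2 w2 fr h1 h3; split=> //; split=> [i j hi hj|x hx].
      by have := h1 i j hi hj; rewrite add0n.
    by rewrite h3 //=; lia.
move=> s2 w2 _ [fr2 [p2 q2]].
have n2 : vr s2 vn = n by rewrite (frv fr2).
have k2 : vr s2 vk = k by rewrite (frv fr2).
apply: (hoare_then (Q1 := fun s' => frame [:: 10; 11] [::] s s' /\ [/\
   forall i j, i < n -> j < k -> pm s' (i * k + j) = f i j,
   forall i j, i < k -> j < n -> pm s' (n * k + i * n + j) = g i j &
   forall x, n * k + k * n <= x -> pm s' x = 0])).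
  apply: (@hoare_poke2 P C WP g (n * k)) => //.
  - rewrite n2 k2 => i j s' hi hj w' fr /= -> ->.
    have fr' := frame_trans fr2 fr.
    rewrite (frv fr') // (frv fr') // hn hk (fra fr') //.
    by have [-> h] := hg i j hi hj; split=> //; lia.
  - by rewrite n2 k2; nia.
  - rewrite n2 k2 => s3 w3 fr h1 h3; split; first exact: frame_trans fr2 fr.
    split=> [i j hi hj|i j hi hj|x hx]; first 1 last.
    + exact: h1.
    + by rewrite h3 ?q2 //; lia.
    + by rewrite h3 ?p2 //; nia.
move=> s3 w3 _ [fr3 [p3 r3 q3]].
have n3 : vr s3 vn = n by rewrite (frv fr3).
have k3 : vr s3 vk = k by rewrite (frv fr3).
have hA i y : i < n -> y < k -> pm s3 (i * k + y) = f i y /\ f i y <= M.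
  by move=> hi hy; rewrite p3 //; case: (hf i y hi hy).
have hB y j : y < k -> j < n -> pm s3 (n * k + y * n + j) = g y j /\ g y j <= M.
  by move=> hy hj; rewrite r3 //; case: (hg y j hy hj).
have [w [t [st [hw he ht hst]]]] := hP hall k0 hA hB q3.
apply: (hoare_then (Q1 := fun s' => s' = setp s3 (memory st))).
  move=> _; exists t.+1, (setp s3 (memory st)); split=> //.
  by exists w, t, st; rewrite n3 k3.
move=> _s w4 _ es; move: w4; rewrite es => {_s es}; set s4 := setp _ _ => w4.
have n4 : vr s4 vn = n by [].
have k4 : vr s4 vk = k by [].
have fr4 : frame [:: 10; 11; 12] [:: aC] s s4.
  by apply: frame_sub fr3 => // z; rewrite !inE => /orP[->|->]; rewrite ?orbT.
pose don (A : nat -> nat -> bool) s' := [/\ frame [:: 10; 11; 12] [:: aC] s s',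
  pm s' = memory st & forall i j, i < n -> j < n -> A i j ->
     is_min k (fun y => f i y + g y j) (ar s' aC 0 i j)].
have mov A v s1' s2' : v \in [:: 10; 11; 12] -> frame [:: v] [::] s1' s2' -> pm s2' = pm s1' ->
    don A s1' -> don A s2'.
  move=> hv h12 e12 [f1 e1 h1]; split; [exact: frame_trans f1 (frame1 _ hv h12) | by rewrite e12 |].
  by move=> i j hi hj hAij; rewrite (fra h12) //; apply: h1.
apply: (hoare_weaken (T := (n * (n * (1 + 1).+1).+1.+1).+1) (Q := don (fun i j => i < n))); last 2 first.
- by nia.
- by move=> s' w' _ [h1 _ h3]; apply: hQ => // i j hi hj; apply: h3.
rewrite -{1}n4; apply: (hoare_for (I := fun i0 => don (fun i j => i < i0))); last first.
- by rewrite n4.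
- move=> i s5 s6; rewrite n4 => hi w6 _ d5 f56 e56 v10.
  have {}d5 := mov _ _ _ _ (isT : 10 \in [:: 10; 11; 12]) f56 e56 d5.
  have n6 : vr s6 vn = n by case: d5 => h _ _; rewrite (frv h).
  rewrite -{1}n6; apply: (hoare_for (I := fun j0 s' => don (fun i' j => (i' < i) || (i' == i) && (j < j0)) s' /\ vr s' 10 = i)).
  + split=> //; case: d5 => h1 h3 h4; split=> // i' j' hi' hj'.
    by rewrite ltn0 andbF orbF; apply: h4.
  + move=> j s7 s8; rewrite n6 => hj w8 _ [d7 v7] f78 e78 v11.
    have {}d7 := mov _ _ _ _ (isT : 11 \in [:: 10; 11; 12]) f78 e78 d7.
    have v10' : vr s8 10 = i by rewrite (frv f78).
    have [fr8 e8 h8] := d7.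
    have n8 : vr s8 vn = n by rewrite (frv fr8).
    have k8 : vr s8 vk = k by rewrite (frv fr8).
    have hc := hst i j hi hj.
    set c := memory st (n * k + k * n + (i * n + j)) in hc.
    have hcC : c <= C.
      case: hc => -[y hy ->] _; apply: leq_trans h2.
      by have [_ ?] := hf i y hi hy; have [_ ?] := hg y j hy hj; lia.
    apply: (hoare_then (Q1 := fun s' => frame [:: 12] [::] s8 s' /\ pm s' = memory st /\ vr s' 12 = c)).
      by apply: hoare_peek; rewrite /= n8 k8 v10' v11 e8 // => s9 f9 e9 v9.
    move=> s9 w9 _ [f9 [e9 v9]].
    have [fr9 e9' h9] := mov _ _ _ _ (isT : 12 \in [:: 10; 11; 12]) f9 (etrans e9 (esym e8)) d7.
    apply: hoare_sto; first by rewrite /= v9.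
    move=> s10 f10 e10 h10; rewrite /= v9 (frv f9) // (frv f9) // v10' v11 in h10.
    split; last by rewrite (frv f10) // (frv f9).
    split.
    * apply: frame_trans fr9 _; apply: frame_sub f10 => // z; by rewrite inE => /eqP->.
    * by rewrite e10.
    * move=> i' j' hi' hj'; rewrite ltnS leq_eqVlt => hA'; rewrite h10 eqxx /=.
      by case: ifP => [/andP[/eqP-> /eqP->] //|hne]; apply: h9 => //; move: hA' hne; lia.
  + rewrite n6 => s7 _ _ [[h1 h3 h4] _]; split=> // i' j' hi' hj' hA'.
    by apply: h4 => //; rewrite hj'; lia.
- by split.
Qed.

Definition bpV := [:: 10; 11; 12; 13; 14; 15; 20; 21; 22].
Definition bpA := [:: aA; aB; aC; aBig].

Definition bprod (f g : nat -> nat -> bool) (i j : nat) : bool :=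
  has (fun y => f i y && g y j) (iota 0 n).

Lemma bprodP (f g : nat -> nat -> bool) i j :
  reflect (exists y, [/\ y < n, f i y & g y j]) (bprod f g i j).
Proof.
apply: (iffP hasP) => [[y]|[y [h1 h2 h3]]].
  by rewrite mem_iota add0n => /andP[_ h] /andP[h1 h2]; exists y.
by exists y; rewrite ?mem_iota ?h2.
Qed.

Lemma hoare_fill (f : nat -> nat -> nat -> nat) a bx bY bz e s T
    (Q : mstate -> Prop) :
  bY \notin [:: 20; 21; 22] -> bz \notin [:: 20; 21; 22] ->
  (forall i j k s', i < vr s bx -> j < vr s bY -> k < vr s bz -> wf s' ->
     frame [:: 20; 21; 22] [:: a] s s' -> vr s' 20 = i -> vr s' 21 = j -> vr s' 22 = k ->
     ar s' a i j k = ar s a i j k -> ev e s' = f i j k /\ f i j k <= C) ->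
  4 * (vr s bx).+1 * (vr s bY).+1 * (vr s bz).+1 <= T ->
  (forall s', wf s' -> frame [:: 20; 21; 22] [:: a] s s' ->
     (forall i j k, ar s' a i j k =
        if [&& i < vr s bx, j < vr s bY & k < vr s bz] then f i j k
        else ar s a i j k) -> Q s') ->
  hoare (Fill a bx bY bz e) s T Q.
Proof. by move=> *; apply: hoare_map3; eauto. Qed.

(** A sum of two entries is 0 exactly when the inner index is a witness, so the minimum tests for a
    witness. The square in the bound arises because there are up to [a * b] batches, and after each
    of them the whole result of up to [a * b * (n * n)] cells is rewritten to update a single
    block. *)
Lemma hoare_BigBP vNR vNC EA EB (fA fB : nat -> nat -> bool) NR NC a b s
    (Q : mstate -> Prop) :
  vNR \notin bpV -> vNC \notin bpV ->
  vr s vn = n -> vr s vone = 1 -> vr s vNR = NR -> vr s vNC = NC -> allowed n 1 ->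
  NR < a * n -> NC < b * n -> a <= xpow n 800 -> b <= xpow n 800 ->
  (forall s' er ey, frame bpV bpA s s' ->
     (ev (EA er ey) s' != 0) = fA (ev er s') (ev ey s')) ->
  (forall s' ey er, frame bpV bpA s s' ->
     (ev (EB ey er) s' != 0) = fB (ev ey s') (ev er s')) ->
  (forall s', wf s' -> frame bpV bpA s s' ->
     (forall i j, i < NR -> j < NC -> ar s' aBig 0 i j = bprod fA fB i j) -> Q s') ->
  hoare (BigBP vNR vNC EA EB) s (150 * (a.+1 * b.+1) ^ 2 * G) Q.
Proof.
move=> hvR hvC hn h1 hNR hNC hall hRa hCb ha hb hA hB hQ.
have gn : 0 < n * n by rewrite muln_gt0 n0.
have G0 : 0 < G by apply: leq_trans hG.
have a0 : 0 < a by case: a hRa {ha}.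
have b0 : 0 < b by case: b hCb {hb}.
have r1 : NR %/ n < a by rewrite ltn_divLR.
have r2 : NC %/ n < b by rewrite ltn_divLR.
set nbr := NR %/ n + 1; set nbc := NC %/ n + 1.
have hnbr : nbr <= a by rewrite /nbr addn1.
have hnbc : nbc <= b by rewrite /nbc addn1.
have keep vs bs s' v : frame vs bs s s' -> all (mem bpV) vs -> v \notin bpV -> vr s' v = vr s v.
  move=> h1' /allP h2' h3'; apply: (frv h1'); by apply: contra h3'; apply: h2'.
apply: (hoare_weaken (Q := Q) (T := 1 + (1 + (nbr * nbc * (140 * (a.+1 * b.+1) * G).+1).+1))) => //; last first.
  have hnb : nbr * nbc <= a * b by apply: leq_mul.
  rewrite expnS expn1 mulnA; set m := a.+1 * b.+1.
  have hab : a * b < m by rewrite /m mulSn mulnS; lia.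
  have m0 : 0 < m by [].
  have h3 : nbr * nbc * (140 * m * G).+1 <= m * (140 * m * G).+1.
    by rewrite leq_mul2r; apply/orP; right; apply: leq_trans hnb _; apply: ltnW.
  apply: leq_trans (_ : 3 + m * (140 * m * G).+1 <= _); first by lia.
  clearbody m; rewrite mulnS -!mulnA (mulnCA m 140); set z := m * (m * G).
  have : m <= z by rewrite leq_pmulr // muln_gt0 m0.
  by lia.
apply: (hoare_then (Q1 := fun s' => vr s' 13 = nbc)).
  apply: hoare_asg => /=; last by move=> s' _ ->; rewrite hNC hn.
  move=> _; rewrite hNC hn; apply: (@powC 800); first by lia.
  exact: leq_trans hb.
move=> s1 w1 f1 v13.
have e1 v : v \notin bpV -> vr s1 v = vr s v by apply: keep f1 isT.
apply: (hoare_then (Q1 := fun s' => vr s' 14 = nbr * nbc)).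
  apply: hoare_asg => /=; last by move=> s' _ ->; rewrite v13 (e1 vn isT) (e1 _ hvR) hNR hn.
  move=> _; rewrite v13 (e1 vn isT) (e1 _ hvR) hNR hn; apply: (@powC 1600); first by lia.
  exact: (@xpow_mul _ 800 800) (leq_trans hnbr ha) (leq_trans hnbc hb).
move=> s2 w2 f2 v14.
have f2' : frame bpV bpA s s2.
  by apply: frame_trans (frame_all _ _ f1) (frame_all _ _ f2).
have v13' : vr s2 13 = nbc by rewrite (frv f2).
rewrite -v14.
(* The number of the batch that is responsible for the cell. *)
pose idx i j := i %/ n * nbc + j %/ n.
apply: (hoare_for (I := fun q s' => [/\ frame bpV bpA s s', vr s' 13 = nbc &
   forall i j, i < NR -> j < NC -> idx i j < q -> ar s' aBig 0 i j = bprod fA fB i j])); first 1 last.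
- move=> q s3 s4; rewrite v14 => hq w4 _ [f3 v3 h3] f34 _ v15.
  have f4 : frame bpV bpA s s4 by apply: frame_trans f3 (frame1 _ _ f34).
  have v4 : vr s4 13 = nbc by rewrite (frv f34).
  have nbc0 : 0 < nbc by rewrite /nbc addn1.
  have g4 v : v \notin bpV -> vr s4 v = vr s v by move=> hv; apply: (frv f4).
  have n4 : vr s4 vn = n by rewrite g4.
  have one4 : vr s4 vone = 1 by rewrite g4.
  apply: (hoare_weaken (Q := fun s' => [/\ frame bpV bpA s s', vr s' 13 = nbc &
   forall i j, i < NR -> j < NC -> idx i j < q.+1 -> ar s' aBig 0 i j = bprod fA fB i j])
   (T := 32 * (n * n) + (32 * (n * n) + (60 * G + 4 * 2 * NR.+1 * NC.+1)))) => //; last first.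
    have : NR.+1 * NC.+1 <= (a * n) * (b * n) by apply: leq_mul.
    rewrite -!mulnA (mulnCA n b) !mulnA => hh.
    have h4 : a * b * (n * n) <= a.+1 * b.+1 * G by rewrite leq_mul // leq_mul.
    have h5 : G <= a.+1 * b.+1 * G by rewrite leq_pmull.
    rewrite -!mulnA; move: hh h4; rewrite -!mulnA; set u := NR.+1 * NC.+1.
    move: h5; rewrite -!mulnA; lia.
  have sq : 4 * 2 * n.+1 * n.+1 <= 32 * (n * n) by nia.
  apply: (hoare_then (Q1 := fun s' => forall i y, i < n -> y < n ->
      ar s' aA 0 i y = ~~ fA (q %/ nbc * n + i) y)).
    apply: (@hoare_fill (fun _ i y => nat_of_bool (~~ fA (q %/ nbc * n + i) y))) => //.
    + rewrite n4 one4 => i j k s' hi hj hk w' f' x20 x21 x22 _.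
      have f'' : frame bpV bpA s s' by apply: frame_trans f4 (frame_all _ _ f').
      split; last by case: (fA _ _) => /=; rewrite ?leqC.
      rewrite /= -(negbK (_ == 0)) hA //= x21 x22 (frv f') // (frv f') // (frv f') //.
      by rewrite v15 v4 n4.
    + by rewrite n4 one4.
    + by move=> s' w' f' h' i y hi hy; rewrite h' n4 one4 hi hy.
  move=> s5 w5 f45 h5.
  have f5 : frame bpV bpA s s5 by apply: frame_trans f4 (frame_all _ _ f45).
  have n5 : vr s5 vn = n by rewrite (frv f45).
  have one5 : vr s5 vone = 1 by rewrite (frv f45).
  have v135 : vr s5 13 = nbc by rewrite (frv f45).
  have v155 : vr s5 15 = q by rewrite (frv f45).
  apply: (hoare_then (Q1 := fun s' => forall y j, y < n -> j < n ->
      ar s' aB 0 y j = ~~ fB y (q %% nbc * n + j))).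
    apply: (@hoare_fill (fun _ y j => nat_of_bool (~~ fB y (q %% nbc * n + j)))) => //.
    + rewrite n5 one5 => i j k s' hi hj hk w' f' x20 x21 x22 _.
      have f'' : frame bpV bpA s s' by apply: frame_trans f5 (frame_all _ _ f').
      split; last by case: (fB _ _) => /=; rewrite ?leqC.
      rewrite /= -(negbK (_ == 0)) hB //= x21 x22 (frv f') // (frv f') // (frv f') //.
      by rewrite v155 v135 n5.
    + by rewrite n5 one5.
    + by move=> s' w' f' h' i y hi hy; rewrite h' n5 one5 hi hy.
  move=> s6 w6 f56 h6.
  have f6 : frame bpV bpA s s6 by apply: frame_trans f5 (frame_all _ _ f56).
  have n6 : vr s6 vn = n by rewrite (frv f56).
  have h5' i y : i < n -> y < n -> ar s6 aA 0 i y = ~~ fA (q %/ nbc * n + i) y.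
    by move=> hi hy; rewrite (fra f56) // h5.
  have nn : 0 < n <= n by rewrite n0 leqnn.
  apply: (hoare_then (Q1 := fun s' => forall i j, i < n -> j < n ->
      (ar s' aC 0 i j == 0) = bprod fA fB (q %/ nbc * n + i) (q %% nbc * n + j))).
    apply: (hoare_MP _ n6 n6 nn n0 hall (f := fun i y => ~~ fA (q %/ nbc * n + i) y) (g := fun y j => ~~ fB y (q %% nbc * n + j))) => //.
    + by move=> i y hi hy; rewrite h5' //; case: (fA _ _).
    + by move=> y j hy hj; rewrite h6 //; case: (fB _ _).
    + move=> s' w' f' h' i j hi hj; have [[y hy ->] hmin] := h' i j hi hj.
      rewrite addn_eq0 !eqb0 !negbK; apply/idP/bprodP => [/andP[u1 u2]|[z [hz u1 u2]]].
        by exists y.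
      by have := hmin z hz; rewrite u1 u2 /= leqn0 addn_eq0 !eqb0 !negbK.
  move=> s7 w7 f67 h7.
  have f7 : frame bpV bpA s s7 by apply: frame_trans f6 (frame_all _ _ f67).
  have g7 v : v \notin [:: 10; 11; 12; 20; 21; 22] -> vr s7 v = vr s4 v.
    by move=> hv; rewrite (frv f67) ?(frv f56) ?(frv f45) //; move: hv; rewrite /= !inE; lia.
  have n7 : vr s7 vn = n by rewrite g7.
  have one7 : vr s7 vone = 1 by rewrite g7.
  have nv v : v \notin bpV -> v \notin [:: 20; 21; 22].
    by apply: contra; rewrite /bpV !inE; lia.
  have R7 : vr s7 vNR = NR by rewrite (frv f7).
  have C7 : vr s7 vNC = NC by rewrite (frv f7).
  have v137 : vr s7 13 = nbc by rewrite g7.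
  have v157 : vr s7 15 = q by rewrite g7.
  have b7 i j : ar s7 aBig 0 i j = ar s3 aBig 0 i j.
    by rewrite (fra f67) // (fra f56) // (fra f45) // (fra f34).
  apply: (@hoare_fill (fun _ i j => if idx i j == q then nat_of_bool (bprod fA fB i j) else ar s3 aBig 0 i j)).
  + exact: nv.
  + exact: nv.
  + rewrite one7 R7 C7 => i j k s' hi hj hk w' f' x20 x21 x22 ho.
    have i0 : i = 0 by lia.
    move: ho; rewrite i0 => ho; rewrite i0 in x20.
    rewrite /= x20 x21 x22 ho (frv f') // (frv f') // (frv f') // (fra f') // n7 v137 v157.
    rewrite -/(idx j k) b7.
    case: (idx j k =P q) => hidx /=.
      rewrite muln0 mul1n h7 ?ltn_mod //; split; last by apply: leqC; case: bprod.
      congr (nat_of_bool (bprod _ _ _ _)).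
        by rewrite -hidx /idx divnMDl // (divn_small (_ : _ %/ n < nbc)) ?addn0 -?divn_eq // /nbc addn1 ltnS leq_div2r // ltnW.
      rewrite -hidx /idx modnMDl modn_small -?divn_eq // /nbc addn1 ltnS leq_div2r // ltnW //.
    rewrite muln1 addn0; split=> //.
    by rewrite -b7; case: w7.
  + by rewrite one7 R7 C7.
  + rewrite one7 R7 C7 => s' w' f' h'; split.
    * by apply: frame_trans f7 (frame_all _ _ f').
    * by rewrite (frv f').
    * move=> i j hi hj; rewrite h' hi hj /= ltnS leq_eqVlt.
      by case: eqP => //= _ hlt; apply: h3.
- rewrite v14 => s3 w3 _ [f3 _ h3]; apply: hQ => // i j hi hj; apply: h3 => //.
  rewrite /idx /nbr /nbc.
  have u1 : i %/ n <= NR %/ n by rewrite leq_div2r // ltnW.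
  have u2 : j %/ n <= NC %/ n by rewrite leq_div2r // ltnW.
  apply: (@leq_trans ((i %/ n).+1 * (NC %/ n + 1))).
    by rewrite mulSn addnC ltn_add2r addn1 ltnS.
  by rewrite leq_mul2r [NR %/ n + 1]addn1 ltnS u1 orbT.
- by split=> // i j _ _; rewrite ltn0.
Qed.

End Algorithm.

(** * Isolation by small prime moduli *)

Lemma prod_primes_logn n : 0 < n -> n = \prod_(p <- primes n) p ^ logn p n.
Proof.
move=> n0; rewrite {1}(prod_prime_decomp n0) prime_decompE big_map.
by apply: eq_bigr.
Qed.

(** Legendre's formula: a power [p ^ k <= 2 m] contributes at most 1 to the valuation, because
    [floor (2 x) <= 2 floor x + 1], and larger powers contribute nothing. *)
Lemma logn_central_binom p m : prime p -> 0 < m ->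
  p ^ logn p 'C(m.*2, m) <= m.*2.
Proof.
move=> pp m0; have p1 := prime_gt1 pp.
have m20 : 0 < m.*2 by rewrite double_gt0.
apply: leq_trans (trunc_logP p1 m20); rewrite leq_exp2l //.
have hb : 'C(m.*2, m) * (m`! * m`!) = (m.*2)`!.
  by rewrite -(@bin_fact m.*2 m) -?addnn ?leq_addl // addnK.
have e : logn p 'C(m.*2, m) + (logn p m`! + logn p m`!) = logn p (m.*2)`!.
  by rewrite -hb !lognM ?fact_gt0 ?bin_gt0 ?muln_gt0 ?fact_gt0 // -addnn leq_addl.
suff : logn p (m.*2)`! <= logn p m`! + logn p m`! + trunc_log p m.*2 by lia.
rewrite !logn_fact //.
have big0 a b : a <= b -> \sum_(1 <= k < b.+1) a %/ p ^ k = \sum_(1 <= k < a.+1) a %/ p ^ k.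
  move=> hab; rewrite (big_cat_nat (n := a.+1)) //= [X in _ + X]big_nat_cond [X in _ + X]big1 ?addn0 //.
  move=> k /andP[/andP[hk _] _]; apply: divn_small.
  by apply: leq_trans (ltn_expl k p1); apply: ltnW.
rewrite -(@big0 m m.*2) -?addnn ?leq_addl // -big_split /=.
have -> : trunc_log p (m + m) = \sum_(1 <= k < (trunc_log p (m + m)).+1) 1.
  by rewrite sum_nat_const_nat muln1 subn1.
set t := trunc_log p (m + m).
have ht : t <= m + m by apply: ltnW; apply: leq_trans (ltn_expl _ p1) _; rewrite trunc_logP // addnn.
rewrite (big_cat_nat (n := t.+1)) //= ?ltnS // [in X in _ <= X + _](big_cat_nat (n := t.+1)) //= ?ltnS //.
rewrite [X in _ + X]big_nat_cond [X in _ + X]big1 ?addn0; last first.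
  move=> k /andP[/andP[hk _] _]; apply: divn_small.
  by apply: leq_trans (trunc_log_ltn (m + m) p1) _; rewrite leq_exp2l.
rewrite -addnA [_ + \sum_(1 <= k < t.+1) 1]addnC addnA -big_split /=.
apply: leq_trans (leq_addr _ _); apply: leq_sum => k _.
have d0 : 0 < p ^ k by rewrite expn_gt0 ltnW.
rewrite addn1 -ltnS ltn_divLR //.
by have := ltn_ceil m d0; rewrite !mulSn mulnDl; lia.
Qed.

(** The central coefficient is the largest of [2 m + 1] coefficients with sum [2 ^ (2 m)]. *)
Lemma central_binom_ge m : 2 ^ m.*2 <= m.*2.+1 * 'C(m.*2, m).
Proof.
rewrite -[2]/(1 + 1) expnDn.
rewrite (eq_bigr (fun i : 'I_m.*2.+1 => 'C(m.*2, i))); last first.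
  by move=> i _; rewrite !exp1n !muln1.
have -> : m.*2.+1 * 'C(m.*2, m) = \sum_(i < m.*2.+1) 'C(m.*2, m).
  by rewrite sum_nat_const card_ord.
apply: leq_sum => -[i hi] _ /=.
have step k : k < m -> 'C(m.*2, k) <= 'C(m.*2, k.+1).
  move=> hk; have := mul_bin_left m.*2 k => e.
  rewrite -(@leq_pmul2l k.+1) //  e leq_mul2r; apply/orP; right.
  by rewrite -addnn; lia.
have mono d : d <= m -> 'C(m.*2, m - d) <= 'C(m.*2, m).
  elim: d => [|d IH] hd; first by rewrite subn0.
  by apply: leq_trans (step _ _) _; [lia | rewrite subnSK ?IH // ltnW].
have [him|hmi] := leqP i m; first by rewrite -(subKn him) mono ?leq_subr.
have hi' : i <= m.*2 by exact: hi.
rewrite -(bin_sub hi').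
by rewrite (_ : m.*2 - i = m - (i - m)) ?mono //; lia.
Qed.

(** Chebyshev's lower bound: for [N = 2 ^ b = 2 m], the central binomial coefficient is at most [N]
    to the number of primes up to [N], by bounding each prime power in it by [N]. Comparing
    exponents of 2 with the lower bound [2 ^ N / (N + 1)] gives the claim. *)
Lemma prime_count b : 0 < b -> 2 ^ b <= b * (count prime (iota 0 (2 ^ b).+1) + 2).
Proof.
case: b => // b _; set N := 2 ^ b.+1; set m := 2 ^ b.
have hN : N = m.*2 by rewrite /N expnS mul2n.
have m0 : 0 < m by rewrite expn_gt0.
have c0 : 0 < 'C(m.*2, m) by rewrite bin_gt0 -addnn leq_addr.
set pi := count _ _.
have hC : 'C(m.*2, m) <= N ^ pi.
  rewrite {1}(prod_primes_logn c0) big_seq.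
  have hle p : p \in primes 'C(m.*2, m) -> p ^ logn p 'C(m.*2, m) <= N.
    by rewrite mem_primes hN => /and3P[hp _ _]; apply: logn_central_binom.
  apply: leq_trans (leq_prod (E2 := fun=> N) hle) _.
  rewrite -big_seq big_const_seq count_predT iter_muln_1 leq_pexp2l ?expn_gt0 //.
  rewrite /pi -size_filter; apply: uniq_leq_size; first exact: primes_uniq.
  move=> p hp; move: (hp); rewrite mem_filter mem_iota mem_primes => /and3P[hpp _ hd] /=.
  rewrite hpp add0n ltnS; apply: leq_trans (hle _ hp).
  by rewrite -{1}[p]expn1 leq_pexp2l ?(prime_gt0 hpp) // logn_gt0.
have := leq_trans (central_binom_ge m) (leq_mul (leqnn _) hC).
rewrite -hN => h1.
have h2 : 2 ^ N <= 2 ^ (b.+2 + b.+1 * pi).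
  apply: leq_trans h1 _; rewrite expnD [2 ^ (_ * pi)]expnM leq_mul //.
  by rewrite expnS mul2n -addnn -addn1 leq_add // expn_gt0.
by move: h2; rewrite leq_exp2l // mulnDr; lia.
Qed.

Lemma size_primes_exp n : 0 < n -> 2 ^ size (primes n) <= n.
Proof.
move=> n0; rewrite {2}(prod_primes_logn n0).
rewrite -[X in X <= _](_ : \prod_(p <- primes n) 2 = _); last first.
  by rewrite big_const_seq count_predT iter_muln_1.
rewrite big_seq [X in _ <= X]big_seq; apply: leq_prod => p hp.
have [pp _ _] : [/\ prime p, 0 < n & p %| n].
  by move: hp; rewrite mem_primes => /and3P[].
apply: leq_trans (prime_gt1 pp) _.
by rewrite -{1}[p]expn1 leq_pexp2l ?(prime_gt0 pp) // logn_gt0.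
Qed.

(** A modulus where [x] and [y] collide divides their difference, which is below [2 ^ L] and thus
    has fewer than [L] prime divisors. *)
Lemma count_collisions (Pr : seq nat) L x y :
  uniq Pr -> all prime Pr -> x < 2 ^ L -> y < 2 ^ L -> x != y ->
  count (fun r => x == y %[mod r]) Pr <= L.
Proof.
wlog hxy : x y / x <= y => [hw|].
  move=> h1 h2 h3 h4 h5; case/orP: (leq_total x y) => h; first exact: hw.
  rewrite (eq_count (a2 := fun r => y == x %[mod r])); first by apply: hw => //; rewrite eq_sym.
  by move=> r /=; rewrite eq_sym.
move=> hu /allP hp hx hy hne.
have d0 : 0 < y - x by rewrite subn_gt0 ltn_neqAle hne.
have h2 : 2 ^ size (primes (y - x)) < 2 ^ L.
  apply: leq_ltn_trans (size_primes_exp d0) _.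
  by apply: leq_ltn_trans hy; rewrite leq_subr.
rewrite ltn_exp2l // in h2; apply: leq_trans (ltnW h2).
rewrite -size_filter; apply: uniq_leq_size; first exact: filter_uniq.
move=> r; rewrite mem_filter mem_primes d0 => /andP[he hr]; rewrite (hp _ hr) /=.
by rewrite eq_sym eqn_mod_dvd in he.
Qed.

(* [isolates W w r]: no other element of W is congruent to w modulo r. *)
Definition isolates (W : seq nat) (w r : nat) : bool :=
  all (fun v => (v == w) || (v != w %[mod r])) W.

(** Union bound: each other element of [W] spoils at most [L] of the moduli. *)
Lemma count_isolates (Pr W : seq nat) L w :
  uniq Pr -> all prime Pr -> all (fun x => x < 2 ^ L) W -> w < 2 ^ L ->
  size Pr <= count (isolates W w) Pr + size W * L.
Proof.
move=> hu hp; elim: W => [|v W IH] /=; first by move=> _ _; rewrite count_predT addn0.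
case/andP=> hv hW hw; apply: leq_trans (IH hW hw) _.
have [->|ne] := eqVneq v w.
  rewrite (eq_count (a2 := isolates W w)) ?mulSn ?leq_add2l ?leq_addl //.
  by move=> r; rewrite /= eqxx.
have hc := count_collisions hu hp hv hw ne.
suff : count (isolates W w) Pr <= count (isolates (v :: W) w) Pr + count (fun r => v == w %[mod r]) Pr by lia.
rewrite -count_predUI; apply: leq_trans (leq_addr _ _); apply: sub_count => r /=.
by rewrite (negbTE ne) /= => ->; rewrite andbT orNb.
Qed.

Lemma has_isolating (Pr W : seq nat) L w :
  uniq Pr -> all prime Pr -> all (fun x => x < 2 ^ L) W -> w < 2 ^ L ->
  size W * L < size Pr -> exists2 r, r \in Pr & isolates W w r.
Proof.
move=> h1 h2 h3 h4 h5; have h6 := count_isolates h1 h2 h3 h4.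
apply/hasP; rewrite has_count -(ltn_add2r (size W * L)) add0n.
exact: leq_trans h5 h6.
Qed.

(** At least half of the pairs of an element [w] and a modulus [r] are isolating. Sending such a
    pair to the bucket of [w] modulo [r] is injective, since an isolated element is the only one of
    [W] in its bucket; so at least that many buckets meet [W]. *)
Lemma count_buckets (Pr W : seq nat) L R0 R1 :
  0 < R0 -> uniq Pr -> all prime Pr -> all (fun r => R0 <= r <= R1) Pr ->
  uniq W -> all (fun x => x < 2 ^ L) W -> 2 * (size W * L) <= size Pr ->
  size W * size Pr <= 2 * count (fun b =>
     has (fun w => w %% (R0 + b %/ R1) == b %% R1) W) (iota 0 (R1 * R1)).
Proof.
move=> hR0 hu hp hr huW hW hs.
pose good := [seq (w, r) | w <- W, r <- [seq r <- Pr | isolates W w r]].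
pose beta (x : nat * nat) := (x.2 - R0) * R1 + x.1 %% x.2.
have hgood x : x \in good -> [/\ x.1 \in W, x.2 \in Pr & isolates W x.1 x.2].
  by case/allpairsPdep => w [r [h1 + ->]]; rewrite mem_filter => /andP[].
have R1r r : r \in Pr -> [/\ 0 < r, R0 <= r & r <= R1].
  by move=> h; move/allP: hp => /(_ _ h)/prime_gt0 ->; move/allP: hr => /(_ _ h)/andP[].
have dm x : x \in good -> beta x %/ R1 = x.2 - R0 /\ beta x %% R1 = x.1 %% x.2.
  move=> /hgood[h1 /R1r[h2 h3 h4] _].
  have hlt : x.1 %% x.2 < R1 by apply: leq_trans h4; rewrite ltn_mod.
  have R10 : 0 < R1 by apply: leq_trans h4.
  by rewrite /beta divnMDl // modnMDl divn_small // modn_small // addn0.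
have hsz : size W * size Pr <= 2 * size good.
  rewrite size_allpairs_dep sumnE big_map.
  have -> : size W * size Pr = \sum_(w <- W) size Pr.
    by rewrite big_const_seq count_predT iter_addn_0 mulnC.
  rewrite big_distrr /= big_seq [X in _ <= X]big_seq; apply: leq_sum => w hw.
  have half a c t : a <= c + t -> 2 * t <= a -> a <= 2 * c by lia.
  rewrite size_filter; exact: half (count_isolates hu hp hW (allP hW _ hw)) hs.
apply: leq_trans hsz _; rewrite leq_mul2l /=.
rewrite -size_filter -(size_map beta); apply: uniq_leq_size.
  rewrite map_inj_in_uniq.
    apply: allpairs_uniq_dep => // [w hw|x y hx hy /=]; first exact: filter_uniq.
    by case: x y {hx hy} => w r [w' r'] /= [-> ->].
  move=> [w r] [w' r'] hx hy e.
  have [e1 e2] := dm _ hx; have [e3 e4] := dm _ hy.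
  rewrite e in e1 e2; rewrite e1 in e3; rewrite e2 in e4; move: e3 e4 => /= e3 e4.
  have [h1 /R1r[_ h2 _] h3] := hgood _ hx; have [h4 /R1r[_ h5 _] h6] := hgood _ hy.
  move: h1 h2 h3 h4 h5 h6 => /= h1 h2 h3 h4 h5 h6.
  have er : r = r' by rewrite -(subnK h2) -(subnK h5) e3.
  move: e4; rewrite -er => e4; congr (_, _) => //.
  by move/allP: h3 => /(_ _ h4); rewrite e4 eqxx orbF => /eqP.
move=> b /mapP[x hx ->]; rewrite mem_filter mem_iota /=.
have [e1 e2] := dm _ hx; have [h1 /R1r[h2 h3 h4] h5] := hgood _ hx.
rewrite e1 e2 subnKC //; apply/andP; split; first by apply/hasP; exists x.1.
rewrite add0n /beta.
have hlt : x.1 %% x.2 < x.2 by rewrite ltn_mod.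
apply: (@leq_trans ((x.2 - R0).+1 * R1)); first by rewrite mulSn addnC ltn_add2r; lia.
by rewrite leq_mul2r; apply/orP; right; lia.
Qed.

(** * Hitting sets by thresholds *)

Section HittingSet.

Variables (inc : nat -> seq nat) (NU : nat).
Hypothesis inc_uniq : forall y, uniq (inc y).

(** Here [inc y] lists the sets that contain the element [y]. The state consists of the predicate of
    the sets not hit yet and of the elements picked so far. *)
Definition hs_step (tau : nat) (st : (nat -> bool) * seq nat) (y : nat) :=
  if tau <= count st.1 (inc y) then
    (fun e => st.1 e && (e \notin inc y), rcons st.2 y)
  else st.

Definition hs_pass (st : (nat -> bool) * seq nat) (tau : nat) :=
  foldl (hs_step tau) st (iota 0 NU).

Definition member (e : nat) : bool := has (fun y => e \in inc y) (iota 0 NU).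

Let E := undup (flatten (map inc (iota 0 NU))).

Lemma mem_E e : (e \in E) = member e.
Proof.
rewrite mem_undup; apply/flatten_mapP/hasP => -[y hy he]; by exists y.
Qed.

Lemma hs_step_sub tau st y e : (hs_step tau st y).1 e -> st.1 e.
Proof. by rewrite /hs_step; case: ifP => //= _ /andP[]. Qed.

Lemma hs_fold_sub tau st ys e : (foldl (hs_step tau) st ys).1 e -> st.1 e.
Proof.
by elim: ys st => [|y ys IH] st //= /IH; exact: hs_step_sub.
Qed.

(** When [y] is examined, either it is picked and no set containing it remains, or fewer than [tau]
    remain; later steps only remove sets. *)
Lemma hs_fold_small tau st ys y : 0 < tau -> y \in ys ->
  count (foldl (hs_step tau) st ys).1 (inc y) < tau.
Proof.
move=> t0; elim: ys st => [|z ys IH] st //=; rewrite inE => /orP[/eqP<-|]; last exact: IH.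
apply: (@leq_ltn_trans (count (hs_step tau st y).1 (inc y))).
  by apply: sub_count => e; exact: hs_fold_sub.
rewrite /hs_step; case: ifP => [_ /=|/negbT]; last by rewrite -ltnNge.
rewrite (eq_in_count (a2 := pred0)) ?count_pred0 // => e he /=.
by rewrite he andbF.
Qed.

Definition killed (al0 : nat -> bool) (st : (nat -> bool) * seq nat) :=
  (forall e, al0 e -> ~~ st.1 e -> exists2 y, y \in st.2 & e \in inc y) /\
  all (fun y => y < NU) st.2.

Lemma hs_fold_killed al0 tau st ys : all (fun y => y < NU) ys ->
  killed al0 st -> killed al0 (foldl (hs_step tau) st ys).
Proof.
elim: ys st => [|y ys IH] st //= /andP[hy hys] hk; apply: IH => //.
case: hk => h1 h2; rewrite /hs_step; case: ifP => // _; split=> /=; last first.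
  by rewrite all_rcons hy.
move=> e he; rewrite negb_and negbK => /orP[/(h1 e he)[z hz hez]|hey].
  by exists z => //; rewrite mem_rcons inE hz orbT.
by exists y => //; rewrite mem_rcons mem_head.
Qed.

(** Potential argument: a pick adds [tau] to the first term and removes at least [tau] sets from the
    second. *)
Lemma hs_fold_picks tau st ys : all (fun y => y < NU) ys ->
  size (foldl (hs_step tau) st ys).2 * tau + count (foldl (hs_step tau) st ys).1 E
    <= size st.2 * tau + count st.1 E.
Proof.
elim: ys st => [|y ys IH] st //= /andP[hy hys]; apply: leq_trans (IH _ hys) _.
rewrite /hs_step; case: ifP => //= ht; rewrite size_rcons mulSn.
have ar a b c d : b + d <= c -> d + a + b <= a + c by lia.
apply: ar.
have hsub : {subset inc y <= E}.
  by move=> e he; rewrite mem_E; apply/hasP; exists y => //; rewrite mem_iota.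
have e1 : count st.1 E = count (fun e => st.1 e && (e \notin inc y)) E + count (fun e => st.1 e && (e \in inc y)) E.
  rewrite -count_predUI [X in _ + X](eq_count (a2 := pred0)) ?count_pred0 ?addn0.
    by apply: eq_count => e /=; case: (e \in inc y); rewrite /= ?andbT ?andbF ?orbF.
  by move=> e /=; case: (e \in inc y); rewrite /= ?andbF.
rewrite e1 leq_add2l; apply: leq_trans ht _.
rewrite -!size_filter; apply: uniq_leq_size; first by rewrite filter_uniq.
by move=> e; rewrite !mem_filter => /andP[-> he]; rewrite he (hsub _ he).
Qed.

(** Double counting of the incidences between the remaining sets and the elements. *)
Lemma alive_double_count (al : nat -> bool) q :
  (forall e, al e -> member e -> q <= count (fun y => e \in inc y) (iota 0 NU)) ->
  count al E * q <= \sum_(y <- iota 0 NU) count al (inc y).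
Proof.
move=> hq; have e1 : \sum_(y <- iota 0 NU) count al (inc y) =
    \sum_(y <- iota 0 NU) \sum_(e <- E | al e) (e \in inc y).
  rewrite big_seq [RHS]big_seq; apply: eq_bigr => y hy.
  have -> : \sum_(e <- E | al e) (e \in inc y) = count (fun e => al e && (e \in inc y)) E.
    rewrite -sum1_count [RHS]big_mkcondr; apply: eq_bigr => e _.
    by case: (e \in inc y).
  rewrite -!size_filter; apply: perm_size; apply: uniq_perm.
  - by rewrite filter_uniq.
  - by rewrite filter_uniq ?undup_uniq.
  - move=> e; rewrite !mem_filter mem_E; case: (al e) => //=.
    by case he : (e \in inc y) => //=; apply/esym/hasP; exists y.
rewrite e1 exchange_big /= -sum1_count big_distrl /= big_seq_cond [X in _ <= X]big_seq_cond.
apply: leq_sum => e /andP[]; rewrite mem_E mul1n => he ha.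
apply: leq_trans (hq e ha he) _; rewrite -sum1_count big_mkcond leq_sum //.
Qed.

Lemma hs_pass_picks (al0 : nat -> bool) (st : (nat -> bool) * seq nat) tau q : 0 < tau ->
  (forall e, al0 e -> member e -> q <= count (fun y => e \in inc y) (iota 0 NU)) ->
  (forall e, st.1 e -> al0 e) ->
  (forall y, y < NU -> count st.1 (inc y) <= 2 * tau) ->
  (size (hs_pass st tau).2) * q <= size st.2 * q + 2 * NU.
Proof.
move=> t0 hq hal hc.
have h1 : size (hs_pass st tau).2 * tau <= size st.2 * tau + count st.1 E.
  have := @hs_fold_picks tau st (iota 0 NU); rewrite -/(hs_pass st tau) => h.
  apply: leq_trans (h _); first exact: leq_addr.
  by apply/allP => y; rewrite mem_iota.
have h2 : count st.1 E * q <= NU * (2 * tau).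
  apply: leq_trans (alive_double_count (q := q) _) _.
    by move=> e he; apply: hq; apply: hal.
  apply: (@leq_trans (\sum_(y <- iota 0 NU) 2 * tau)).
    rewrite big_seq [X in _ <= X]big_seq; apply: leq_sum => y.
    by rewrite mem_iota => hy; apply: hc.
  by rewrite big_const_seq count_predT size_iota iter_addn_0 mulnC.
rewrite -(leq_pmul2r t0).
have h3 : size (hs_pass st tau).2 * tau * q <= (size st.2 * tau + count st.1 E) * q by rewrite leq_mul2r h1 orbT.
rewrite mulnAC; apply: leq_trans h3 _; rewrite mulnDl mulnDl.
by rewrite mulnAC leq_add2l; apply: leq_trans h2 _; rewrite mulnA (mulnC NU).
Qed.

(* For the thresholds tau = 2 ^ (PS - 1), ..., 1, every element which lies in tau of
   the sets not hit yet is picked. Then each element lies in at most 2 * tau of the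
   sets left; if these have q elements each, there are at most 2 * tau * NU / q of
   them, and at most 2 * NU / q elements are picked at the threshold tau. *)
Definition hs_run (PS : nat) (al0 : nat -> bool) :=
  foldl (fun st t => hs_pass st (2 ^ (PS.-1 - t))) (al0, [::]) (iota 0 PS).

(** The strict inequality holds only once a pass has been made. At [m = PS] it says that fewer than
    one remaining set contains any given element, so that no nonempty set remains. *)
Lemma hs_run_prefix PS (al0 : nat -> bool) q m : m <= PS ->
  (forall y, y < NU -> count al0 (inc y) <= 2 ^ PS) ->
  (forall e, al0 e -> member e -> q <= count (fun y => e \in inc y) (iota 0 NU)) ->
  let st := foldl (fun st t => hs_pass st (2 ^ (PS.-1 - t))) (al0, [::]) (iota 0 m) in
  [/\ killed al0 st, forall e, st.1 e -> al0 e,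
      forall y, y < NU -> count st.1 (inc y) <= 2 ^ (PS - m),
      0 < m -> forall y, y < NU -> count st.1 (inc y) < 2 ^ (PS - m) &
      size st.2 * q <= m * (2 * NU)].
Proof.
move=> + hc hq; elim: m => [|m IH] hm.
  split=> //=; [|by rewrite subn0].
  by split=> // e he /=; rewrite he.
have ei : iota 0 m.+1 = rcons (iota 0 m) m by rewrite -addn1 iotaD cats1.
move: {IH} (IH (ltnW hm)); rewrite ei foldl_rcons.
set st := foldl _ _ _ => /= -[h1 h2 h3 _ h4].
have e : PS - m.+1 = PS.-1 - m by lia.
have e2 : PS - m = (PS.-1 - m).+1 by lia.
have t0 : 0 < 2 ^ (PS.-1 - m) by rewrite expn_gt0.
have hall : all (fun y => y < NU) (iota 0 NU) by apply/allP => y; rewrite mem_iota.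
split.
- exact: hs_fold_killed.
- by move=> x hx; apply: h2; apply: hs_fold_sub hx.
- move=> y hy; rewrite e; apply: ltnW; apply: hs_fold_small => //.
  by rewrite mem_iota.
- by move=> _ y hy; rewrite e; apply: hs_fold_small => //; rewrite mem_iota.
- rewrite mulSn addnC; apply: leq_trans (leq_add h4 (leqnn _)).
  apply: (hs_pass_picks t0 hq h2) => y hy.
  by rewrite -expnS -e2; apply: h3.
Qed.

Lemma hs_runP PS (al0 : nat -> bool) q : 0 < PS ->
  (forall y, y < NU -> count al0 (inc y) <= 2 ^ PS) ->
  (forall e, al0 e -> member e -> q <= count (fun y => e \in inc y) (iota 0 NU)) ->
  [/\ forall e, al0 e -> member e ->
        exists2 y, y \in (hs_run PS al0).2 & e \in inc y,
      all (fun y => y < NU) (hs_run PS al0).2 &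
      size (hs_run PS al0).2 * q <= PS * (2 * NU)].
Proof.
move=> hPS hc hq; have [[h1 h2] h3 _ h4 h5] := hs_run_prefix (leqnn PS) hc hq.
split=> // e he hm; apply: h1 => //; apply/negP => hal.
case/hasP: hm => y; rewrite mem_iota => hy hey.
have := h4 hPS y hy; rewrite subnn expn0 ltnS leqn0 => /eqP h0.
have : 0 < count (foldl (fun st t => hs_pass st (2 ^ (PS.-1 - t))) (al0, [::]) (iota 0 PS)).1 (inc y).
  by rewrite -has_count; apply/hasP; exists e.
by rewrite h0.
Qed.

End HittingSet.

(** * Hitting sets as a program *)

Notation vps := 4.
Notation vnp := 36.
Notation aPk := 5.
Notation aAl := 6.
Notation aPw := 7.

Definition E1 a e := EArr a (ENum 0) (ENum 0) e.

(** The incidence lists are given by expressions because there are two uses: buckets against matrix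
    positions, with a full table and a guard, and vertices against pairs of sources, with explicit
    lists and a trivial guard. *)
Definition HITSET (vNU : nat) (eDeg : expr -> expr) (eSet eGrd : expr -> expr -> expr) : cmd :=
  Asg vnp (ENum 0) ;;
  For 30 vps (
    Asg 31 (E1 aPw (EVar vps -^ ENum 1 -^ EVar 30)) ;;
    For 32 vNU (
      Asg 33 (ENum 0) ;; Asg 34 (eDeg (EVar 32)) ;;
      For 35 34 (Asg 33 (EVar 33 +^ eGrd (EVar 32) (EVar 35) *^ E1 aAl (eSet (EVar 32) (EVar 35)))) ;;
      Ife (EVar 33 <^ EVar 31) Nop (
        Sto aPk (ENum 0) (ENum 0) (EVar vnp) (EVar 32) ;;
        Asg vnp (EVar vnp +^ ENum 1) ;;
        For 35 34 (Ife (eGrd (EVar 32) (EVar 35))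
          (Sto aAl (ENum 0) (ENum 0) (eSet (EVar 32) (EVar 35)) (ENum 0)) Nop)))).

Definition hsV := [:: 30; 31; 32; 33; 34; 35; 36].
Definition hsA := [:: aPk; aAl].

Section HitsetSpec.

Variables (P : program) (C WP : nat).

Notation hoare := (hoare P C WP).
Notation wf := (wf C).

Lemma hs_fold_size inc tau st ys :
  size (foldl (hs_step inc tau) st ys).2 <= size st.2 + size ys.
Proof.
elim: ys st => [|y ys IH] st /=; first by rewrite addn0.
apply: leq_trans (IH _) _; rewrite addnS -addSn leq_add2r /hs_step.
by case: ifP => //= _; rewrite size_rcons.
Qed.

Lemma hs_run_size inc NU st PS m :
  size (foldl (fun st t => hs_pass inc NU st (2 ^ (PS - t))) st (iota 0 m)).2
  <= size st.2 + m * NU.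
Proof.
elim: m => [|m IH]; first by rewrite /= addn0.
have -> : iota 0 m.+1 = rcons (iota 0 m) m by rewrite -addn1 iotaD cats1.
rewrite foldl_rcons; apply: leq_trans (hs_fold_size _ _ _ _) _.
by rewrite size_iota mulSn (addnC NU) addnA leq_add2r.
Qed.

Lemma hoare_hitset vNU eDeg eSet eGrd NU NS PS D (deg : nat -> nat)
    (sset : nat -> nat -> nat) (grd : nat -> nat -> bool) (al0 : nat -> bool) s
    (Q : mstate -> Prop) :
  let inc y := [seq sset y t | t <- iota 0 (deg y) & grd y t] in
  vNU \notin hsV -> vr s vNU = NU -> vr s vps = PS ->
  (forall k, k < PS -> ar s aPw 0 0 k = 2 ^ k) ->
  (forall s' ey, frame hsV hsA s s' -> ev ey s' < NU -> ev (eDeg ey) s' = deg (ev ey s')) ->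
  (forall s' ey et, frame hsV hsA s s' -> ev ey s' < NU -> ev et s' < deg (ev ey s') ->
     ev (eGrd ey et) s' = grd (ev ey s') (ev et s') /\
     (grd (ev ey s') (ev et s') -> ev (eSet ey et) s' = sset (ev ey s') (ev et s'))) ->
  (forall y t, y < NU -> t < deg y -> grd y t -> sset y t < NS) ->
  (forall e, e < NS -> ar s aAl 0 0 e = al0 e) ->
  PS * NU < C -> (forall y, y < NU -> deg y <= C) ->
  \sum_(y < NU) deg y <= D ->
  (forall s', wf s' -> frame hsV hsA s s' ->
     let pk := (hs_run inc NU PS al0).2 in
     vr s' vnp = size pk -> (forall t, t < size pk -> ar s' aPk 0 0 t = nth 0 pk t) ->
     Q s') ->
  hoare (HITSET vNU eDeg eSet eGrd) s (PS * (5 * D + 20 * NU + 10) + 5) Q.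
Proof.
move=> inc hvN hNU hPS hPw hDeg hGS hss hal0 hPSC hdegC hD hQ.
pose R (st : (nat -> bool) * seq nat) s' := [/\
  forall e, e < NS -> ar s' aAl 0 0 e = st.1 e, vr s' vnp = size st.2 &
  forall t, t < size st.2 -> ar s' aPk 0 0 t = nth 0 st.2 t].
have Rmov st vs s1 s2 : vnp \notin vs -> frame vs [::] s1 s2 -> R st s1 -> R st s2.
  move=> hv f [h1 h2 h3]; split=> [e he||t ht]; rewrite ?(fra f) ?(frv f) //; auto.
apply: (hoare_weaken (Q := Q) (T := 1 + (PS * (1 + (5 * D + 20 * NU + 5)).+1).+1)) => //; last first.
  by rewrite -[(1 + (5 * D + 20 * NU + 5)).+1](_ : 5 * D + 20 * NU + 7 = _) ?mulnDr; lia.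
apply: (hoare_then (Q1 := fun s' => R (al0, [::]) s')).
  apply: hoare_asg => // s1 f1 v1; split=> // e he; rewrite (fra f1) //; exact: hal0.
move=> s1 w1 f1 R1.
have F1 : frame hsV hsA s s1 by apply: frame_all f1.
have P1 : vr s1 vps = PS by rewrite (frv F1).
rewrite -{1}P1.
pose pre m := foldl (fun st t => hs_pass inc NU st (2 ^ (PS.-1 - t))) (al0, [::]) (iota 0 m).
apply: (hoare_for (I := fun m s' => frame hsV hsA s s' /\ R (pre m) s')) => //; last first.
  by rewrite P1 => s' w' _ [f' [_ h2 h3]]; apply: hQ.
rewrite P1 => m s2 s3 hm w3 _ [f2 R2] f23 _ v30.
have f3 : frame hsV hsA s s3 by apply: frame_trans f2 (frame1 _ _ f23).
have {}R2 : R (pre m) s3 by apply: Rmov f23 R2.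
apply: (hoare_then (Q1 := fun s' => vr s' 31 = 2 ^ (PS.-1 - m))).
  have e : ev (E1 aPw (EVar vps -^ ENum 1 -^ EVar 30)) s3 = 2 ^ (PS.-1 - m).
    by rewrite /= v30 (frv f3) // hPS subn1 (fra f3) // hPw //; lia.
  apply: hoare_asg => [_|s' _ ->] //.
  by rewrite /E1 [ev _ _]/=; case: w3.
move=> s4 w4 f4 v31; set tau := 2 ^ _ in v31.
have F4 : frame hsV hsA s s4 by apply: frame_trans f3 (frame_all _ _ f4).
have {}R2 : R (pre m) s4 by apply: Rmov f4 R2.
have N4 : vr s4 vNU = NU by rewrite (frv F4).
apply: (hoare_weaken (Q := fun s' => frame hsV hsA s s' /\ R (pre m.+1) s')
   (T := (\sum_(y < vr s4 vNU) (5 * deg y + 14).+1).+1)) => //; last first.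
  rewrite N4 (eq_bigr (fun y : 'I_NU => 5 * deg y + 15)); last by move=> y _; rewrite -addnS.
  rewrite big_split /= -big_distrr /= sum_nat_const card_ord.
  by move: hD; set S := \sum_(y < NU) _; lia.
apply: (hoare_for_sum (T := fun y => 5 * deg y + 14) (I := fun y s' => [/\ frame hsV hsA s s', vr s' 31 = tau
   & R (foldl (hs_step inc tau) (pre m) (iota 0 y)) s'])) => //; last first.
  rewrite N4 => s' _ _ [h1 h2 h3]; split=> //.
  by rewrite /pre -[in iota 0 m.+1]addn1 iotaD cats1 foldl_rcons.
rewrite N4 => y s5 s6 hy w6 _ [f5 v315 R5] f56 _ v32.
set st := foldl _ _ (iota 0 y) in R5.
have F6 : frame hsV hsA s s6 by apply: frame_trans f5 (frame1 _ _ f56).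
have {}R5 : R st s6 by apply: Rmov f56 R5.
have {}v315 : vr s6 31 = tau by rewrite (frv f56).
have step : foldl (hs_step inc tau) (pre m) (iota 0 y.+1) = hs_step inc tau st y.
  by rewrite -addn1 iotaD cats1 foldl_rcons.
rewrite step.
apply: (hoare_weaken (T := 1 + (1 + ((deg y * 1.+1).+1 + (1 + (1 + (deg y * 2.+1).+1)).+1)))
  (Q := fun s' => [/\ frame hsV hsA s s', vr s' 31 = tau & R (hs_step inc tau st y) s'])) => //; last by lia.
apply: (hoare_then (Q1 := fun s' => vr s' 33 = 0)); first by apply: hoare_asg.
move=> s7 w7 f7 v33.
have F7 : frame hsV hsA s s7 by apply: frame_trans F6 (frame_all _ _ f7).
have v327 : vr s7 32 = y by rewrite (frv f7).
apply: (hoare_then (Q1 := fun s' => vr s' 34 = deg y)).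
  have e : ev (eDeg (EVar 32)) s7 = deg y by rewrite hDeg //= v327.
  by apply: hoare_asg => [_|s' _ ->]; rewrite e //; apply: hdegC.
move=> s8 w8 f8 v34.
have F8 : frame hsV hsA s s8 by apply: frame_trans F7 (frame_all _ _ f8).
have f68 : frame [:: 33; 34] [::] s6 s8.
  by apply: frame_trans (frame_all _ _ f7) (frame_all _ _ f8).
have R8 : R st s8 by apply: Rmov f68 R5.
have v328 : vr s8 32 = y by rewrite (frv f8).
have v318 : vr s8 31 = tau by rewrite (frv f68).
have v338 : vr s8 33 = 0 by rewrite (frv f8).
pose inck k := [seq sset y t | t <- iota 0 k & grd y t].
have inckS k : inck k.+1 = inck k ++ (if grd y k then [:: sset y k] else [::]).
  by rewrite /inck -addn1 iotaD filter_cat map_cat /= add0n; case: ifP.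
have cntC k : k <= deg y -> count st.1 (inck k) <= C.
  move=> hk; apply: leq_trans (count_size _ _) _; rewrite size_map size_filter.
  apply: leq_trans (count_size _ _) _; rewrite size_iota; exact: leq_trans (hdegC _ hy).
apply: (hoare_then (Q1 := fun s' => vr s' 33 = count st.1 (inc y))).
  rewrite -v34; apply: (hoare_for (I := fun k s' => frame [:: 33; 35] [::] s8 s' /\ vr s' 33 = count st.1 (inck k))) => //; last first.
    by rewrite v34 => s' _ _ [].
  rewrite v34 => k s9 s10 hk w10 _ [f9 v339] f910 _ v35.
  have f810 : frame [:: 33; 35] [::] s8 s10 by apply: frame_trans f9 (frame1 _ _ f910).
  have F10 : frame hsV hsA s s10 by apply: frame_trans F8 (frame_all _ _ f810).
  have y10 : vr s10 32 = y by rewrite (frv f810).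
  have [eg es] := hGS s10 (EVar 32) (EVar 35) F10 ltac:(by rewrite /= y10) ltac:(by rewrite /= y10 v35).
  have e : ev (EVar 33 +^ eGrd (EVar 32) (EVar 35) *^ E1 aAl (eSet (EVar 32) (EVar 35))) s10 = count st.1 (inck k.+1).
    move: eg es; rewrite /= y10 v35 => -> es; rewrite inckS count_cat (frv f910) // v339.
    case hg : (grd y k) es => /=; last by rewrite mul0n.
    move=> /(_ isT) ->; rewrite mul1n addn0 (fra f810) //.
    by have [-> //] := R8; apply: hss.
  apply: hoare_asg => [_|s' f' ->]; rewrite e; first exact: cntC.
  by split=> //; apply: frame_trans f810 (frame_all _ _ f').
move=> s9 w9 f9 v339.
have F9 : frame hsV hsA s s9 by apply: frame_trans F8 (frame_all _ _ f9).
have R9 : R st s9 by apply: Rmov f9 R8.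
have v329 : vr s9 32 = y by rewrite (frv f9).
have v349 : vr s9 34 = deg y by rewrite (frv f9).
have v319 : vr s9 31 = tau by rewrite (frv f9).
rewrite /hs_step; apply: hoare_if; rewrite /= v339 v319 ltnNge.
  rewrite eqb0 negbK => /negbTE->.
  apply: (hoare_weaken (T := 1) (Q := fun s' => s' = s9)); [exact: hoare_nop | by lia |].
  by move=> s' _ _ ->.
move/eqP; rewrite eqb0 negbK => hge; rewrite hge.
(* There is at most one pick per element and pass, so the counter of picks never reaches the cap. *)
have szC : size st.2 < C.
  apply: leq_ltn_trans hPSC.
  have h1 : size st.2 <= size (pre m).2 + y by apply: leq_trans (hs_fold_size _ _ _ _) _; rewrite size_iota.
  have h2 : size (pre m).2 <= m * NU by apply: leq_trans (hs_run_size _ _ _ _ _) _.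
  apply: leq_trans h1 _; apply: (@leq_trans (m.+1 * NU)); last by rewrite leq_mul2r hm orbT.
  by rewrite mulSn addnC leq_add // ltnW.
apply: (hoare_then (Q1 := fun s' => [/\ forall e, e < NS -> ar s' aAl 0 0 e = st.1 e,
    vr s' vnp = size st.2 & forall t, t < (size st.2).+1 -> ar s' aPk 0 0 t = nth 0 (rcons st.2 y) t])).
  apply: hoare_sto => [_|s' f' _ h']; first by case: w9 => hv _; apply: hv.
  case: R9 => h1 h2 h3; split=> [e he||t].
  - by rewrite (fra f') // h1.
  - by rewrite (frv f').
  - rewrite h' /= v329 h2 nth_rcons ltnS leq_eqVlt.
    by case: eqP => [->|_] /=; [rewrite ltnn | move=> ht; rewrite ht h3].
move=> s10 w10 f10 [h1 h2 h3].
have F10 : frame hsV hsA s s10 by apply: frame_trans F9 (frame_all _ _ f10).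
apply: (hoare_then (Q1 := fun s' => [/\ forall e, e < NS -> ar s' aAl 0 0 e = st.1 e,
    vr s' vnp = (size st.2).+1 & forall t, t < (size st.2).+1 -> ar s' aPk 0 0 t = nth 0 (rcons st.2 y) t])).
  apply: hoare_asg => [_|s' f' ->] /=; rewrite h2 addn1 //.
  by split=> // *; rewrite (fra f') //; [apply: h1 | apply: h3].
move=> s11 w11 f11 [k1 k2 k3].
have F11 : frame hsV hsA s s11 by apply: frame_trans F10 (frame_all _ _ f11).
have v3411 : vr s11 34 = deg y by rewrite (frv f11) // (frv f10).
have v3211 : vr s11 32 = y by rewrite (frv f11) // (frv f10).
have v3111 : vr s11 31 = tau by rewrite (frv f11) // (frv f10).
rewrite -v3411; apply: (hoare_for (I := fun k s' => frame [:: 35] [:: aAl] s11 s' /\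
   forall e, e < NS -> ar s' aAl 0 0 e = (st.1 e && (e \notin inck k)))); first 1 last.
- rewrite v3411 => k s12 s13 hk w13 _ [f12 h12] f1213 _ v35.
  have f1113 : frame [:: 35] [:: aAl] s11 s13 by apply: frame_trans f12 (frame1 _ _ f1213).
  have F13 : frame hsV hsA s s13 by apply: frame_trans F11 (frame_all _ _ f1113).
  have y13 : vr s13 32 = y by rewrite (frv f1113).
  have [eg es] := hGS s13 (EVar 32) (EVar 35) F13 ltac:(by rewrite /= y13) ltac:(by rewrite /= y13 v35).
  move: eg es; rewrite /= y13 v35 => eg es.
  apply: hoare_if; rewrite eg inckS; case hg : (grd y k) es => // es _.
    apply: hoare_sto => // s14 f14 _ h14; split; first by apply: frame_trans f1113 (frame_all _ _ f14).
    move=> e he; rewrite h14 /= es // mem_cat inE.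
    case: eqP => [->|_] /=; first by rewrite orbT andbF.
    by rewrite orbF (fra f1213) // h12.
  apply: hoare_nop; split=> // e he.
  by rewrite cats0 (fra f1213) // h12.
- rewrite v3411 => s' _ _ [f' h']; split.
  + by apply: frame_trans F11 (frame_all _ _ f').
  + by rewrite (frv f').
  + split=> //=; rewrite ?size_rcons ?(frv f') //.
    by move=> t ht; rewrite (fra f') // k3.
- by split=> // e he; rewrite k1 // andbT.
Qed.

End HitsetSpec.

(* [pR0] and [pR1] bound the moduli r; the [pNB] buckets are the pairs of a
   modulus and a residue. A set of few candidates has an element isolated by some
   prime modulus, and a set of many candidates meets so many buckets that at most
   [pR0 / 4] buckets hit all such sets. *)
Definition pll (lam : nat) := (trunc_log 2 lam).+1.
Definition pB lam := 8 * pll lam + 64.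
Definition pR1 lam := 2 ^ pB lam.
Definition pPS lam := 4 * lam + 40.
Definition pR0 lam := 1024 * (pPS lam * (pB lam * pB lam * lam)).
Definition pNB lam := pR1 lam * pR1 lam.

Lemma lam_pll lam : lam < 2 ^ pll lam.
Proof. exact: trunc_log_ltn. Qed.

Lemma pR0_gt0 lam : 0 < lam -> 0 < pR0 lam.
Proof.
move=> h; rewrite /pR0 /pPS /pB !muln_gt0 h /= !addn_gt0 !orbT //.
Qed.

(** The left side is at most [2 ^ (5 * pll lam + 36)], which the exponent [8 * pll lam + 64] of
    [pR1] generously covers. With [prime_count] it follows that the numbers below [pR0] account for
    at most half of the guaranteed primes up to [pR1]. *)
Lemma pR0_small lam : 0 < lam -> 2 * (pB lam * (pR0 lam + 2)) <= pR1 lam.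
Proof.
move=> l0; set b := pB lam; have hR := pR0_gt0 l0.
apply: (@leq_trans (2 * (b * (2 * pR0 lam)))).
  rewrite leq_mul // leq_mul // mul2n -addnn leq_add2l.
  by move: hR; rewrite /pR0 muln_gt0 /=; lia.
have hl := ltnW (lam_pll lam).
have hp : pPS lam <= 2 ^ (pll lam + 6).
  rewrite /pPS expnD -[2 ^ 6]/64; lia.
have hb : b <= 2 ^ (pll lam + 6).
  rewrite /b /pB expnD -[2 ^ 6]/64; have := ltn_expl (pll lam) (leqnn 2); lia.
rewrite /pR0 -/b.
have -> : 2 * (b * (2 * (1024 * (pPS lam * (b * b * lam))))) = 2 ^ 12 * (b * (pPS lam * (b * b * lam))).
  by rewrite -[2 ^ 12]/4096 (mulnCA b 2) (mulnCA b 1024) !mulnA.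
apply: (@leq_trans (2 ^ 12 * (2 ^ (pll lam + 6) * (2 ^ (pll lam + 6) * (2 ^ (pll lam + 6) * 2 ^ (pll lam + 6) * 2 ^ pll lam))))).
  by rewrite leq_mul2l /= leq_mul // leq_mul // leq_mul // leq_mul.
by rewrite /pR1 /pB -!expnD leq_exp2l //; lia.
Qed.

(** If [W] is small compared with the number of primes, some prime isolates an element. Otherwise a
    subset of about [size Pr / (2 * lam)] elements already meets a number of buckets quadratic in
    [size Pr], that is, a fraction of about [1 / (32 b ^ 2 lam)] of all buckets. The value of [pR0]
    is made so that this fraction is at least [8 * pPS lam / pR0 lam]; the factor 8 later yields at
    most [pR0 / 4] picks. *)
Lemma bucket_dichotomy lam (W : seq nat) :
  0 < lam -> uniq W -> W != [::] -> all (fun x => x < 2 ^ lam) W ->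
  (exists w b, [/\ w \in W, b < pNB lam &
     forall v, v \in W -> (v %% (pR0 lam + b %/ pR1 lam) == b %% pR1 lam) = (v == w)]) \/
  8 * (pPS lam * pNB lam) <= pR0 lam * count (fun b =>
     has (fun w => w %% (pR0 lam + b %/ pR1 lam) == b %% pR1 lam) W) (iota 0 (pNB lam)).
Proof.
move=> l0 uW nW aW; have r0 := pR0_gt0 l0; have hsm := pR0_small l0.
set b := pB lam in hsm *.
have b0 : 0 < b by rewrite /b /pB addn_gt0 orbT.
set R0 := pR0 lam in r0 hsm *; set R1 := pR1 lam in hsm *.
have hRR : R0 <= R1.
  apply: leq_trans hsm; rewrite mulnCA; apply: leq_trans (leq_pmull _ b0); lia.
pose Pr := [seq r <- iota R0 (R1.+1 - R0) | prime r].
have uPr : uniq Pr by rewrite filter_uniq ?iota_uniq.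
have aPr : all prime Pr by apply/allP => r; rewrite mem_filter => /andP[].
have rPr : all (fun r => R0 <= r <= R1) Pr.
  by apply/allP => r; rewrite mem_filter mem_iota subnKC ?ltnS ?leqW // => /andP[_].
(* Discarding all numbers below [R0] loses at most half of the guaranteed primes. *)
have hpi : R1 <= 2 * (b * size Pr).
  have h1 := prime_count b0; rewrite -/(pR1 lam) -/R1 in h1.
  have h2 : count prime (iota 0 R1.+1) <= R0 + size Pr.
    rewrite -{1}(subnKC (leqW hRR)) iotaD count_cat add0n size_filter leq_add2r.
    by apply: leq_trans (count_size _ _) _; rewrite size_iota.
  have h3 : b * (count prime (iota 0 R1.+1) + 2) <= b * (R0 + 2) + b * size Pr.
    by rewrite -mulnDr leq_mul2l; apply/orP; right; lia.
  by move: hsm h1 h3; set z := b * (R0 + 2); set z' := b * (_ + 2); lia.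
have hpl : 2 * lam <= size Pr.
  have : R0 <= size Pr.
    rewrite -(leq_pmul2l (m := 2 * b)); last by rewrite muln_gt0.
    rewrite -mulnA; apply: leq_trans (_ : 2 * b * size Pr <= _); last by [].
    rewrite -[X in _ <= X]mulnA; apply: leq_trans hpi; apply: leq_trans hsm.
    by rewrite !leq_mul2l leq_addr !orbT.
  apply: leq_trans; rewrite /R0 /pR0 -/b.
  rewrite (_ : 1024 * _ = 2 * lam * (512 * (pPS lam * (b * b)))); last by rewrite !mulnA; lia.
  by rewrite leq_pmulr // !muln_gt0 b0 /pPS addn_gt0 orbT.
case: (ltnP (size W * lam) (size Pr)) => hW.
  left; have [w hw] : exists w, w \in W.
    by case: W nW {uW aW hW} => // w W _; exists w; rewrite mem_head.
  have [r hr /allP hi] := has_isolating uPr aPr aW (allP aW _ hw) hW.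
  have /andP[h1 h2] := allP rPr _ hr.
  have rp : 0 < r by apply: leq_trans h1.
  have hwr : w %% r < R1 by apply: leq_trans h2; rewrite ltn_mod.
  exists w, ((r - R0) * R1 + w %% r); split=> //.
    apply: (@leq_trans ((r - R0).+1 * R1)); first by rewrite mulSn addnC ltn_add2r.
    by rewrite /pNB -/R1 leq_mul2r; apply/orP; right; lia.
  move=> v hv; rewrite divnMDl ?modnMDl ?(divn_small hwr) ?(modn_small hwr); last by lia.
  rewrite addn0 subnKC //; have := hi v hv.
  by case: (v =P w) => [->|_] /=; [rewrite eqxx | move/negbTE].
(* The largest size for which at least half of the pairs are still sure to be isolating. *)
right; pose m := size Pr %/ (2 * lam).
have m0 : 0 < m by rewrite divn_gt0 // muln_gt0.
have hm : 2 * (m * lam) <= size Pr.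
  by rewrite mulnCA; apply: leq_trunc_div.
have hm2 : size Pr <= 4 * (lam * m).
  have h1 : size Pr < m.+1 * (2 * lam) by rewrite -ltn_divLR // muln_gt0.
  apply: ltnW; apply: leq_trans h1 _.
  rewrite (_ : 4 * _ = (2 * m) * (2 * lam)); last by rewrite mulnACA (mulnC m).
  by rewrite leq_mul2r; apply/orP; right; lia.
have hms : m <= size W.
  rewrite -(leq_pmul2r l0); apply: leq_trans hW; apply: leq_trans hm; exact: leq_pmull.
have sz : size (take m W) = m by rewrite size_takel.
have aW' : all (fun x => x < 2 ^ lam) (take m W).
  by apply/allP => x /mem_take hx; apply: (allP aW).
have := count_buckets r0 uPr aPr rPr (take_uniq m uW) aW'.
rewrite sz => /(_ hm).
set c' := count _ _; set c := count _ _ => hc'.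
have hcc : c' <= c.
  apply: sub_count => y /hasP[w /mem_take hw e]; apply/hasP; by exists w.
have h1 : size Pr * size Pr <= 8 * (lam * c).
  apply: (@leq_trans (4 * (lam * m) * size Pr)); first by rewrite leq_mul2r hm2 orbT.
  rewrite -!mulnA; apply: (@leq_trans (4 * (lam * (2 * c)))); last by rewrite (mulnCA lam 2) mulnA.
  rewrite !leq_mul2l; apply/orP; right; apply/orP; right; apply: leq_trans hc' _.
  by rewrite leq_mul2l.
have h2 : pNB lam <= 4 * (b * b * (size Pr * size Pr)).
  apply: leq_trans (leq_mul hpi hpi) _.
  by rewrite mulnACA leq_mul2l /= mulnACA.
apply: (@leq_trans (8 * (pPS lam * (4 * (b * b * (8 * (lam * c))))))).
  rewrite !leq_mul2l; apply/orP; right; apply/orP; right; apply: leq_trans h2 _.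
  by rewrite !leq_mul2l h1 !orbT.
have ar x y l z : 8 * (x * (4 * (y * y * (8 * (l * z))))) <= 1024 * (x * (y * y * l)) * z.
  have -> : 8 * (x * (4 * (y * y * (8 * (l * z))))) = 256 * (x * (y * y * l) * z) by lia.
  by rewrite -!mulnA leq_mul2r orbT.
exact: ar.
Qed.

Notation vR0 := 5.
Notation vR1 := 6.
Notation vNB := 7.

(** * Polylogarithmic cost bounds *)
(** The factor 2 in the base absorbs numerical constants, even when [lam = 1]; a polylogarithm is
    thus described by one exponent. *)
Definition pw (lam k : nat) : nat := (2 * lam) ^ k.

Section Cost.

Variable lam : nat.
Hypothesis l0 : 0 < lam.

Lemma pw_gt0 k : 0 < pw lam k. Proof. by rewrite expn_gt0 muln_gt0 l0. Qed.

Lemma pw_mono i j a : i <= j -> a <= pw lam i -> a <= pw lam j.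
Proof. by move=> h h'; apply: leq_trans h' _; rewrite leq_pexp2l // muln_gt0 l0. Qed.

Lemma pw_mul i j a b : a <= pw lam i -> b <= pw lam j -> a * b <= pw lam (i + j).
Proof. by rewrite /pw expnD; apply: leq_mul. Qed.

Lemma pw_add i j a b : a <= pw lam i -> b <= pw lam j -> a + b <= pw lam (maxn i j).+1.
Proof.
move=> /(pw_mono (leq_maxl i j)) h1 /(pw_mono (leq_maxr i j)) h2.
rewrite /pw expnS -mulnA mul2n -addnn; set x := _ ^ _.
by apply: leq_add; apply: leq_trans (leq_pmull x l0).
Qed.

Lemma pw_const c k : c <= 2 ^ k -> c <= pw lam k.
Proof.
case: k => [|k] h; first by rewrite /pw expn0.
by apply: leq_trans h _; rewrite leq_exp2r // leq_pmulr.
Qed.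

Lemma pw_lam : lam <= pw lam 1.
Proof. by rewrite /pw expn1 leq_pmull. Qed.

Lemma pw_S i a : a <= pw lam i -> a.+1 <= pw lam i.+1.
Proof.
move=> h; rewrite -addn1; apply: (pw_mono (i := (maxn i 0).+1)); first by rewrite maxn0.
by apply: pw_add => //; apply: pw_const.
Qed.

Lemma pw_pPS : pPS lam <= pw lam 8.
Proof.
apply: (@leq_trans (2 ^ 6 * lam)); first by rewrite /pPS -[2 ^ 6]/64; lia.
by apply: (pw_mono (i := 7)) => //; apply: (@pw_mul 6 1); [apply: pw_const | apply: pw_lam].
Qed.

Lemma pll_le : pll lam <= lam.
Proof.
rewrite /pll; have := trunc_logP (leqnn 2) l0; apply: leq_trans; exact: ltn_expl.
Qed.

Lemma pw_pB : pB lam <= pw lam 8.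
Proof.
apply: (@leq_trans (2 ^ 7 * lam)); first by have := pll_le; rewrite /pB -[2 ^ 7]/128; lia.
by apply: (@pw_mul 7 1); [apply: pw_const | apply: pw_lam].
Qed.

Lemma pw_pR1 : pR1 lam <= pw lam 72.
Proof.
rewrite /pR1 /pB expnD; apply: (@pw_mul 8 64); last exact: pw_const (leqnn _).
rewrite mulnC expnM leq_exp2r // /pll expnS leq_mul2l /=; exact: trunc_logP.
Qed.

Lemma pw_pNB : pNB lam <= pw lam 144.
Proof. exact: (@pw_mul 72 72) pw_pR1 pw_pR1. Qed.

Lemma pw_pR0 : pR0 lam <= pw lam 40.
Proof.
apply: (pw_mono (i := 10 + (8 + (8 + 8 + 1)))) => //.
apply: pw_mul; first exact: pw_const.
apply: pw_mul pw_pPS _; apply: pw_mul pw_lam; exact: pw_mul pw_pB pw_pB.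
Qed.

Variable G : nat.
Hypothesis G0 : 0 < G.

(** Sums raise the larger exponent by one and products add exponents. A running time is then bounded
    by a proof term of its own shape, followed by a comparison of numerals. *)
Definition cb (k T : nat) : Prop := T <= pw lam k * G.

Lemma cb_mono i j T : i <= j -> cb i T -> cb j T.
Proof. by move=> h h'; apply: leq_trans h' _; rewrite leq_mul2r (pw_mono h) ?orbT. Qed.

Lemma cb_leq k T T' : T' <= T -> cb k T -> cb k T'.
Proof. exact: leq_trans. Qed.

Lemma cb_add i j a b : cb i a -> cb j b -> cb (maxn i j).+1 (a + b).
Proof.
move=> /(cb_mono (leq_maxl i j)) h1 /(cb_mono (leq_maxr i j)) h2.
apply: (@leq_trans ((pw lam (maxn i j) + pw lam (maxn i j)) * G)).
  by rewrite mulnDl leq_add.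
rewrite leq_mul2r; apply/orP; right.
by have := pw_add (leqnn (pw lam (maxn i j))) (leqnn (pw lam (maxn i j))); rewrite maxnn.
Qed.

Lemma cb_mul i j x a : x <= pw lam i -> cb j a -> cb (i + j) (x * a).
Proof. by move=> h1 h2; rewrite /cb /pw expnD -mulnA; apply: leq_mul. Qed.

Lemma cb_const c k : c <= 2 ^ k -> cb k c.
Proof. by move=> h; apply: leq_trans (pw_const h) _; rewrite leq_pmulr. Qed.

Lemma cb_pw x k : x <= pw lam k -> cb k x.
Proof. by move=> h; apply: leq_trans h _; rewrite leq_pmulr. Qed.

Lemma cb_S i a : cb i a -> cb i.+1 a.+1.
Proof.
move=> h; have h1 : cb 0 1 by apply: cb_const.
by have := cb_add h h1; rewrite maxn0 addn1.
Qed.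

Lemma cb_G : cb 0 G.
Proof. by rewrite /cb /pw mul1n. Qed.

End Cost.

(** * Witnesses of boolean products *)

Notation aU := 8.
Notation aHit := 9.
Notation aCand := 10.
Notation aW := 11.
Notation aMk := 12.

(** The only facts about [P] that the algorithm uses. One bound [G] covers all calls, and [allowed]
    keeps them to the shapes occurring in the claimed maximum. *)
Definition oracle (P : program) (n WP G : nat) (allowed : nat -> nat -> Prop) : Prop :=
  forall k M m (f g : nat -> nat -> nat), allowed k M -> 0 < k ->
    (forall i y, i < n -> y < k -> m (i * k + y) = f i y /\ f i y <= M) ->
    (forall y j, y < k -> j < n -> m (n * k + y * n + j) = g y j /\ g y j <= M) ->
    (forall x, n * k + k * n <= x -> m x = 0) ->
    exists w t st, [/\ 2 ^ w <= WP, exec w P (State (nth 0 [:: n; k; n]) m) t st,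
      t <= G & forall i j, i < n -> j < n ->
        is_min k (fun y => f i y + g y j) (memory st (n * k + k * n + (i * n + j)))].

Section Env.

Variables (n lam : nat).

(** Constants that hold throughout the run. Powers of two are tabulated because expressions have
    neither shifts nor powers. *)
Definition env (s : mstate) : Prop :=
  [/\ vr s vn = n, vr s vone = 1, vr s vlam = lam, vr s vps = pPS lam &
    [/\ vr s vR0 = pR0 lam, vr s vR1 = pR1 lam, vr s vNB = pNB lam &
      forall k, k < pPS lam -> ar s aPw 0 0 k = 2 ^ k]].

Lemma env_frame vs bs s s' : env s -> frame vs bs s s' ->
  all (fun v => 8 < v) vs -> aPw \notin bs -> env s'.
Proof.
move=> [h1 h2 h3 h4 [h5 h6 h7 h8]] f /allP hv hb.
have e v : v <= 8 -> vr s' v = vr s v.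
  move=> h; apply: (frv f); apply/negP => /hv; lia.
split; rewrite ?e //; split; rewrite ?e // => k hk; rewrite (fra f) //; exact: h8.
Qed.

Lemma env_n s : env s -> vr s vn = n. Proof. by case. Qed.
Lemma env_one s : env s -> vr s vone = 1. Proof. by case. Qed.
Lemma env_lam s : env s -> vr s vlam = lam. Proof. by case. Qed.
Lemma env_ps s : env s -> vr s vps = pPS lam. Proof. by case. Qed.
Lemma env_R0 s : env s -> vr s vR0 = pR0 lam. Proof. by case=> _ _ _ _ []. Qed.
Lemma env_R1 s : env s -> vr s vR1 = pR1 lam. Proof. by case=> _ _ _ _ []. Qed.
Lemma env_NB s : env s -> vr s vNB = pNB lam. Proof. by case=> _ _ _ _ []. Qed.
Lemma env_pw s k : env s -> k < pPS lam -> ar s aPw 0 0 k = 2 ^ k.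
Proof. by case=> _ _ _ _ [_ _ _ h]; apply: h. Qed.

End Env.

Lemma sum_bits y t : \sum_(b < t) 2 ^ b * odd (y %/ 2 ^ b) = y %% 2 ^ t.
Proof.
elim: t => [|t IH]; first by rewrite big_ord0 modn1.
rewrite big_ord_recr /= IH.
have h : (y %/ 2 ^ t) = (y %/ 2 ^ t.+1) * 2 + odd (y %/ 2 ^ t).
  by rewrite expnSr divnMA {1}(divn_eq (y %/ 2 ^ t) 2) modn2.
have e : y = (y %/ 2 ^ t.+1) * 2 ^ t.+1 + (y %% 2 ^ t + 2 ^ t * odd (y %/ 2 ^ t)).
  by rewrite {1}(divn_eq y (2 ^ t)) {1}h mulnDl expnS; lia.
rewrite [in RHS]e modnMDl [RHS]modn_small //.
have h1 : y %% 2 ^ t < 2 ^ t by rewrite ltn_mod expn_gt0.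
rewrite expnS mul2n -addnn -addSn; apply: leq_add; first exact: h1.
by case: (odd _); rewrite ?muln0 ?muln1.
Qed.

Lemma sum_bits_lt (c : nat -> bool) t : \sum_(b < t) 2 ^ b * c b < 2 ^ t.
Proof.
elim: t => [|t IH]; first by rewrite big_ord0.
rewrite big_ord_recr /= expnS mul2n -addnn -addSn; apply: leq_add; first exact: IH.
by case: (c t); rewrite ?muln0 ?muln1.
Qed.

Section Wit.

(* Restricts the inner index to the positions in the list of candidates which lie
   in the current bucket. *)
Definition EU1 (EA : expr -> expr -> expr) (er ex : expr) : expr :=
  EA er (E1 aU ex) *^ (ex <^ EVar 50) *^ (ex %^ EVar 51 =^ EVar 52).
Definition EU2 (EA : expr -> expr -> expr) (er ex : expr) : expr :=
  EU1 EA er ex *^ (E1 aU ex /^ E1 aPw (EVar 54) %^ ENum 2).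
Definition EUB (EB : expr -> expr -> expr) (ex er : expr) : expr := EB (E1 aU ex) er.

(* If exactly one candidate of the bucket is a witness, then the products with the
   bits of the candidates spell it; other outcomes are discarded by the test. *)
Definition BUCKET vNR vNC EA EB : cmd :=
  Asg 51 (EVar vR0 +^ EVar 53 /^ EVar vR1) ;;
  Asg 52 (EVar 53 %^ EVar vR1) ;;
  BigBP vNR vNC (EU1 EA) (EUB EB) ;;
  Fill aHit vNB vNR vNC
    ((EVar 20 =^ EVar 53) *^ EArr aBig (ENum 0) (EVar 21) (EVar 22) +^
     ((EVar 20 =^ EVar 53) =^ ENum 0) *^ EArr aHit (EVar 20) (EVar 21) (EVar 22)) ;;
  Fill aCand vone vNR vNC (ENum 0) ;;
  For 54 vlam (
    BigBP vNR vNC (EU2 EA) (EUB EB) ;;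
    Fill aCand vone vNR vNC
      (EArr aCand (ENum 0) (EVar 21) (EVar 22) +^
       E1 aPw (EVar 54) *^ EArr aBig (ENum 0) (EVar 21) (EVar 22))) ;;
  Fill aW vone vNR vNC
    (EArr aW (ENum 0) (EVar 21) (EVar 22) +^
     (EArr aW (ENum 0) (EVar 21) (EVar 22) =^ ENum 0) *^
     (EArr aCand (ENum 0) (EVar 21) (EVar 22) <^ EVar vn) *^
     ((EA (EVar 21) (EArr aCand (ENum 0) (EVar 21) (EVar 22)) =^ ENum 0) =^ ENum 0) *^
     ((EB (EArr aCand (ENum 0) (EVar 21) (EVar 22)) (EVar 22) =^ ENum 0) =^ ENum 0) *^
     (EArr aCand (ENum 0) (EVar 21) (EVar 22) +^ ENum 1)).

(* Keeps the candidates in the picked buckets. *)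
Definition SHRINK : cmd :=
  Fill aMk vone vone 50 (ENum 0) ;;
  For 60 vnp (
    Fill aMk vone vone 50
      (EArr aMk (ENum 0) (ENum 0) (EVar 22) +^
       (EArr aMk (ENum 0) (ENum 0) (EVar 22) =^ ENum 0) *^
       (EVar 22 %^ (EVar vR0 +^ E1 aPk (EVar 60) /^ EVar vR1) =^ E1 aPk (EVar 60) %^ EVar vR1))) ;;
  Asg 58 (ENum 0) ;;
  For 61 50 (Ife (E1 aMk (EVar 61))
    (Sto aU (ENum 0) (ENum 0) (EVar 58) (E1 aU (EVar 61)) ;; Asg 58 (EVar 58 +^ ENum 1)) Nop) ;;
  Asg 50 (EVar 58).

(** An entry of [aW] is 1 + a witness, or 0 as long as none is known. Each round at least halves the
    list of candidates, so after [lam + 1] rounds the list of initially [n < 2 ^ lam] candidates is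
    empty, and positions that are still 0 have no witness at all. *)
Definition WIT vNR vNC EA EB : cmd :=
  Fill aW vone vNR vNC (ENum 0) ;;
  Fill aU vone vone vn (EVar 22) ;;
  Asg 50 (EVar vn) ;;
  Asg 57 (EVar vNR *^ EVar vNC) ;;
  Asg 56 (EVar vlam +^ ENum 1) ;;
  For 55 56 (
    For 53 vNB (BUCKET vNR vNC EA EB) ;;
    Fill aAl vone vone 57 (EArr aW (ENum 0) (EVar 22 /^ EVar vNC) (EVar 22 %^ EVar vNC) =^ ENum 0) ;;
    HITSET vNB (fun _ => EVar 57) (fun _ et => et)
      (fun ey et => EArr aHit ey (et /^ EVar vNC) (et %^ EVar vNC)) ;;
    SHRINK).

Definition witV := bpV ++ hsV ++ [:: 50; 51; 52; 53; 54; 55; 56; 57; 58; 60; 61].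
Definition witA := bpA ++ hsA ++ [:: aU; aHit; aCand; aW; aMk].

Variables (P : program) (n C WP G : nat) (allowed : nat -> nat -> Prop).
Hypotheses (n0 : 0 < n) (hG : n * n <= G) (KC : nat)
  (hKC : 2000 <= KC) (hC : n.+1 ^ KC <= C) (hO : oracle P n WP G allowed)
  (hn1 : allowed n 1).
Variable (lam : nat).
Hypotheses (l0 : 0 < lam) (ln : lam <= n) (hln : n < 2 ^ lam) (hnl : 2 ^ lam <= n * 2).

Let env := env n lam.
Notation hoare := (hoare P C WP).
Notation wf := (wf C).

Lemma G0 : 0 < G.
Proof. by apply: leq_trans hG; rewrite muln_gt0 n0. Qed.

Lemma pw_xpow k a : a <= pw lam k -> a <= xpow n (2 * k).
Proof.
move=> h; apply: leq_trans h _; rewrite /pw /xpow expnM.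
case: k => [|k]; first by rewrite !expn0.
by rewrite leq_exp2r // expnS expn1; apply: leq_mul; [rewrite ltnS | apply: leqW].
Qed.

Lemma smallC k v : v <= xpow n k -> k <= 2000 -> v <= C.
Proof.
by move=> h hk; apply: leq_trans (xpow_leq _ h) _; [exact: leq_trans hk hKC | exact: hC].
Qed.

Lemma pwC k v : v <= pw lam k -> k <= 1000 -> v <= C.
Proof.
move=> /pw_xpow h hk; apply: smallC h _; rewrite (leq_mul2l 2 k 1000) //.
Qed.

Lemma envwit s s' : env s -> frame witV witA s s' -> env s'.
Proof. by move=> h f; apply: (env_frame h f). Qed.

Lemma hoare_bp vNR vNC EA EB fA fB NR NC a b s (Q : mstate -> Prop) :
  vNR \notin bpV -> vNC \notin bpV -> env s -> vr s vNR = NR -> vr s vNC = NC ->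
  NR < a * n -> NC < b * n -> a < pw lam 12 -> b < pw lam 12 ->
  (forall s' er ey, frame bpV bpA s s' ->
     (ev (EA er ey) s' != 0) = fA (ev er s') (ev ey s')) ->
  (forall s' ey er, frame bpV bpA s s' ->
     (ev (EB ey er) s' != 0) = fB (ev ey s') (ev er s')) ->
  (forall s', wf s' -> frame bpV bpA s s' ->
     (forall i j, i < NR -> j < NC -> ar s' aBig 0 i j = bprod n fA fB i j) -> Q s') ->
  hoare (BigBP vNR vNC EA EB) s (pw lam 60 * G) Q.
Proof.
move=> hvR hvC envs R C' hNR hNC ha hb hA hB hQ.
apply: (hoare_weaken (Q := Q) (T := 150 * (a.+1 * b.+1) ^ 2 * G)) => //; last first.
  rewrite leq_mul2r; apply/orP; right; apply: (@pw_mono _ l0 (8 + (24 + 24))) => //.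
  apply: pw_mul; first exact: (pw_const l0).
  by rewrite expnS expn1; apply: pw_mul; apply: (@pw_mul _ 12 12).
apply: (@hoare_BigBP P n C WP G allowed n0 hG KC hKC hC hO vNR vNC EA EB fA fB NR NC a b) => //.
- exact: env_n envs.
- exact: env_one envs.
- by apply: (xpow_leq _ (pw_xpow (ltnW ha))).
- by apply: (xpow_leq _ (pw_xpow (ltnW hb))).
Qed.

(** * Correctness of the witness computation for two given factors *)

Section Factors.

Variables (vNR vNC : nat) (EA EB : expr -> expr -> expr) (fA fB : nat -> nat -> bool).
Variables (NR NC : nat) (s0 : mstate).
Hypotheses (hvR : vNR \notin witV) (hvC : vNC \notin witV)
  (hR0 : vr s0 vNR = NR) (hC0 : vr s0 vNC = NC) (env0 : env s0)
  (hA : forall s' er ey, frame witV witA s0 s' ->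
     (ev (EA er ey) s' != 0) = fA (ev er s') (ev ey s'))
  (hB : forall s' ey er, frame witV witA s0 s' ->
     (ev (EB ey er) s' != 0) = fB (ev ey s') (ev er s')).
Variables (a b : nat).
Hypotheses (hNR : NR < a * n) (hNC : NC < b * n) (ha : a < pw lam 12) (hb : b < pw lam 12).

Definition cands (Us : seq nat) i j :=
  [seq x <- iota 0 (size Us) | fA i (nth 0 Us x) && fB (nth 0 Us x) j].
(* The bucket bu has modulus pR0 + bu / pR1 and residue bu mod pR1; it
   contains positions in the list of candidates, not the candidates themselves. *)
Definition inb bu x := x %% (pR0 lam + bu %/ pR1 lam) == bu %% pR1 lam.

Definition sound s := forall i j, i < NR -> j < NC -> forall y, ar s aW 0 i j = y.+1 ->
  [/\ y < n, fA i y & fB y j].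
Definition ustate (Us : seq nat) s := [/\ vr s 50 = size Us, size Us <= n &
  forall x, x < size Us -> ar s aU 0 0 x = nth 0 Us x /\ nth 0 Us x < n].

Lemma ustate_frame Us vs bs s s' : ustate Us s -> frame vs bs s s' ->
  50 \notin vs -> aU \notin bs -> ustate Us s'.
Proof.
move=> [h1 h2 h3] f hv hb'; split; rewrite ?(frv f) // => x hx; rewrite (fra f) //; exact: h3.
Qed.

Lemma cb_area : cb lam G 27 (8 * (NR.+1 * NC.+1)).
Proof.
apply: (@cb_leq lam G 27 (pw lam 3 * (pw lam 12 * pw lam 12 * G))); last first.
  apply: (@cb_mul lam G 3 24 _ _ (leqnn _)); apply: (@cb_mul lam G 24 0); last exact: cb_G.
  exact: (@pw_mul lam 12 12).
apply: leq_mul; first exact: (pw_const l0 (k := 3)).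
apply: (@leq_trans ((a * n) * (b * n))); first exact: leq_mul.
by rewrite mulnACA; apply: leq_mul => //; apply: leq_mul; apply: ltnW.
Qed.

Lemma hoare_bigwit EA' EB' (fA' fB' : nat -> nat -> bool) s (Q : mstate -> Prop) :
  frame witV witA s0 s ->
  (forall s' er ey, frame bpV bpA s s' ->
     (ev (EA' er ey) s' != 0) = fA' (ev er s') (ev ey s')) ->
  (forall s' ey er, frame bpV bpA s s' ->
     (ev (EB' ey er) s' != 0) = fB' (ev ey s') (ev er s')) ->
  (forall s', wf s' -> frame bpV bpA s s' ->
     (forall i j, i < NR -> j < NC -> ar s' aBig 0 i j = bprod n fA' fB' i j) -> Q s') ->
  hoare (BigBP vNR vNC EA' EB') s (pw lam 60 * G) Q.
Proof.
move=> fr hA' hB' hQ; have envs := envwit env0 fr.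
have nb v : v \notin witV -> v \notin bpV by apply: contra; rewrite /witV mem_cat => ->.
apply: (@hoare_bp vNR vNC EA' EB' fA' fB' NR NC a b s) => //.
- exact: nb.
- exact: nb.
- by rewrite (frv fr).
- by rewrite (frv fr).
Qed.

Lemma areaC : NR * NC <= C /\ NR.+1 * NC.+1 <= C.
Proof.
have h : NR.+1 * NC.+1 <= C.
  apply: (@leq_trans ((a * n) * (b * n))); first exact: leq_mul.
  apply: (@smallC (24 + 1 + (24 + 1))) => //.
  have n1 : n <= xpow n 1 by rewrite /xpow expn1.
  by apply: xpow_mul; apply: xpow_mul => //; apply: (@pw_xpow 12); apply: ltnW.
by split=> //; apply: leq_trans h; apply: leq_mul.
Qed.

(** Soundness needs no assumption on the bucket, because a spelled candidate is stored only after a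
    test against both factors. A position that is still 0 afterwards is one in which the bucket
    isolates no candidate. *)
Lemma hoare_bucket Us bu s (Q : mstate -> Prop) :
  frame witV witA s0 s -> ustate Us s -> vr s 53 = bu -> bu < pNB lam -> sound s ->
  (forall s', wf s' -> sound s' ->
    (forall i j, i < NR -> j < NC -> ar s' aW 0 i j = 0 -> ar s aW 0 i j = 0 /\
       ~ exists w, [/\ w \in cands Us i j, inb bu w &
           forall v, v \in cands Us i j -> inb bu v -> v = w]) ->
    (forall i j c, i < NR -> j < NC -> c < pNB lam -> ar s' aHit c i j =
       if c == bu then has (inb bu) (cands Us i j) : nat else ar s aHit c i j) -> Q s') ->
  hoare (BUCKET vNR vNC EA EB) s (pw lam 200 * G) Q.
Proof.
move=> fr hU v53 hbu hsd hQ; have G0' := G0.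
have nb v : v \notin witV -> v \notin bpV by apply: contra; rewrite /witV mem_cat => ->.
have n22 v : v \notin witV -> v \notin [:: 20; 21; 22].
  by apply: contra; rewrite /witV /bpV !inE; lia.
pose r := pR0 lam + bu %/ pR1 lam; pose c := bu %% pR1 lam.
have NBC : pNB lam <= C by apply: (pwC (pw_pNB l0)).
have R0C : pR0 lam <= pw lam 40 by exact: (pw_pR0 l0).
have rC : r <= C.
  apply: (@pwC 150) => //; apply: (@pw_mono _ l0 (maxn 40 144).+1) => //; apply: (pw_add l0 R0C).
  apply: leq_trans (leq_div _ _) _; apply: leq_trans (ltnW hbu) (pw_pNB l0).
have [aC1 _] := areaC.
apply: (hoare_weaken (Q := Q) (T := 1 + (1 + (pw lam 60 * G + (4 * (pNB lam).+1 * NR.+1 * NC.+1 +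
  (8 * (NR.+1 * NC.+1) + ((lam * (pw lam 60 * G + 8 * (NR.+1 * NC.+1)).+1).+1 +
  8 * (NR.+1 * NC.+1)))))))) => //; last first.
  have ca := cb_area; have c1 : cb lam G 0 1 by apply: cb_const.
  have cB : cb lam G 60 (pw lam 60 * G) by exact: leqnn.
  apply: (@cb_mono lam l0 G 176) => //.
  apply: (cb_add l0 c1 (cb_add l0 c1 (cb_add l0 cB (cb_add l0 (_ : cb lam G 172 _) (cb_add l0 ca
     (cb_add l0 (cb_S l0 G0' (cb_mul (pw_lam lam) (cb_S l0 G0' (cb_add l0 cB ca)))) ca)))))).
  apply: (@cb_leq _ _ _ ((pNB lam).+1 * (8 * (NR.+1 * NC.+1)))).
    by rewrite -!mulnA mulnCA leq_mul // leq_mul.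
  by apply: (@cb_mul lam G 145 27) => //; exact: (pw_S l0 (pw_pNB l0)).
have envs := envwit env0 fr.
apply: (hoare_then (Q1 := fun s' => vr s' 51 = r)).
  apply: hoare_asg => [_|s' _ ->]; rewrite /= (env_R0 envs) (env_R1 envs) v53 //.
move=> s1 w1 f1 v51.
have F1 : frame witV witA s0 s1 by apply: frame_trans fr (frame_all _ _ f1).
have env1 := envwit env0 F1.
have v531 : vr s1 53 = bu by rewrite (frv f1).
apply: (hoare_then (Q1 := fun s' => vr s' 52 = c)).
  apply: hoare_asg => [_|s' _ ->]; rewrite /= (env_R1 env1) v531 //.
  apply: leq_trans (leq_mod _ _) _; exact: leq_trans (ltnW hbu) NBC.
move=> s2 w2 f2 v52.
have F2 : frame witV witA s0 s2 by apply: frame_trans F1 (frame_all _ _ f2).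
have env2 := envwit env0 F2.
have {}v51 : vr s2 51 = r by rewrite (frv f2).
have {}f2 : frame [:: 51; 52] [::] s s2 by apply: frame_trans (frame_all _ _ f1) (frame_all _ _ f2).
pose fA1 i x := [&& fA i (ar s aU 0 0 x), x < size Us & inb bu x].
pose fB1 x j := fB (ar s aU 0 0 x) j.
have [U50 Un Ux] := hU.
have mem_c x i j : (x \in cands Us i j) = [&& x < size Us, fA i (nth 0 Us x) & fB (nth 0 Us x) j].
  by rewrite mem_filter mem_iota add0n andbC.
have hasE (p : pred nat) i j : bprod n (fun i x => fA1 i x && p x) fB1 i j =
    has (fun x => inb bu x && p x) (cands Us i j).
  apply/bprodP/hasP => [[x [h1 /andP[/and3P[h2 h3 h4] h5] h6]]|[x]].
    exists x; last by rewrite h4 h5.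
    by move: h2 h6; rewrite mem_c /fB1 h3; case: (Ux x h3) => -> _ -> ->.
  rewrite mem_c => /and3P[h1 h2 h3] /andP[h4 h5]; exists x; have [e _] := Ux x h1.
  by rewrite /fA1 /fB1 e h1 h2 h3 h4 h5; split=> //; apply: leq_trans Un.
have hasE1 i j : bprod n fA1 fB1 i j = has (inb bu) (cands Us i j).
  rewrite -(eq_has (a1 := fun x => inb bu x && true)); last by move=> x; rewrite andbT.
  rewrite -(hasE xpredT); apply: eq_has => x; by rewrite andbT.
pose good s' := [/\ frame witV witA s0 s', vr s' 50 = size Us, vr s' 51 = r, vr s' 52 = c &
  forall x, ar s' aU 0 0 x = ar s aU 0 0 x].
have gmov vs bs s1' s2' : good s1' -> frame vs bs s1' s2' -> all (mem witV) vs -> all (mem witA) bs ->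
    all (fun v => v \notin vs) [:: 50; 51; 52] -> aU \notin bs -> good s2'.
  move=> [g1 g2 g3 g4 g5] f hv hb' /= /and4P[m1 m2 m3 _] m4.
  split; [by apply: frame_trans g1 (frame_all _ _ f) | by rewrite (frv f) | by rewrite (frv f) | by rewrite (frv f) |].
  by move=> x; rewrite (fra f).
have g2 : good s2 by split=> //; [rewrite (frv f2) | move=> x; rewrite (fra f2)].
have eA1 s' er ex : good s' -> (ev (EU1 EA er ex) s' != 0) = fA1 (ev er s') (ev ex s').
  move=> [h1 h2 h3 h4 h5]; rewrite /= !muln_eq0 !negb_or !eqb0 !negbK hA //= h5 h2 h3 h4.
  by rewrite /fA1 /inb -andbA.
have eB1 s' ex er : good s' -> (ev (EUB EB ex er) s' != 0) = fB1 (ev ex s') (ev er s').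
  by move=> [h1 h2 h3 h4 h5]; rewrite /EUB hB //= h5.
apply: (hoare_then (Q1 := fun s' => forall i j, i < NR -> j < NC ->
    ar s' aBig 0 i j = has (inb bu) (cands Us i j))).
  apply: (hoare_bigwit (fA' := fA1) (fB' := fB1)) => //.
  - by move=> s' er ey f; apply: eA1; apply: gmov f _ _ _ _.
  - by move=> s' er ey f; apply: eB1; apply: gmov f _ _ _ _.
  - by move=> s' _ f h i j hi hj; rewrite h // hasE1.
move=> s3 w3 f3 h3; have g3 : good s3 by apply: gmov f3 _ _ _ _.
have [F3 _ _ _ _] := g3; have env3 := envwit env0 F3.
have v533 : vr s3 53 = bu by rewrite (frv f3) // (frv f2).
have H23 i j k : ar s3 aHit i j k = ar s aHit i j k by rewrite (fra f3) // (fra f2).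
have R3 : vr s3 vNR = NR by rewrite (frv F3).
have C3 : vr s3 vNC = NC by rewrite (frv F3).
apply: (hoare_then (Q1 := fun s' => forall d i j, i < NR -> j < NC -> d < pNB lam ->
    ar s' aHit d i j = if d == bu then has (inb bu) (cands Us i j) : nat else ar s aHit d i j)).
  apply: (@hoare_fill P C WP (fun d i j => if d == bu then has (inb bu) (cands Us i j) : nat else ar s aHit d i j)).
  - exact: n22.
  - exact: n22.
  - rewrite (env_NB env3) R3 C3 => d i j s' hd hi hj w' f' x20 x21 x22 ho.
    rewrite /= x20 x21 x22 ho (frv f') // v533 (fra f') // h3 // H23.
    case: (d == bu); rewrite ?mul1n ?mul0n ?addn0 ?add0n; split=> //.
      by apply: (pwC (k := 0)) => //; case: has.
    by rewrite -H23; case: w3.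
  - by rewrite (env_NB env3) R3 C3.
  - by rewrite (env_NB env3) R3 C3 => s' _ f' h' d i j hi hj hd; rewrite h' hd hi hj .
move=> s4 w4 f4 h4; have g4 : good s4 by apply: gmov f4 _ _ _ _.
have [F4 _ _ _ _] := g4; have env4 := envwit env0 F4.
have R4 : vr s4 vNR = NR by rewrite (frv F4).
have C4 : vr s4 vNC = NC by rewrite (frv F4).
apply: (hoare_then (Q1 := fun s' => forall i j, i < NR -> j < NC -> ar s' aCand 0 i j = 0)).
  apply: (@hoare_fill P C WP (fun _ _ _ => 0)); rewrite ?(env_one env4) ?R4 ?C4 //.
  - exact: n22.
  - exact: n22.
  - by rewrite mulnA.
  - by move=> s' w' f' h' i j hi hj; rewrite h' hi hj.
move=> s5 w5 f5 h5; have g5 : good s5 by apply: gmov f5 _ _ _ _.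
have [F5 _ _ _ _] := g5; have env5 := envwit env0 F5.
pose fb t x := odd (ar s aU 0 0 x %/ 2 ^ t).
pose cnd m i j := \sum_(t < m) 2 ^ t * has (fun x => inb bu x && fb t x) (cands Us i j).
apply: (hoare_then (Q1 := fun s' => [/\ good s', frame [:: 10; 11; 12; 13; 14; 15; 20; 21; 22; 54] [:: aA; aB; aC; aBig; aCand] s5 s' &
   forall i j, i < NR -> j < NC -> ar s' aCand 0 i j = cnd lam i j])).
  rewrite -{1}(env_lam env5).
  apply: (hoare_for (I := fun t s' => [/\ good s', frame [:: 10; 11; 12; 13; 14; 15; 20; 21; 22; 54] [:: aA; aB; aC; aBig; aCand] s5 s' &
   forall i j, i < NR -> j < NC -> ar s' aCand 0 i j = cnd t i j])).
  - by split=> // i j hi hj; rewrite h5 // /cnd big_ord0.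
  - rewrite (env_lam env5) => t s6 s7 ht w7 _ [g6 f56 h6] f67 _ v54.
    have g7 : good s7 by apply: gmov f67 _ _ _ _.
    have f57 : frame [:: 10; 11; 12; 13; 14; 15; 20; 21; 22; 54] [:: aA; aB; aC; aBig; aCand] s5 s7.
      by apply: frame_trans f56 (frame1 _ _ f67).
    have [F7 _ _ _ _] := g7; have env7 := envwit env0 F7.
    have htP : t < pPS lam by rewrite /pPS; lia.
    apply: (hoare_then (Q1 := fun s' => forall i j, i < NR -> j < NC ->
       ar s' aBig 0 i j = has (fun x => inb bu x && fb t x) (cands Us i j))).
      apply: (hoare_bigwit (fA' := fun i x => fA1 i x && fb t x) (fB' := fB1)) => //.
      + move=> s' er ex f; have g' : good s' by apply: gmov f _ _ _ _.
        have e' := envwit env0 (let: And5 h _ _ _ _ := g' in h).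
        have v54' : vr s' 54 = t by rewrite (frv f).
        have [_ _ _ _ U'] := g'.
        rewrite -(eA1 s') // /EU2 /= v54' (env_pw e' htP) U' modn2 muln_eq0 negb_or eqb0 negbK //.
      + by move=> s' er ey f; apply: eB1; apply: gmov f _ _ _ _.
      + by move=> s' _ f h i j hi hj; rewrite h // hasE.
    move=> s8 w8 f8 h8; have g8 : good s8 by apply: gmov f8 _ _ _ _.
    have [F8 _ _ _ _] := g8; have env8 := envwit env0 F8.
    have R8 : vr s8 vNR = NR by rewrite (frv F8).
    have C8 : vr s8 vNC = NC by rewrite (frv F8).
    have v548 : vr s8 54 = t by rewrite (frv f8).
    have K8 i j : i < NR -> j < NC -> ar s8 aCand 0 i j = cnd t i j.
      by move=> hi hj; rewrite (fra f8) // (fra f67) // h6.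
    apply: (@hoare_fill P C WP (fun _ i j => cnd t.+1 i j)); rewrite ?(env_one env8) ?R8 ?C8 //.
    + exact: n22.
    + exact: n22.
    + move=> i j k s' hi hj hk w' f' x20 x21 x22 ho; have i0 : i = 0 by lia.
      rewrite i0 in ho x20; have e' := env_frame env8 f' isT isT.
      rewrite /= x21 x22 ho (frv f') // v548 (env_pw e' htP) (fra f') // h8 // K8 //.
      rewrite /cnd big_ord_recr /=; split=> //.
      apply: (@leq_trans (2 ^ lam)); last by apply: (@leq_trans (n * 2)) => //; apply: (@smallC 2) => //; rewrite /xpow expnS expn1; nia.
      apply: ltnW; apply: leq_trans (_ : 2 ^ t.+1 <= _); last by rewrite leq_exp2l.
      have := sum_bits_lt (fun t => has (fun x => inb bu x && fb t x) (cands Us j k)) t.+1.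
      by rewrite big_ord_recr.
    + by rewrite mulnA.
    + move=> s' w' f' h'; split.
      * by apply: gmov f' _ _ _ _.
      * by apply: frame_trans f57 _; apply: frame_trans (frame_all _ _ f8) (frame_all _ _ f').
      * by move=> i j hi hj; rewrite h' hi hj.
  - by rewrite (env_lam env5).
move=> s6 w6 _ [g6 f56 h6].
have [F6 _ _ _ _] := g6; have env6 := envwit env0 F6.
have R6 : vr s6 vNR = NR by rewrite (frv F6).
have C6 : vr s6 vNC = NC by rewrite (frv F6).
have W6 i j : ar s6 aW 0 i j = ar s aW 0 i j.
  by rewrite (fra f56) // (fra f5) // (fra f4) // (fra f3) // (fra f2).
pose vw i j := let y := cnd lam i j in
  if (ar s aW 0 i j == 0) && [&& y < n, fA i y & fB y j] then y.+1 else ar s aW 0 i j.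
apply: (@hoare_fill P C WP (fun _ i j => vw i j)); rewrite ?(env_one env6) ?R6 ?C6 //.
- exact: n22.
- exact: n22.
- move=> i j k s' hi hj hk w' f' x20 x21 x22 ho; have i0 : i = 0 by lia.
  rewrite i0 in ho x20.
  have F' : frame witV witA s0 s' by apply: frame_trans F6 (frame_all _ _ f').
  have e' := envwit env0 F'.
  have K' : ar s' aCand 0 j k = cnd lam j k by rewrite (fra f') // h6.
  have -> : forall e, ev (EArr aW (ENum 0) (EVar 21) (EVar 22) +^ e) s' = ar s aW 0 j k + ev e s'.
    by move=> e; rewrite /= x21 x22 ho W6.
  have eA := hA (EVar 21) (EArr aCand (ENum 0) (EVar 21) (EVar 22)) F'.
  have eB := hB (EArr aCand (ENum 0) (EVar 21) (EVar 22)) (EVar 22) F'.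
  have nC : n <= C by apply: (@smallC 1) => //; rewrite /xpow expn1.
  rewrite /= in eA eB; rewrite x21 x22 K' in eA eB.
  rewrite /= x21 x22 ho W6 K' (env_n e') !eqb0 eA eB /vw.
  case: (ar s aW 0 j k =P 0) => [->|_] /=; last first.
    by rewrite !mul0n addn0; split=> //; rewrite -W6; case: w6.
  rewrite mul1n; case: (ltnP (cnd lam j k) n) => //= hlt; rewrite ?mul0n //.
  rewrite mul1n; case: (fA _ _) => //=; case: (fB _ _) => //=; rewrite !mul1n addn1; split=> //.
  exact: leq_trans nC.
- by rewrite mulnA.
- move=> s' w' f' h'; apply: hQ => //.
  + move=> i j hi hj y; rewrite h' hi hj /= /vw.
    by case: ifP => [/andP[_ /and3P[? ? ?]] [<-] //|_]; apply: hsd.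
  + move=> i j hi hj; rewrite h' hi hj /= /vw; case: ifP => // hc h0; split=> //.
    (* When [w] is the only candidate in the bucket, each product with a bit returns that bit of
       [nth 0 Us w], and [lam] bits determine a number below [n]. *)
    move=> [w [hw hbw huw]].
    have hcw t : has (fun x => inb bu x && fb t x) (cands Us i j) = fb t w.
      apply/hasP/idP => [[v hv /andP[h1 h2]]|h1]; first by rewrite -(huw v hv h1).
      by exists w => //; rewrite hbw.
    have := hw; rewrite mem_c => /and3P[hsw hfa hfb]; have [Uw Uwn] := Ux w hsw.
    have ec : cnd lam i j = nth 0 Us w.
      rewrite /cnd; under eq_bigr => t _ do rewrite hcw /fb Uw.
      by rewrite sum_bits modn_small //; apply: ltn_trans hln.
    by move: hc; rewrite h0 ec Uwn hfa hfb.
  + move=> i j d hi hj hd; rewrite (fra f') // (fra f56) // (fra f5) // h4 //.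
Qed.

Definition shrunk (pk Us : seq nat) : seq nat :=
  [seq nth 0 Us x | x <- iota 0 (size Us) & has (fun c => inb c x) pk].

Lemma hoare_shrink Us pk s (Q : mstate -> Prop) :
  frame witV witA s0 s -> ustate Us s -> vr s vnp = size pk -> size pk <= pw lam 160 ->
  (forall t, t < size pk -> ar s aPk 0 0 t = nth 0 pk t) ->
  (forall s', wf s' -> ustate (shrunk pk Us) s' -> Q s') ->
  hoare SHRINK s (pw lam 180 * G) Q.
Proof.
move=> fr hU hnp hsp hpk hQ; have G0' := G0; have [U50 Un Ux] := hU.
have nG : n.+1 * 16 <= pw lam 6 * G.
  apply: leq_trans (_ : 2 ^ 6 * G <= _); last by rewrite leq_mul2r (pw_const l0 (leqnn _)) orbT.
  by apply: leq_trans (leq_mul (leqnn _) hG); nia.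
have NBC : pNB lam <= C by apply: (pwC (pw_pNB l0)).
have szC x : x <= size Us -> x <= C.
  by move=> h; apply: (@smallC 1) => //; rewrite /xpow expn1; lia.
apply: (hoare_weaken (Q := Q) (T := n.+1 * 16 + ((size pk * (n.+1 * 16).+1).+1 + (1 + ((size Us * 4).+1 + 1))))) => //; last first.
  have c1 : cb lam G 0 1 by apply: cb_const.
  have cn : cb lam G 6 (n.+1 * 16) by exact: nG.
  apply: (@cb_mono lam l0 G 170) => //.
  apply: (cb_add l0 cn (cb_add l0 (cb_S l0 G0' (cb_mul hsp (cb_S l0 G0' cn)))
    (cb_add l0 c1 (cb_add l0 (cb_S l0 G0' (_ : cb lam G 6 _)) c1)))).
  by apply: cb_leq cn; lia.
have env1 := envwit env0 fr.
apply: (hoare_then (Q1 := fun s' => forall x, x < size Us -> ar s' aMk 0 0 x = 0)).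
  apply: (@hoare_fill P C WP (fun _ _ _ => 0)) => //; rewrite (env_one env1) U50; first by lia.
  by move=> s' w' f' h' x hx; rewrite h' hx.
move=> s1 w1 f1 h1.
have F1 : frame witV witA s0 s1 by apply: frame_trans fr (frame_all _ _ f1).
have np1 : vr s1 vnp = size pk by rewrite (frv f1).
have pk1 t : t < size pk -> ar s1 aPk 0 0 t = nth 0 pk t by move=> ht; rewrite (fra f1) // hpk.
have {}hU : ustate Us s1 by apply: ustate_frame f1 _ _.
have U501 : vr s1 50 = size Us by case: hU.
apply: (hoare_then (Q1 := fun s' => forall x, x < size Us -> ar s' aMk 0 0 x = has (fun c => inb c x) pk)).
  rewrite -{1}np1.
  apply: (hoare_for (I := fun m s' => forall x, x < size Us -> ar s' aMk 0 0 x = has (fun c => inb c x) (take m pk))).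
  - by move=> x hx; rewrite h1 // take0.
  - rewrite np1 => m s2 s3 hm w3 f12 h2 f23 _ v60.
    have F3 : frame witV witA s0 s3 by apply: frame_trans F1 (frame_trans (frame_all _ _ f12) (frame_all _ _ f23)).
    have env3 := envwit env0 F3.
    have U503 : vr s3 50 = size Us by rewrite (frv f23) // (frv f12).
    apply: (@hoare_fill P C WP (fun _ _ x => nat_of_bool (has (fun c => inb c x) (take m.+1 pk)))) => //;
      rewrite (env_one env3) U503.
    + move=> i j x s' hi hj hx w' f' x20 x21 x22 ho.
      have i0 : i = 0 by lia. have j0 : j = 0 by lia.
      rewrite i0 j0 in ho; have e' := env_frame env3 f' isT isT.
      have pkm : ar s' aPk 0 0 m = nth 0 pk m by rewrite (fra f') // (fra f23) // (fra f12) // pk1.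
      rewrite /= x22 ho (env_R0 e') (env_R1 e') (frv f') // v60 pkm.
      rewrite (fra f23) // h2 // (take_nth 0 hm) -cats1 has_cat /= orbF -/(inb (nth 0 pk m) x).
      split; last by apply: (@smallC 1) => //; apply: leq_trans (leq_b1 _) _; exact: xpow_gt0.
      by case: (has _ _) => /=; rewrite ?mul0n ?mul1n ?addn0.
    + by lia.
    + by move=> s' w' f' h' x hx; rewrite h' hx.
  - by rewrite np1 => s' _ _ h' x hx; rewrite h' // take_size.
move=> s2 w2 f2 h2.
have {}hU : ustate Us s2 by apply: ustate_frame f2 _ _.
apply: (hoare_then (Q1 := fun s' => vr s' 58 = 0)); first by apply: hoare_asg.
move=> s3 w3 f3 v58; have {}hU : ustate Us s3 by apply: ustate_frame f3 _ _.
have [U503 _ U3] := hU.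
pose pre m := [seq nth 0 Us x | x <- iota 0 m & has (fun c => inb c x) pk].
have preS m : pre m.+1 = pre m ++ (if has (fun c => inb c m) pk then [:: nth 0 Us m] else [::]).
  by rewrite /pre -addn1 iotaD filter_cat map_cat /= add0n; case: ifP.
have pre_le m : size (pre m) <= m.
  by rewrite size_map size_filter; apply: leq_trans (count_size _ _) _; rewrite size_iota.
apply: (hoare_then (Q1 := fun s' => vr s' 58 = size (pre (size Us)) /\
    forall x, x < size (pre (size Us)) -> ar s' aU 0 0 x = nth 0 (pre (size Us)) x)).
  rewrite -{1}U503.
  (* The list is compacted in place. The write index [size (pre m)] never overtakes the read index
     [m], so the entries from [m] on are still the old ones. *)
  apply: (hoare_for (I := fun m s' => [/\ vr s' 58 = size (pre m),
     forall x, x < size (pre m) -> ar s' aU 0 0 x = nth 0 (pre m) x &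
     forall x, m <= x -> x < size Us -> ar s' aU 0 0 x = nth 0 Us x])).
  - by split=> // x _ hx; case: (U3 x hx).
  - rewrite U503 => m s4 s5 hm w5 f34 [h3 h4 h5] f45 _ v61.
    have M5 x : x < size Us -> ar s5 aMk 0 0 x = has (fun c => inb c x) pk.
      by move=> hx; rewrite (fra f45) // (fra f34) // (fra f3) // h2.
    apply: hoare_if; rewrite /= v61 M5 //.
      rewrite eqb0 negbK => hh.
      apply: (hoare_weaken (T := 1 + 1) (Q := fun s' => [/\ vr s' 58 = size (pre m.+1),
        forall x, x < size (pre m.+1) -> ar s' aU 0 0 x = nth 0 (pre m.+1) x &
        forall x, m.+1 <= x -> x < size Us -> ar s' aU 0 0 x = nth 0 Us x])) => //.
      apply: (hoare_then (Q1 := fun s' => [/\ vr s' 58 = size (pre m),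
        forall x, x < size (pre m.+1) -> ar s' aU 0 0 x = nth 0 (pre m.+1) x &
        forall x, m.+1 <= x -> x < size Us -> ar s' aU 0 0 x = nth 0 Us x])).
        apply: hoare_sto => [_|s6 f6 _ h6]; first by case: w5 => _ h; apply: h.
        have v585 : vr s5 58 = size (pre m) by rewrite (frv f45).
        split; first by rewrite (frv f6).
        - move=> x; rewrite preS hh size_cat addn1 ltnS leq_eqVlt => hx; rewrite h6 /= v585 v61.
          case: eqP hx => [->|ne] /= hx.
            by rewrite nth_cat ltnn subnn /= (fra f45) // h5.
          by rewrite nth_cat hx (fra f45) // h4.
        - move=> x hx hx'; rewrite h6 /= v585; case: eqP => [e|_] /=.
            by have := pre_le m; lia.
          by rewrite (fra f45) // h5 // ltnW.
      move=> s6 w6 _ [k1 k2 k3].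
      apply: hoare_asg => [_|s7 f7 ->]; rewrite /= k1.
        by apply: szC; have := pre_le m; lia.
      split; first by rewrite preS hh size_cat.
        by move=> x hx; rewrite (fra f7) // k2.
      by move=> x hx hx'; rewrite (fra f7) // k3.
    move/eqP; rewrite eqb0 => /negbTE hh.
    apply: (hoare_weaken (T := 1) (Q := fun s' => s' = s5)) => //; first exact: hoare_nop.
    move=> s6 _ _ ->; rewrite preS hh cats0; split.
    + by rewrite (frv f45).
    + by move=> x hx; rewrite (fra f45) // h4.
    + by move=> x hx hx'; rewrite (fra f45) // h5 // ltnW.
  - by rewrite U503 => s' _ _ [].
move=> s4 w4 f4 [v584 U4].
apply: (hoare_weaken (T := 1) (Q := ustate (shrunk pk Us))) => //; last by move=> s' w' _; apply: hQ.
apply: hoare_asg => [_|s5 f5 v50] /=; first by rewrite v584; apply: szC.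
split; first by rewrite v50 /= v584.
  by apply: leq_trans Un; exact: pre_le.
move=> x hx; rewrite (fra f5) // U4 //; split=> //.
have : nth 0 (shrunk pk Us) x \in shrunk pk Us by rewrite mem_nth.
by case/mapP => y; rewrite mem_filter mem_iota => /andP[_ /= hy] ->; case: (Ux y hy).
Qed.

Lemma count_mod r c m : 0 < r -> count (fun x => x %% r == c) (iota 0 m) <= (m %/ r).+1.
Proof.
move=> r0; rewrite -size_filter; set s := filter _ _.
rewrite -(size_map (fun x => x %/ r)) -[X in _ <= X](size_iota 0); apply: uniq_leq_size.
  rewrite map_inj_in_uniq ?filter_uniq ?iota_uniq // => x y.
  rewrite !mem_filter => /andP[/eqP hx _] /andP[/eqP hy _] e.
  by rewrite (divn_eq x r) (divn_eq y r) hx hy e.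
move=> z /mapP[x]; rewrite mem_filter mem_iota !add0n => /and3P[_ _ hx] ->.
by rewrite mem_iota add0n /= ltnS leq_div2r // ltnW.
Qed.

(** Here it matters that buckets contain positions: positions fill an interval, so a residue class
    of modulus at least [pR0] contains at most [size Us / pR0 + 1] of them, whatever the candidates
    are. *)
Lemma size_shrunk pk Us : size (shrunk pk Us) <= size pk * (size Us %/ pR0 lam).+1.
Proof.
rewrite size_map size_filter; elim: pk => [|c pk IH] /=.
  by rewrite (eq_count (a2 := pred0)) ?count_pred0.
have h : count (fun x => inb c x || has (fun c => inb c x) pk) (iota 0 (size Us)) <=
   count (inb c) (iota 0 (size Us)) + count (fun x => has (fun c => inb c x) pk) (iota 0 (size Us)).
  by rewrite -count_predUI leq_addr.
apply: leq_trans h _; rewrite mulSn; apply: leq_add IH.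
have r0 := pR0_gt0 l0; apply: leq_trans (count_mod _ _ _) _; first by rewrite addn_gt0 r0.
by rewrite ltnS leq_div2l // leq_addr.
Qed.

Hypothesis hPS : NR * NC <= 2 ^ pPS lam.

Definition iso (Us : seq nat) i j bu := exists w, [/\ w \in cands Us i j, inb bu w &
  forall v, v \in cands Us i j -> inb bu v -> v = w].

Lemma cands_lt Us i j : size Us <= n -> all (fun x => x < 2 ^ lam) (cands Us i j).
Proof.
move=> h; apply/allP => x; rewrite mem_filter mem_iota => /andP[_ /= hx].
by apply: ltn_trans hln; apply: leq_trans h.
Qed.

Lemma cands_uniq Us i j : uniq (cands Us i j).
Proof. by rewrite filter_uniq ?iota_uniq. Qed.

Section RoundAnalysis.

Variables (Us : seq nat) (al0 : nat -> bool).
Hypotheses (hUn : size Us <= n)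
  (hal : forall e, e < NR * NC -> al0 e -> forall bu, bu < pNB lam ->
     ~ iso Us (e %/ NC) (e %% NC) bu).

Let inc bu := [seq t | t <- iota 0 (NR * NC) & has (inb bu) (cands Us (t %/ NC) (t %% NC))].

Lemma mem_inc e bu : (e \in inc bu) = (e < NR * NC) && has (inb bu) (cands Us (e %/ NC) (e %% NC)).
Proof. by rewrite /inc map_id mem_filter mem_iota add0n andbC. Qed.

Lemma inc_uniq bu : uniq (inc bu).
Proof. by rewrite /inc map_id filter_uniq ?iota_uniq. Qed.

(** No bucket isolates a candidate at an open position, so by the dichotomy every nonempty set of
    candidates there meets many buckets, and few buckets hit all these sets. The picked buckets then
    contain at most [pR0 / 4 * (size Us / pR0 + 1)] list positions, at most half of the list once
    the list has length at least [pR0]. *)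
Lemma round_analysis :
  let pk := (hs_run inc (pNB lam) (pPS lam) al0).2 in
  [/\ forall e, e < NR * NC -> al0 e -> cands Us (e %/ NC) (e %% NC) != [::] ->
        exists2 bu, bu \in pk & has (inb bu) (cands Us (e %/ NC) (e %% NC)),
      all (fun bu => bu < pNB lam) pk, 4 * size pk <= pR0 lam &
      2 * size (shrunk pk Us) <= size Us].
Proof.
have r0 := pR0_gt0 l0.
have PS0 : 0 < pPS lam by rewrite /pPS addn_gt0 orbT.
have NB0 : 0 < pNB lam by rewrite /pNB /pR1 muln_gt0 expn_gt0.
have hcnt bu : bu < pNB lam -> count al0 (inc bu) <= 2 ^ pPS lam.
  move=> _; apply: leq_trans (count_size _ _) _; rewrite /inc size_map size_filter.
  by apply: leq_trans (count_size _ _) _; rewrite size_iota.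
set X := 8 * (pPS lam * pNB lam).
have PN0 : 0 < pPS lam * pNB lam by rewrite (muln_gt0 (pPS lam)) PS0 NB0.
have X0 : 0 < X by rewrite /X (muln_gt0 8).
have big e : e < NR * NC -> al0 e -> cands Us (e %/ NC) (e %% NC) != [::] ->
    X <= pR0 lam * count (fun bu => e \in inc bu) (iota 0 (pNB lam)).
  move=> he ha' hne.
  case: (bucket_dichotomy l0 (cands_uniq Us _ _) hne (cands_lt _ _ hUn)) => [[w [bu [h1 h2 h3]]]|].
    case: (hal he ha' h2); exists w; split=> //; first by rewrite /inb h3.
    by move=> v hv; rewrite /inb h3 // => /eqP.
  rewrite (eq_count (a1 := fun bu => e \in inc bu) (a2 := fun b0 => has (fun w => w %% (pR0 lam + b0 %/ pR1 lam) == b0 %% pR1 lam)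
     (cands Us (e %/ NC) (e %% NC)))) // => bu.
  by rewrite mem_inc he.
have mem1 e : al0 e -> member inc (pNB lam) e ->
    e < NR * NC /\ cands Us (e %/ NC) (e %% NC) != [::].
  move=> _ /hasP[bu _]; rewrite mem_inc => /andP[-> h]; split=> //.
  by case: (cands _ _ _) h.
have mem2 e : e < NR * NC -> al0 e -> cands Us (e %/ NC) (e %% NC) != [::] -> member inc (pNB lam) e.
  move=> h1 h2 h3; rewrite /member has_count.
  have := big e h1 h2 h3; case: (count _ _) => //; rewrite muln0; lia.
(* The ceiling of [X / pR0]: the number of buckets that every set is guaranteed to meet. *)
pose q := (X + (pR0 lam).-1) %/ pR0 lam.
have qX : X <= pR0 lam * q.
  have := ltn_ceil (X + (pR0 lam).-1) r0; rewrite -/q mulSn; lia.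
have hq e : al0 e -> member inc (pNB lam) e -> q <= count (fun bu => e \in inc bu) (iota 0 (pNB lam)).
  move=> ha' hm; have [h1 h2] := mem1 e ha' hm; have := big e h1 ha' h2.
  set c := count _ _ => hc; rewrite -ltnS /q ltn_divLR // mulSn mulnC; lia.
have [k1 k2 k3] := hs_runP inc_uniq PS0 hcnt hq.
set pk := (hs_run _ _ _ _).2 in k1 k2 k3 *.
have k4 : 4 * size pk <= pR0 lam.
  have h : size pk * X <= pR0 lam * (pPS lam * (2 * pNB lam)).
    apply: (@leq_trans (size pk * (pR0 lam * q))); first by rewrite leq_mul2l qX orbT.
    by rewrite mulnCA leq_mul2l k3 orbT.
  have h0 : 0 < pPS lam * pNB lam * 2 by rewrite (muln_gt0 _ 2) PN0.
  rewrite -(leq_pmul2r h0); apply: leq_trans (leq_trans _ h) _; rewrite /X.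
    by rewrite -mulnA mulnCA leq_mul2l; apply/orP; right; lia.
  by rewrite leq_mul2l; apply/orP; right; rewrite mulnCA mulnC.
split=> //= [e h1 h2 h3|].
  have [bu hb1] := k1 e h2 (mem2 e h1 h2 h3); rewrite mem_inc => /andP[_ hb2].
  by exists bu.
(* In a list shorter than [pR0] the bucket numbered [w], with modulus [pR0] and residue [w],
   contains the position [w] alone. So every open position with candidates would have been settled,
   and there is nothing to hit. *)
case: (ltnP (size Us) (pR0 lam)) => hU.
  have none e : al0 e -> member inc (pNB lam) e -> False.
    move=> h1 h2; have [h3 h4] := mem1 e h1 h2.
    have [w hw] : exists w, w \in cands Us (e %/ NC) (e %% NC).
      by case: (cands _ _ _) h4 => // w W _; exists w; rewrite mem_head.
    have small v : v \in cands Us (e %/ NC) (e %% NC) -> v < pR0 lam.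
      by rewrite mem_filter mem_iota => /andP[_ /= hv]; apply: ltn_trans hU.
    have R01 : pR0 lam <= pR1 lam.
      have := pR0_small l0; apply: leq_trans; rewrite mulnCA.
      have b0 : 0 < pB lam by rewrite /pB addn_gt0 orbT.
      apply: leq_trans (leq_pmull _ b0); lia.
    have hwR : w < pR1 lam by apply: leq_trans R01; apply: small.
    apply: (hal h3 h1 (bu := w)).
      by apply: leq_trans hwR _; rewrite /pNB leq_pmull // /pR1 expn_gt0.
    have iw v : v \in cands Us (e %/ NC) (e %% NC) -> inb w v = (v == w).
      by move=> /small hv; rewrite /inb (divn_small hwR) addn0 (modn_small hwR) modn_small.
    by exists w; split; rewrite ?iw // => v hv; rewrite iw // => /eqP.
  (* As no set is left, the lower bound on set sizes holds vacuously for any [q]; a huge one forces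
     the number of picks to be 0, and the list becomes empty. *)
  have [_ _] := hs_runP (q := (pPS lam * (2 * pNB lam)).+1) inc_uniq PS0 hcnt
    (fun e h1 h2 => match none e h1 h2 with end).
  rewrite -/pk => h; have p0 : size pk = 0 by case: (size pk) h => // m; rewrite mulSn; lia.
  have := size_shrunk pk Us; rewrite p0 mul0n; lia.
apply: (@leq_trans (2 * (size pk * (size Us %/ pR0 lam).+1))).
  by rewrite leq_mul2l size_shrunk orbT.
set z := size Us %/ pR0 lam.
have z0 : 0 < z by rewrite divn_gt0.
apply: (@leq_trans (4 * size pk * z)); first by rewrite -!mulnA; nia.
apply: (@leq_trans (pR0 lam * z)); first by rewrite leq_mul2r k4 orbT.
by rewrite mulnC leq_trunc_div.
Qed.

End RoundAnalysis.

(** Dropping candidates is harmless as long as every open position that has a witness keeps one in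
    the list; it need not be the same one. *)
Definition covers Us s := forall i j, i < NR -> j < NC -> ar s aW 0 i j = 0 ->
  forall y, y < n -> fA i y -> fB y j -> cands Us i j != [::].

Definition ROUND :=
    For 53 vNB (BUCKET vNR vNC EA EB) ;;
    Fill aAl vone vone 57 (EArr aW (ENum 0) (EVar 22 /^ EVar vNC) (EVar 22 %^ EVar vNC) =^ ENum 0) ;;
    HITSET vNB (fun _ => EVar 57) (fun _ et => et)
      (fun ey et => EArr aHit ey (et /^ EVar vNC) (et %^ EVar vNC)) ;;
    SHRINK.

Lemma hoare_round Us s (Q : mstate -> Prop) :
  frame witV witA s0 s -> vr s 57 = NR * NC -> ustate Us s -> sound s -> covers Us s ->
  (forall s' Us', wf s' -> ustate Us' s' -> 2 * size Us' <= size Us -> sound s' ->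
     covers Us' s' -> Q s') ->
  hoare ROUND s (pw lam 370 * G) Q.
Proof.
move=> fr v57 hU hsd hcv hQ; have G0' := G0; have [U50 Un Ux] := hU.
have NBC : pNB lam <= C by apply: (pwC (pw_pNB l0)).
have [aC1 _] := areaC.
have nb v : v \notin witV -> v \notin hsV.
  by apply: contra; rewrite /witV !mem_cat => ->; rewrite orbT.
have PSb := pw_pPS l0; have NBb := pw_pNB l0.
set D := pNB lam * (NR * NC).
have ca := cb_area.
have cna : cb lam G 27 (NR * NC).
  by apply: cb_leq ca; apply: (@leq_trans (NR.+1 * NC.+1)); [apply: leq_mul | apply: leq_pmull].
apply: (hoare_weaken (Q := Q) (T := (pNB lam * (pw lam 200 * G).+1).+1 + (16 * (NR * NC).+1 +
   (pPS lam * (5 * D + 20 * pNB lam + 10) + 5 + pw lam 180 * G)))) => //; last first.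
  have cB k : cb lam G k (pw lam k * G) by exact: leqnn.
  have c5 c k : c <= 2 ^ k -> cb lam G k c by apply: cb_const.
  have cD : cb lam G (144 + 27) D by apply: cb_mul.
  apply: (@cb_mono lam l0 G 347) => //.
  apply: (cb_add l0 (cb_S l0 G0' (cb_mul NBb (cb_S l0 G0' (cB 200))))
    (cb_add l0 (cb_mul (pw_const l0 (k := 4) _) (cb_S l0 G0' cna))
    (cb_add l0 (cb_add l0 (cb_mul PSb (cb_add l0 (cb_add l0 (cb_mul (pw_const l0 (k := 3) _) cD)
       (cb_mul (pw_const l0 (k := 5) _) (cb_pw G0' NBb))) (c5 10 4 _))) (c5 5 3 _)) (cB 180)))) => //.
apply: (hoare_then (Q1 := fun s' => [/\ frame witV witA s0 s', vr s' 57 = NR * NC,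
   ustate Us s', sound s' & (forall i j, i < NR -> j < NC -> ar s' aW 0 i j = 0 -> ar s aW 0 i j = 0 /\
      forall bu, bu < pNB lam -> ~ iso Us i j bu) /\
   (forall i j c, i < NR -> j < NC -> c < pNB lam ->
      ar s' aHit c i j = has (inb c) (cands Us i j))])).
  have eNB : vr s vNB = pNB lam by have := env_NB (envwit env0 fr).
  rewrite -{1}eNB.
  apply: (hoare_for (I := fun m s' => sound s' /\
    (forall i j, i < NR -> j < NC -> ar s' aW 0 i j = 0 -> ar s aW 0 i j = 0 /\
      forall bu, bu < m -> ~ iso Us i j bu) /\
    (forall i j c, i < NR -> j < NC -> c < m -> ar s' aHit c i j = has (inb c) (cands Us i j)))).
  - by split=> //; split.
  - rewrite eNB => m s1 s2 hm w2 f1 [I1 [I2 I3]] f12 _ v53.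
    have f2 : frame (53 :: mv (BUCKET vNR vNC EA EB)) (ma (BUCKET vNR vNC EA EB)) s s2.
      by apply: frame_trans f1 (frame1 _ _ f12).
    apply: (hoare_bucket (Us := Us) _ _ v53 hm).
    + by apply: frame_trans fr (frame_all _ _ f2).
    + by apply: ustate_frame hU f2 _ _.
    + by move=> i j hi hj y; rewrite (fra f12) //; apply: I1.
    + move=> s3 w3 J1 J2 J3; split=> //; split.
        move=> i j hi hj h0; have [h1 h2] := J2 i j hi hj h0.
        have [h3 h4] := I2 i j hi hj (etrans (esym (fra f12 isT _ _ _)) h1).
        split=> // bu; rewrite ltnS leq_eqVlt => /orP[/eqP->|]; [exact: h2 | exact: h4].
      move=> i j c hi hj hc; have hcN : c < pNB lam by apply: leq_trans hm.
      rewrite J3 //; case: eqP => [->//|ne].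
      by rewrite (fra f12) // I3 //; move: hc; rewrite ltnS leq_eqVlt; case: eqP ne.
  - rewrite eNB => s' w' f' [I1 [I2 I3]]; split=> //.
    + by apply: frame_trans fr (frame_all _ _ f').
    + by rewrite (frv f').
    + by apply: ustate_frame hU f' _ _.
move=> s1 w1 _ [F1 v571 U1 sd1 [I1 I2]]; have env1 := envwit env0 F1.
have C1 : vr s1 vNC = NC by rewrite (frv F1).
have n22 v : v \notin witV -> v \notin [:: 20; 21; 22].
  by apply: contra; rewrite /witV /bpV !inE; lia.
have dm e : e < NR * NC -> e %/ NC < NR /\ e %% NC < NC.
  move=> he; have c0 : 0 < NC by case: NC he => //; rewrite muln0.
  by rewrite ltn_divLR // ltn_mod.
pose al0 e := ar s1 aW 0 (e %/ NC) (e %% NC) == 0.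
have eNC s' : frame [:: 20; 21; 22] [:: aAl] s1 s' -> vr s' vNC = NC.
  by move=> f; rewrite (frv f) // n22.
apply: (hoare_then (Q1 := fun s' => forall e, e < NR * NC -> ar s' aAl 0 0 e = al0 e)).
  apply: (@hoare_fill P C WP (fun _ _ e => nat_of_bool (al0 e))) => //; rewrite (env_one env1) v571.
  - move=> i j e s' hi hj he w' f' x20 x21 x22 _.
    rewrite /= x22 eNC // (fra f') //; split=> //.
    by apply: (@smallC 1) => //; apply: leq_trans (leq_b1 _) _; exact: xpow_gt0.
  - by lia.
  - by move=> s' w' f' h' e he; rewrite h' he.
move=> s2 w2 f2 h2.
have F2 : frame witV witA s0 s2 by apply: frame_trans F1 (frame_all _ _ f2).
have env2 := envwit env0 F2.
have v572 : vr s2 57 = NR * NC by rewrite (frv f2).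
pose inc bu := [seq t | t <- iota 0 (NR * NC) & has (inb bu) (cands Us (t %/ NC) (t %% NC))].
pose pk := (hs_run inc (pNB lam) (pPS lam) al0).2.
have hal e : e < NR * NC -> al0 e -> forall bu, bu < pNB lam -> ~ iso Us (e %/ NC) (e %% NC) bu.
  by move=> he /eqP h0; have [h3 h4] := dm e he; case: (I1 _ _ h3 h4 h0).
have [A1 A2 A3 A4] := round_analysis Un hal.
rewrite -/inc -/pk in A1 A2 A3 A4.
apply: (hoare_then (Q1 := fun s' => vr s' vnp = size pk /\ forall t, t < size pk -> ar s' aPk 0 0 t = nth 0 pk t)).
  apply: (@hoare_hitset P C WP vNB _ _ _ (pNB lam) (NR * NC) (pPS lam) D (fun _ => NR * NC)
    (fun _ t => t) (fun bu t => has (inb bu) (cands Us (t %/ NC) (t %% NC))) al0) => //.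
  - by rewrite (env_NB env2).
  - by rewrite (env_ps env2).
  - by move=> k hk; apply: env_pw env2 _.
  - by move=> s' ey f' _; rewrite /= (frv f').
  - move=> s' ey et f' h3 h4; have [h5 h6] := dm _ h4; split=> //=.
    rewrite (fra f') // (frv f') ?(nb _ hvC) // (fra f2) // (frv f2) ?n22 // C1 I2 //.
  - apply: (@leq_ltn_trans (pw lam 152)); first exact: (@pw_mul _ 8 144).
    have : (pw lam 152).+1 <= pw lam 153 by apply: pw_S.
    by move=> h; apply: (pwC h).
  - by rewrite sum_nat_const card_ord.
move=> s3 w3 f3 [np3 pk3].
have F3 : frame witV witA s0 s3 by apply: frame_trans F2 (frame_all _ _ f3).
have f13 : frame (hsV ++ [:: 20; 21; 22]) (aAl :: hsA) s1 s3 by apply: frame_trans (frame_all _ _ f2) (frame_all _ _ f3).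
have U3 : ustate Us s3 by apply: ustate_frame U1 f13 _ _.
have psz : size pk <= pw lam 160.
  apply: (@leq_trans (pR0 lam)); first by lia.
  by apply: (pw_mono l0 (i := 40)) => //; exact: pw_pR0.
apply: (hoare_weaken (Q := ustate (shrunk pk Us)) (T := pw lam 180 * G)) => //.
  by apply: (hoare_shrink F3 U3 np3 psz pk3).
move=> s4 w4 f4 U4.
have W4 i j k : ar s4 aW i j k = ar s1 aW i j k by rewrite (fra f4) // (fra f13).
apply: (hQ s4 _ w4 U4 A4).
  by move=> i j hi hj y; rewrite W4; apply: sd1.
move=> i j hi hj; rewrite W4 => h0 y hy hfa hfb.
have [h1 _] := I1 i j hi hj h0.
have hne := hcv i j hi hj h1 y hy hfa hfb.
have he : i * NC + j < NR * NC.
  by apply: (@leq_trans (i.+1 * NC)); [rewrite mulSn addnC ltn_add2r | rewrite leq_mul2r hi orbT].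
have NC0 : 0 < NC by apply: leq_ltn_trans hj.
have ei : (i * NC + j) %/ NC = i by rewrite divnMDl // divn_small // addn0.
have ej : (i * NC + j) %% NC = j by rewrite modnMDl modn_small.
have := A1 (i * NC + j) he; rewrite /al0 ei ej h0 eqxx => /(_ isT hne)[bu hbu /hasP[x hx hxb]].
move: hx; rewrite mem_filter mem_iota add0n /= => /andP[/andP[hxa hxb'] hxs].
have : nth 0 Us x \in shrunk pk Us.
  apply/mapP; exists x => //; rewrite mem_filter mem_iota add0n hxs /= andbT.
  by apply/hasP; exists bu.
move=> hm; have hi' : index (nth 0 Us x) (shrunk pk Us) \in cands (shrunk pk Us) i j.
  by rewrite mem_filter mem_iota add0n index_mem hm nth_index // hxa hxb'.
by apply/eqP => e; rewrite e in hi'.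
Qed.

Lemma hoare_wit (Q : mstate -> Prop) :
  (forall s', wf s' -> frame witV witA s0 s' ->
     (forall i j y, i < NR -> j < NC -> ar s' aW 0 i j = y.+1 -> [/\ y < n, fA i y & fB y j]) ->
     (forall i j y, i < NR -> j < NC -> y < n -> fA i y -> fB y j -> ar s' aW 0 i j != 0) ->
     Q s') ->
  hoare (WIT vNR vNC EA EB) s0 (pw lam 380 * G) Q.
Proof.
move=> hQ; have G0' := G0; have [aC1 aC2] := areaC.
have n22 v : v \notin witV -> v \notin [:: 20; 21; 22].
  by apply: contra; rewrite /witV /bpV !inE; lia.
have nC : n <= C by apply: (@smallC 1) => //; rewrite /xpow expn1.
have lC : lam.+1 <= C by apply: (pwC (k := 2)) => //; apply: (pw_S l0 (pw_lam lam)).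
apply: (hoare_weaken (T := 8 * (NR.+1 * NC.+1) + (16 * n.+1 + (1 + (1 + (1 +
   (lam.+1 * (pw lam 370 * G).+1).+1)))))
  (Q := fun s' => frame witV witA s0 s' /\ exists Us, [/\ ustate Us s', size Us * 2 ^ lam.+1 <= n, sound s' & covers Us s'])); last 2 first.
- have c1 : cb lam G 0 1 by apply: cb_const.
  have cn : cb lam G 6 (16 * n.+1).
    apply: leq_trans (_ : 2 ^ 6 * G <= _); last by rewrite leq_mul2r (pw_const l0 (leqnn _)) orbT.
    by apply: leq_trans (leq_mul (leqnn _) hG); nia.
  apply: (@cb_mono lam l0 G 379) => //.
  apply: (cb_add l0 cb_area (cb_add l0 cn (cb_add l0 c1 (cb_add l0 c1 (cb_add l0 c1
    (cb_S l0 G0' (cb_mul (pw_S l0 (pw_lam lam)) (cb_S l0 G0' (leqnn _))))))))).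
- move=> s' w' _ [f' [Us [h1 h2 h3 h4]]]; apply: hQ => // [i j y hi hj|i j y hi hj hy hfa hfb]; first exact: h3.
  have U0 : Us = [::].
    apply: size0nil; case: (size Us) h2 => // m; rewrite mulSn => h.
    have : 2 ^ lam.+1 <= n by apply: leq_trans h; apply: leq_addr.
    by rewrite leqNgt; case/negP; apply: leq_trans hln _; rewrite leq_exp2l.
  by apply/eqP => h0; have := h4 i j hi hj h0 y hy hfa hfb; rewrite U0.
have R0' : vr s0 vNR = NR by []. have C0' : vr s0 vNC = NC by [].
apply: (hoare_then (Q1 := fun s' => forall i j, i < NR -> j < NC -> ar s' aW 0 i j = 0)).
  apply: (@hoare_fill P C WP (fun _ _ _ => 0)); rewrite ?(env_one env0) ?R0' ?C0' //.
  - exact: n22.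
  - exact: n22.
  - by rewrite mulnA.
  - by move=> s' w' f' h' i j hi hj; rewrite h' hi hj.
move=> s1 w1 f1 h1.
have F1 : frame witV witA s0 s1 by apply: frame_all f1.
have env1 := envwit env0 F1.
apply: (hoare_then (Q1 := fun s' => forall x, x < n -> ar s' aU 0 0 x = x)).
  apply: (@hoare_fill P C WP (fun _ _ x => x)) => //; rewrite (env_one env1) (env_n env1).
  - move=> i j x s' _ _ hx _ _ _ _ x22 _; rewrite /= x22; split=> //.
    by apply: leq_trans nC; apply: ltnW.
  - by lia.
  - by move=> s' w' f' h' x hx; rewrite h' hx.
move=> s2 w2 f2 h2.
have F2 : frame witV witA s0 s2 by apply: frame_trans F1 (frame_all _ _ f2).
apply: (hoare_then (Q1 := fun s' => vr s' 50 = n)).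
  by apply: hoare_asg => [_|s' _ ->]; rewrite /= (env_n (envwit env0 F2)).
move=> s3 w3 f3 v50.
have F3 : frame witV witA s0 s3 by apply: frame_trans F2 (frame_all _ _ f3).
apply: (hoare_then (Q1 := fun s' => vr s' 57 = NR * NC)).
  by apply: hoare_asg => [_|s' _ ->]; rewrite /= !(frv F3) // R0' C0'.
move=> s4 w4 f4 v57.
have F4 : frame witV witA s0 s4 by apply: frame_trans F3 (frame_all _ _ f4).
apply: (hoare_then (Q1 := fun s' => vr s' 56 = lam.+1)).
  by apply: hoare_asg => [_|s' _ ->]; rewrite /= (env_lam (envwit env0 F4)) addn1.
move=> s5 w5 f5 v56.
have F5 : frame witV witA s0 s5 by apply: frame_trans F4 (frame_all _ _ f5).
have v575 : vr s5 57 = NR * NC by rewrite (frv f5).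
rewrite -v56.
pose I m s' := frame witV witA s0 s' /\ exists Us, [/\ ustate Us s', size Us * 2 ^ m <= n, sound s' & covers Us s'].
have W5 i j : i < NR -> j < NC -> ar s5 aW 0 i j = 0.
  by move=> hi hj; rewrite (fra f5) // (fra f4) // (fra f3) // (fra f2) // h1.
apply: (hoare_for (I := I)); last by rewrite v56.
  split=> //; exists (iota 0 n); rewrite size_iota muln1; split=> //.
  - split; rewrite ?size_iota //; first by rewrite (frv f5) // (frv f4).
    by move=> x hx; rewrite nth_iota // (fra f5) // (fra f4) // (fra f3) // h2.
  - by move=> i j hi hj y; rewrite W5.
  - move=> i j hi hj _ y hy hfa hfb; apply/eqP => e.
    have : y \in cands (iota 0 n) i j by rewrite mem_filter mem_iota size_iota nth_iota // hfa hfb hy.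
    by rewrite e.
rewrite v56 => m s6 s7 hm w7 f56 [F6 [Us [U6 hsz sd6 cv6]]] f67 _ _.
have F7 : frame witV witA s0 s7 by apply: frame_trans F6 (frame1 _ _ f67).
have v577 : vr s7 57 = NR * NC by rewrite (frv f67) // (frv f56).
have W7 i j k : ar s7 aW i j k = ar s6 aW i j k by rewrite (fra f67).
apply: (hoare_weaken (T := pw lam 370 * G) (Q := fun s' => exists Us, [/\ ustate Us s',
   size Us * 2 ^ m.+1 <= n, sound s' & covers Us s'])) => //; last first.
  by move=> s' w' f' h'; split=> //; apply: frame_trans F7 (frame_all _ _ f').
apply: (hoare_round (Us := Us) F7 v577).
- by apply: ustate_frame U6 f67 _ _.
- by move=> i j hi hj y; rewrite W7; apply: sd6.
- by move=> i j hi hj; rewrite W7; apply: cv6.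
move=> s8 Us' w8 U8 hs' sd8 cv8; exists Us'; split=> //.
by rewrite expnS mulnA (mulnC _ 2); apply: leq_trans hsz; rewrite leq_mul2r hs' orbT.
Qed.

End Factors.

End Wit.

(** * Distances *)

Section Balls.

Variables (n : nat) (E : nat -> nat -> bool).

(* There is a walk of at most k edges. *)
Fixpoint dl (k u v : nat) : bool :=
  if k is k'.+1 then dl k' u v || has (fun y => dl k' u y && E y v) (iota 0 n)
  else u == v.

Lemma dl_mono k l u v : k <= l -> dl k u v -> dl l u v.
Proof.
move=> /subnK <-; elim: (l - k) => [|m IH] //= h; by rewrite IH.
Qed.

Lemma dl_step k u v y : y < n -> dl k u y -> E y v -> dl k.+1 u v.
Proof.
move=> hy h1 h2 /=; apply/orP; right; apply/hasP; exists y; last by rewrite h1.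
by rewrite mem_iota.
Qed.

Lemma dl_cat a b u v y : dl a u y -> dl b y v -> dl (a + b) u v.
Proof.
elim: b v => [|b IH] v h /=; first by move=> /eqP <-; rewrite addn0.
case/orP=> [h2|/hasP[z]]; first by rewrite addnS /= IH.
rewrite mem_iota => /= hz /andP[h2 h3]; rewrite addnS; exact: dl_step hz (IH z h h2) h3.
Qed.

Lemma dl_split a b u v : u < n -> v < n -> dl (a + b) u v ->
  exists y, [/\ y < n, dl a u y & dl b y v].
Proof.
move=> hu; elim: b v => [|b IH] v hv; first by rewrite addn0 => h; exists v; rewrite /= eqxx.
rewrite addnS /= => /orP[/(IH _ hv)[y [h1 h2 h3]]|/hasP[z]].
  by exists y; rewrite h3.
rewrite mem_iota => /= hz /andP[/(IH _ hz)[y [h1 h2 h3]] h4]; exists y; split=> //.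
by apply/orP; right; apply/hasP; exists z; rewrite ?mem_iota ?h3.
Qed.

End Balls.

(** The properties of bounded reachability which are used. They are symmetric under reversal, so
    distances to the sources come from the same statements as distances from them. *)
Definition balls (n : nat) (B : nat -> nat -> nat -> bool) : Prop :=
  [/\ forall u v, B 0 u v = (u == v),
      forall k l u v, k <= l -> B k u v -> B l u v,
      forall a b u v y, B a u y -> B b y v -> B (a + b) u v &
      forall a b u v, u < n -> v < n -> B (a + b) u v ->
        exists y, [/\ y < n, B a u y & B b y v]].

Lemma balls_dl n E : balls n (dl n E).
Proof.
split=> //; [exact: dl_mono | exact: dl_cat | exact: dl_split].
Qed.

Lemma balls_rev n B : balls n B -> balls n (fun k u v => B k v u).
Proof.
case=> h1 h2 h3 h4; split=> [u v|k l u v|a b u v y h h'|a b u v hu hv].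
- by rewrite h1 eq_sym.
- exact: h2.
- by rewrite addnC; apply: h3 h' h.
- by rewrite addnC => /(h4 _ _ _ _ hv hu)[y [? ? ?]]; exists y.
Qed.

Section Distance.

Variables (n : nat) (B : nat -> nat -> nat -> bool).
Hypothesis hB : balls n B.

(* The distance from u to v is d. *)
Definition isd (d u v : nat) : bool := B d u v && ((d == 0) || ~~ B d.-1 u v).

Lemma isd_B d k u v : isd d u v -> B k u v = (d <= k).
Proof.
have [h1 h2 _ _] := hB; case/andP=> h3 h4; apply/idP/idP => [h|h]; last exact: h2 h h3.
case: d h3 h4 => [|d] h3 //= h4; rewrite ltnNge; apply: contra h4 => hk.
exact: h2 hk h.
Qed.

Lemma isd_inj d d' u v : isd d u v -> isd d' u v -> d = d'.
Proof.
move=> h h'; have /andP[h1 _] := h; have /andP[h2 _] := h'.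
by apply/eqP; rewrite eqn_leq -(isd_B _ h) h2 -(isd_B _ h') h1.
Qed.

Lemma isd_ex k u v : B k u v -> exists2 d, d <= k & isd d u v.
Proof.
elim: k => [|k IH] h; first by exists 0; rewrite /isd ?h.
case h': (B k u v); first by have [d h1 h2] := IH h'; exists d => //; apply: leqW.
by exists k.+1; rewrite /isd ?h /= ?h'.
Qed.

(** Both parts of a shortest path are shortest, since a shorter part would shorten the whole. *)
Lemma isd_split a b u v : u < n -> v < n -> isd (a + b) u v ->
  exists y, [/\ y < n, isd a u y & isd b y v].
Proof.
move=> hu hv h; have [_ _ h3 h4] := hB; have /andP[h5 _] := h.
have [y [hy h6 h7]] := h4 _ _ _ _ hu hv h5; exists y; split=> //.
  have [d hd hdy] := isd_ex h6; have /andP[h8 _] := hdy.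
  have := h3 _ _ _ _ _ h8 h7; rewrite (isd_B _ h) => hh.
  by have <- : d = a by lia.
have [d hd hdy] := isd_ex h7; have /andP[h8 _] := hdy.
have := h3 _ _ _ _ _ h6 h8; rewrite (isd_B _ h) => hh.
by have <- : d = b by lia.
Qed.

Lemma isd_triangle a b c u y v : isd a u y -> isd b y v -> isd c u v -> c <= a + b.
Proof.
move=> /andP[h1 _] /andP[h2 _] h; rewrite -(isd_B _ h).
by have [_ _ h3 _] := hB; apply: h3 h1 h2.
Qed.

Lemma isd_refl u : isd 0 u u.
Proof. by have [h1 _ _ _] := hB; rewrite /isd h1 eqxx. Qed.

(** A shortest path has a vertex at each distance [0, ..., d] from [u], and these vertices are
    distinct. *)
Lemma isd_lt d u v : u < n -> v < n -> isd d u v -> d < n.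
Proof.
move=> hu hv h; pose f a := find (isd a u) (iota 0 n).
have hf a : a <= d -> f a < n /\ isd a u (f a).
  move=> ha; have [|y [hy h1 _]] := @isd_split a (d - a) u v hu hv; first by rewrite subnKC.
  have hh : has (isd a u) (iota 0 n) by apply/hasP; exists y; rewrite ?mem_iota.
  have hlt : f a < n by move: hh; rewrite has_find size_iota.
  by split=> //; have := nth_find 0 hh; rewrite nth_iota.
rewrite -[n](size_iota 0) -[d.+1](size_iota 0) -(size_map f); apply: uniq_leq_size.
  rewrite map_inj_in_uniq ?iota_uniq // => a b; rewrite !mem_iota !add0n !ltnS.
  move=> /andP[_ /hf[_ ha]] /andP[_ /hf[_ hb']] e; rewrite e in ha; exact: isd_inj ha hb'.
move=> x /mapP[a]; rewrite mem_iota add0n ltnS => /andP[_ /hf[h1 _]] ->.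
by rewrite mem_iota.
Qed.

(* 0 when the distance exceeds c, and 1 + the distance otherwise. *)
Definition encd (c u v : nat) : nat :=
  if B c u v then (find (fun k => B k u v) (iota 0 c.+1)).+1 else 0.

Lemma encdP c u v d : (encd c u v == d.+1) = (d <= c) && isd d u v.
Proof.
rewrite /encd; case h: (B c u v); last first.
  apply/esym/negbTE/negP => /andP[h1 h2]; by rewrite (isd_B _ h2) h1 in h.
have [d0 h1 h2] := isd_ex h.
have -> : find (fun k => B k u v) (iota 0 c.+1) = d0.
  have hh : has (fun k => B k u v) (iota 0 c.+1).
    by apply/hasP; exists c; rewrite ?mem_iota ?add0n ?leqnn.
  set f := find _ _; have hf : f < c.+1 by move: hh; rewrite has_find size_iota.
  have hBf : B f u v by have := nth_find 0 hh; rewrite nth_iota.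
  apply/eqP; rewrite eqn_leq -(isd_B _ h2) hBf andbT leqNgt; apply/negP => hlt.
  by have := before_find 0 hlt; rewrite nth_iota ?ltnS // add0n (isd_B _ h2) leqnn.
rewrite eqSS; apply/eqP/andP => [<-|[_ h3]] //; exact: isd_inj h2 h3.
Qed.

Lemma encd0 c u v : (encd c u v == 0) = ~~ B c u v.
Proof. by rewrite /encd; case: (B c u v). Qed.

(** The update which [DIST] performs: a cell that is still 0 receives 1 + the radius when the ball
    first contains the vertex. *)
Lemma encdS c u v :
  encd c.+1 u v = encd c u v + (encd c u v == 0) * B c.+1 u v * c.+2.
Proof.
have [_ h2 _ _] := hB; case h: (encd c u v) => [|d] /=; last first.
  move/eqP: h; rewrite encdP => /andP[h3 h4]; apply/eqP.
  by rewrite !mul0n addn0 encdP (leqW h3).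
move/eqP: h; rewrite encd0 => h3; case h4: (B c.+1 u v); last first.
  by apply/eqP; rewrite encd0 h4.
by apply/eqP; rewrite !mul1n add0n encdP leqnn /isd h4.
Qed.

Lemma encd_leq c u v : encd c u v <= c.+1.
Proof.
case h: (encd c u v) => [|d] //; move/eqP: h; rewrite encdP => /andP[h _].
by rewrite ltnS.
Qed.

Lemma encd_B c d u v : d <= c -> (0 < encd c u v) && (encd c u v < d.+2) = B d u v.
Proof.
move=> hd; case h: (encd c u v) => [|d0] /=.
  move/eqP: h; rewrite encd0; have [_ h2 _ _] := hB.
  by move=> h; apply/esym/negbTE; apply: contra h; apply: h2.
by move/eqP: h; rewrite encdP !ltnS => /andP[_ h]; rewrite (isd_B _ h).
Qed.

End Distance.

Lemma isd_rev B d u v : isd (fun k u v => B k v u) d u v = isd B d v u.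
Proof. by []. Qed.

(** * Bounded distances from the sources *)

Notation aR := 13.
Notation aS := 14.

Section Dist.

(** Repeated squaring of the relation of being joined by at most [2 ^ j] edges. All levels are kept,
    since the doubling number [j] of [DIST] uses level [j]. On level 0 a loop gives the entry 2, so
    the entries are only compared with 0. *)
Definition REACH : cmd :=
  Fill aR vone vn vn ((EVar 21 =^ EVar 22) +^ E1 aIO (EVar 21 *^ EVar vn +^ EVar 22)) ;;
  Asg 46 (EVar vlam +^ ENum 1) ;;
  For 47 vlam (
    BigBP vn vn (fun er ey => EArr aR (EVar 47) er ey) (fun ey er => EArr aR (EVar 47) ey er) ;;
    Fill aR 46 vn vn
      ((EVar 20 =^ EVar 47 +^ ENum 1) *^ EArr aBig (ENum 0) (EVar 21) (EVar 22) +^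
       ((EVar 20 =^ EVar 47 +^ ENum 1) =^ ENum 0) *^ EArr aR (EVar 20) (EVar 21) (EVar 22))).

(* The variable 40 holds the number of sources, and 42 the number m of doublings.
   A distance 2 ^ j + d with d < 2 ^ j splits into d, which is known, and 2 ^ j. *)
Definition DIST (aD : nat) (ER : expr -> expr -> expr -> expr) : cmd :=
  Fill aD vone 40 vn (E1 aS (EVar 21) =^ EVar 22) ;;
  For 41 42 (
    Asg 43 (E1 aPw (EVar 41)) ;;
    Asg 44 (EVar 40 *^ EVar 43) ;;
    BigBP 44 vn
      (fun er ey => (ENum 0 <^ EArr aD (ENum 0) (er /^ EVar 43) ey) *^
         (EArr aD (ENum 0) (er /^ EVar 43) ey <^ er %^ EVar 43 +^ ENum 2))
      (fun ey er => ER (EVar 41) ey er) ;;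
    For 45 43 (
      Fill aD vone 40 vn
        (EArr aD (ENum 0) (EVar 21) (EVar 22) +^
         (EArr aD (ENum 0) (EVar 21) (EVar 22) =^ ENum 0) *^
         EArr aBig (ENum 0) (EVar 21 *^ EVar 43 +^ EVar 45) (EVar 22) *^
         (EVar 43 +^ EVar 45 +^ ENum 1)))).

Definition dV := bpV ++ [:: 41; 43; 44; 45].

Variables (P : program) (n C WP G : nat) (allowed : nat -> nat -> Prop).
Hypotheses (n0 : 0 < n) (hG : n * n <= G) (KC : nat)
  (hKC : 2000 <= KC) (hC : n.+1 ^ KC <= C) (hO : oracle P n WP G allowed)
  (hn1 : allowed n 1).
Variable (lam : nat).
Hypotheses (l0 : 0 < lam) (ln : lam <= n) (hln : n < 2 ^ lam) (hnl : 2 ^ lam <= n * 2).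

Let env := env n lam.
Notation hoare := (hoare P C WP).
Notation wf := (wf C).
Let smallC := @smallC n C KC hKC hC.
Let pwC := @pwC n C n0 KC hKC hC lam ln.
Let bp := @hoare_bp P n C WP G allowed n0 hG KC hKC hC hO hn1 lam l0 ln.
Let G0 := @G0 n G n0 hG.

Lemma leq_nC : n <= C. Proof. by apply: (@smallC 1) => //; rewrite /xpow expn1. Qed.

Lemma leq_lamC : lam.+1 <= C.
Proof. exact: (pwC (k := 2) (pw_S l0 (pw_lam lam))). Qed.

Lemma boolC (b : bool) : b <= C.
Proof. by apply: (@smallC 1) => //; apply: leq_trans (leq_b1 _) _; exact: xpow_gt0. Qed.

Lemma cb_nn k : k <= 32 -> cb lam G 5 (k * (n * n)).
Proof.
move=> h; apply: leq_trans (leq_mul h hG) _.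
by rewrite leq_mul2r (pw_const l0 (leqnn (2 ^ 5))) orbT.
Qed.

Lemma pw12 c : c < 2 ^ 12 -> c < pw lam 12.
Proof. exact: (pw_const l0 (c := c.+1) (k := 12)). Qed.

Lemma hoare_reach (E : nat -> nat -> bool) s (Q : mstate -> Prop) :
  env s -> (forall u v, u < n -> v < n -> ar s aIO 0 0 (u * n + v) = E u v) ->
  (forall s', wf s' -> frame (mv REACH) [:: aA; aB; aC; aBig; aR] s s' ->
     (forall j u v, j <= lam -> u < n -> v < n ->
        (ar s' aR j u v != 0) = dl n E (2 ^ j) u v) -> Q s') ->
  hoare REACH s (pw lam 70 * G) Q.
Proof.
move=> envs hE hQ; have nC' := leq_nC; have G0' := G0.
have [bs1 bs2 bs3 bs4] := balls_dl n E.
have nn : n.+1 * n.+1 <= 4 * (n * n) by nia.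
have hn2 : n < 2 * n by lia.
have p2 : 2 < pw lam 12 by apply: pw12.
apply: (hoare_weaken (T := 32 * (n * n) + (1 + (lam * (pw lam 60 * G + (lam.+2 * (16 * (n * n)))).+1).+1))
  (Q := fun s' => forall j u v, j <= lam -> u < n -> v < n ->
        (ar s' aR j u v != 0) = dl n E (2 ^ j) u v)); last 2 first.
- apply: (@cb_mono lam l0 G 66) => //.
  apply: (cb_add l0 (cb_nn _) (cb_add l0 (cb_const l0 G0' (k := 0) _) (cb_S l0 G0' (cb_mul (pw_lam lam)
    (cb_S l0 G0' (cb_add l0 (leqnn _ : cb lam G 60 _) (cb_mul (pw_S l0 (pw_S l0 (pw_lam lam))) (cb_nn _)))))))) => //.
- by move=> s' w' f' h'; apply: hQ => //; apply: frame_all f'.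
apply: (hoare_then (Q1 := fun s' => forall u v, u < n -> v < n ->
        (ar s' aR 0 u v != 0) = dl n E 1 u v)).
  apply: (@hoare_fill P C WP (fun _ u v => (u == v) + E u v)) => //; rewrite (env_one envs) (env_n envs).
  - move=> i u v s' hi hu hv w' f' x20 x21 x22 _.
    rewrite /= x21 x22 (frv f') // (env_n envs) (fra f') // hE //; split=> //.
    by apply: (@smallC 2) => //; rewrite /xpow expnS expn1; case: eqP; case: (E u v); nia.
  - nia.
  - move=> s' w' f' h' u v hu hv; rewrite h' hu hv /= addn_eq0 !eqb0.
    rewrite negb_and !negbK; congr (_ || _); apply/idP/hasP => [h|[y _ /andP[/eqP <-]]] //.
    by exists u; rewrite ?mem_iota ?eqxx.
move=> s1 w1 f1 h1; have env1 := env_frame envs f1 isT isT.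
apply: (hoare_then (Q1 := fun s' => vr s' 46 = lam.+1)).
  apply: hoare_asg => [_|s' _ ->]; rewrite /= (env_lam env1) addn1 //; exact: leq_lamC.
move=> s2 w2 f2 v46; have env2 := env_frame env1 f2 isT isT.
rewrite -{1}(env_lam env2).
apply: (hoare_for (I := fun m s' => forall j u v, j <= m -> u < n -> v < n ->
        (ar s' aR j u v != 0) = dl n E (2 ^ j) u v)).
- move=> j u v; rewrite leqn0 => /eqP-> hu hv; rewrite (fra f2) //; exact: h1.
- rewrite (env_lam env2) => m s3 s4 hm w4 f23 h3 f34 _ v47.
  have env4 := env_frame (env_frame env2 f23 isT isT) f34 isT isT.
  have v464 : vr s4 46 = lam.+1 by rewrite (frv f34) // (frv f23).
  have n4 := env_n env4.
  have h4 j u v : j <= m -> u < n -> v < n -> (ar s4 aR j u v != 0) = dl n E (2 ^ j) u v.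
    by move=> *; rewrite (fra f34) // h3.
  pose fA u v := ar s4 aR m u v != 0.
  apply: (hoare_then (Q1 := fun s' => forall u v, u < n -> v < n -> ar s' aBig 0 u v = dl n E (2 ^ m.+1) u v)).
    apply: (bp (fA := fA) (fB := fA) _ _ env4 n4 n4 hn2 hn2 p2 p2) => //.
    + by move=> s' er ey f; rewrite /= (frv f) // v47 (fra f).
    + by move=> s' er ey f; rewrite /= (frv f) // v47 (fra f).
    + move=> s' _ f h u v hu hv; rewrite h //; congr nat_of_bool; rewrite expnS mul2n -addnn.
      apply/bprodP/idP => [[y [hy]]|]; first by rewrite /fA !h4 //; apply: bs3.
      by move/(bs4 _ _ _ _ hu hv) => [y [hy y1 y2]]; exists y; rewrite /fA !h4.
  move=> s5 w5 f5 h5; have env5 := env_frame env4 f5 isT isT.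
  have v465 : vr s5 46 = lam.+1 by rewrite (frv f5).
  have v475 : vr s5 47 = m by rewrite (frv f5).
  apply: (@hoare_fill P C WP (fun j u v => if j == m.+1 then nat_of_bool (dl n E (2 ^ m.+1) u v) else ar s4 aR j u v)) => //;
    rewrite v465 (env_n env5).
  + move=> j u v s' hj hu hv w' f' x20 x21 x22 ho.
    rewrite /= x20 x21 x22 ho (frv f') // v475 (fra f') // h5 // addn1 (fra f5) //.
    case: (j == m.+1); rewrite ?mul1n ?mul0n ?addn0 ?add0n; split=> //; first exact: boolC.
    by case: w4.
  + by move: (n.+1) nn => z; nia.
  + move=> s' w' f' h' j u v hj hu hv; rewrite h' hu hv ltnS /=.
    rewrite (_ : j <= lam); last by apply: leq_trans hm.
    have [->|ne] := eqVneq j m.+1; first by rewrite eqb0 negbK.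
    by rewrite h4 // -ltnS ltn_neqAle ne hj.
- by rewrite (env_lam env2).
Qed.

(** Row [x * 2 ^ j + d] of the product stands for the ball of radius [d] around source [x], so one
    product yields the balls of all radii [2 ^ j + d] with [d < 2 ^ j]. Reading them off in
    increasing order of [d] gives exact distances. The bound on [k * 2 ^ m] keeps the number of
    batches polylogarithmic. *)
Lemma hoare_dist aD ER B (Rr : nat -> nat -> nat -> nat) (S : nat -> nat) k m a s
    (Q : mstate -> Prop) :
  aD \notin aPw :: aR :: aS :: bpA -> balls n B -> env s -> vr s 40 = k -> vr s 42 = m ->
  m <= lam.+1 ->
  (forall x, x < k -> ar s aS 0 0 x = S x /\ S x < n) ->
  (forall s' ej ey er, frame dV (aD :: bpA) s s' ->
     ev (ER ej ey er) s' = Rr (ev ej s') (ev ey s') (ev er s')) ->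
  (forall j y v, j < m -> y < n -> v < n -> (Rr j y v != 0) = B (2 ^ j) y v) ->
  k * 2 ^ m < a * n -> a + 5 < pw lam 12 ->
  (forall s', wf s' -> frame dV (aD :: bpA) s s' ->
     (forall x v, x < k -> v < n -> ar s' aD 0 x v = encd B (2 ^ m).-1 (S x) v) -> Q s') ->
  hoare (DIST aD ER) s (pw lam 80 * G) Q.
Proof.
rewrite !inE !negb_or => /and4P[na7 na13 na14 /and4P[na1 na2 na3 na4]].
move=> hB envs v40 v42 hm hS hER hRr hkm ha hQ; have nC' := leq_nC; have G0' := G0.
have [bs1 bs2 bs3 bs4] := hB.
have hn2 : n < 2 * n by lia.
have p2 : 2 < pw lam 12 by apply: pw12.
have m2 : 2 ^ m <= 4 * n.
  by apply: (@leq_trans (2 ^ lam.+1)); [rewrite leq_exp2l | rewrite expnS; lia].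
have kan : k < a * n by apply: leq_ltn_trans hkm; rewrite leq_pmulr // expn_gt0.
have a12 : a < pw lam 12 by apply: leq_ltn_trans ha; rewrite leq_addr.
have cK := @cb_area n G hG lam l0 _ _ _ _ kan hn2 a12 p2.
set X := 8 * (k.+1 * n.+1) in cK.
(* The area bound concerns [k.+1 * p] rows; the additional [p <= 4 * n] explains [a + 5] in place of
   [a]. *)
have cI p : p <= 2 ^ m -> cb lam G 29 ((p * X.+1).+1).
  move=> hp; have h1 : k.+1 * p < (a + 5) * n.
    rewrite mulSn mulnDl addnC; have : k * p <= k * 2 ^ m by rewrite leq_mul2l hp orbT.
    lia.
  have h2 := @cb_area n G hG lam l0 _ _ _ _ h1 hn2 ha p2.
  apply: (@cb_mono lam l0 G 28) => //; apply: (cb_S l0 G0'); apply: cb_leq h2.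
  rewrite mulnS /X; have -> : p * (8 * (k.+1 * n.+1)) = 8 * (k.+1 * p * n.+1).
    by rewrite mulnCA -mulnA (mulnCA k.+1 p).
  by rewrite (mulSn (k.+1 * p)) mulnDr leq_add2r; lia.
apply: (hoare_weaken (T := X + (m * (pw lam 70 * G).+1).+1)
  (Q := fun s' => forall x v, x < k -> v < n -> ar s' aD 0 x v = encd B (2 ^ m).-1 (S x) v)); last 2 first.
- apply: (@cb_mono lam l0 G 75) => //.
  apply: (cb_add l0 cK (cb_S l0 G0' (cb_mul (_ : m <= pw lam 2) (cb_S l0 G0' (leqnn _ : cb lam G 70 _))))).
  exact: leq_trans hm (pw_S l0 (pw_lam lam)).
- move=> s' w' f' h'; apply: hQ => //; apply: frame_all f'; rewrite //= !inE eqxx !orbT //.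
have dS vs bs s' : frame vs bs s s' -> aS \notin bs -> forall x, x < k -> ar s' aS 0 0 x = S x.
  by move=> f hb x hx; rewrite (fra f) //; case: (hS x hx).
apply: (hoare_then (Q1 := fun s' => forall x v, x < k -> v < n -> ar s' aD 0 x v = encd B 0 (S x) v)).
  apply: (@hoare_fill P C WP (fun _ x v => encd B 0 (S x) v)) => //; rewrite (env_one envs) v40 (env_n envs).
  - move=> i x v s' hi hx hv w' f' x20 x21 x22 _.
    have aSD : aS \notin [:: aD] by rewrite inE eq_sym.
    have hSx := dS _ _ s' f' aSD x hx; rewrite /= x21 x22 hSx.
    have -> : encd B 0 (S x) v = (S x == v) by rewrite /encd /= bs1; case: eqP.
    by split=> //; exact: boolC.
  - by rewrite /X mulnA.
  - by move=> s' w' f' h' x v hx hv; rewrite h' hx hv.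
move=> s1 w1 f1 h1.
have F1 : frame dV (aD :: bpA) s s1 by apply: (frame_all _ _ f1); rewrite //= inE eqxx.
have fD s1' s2' : frame bpV bpA s1' s2' -> frame dV (aD :: bpA) s1' s2'.
  by apply: frame_sub => z hz; [rewrite mem_cat hz | rewrite in_cons hz orbT].
have aDn : aPw \notin aD :: bpA by rewrite inE negb_or eq_sym na7.
have env1 := env_frame envs F1 isT aDn.
have v421 : vr s1 42 = m by rewrite (frv F1).
rewrite -{1}v421.
apply: (hoare_for (I := fun j s' => frame dV (aD :: bpA) s s' /\ forall x v, x < k -> v < n -> ar s' aD 0 x v = encd B (2 ^ j).-1 (S x) v)) => //; last first.
  by rewrite v421 => s' _ _ [].
rewrite v421 => j s2 s3 hj w3 _ [F2 h2] f23 _ v41.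
have F3 : frame dV (aD :: bpA) s s3 by apply: frame_trans F2 (frame1 _ _ f23).
have env3 := env_frame envs F3 isT aDn.
have h3 x v : x < k -> v < n -> ar s3 aD 0 x v = encd B (2 ^ j).-1 (S x) v.
  by move=> *; rewrite (fra f23) // h2.
have p0 : 0 < 2 ^ j by rewrite expn_gt0.
have pm2 : 2 ^ j <= 2 ^ m by rewrite leq_exp2l // ltnW.
have kp : k * 2 ^ j < a * n by apply: leq_ltn_trans hkm; rewrite leq_mul2l pm2 orbT.
have pC : 4 * n <= C by apply: (@smallC 3) => //; rewrite /xpow !expnS expn0; nia.
apply: (hoare_weaken (T := 1 + (1 + (pw lam 60 * G + (2 ^ j * X.+1).+1)))
  (Q := fun s' => frame dV (aD :: bpA) s s' /\ forall x v, x < k -> v < n -> ar s' aD 0 x v = encd B (2 ^ j.+1).-1 (S x) v)) => //; last first.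
  apply: (@cb_mono lam l0 G 63) => //.
  apply: (cb_add l0 (cb_const l0 G0' (k := 0) _) (cb_add l0 (cb_const l0 G0' (k := 0) _)
     (cb_add l0 (leqnn _ : cb lam G 60 _) (cI _ pm2)))) => //.
apply: (hoare_then (Q1 := fun s' => vr s' 43 = 2 ^ j)).
  have hjP : j < pPS lam by rewrite /pPS; lia.
  apply: hoare_asg => [_|s' _ ->]; rewrite /E1 /= v41 (env_pw env3) //.
  by apply: leq_trans pC; apply: leq_trans m2.
move=> s4 w4 f4 v43.
have F4 : frame dV (aD :: bpA) s s4 by apply: frame_trans F3 (frame_all _ _ f4).
have v404 : vr s4 40 = k by rewrite (frv F4).
apply: (hoare_then (Q1 := fun s' => vr s' 44 = k * 2 ^ j)).
  apply: hoare_asg => [_|s' _ ->]; rewrite /= v404 v43 //.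
  by have [h _] := areaC n0 hKC hC ln kp hn2 a12 p2; apply: leq_trans h; apply: leq_pmulr.
move=> s5 w5 f5 v44.
have F5 : frame dV (aD :: bpA) s s5 by apply: frame_trans F4 (frame_all _ _ f5).
have env5 := env_frame envs F5 isT aDn.
have v435 : vr s5 43 = 2 ^ j by rewrite (frv f5).
have v415 : vr s5 41 = j by rewrite (frv f5) // (frv f4).
have h5 x v : ar s5 aD 0 x v = ar s3 aD 0 x v by rewrite (fra f5) // (fra f4).
pose fA i y := (0 < ar s5 aD 0 (i %/ 2 ^ j) y) && (ar s5 aD 0 (i %/ 2 ^ j) y < i %% 2 ^ j + 2).
pose fB y v := Rr j y v != 0.
apply: (hoare_then (Q1 := fun s' => forall x d v, x < k -> d < 2 ^ j -> v < n ->
   ar s' aBig 0 (x * 2 ^ j + d) v = B (d + 2 ^ j) (S x) v)).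
  apply: (bp (fA := fA) (fB := fB) (NR := k * 2 ^ j) (NC := n) (a := a) (b := 2)) => //.
  - exact: env_n env5.
  - move=> s' er ey f; rewrite /= (frv f) // (fra f); last by rewrite !inE !negb_or na1 na2 na3 na4.
    by rewrite v435 muln_eq0 negb_or !eqb0 !negbK.
  - move=> s' ey er f.
    rewrite hER; last by apply: frame_trans F5 (fD _ _ f).
    by rewrite /= (frv f) // v415.
  - move=> s' _ f h x d v hx hd hv.
    have hSx : S x < n by case: (hS x hx).
    have hlt : x * 2 ^ j + d < k * 2 ^ j.
      by apply: (@leq_trans (x.+1 * 2 ^ j)); [rewrite mulSn addnC ltn_add2r | rewrite leq_mul2r hx orbT].
    rewrite h //; congr nat_of_bool.
    have eA y : y < n -> fA (x * 2 ^ j + d) y = B d (S x) y.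
      move=> hy; rewrite /fA divnMDl // modnMDl divn_small // modn_small // addn0 h5 h3 // addn2.
      by apply: (encd_B hB); rewrite -ltnS prednK.
    apply/bprodP/idP => [[y [hy]]|/(bs4 _ _ _ _ hSx hv)[y [hy b1 b2]]].
      by rewrite eA // /fB hRr //; apply: bs3.
    by exists y; rewrite eA // /fB hRr.
move=> s6 w6 f6 h6.
have F6 : frame dV (aD :: bpA) s s6.
  have f6' : frame bpV bpA s5 s6 by apply: (frame_all _ _ f6).
  exact: frame_trans F5 (fD _ _ f6').
have v436 : vr s6 43 = 2 ^ j by rewrite (frv f6).
have a6 x v : ar s6 aD 0 x v = ar s3 aD 0 x v.
  by rewrite (fra f6) ?h5 // !inE !negb_or na1 na2 na3 na4.
rewrite -{1}v436.
pose c := (2 ^ j).-1.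
apply: (hoare_for (I := fun d s' => frame [:: 20; 21; 22; 45] [:: aD] s6 s' /\
  forall x v, x < k -> v < n -> ar s' aD 0 x v = encd B (c + d) (S x) v)).
- by split=> // x v hx hv; rewrite a6 h3 // addn0.
- rewrite v436 => d s7 s8 hd w8 _ [f67 h7] f78 _ v45.
  have f68 : frame [:: 20; 21; 22; 45] [:: aD] s6 s8 by apply: frame_trans f67 (frame1 _ _ f78).
  have F8 : frame dV (aD :: bpA) s s8.
    apply: frame_trans F6 (frame_all _ _ f68) => //=; by rewrite inE eqxx.
  have env8 := env_frame envs F8 isT aDn.
  have v408 : vr s8 40 = k by rewrite (frv F8).
  apply: (@hoare_fill P C WP (fun _ x v => encd B (c + d.+1) (S x) v)) => //;
    rewrite (env_one env8) v408 (env_n env8).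
  + move=> i x v s' hi hx hv w' f' x20 x21 x22 ho; have i0 : i = 0 by lia.
    rewrite i0 in x20 ho.
    have aBigD : aBig \notin [:: aD] by rewrite inE eq_sym.
    have hBg : ar s' aBig 0 (x * 2 ^ j + d) v = B (d + 2 ^ j) (S x) v.
      by rewrite (fra f') // (fra f68) // h6.
    have own : ar s' aD 0 x v = encd B (c + d) (S x) v by rewrite ho (fra f78) // h7.
    rewrite /= x21 x22 own (frv f') // (frv f68) // v436 (frv f') // v45 hBg.
    have e1 : (c + d).+1 = d + 2 ^ j by rewrite /c addnC -addnS prednK.
    rewrite [c + d.+1]addnS -e1 (_ : 2 ^ j + d + 1 = (c + d).+2); last by rewrite e1; lia.
    split; first by rewrite (encdS hB).
    apply: leq_trans (encd_leq hB _ _ _) _.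
    have h2m : 2 * 2 ^ j <= 2 ^ m by rewrite -expnS leq_exp2l.
    by apply: leq_trans pC; apply: leq_trans m2; rewrite /c; move: h2m hd p0; clear; lia.
  + by rewrite /X mulnA.
  + move=> s' w' f' h'; split.
      by apply: frame_trans f68 (frame_all _ _ f') => //=; rewrite inE eqxx.
    by move=> x v hx hv; rewrite h' hx hv.
- rewrite v436 => s' _ _ [f' h']; split.
    by apply: frame_trans F6 (frame_all _ _ f') => //=; rewrite inE eqxx.
  move=> x v hx hv; rewrite h' //; congr encd; rewrite /c expnS; lia.
Qed.

End Dist.

(** * The next set of sources *)

Notation aDf := 15.
Notation aDb := 16.
Notation aDeg := 17.
Notation aList := 18.

Section Next.

(* The variable 40 holds the number of sources, and 48 the scale r. For each pair
   of sources at distance D with r <= D < 2 * r, one vertex at each distance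
   1, ..., r from the first on a shortest path to the second; the sets of these
   vertices are hit. *)
Definition NEXT : cmd :=
  Asg 62 (EVar 40 *^ EVar 48) ;;
  Asg 63 (EVar 48 +^ EVar 48) ;;
  Asg 64 (EVar 40 *^ EVar 63) ;;
  WIT 62 64
    (fun er ey => EArr aDf (ENum 0) (er /^ EVar 48) ey =^ er %^ EVar 48 +^ ENum 2)
    (fun ey er => EArr aDb (ENum 0) (er /^ EVar 63) ey =^ er %^ EVar 63 +^ ENum 1) ;;
  Fill aDeg vone vone vn (ENum 0) ;;
  Asg 71 (EVar 40 *^ EVar 40) ;;
  For 66 71 (
    Asg 68 (EArr aDf (ENum 0) (EVar 66 /^ EVar 40) (E1 aS (EVar 66 %^ EVar 40))) ;;
    Ife ((EVar 48 <^ EVar 68) *^ (EVar 68 <^ EVar 63 +^ ENum 1))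
      (For 69 48 (
        Asg 70 (EArr aW (ENum 0) (EVar 66 /^ EVar 40 *^ EVar 48 +^ EVar 69)
          (EVar 66 %^ EVar 40 *^ EVar 63 +^ (EVar 68 -^ ENum 2 -^ EVar 69)) -^ ENum 1) ;;
        Sto aList (ENum 0) (EVar 70) (E1 aDeg (EVar 70)) (EVar 66) ;;
        Sto aDeg (ENum 0) (ENum 0) (EVar 70) (E1 aDeg (EVar 70) +^ ENum 1)))
      Nop) ;;
  Fill aAl vone vone 71 (ENum 1) ;;
  HITSET vn (fun ey => E1 aDeg ey) (fun ey et => EArr aList (ENum 0) ey et) (fun _ _ => ENum 1) ;;
  Fill aS vone vone vnp (E1 aPk (EVar 22)) ;;
  Asg 40 (EVar vnp).

Definition nxV := witV ++ [:: 62; 63; 64; 66; 68; 69; 70; 71].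
Definition nxA := witA ++ [:: aDeg; aList].

Section Members.

Variables (n r : nat) (val : nat -> bool) (Y : nat -> nat -> nat).
Hypotheses (Yn : forall e d, val e -> d < r -> Y e d < n)
  (Yinj : forall e d d', val e -> d < r -> d' < r -> Y e d = Y e d' -> d = d').

(* The vertex y occurs among the first m vertices Y e 0, Y e 1, ... of the set e. *)
Definition occ (m e y : nat) : bool := val e && has (fun d => Y e d == y) (iota 0 m).
Definition lst (m y : nat) : seq nat := [seq e <- iota 0 m | occ r e y].

Lemma count_occ e : val e -> count (occ r e) (iota 0 n) = r.
Proof.
move=> he; rewrite -size_filter; transitivity (size (map (Y e) (iota 0 r))); last first.
  by rewrite size_map size_iota.
apply/perm_size/uniq_perm; first by rewrite filter_uniq ?iota_uniq.
  rewrite map_inj_in_uniq ?iota_uniq // => d d'; rewrite !mem_iota !add0n /=.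
  exact: Yinj.
move=> y; rewrite mem_filter mem_iota add0n /= /occ he /=; apply/andP/mapP.
  by case=> /hasP[d hd /eqP <-] _; exists d.
case=> d hd ->; have : d < r by move: hd; rewrite mem_iota.
by move=> hd'; split; [apply/hasP; exists d | apply: Yn].
Qed.

Lemma mem_lst m y e : (e \in lst m y) = (e < m) && occ r e y.
Proof. by rewrite mem_filter mem_iota add0n andbC. Qed.

Lemma lst_uniq m y : uniq (lst m y).
Proof. by rewrite filter_uniq ?iota_uniq. Qed.

Lemma size_lst m y : size (lst m y) <= m.
Proof. by rewrite size_filter -[X in _ <= X](size_iota 0 m) count_size. Qed.

Lemma lstS m y : lst m.+1 y = lst m y ++ (if occ r m y then [:: m] else [::]).
Proof. by rewrite /lst -addn1 iotaD filter_cat /=; case: ifP. Qed.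

(** Every valid set contributes exactly [r] incidences, and the others none; this total is what
    building and scanning the lists costs. *)
Lemma sum_size_lst m : \sum_(y < n) size (lst m y) <= m * r.
Proof.
elim: m => [|m IH]; first by rewrite big1.
rewrite (eq_bigr (fun y : 'I_n => size (lst m y) + occ r m y)); last first.
  by move=> y _; rewrite lstS size_cat; case: occ.
rewrite big_split mulSn addnC; apply: leq_add => //.
have -> : \sum_(y < n) occ r m y = count (occ r m) (iota 0 n).
  rewrite -sum1_count [RHS]big_mkcond /=.
  rewrite -(big_mkord xpredT (fun y => nat_of_bool (occ r m y))) /index_iota subn0.
  by apply: eq_bigr => y _; case: occ.
case h: (val m); first by rewrite count_occ.
by rewrite (eq_count (a2 := pred0)) ?count_pred0 // => y; rewrite /occ h.
Qed.

Lemma occS d e y : occ d.+1 e y = occ d e y || val e && (Y e d == y).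
Proof.
by rewrite /occ -addn1 iotaD has_cat /= add0n orbF; case: (val e).
Qed.

Lemma occ_new d e : val e -> d < r -> occ d e (Y e d) = false.
Proof.
move=> he hd; rewrite /occ he; apply/negbTE/hasPn => d'; rewrite mem_iota add0n => /andP[_ hd'].
apply/negP => /eqP h; have := Yinj he (ltn_trans hd' hd) hd h; lia.
Qed.

(** All indices may start as not yet hit: an invalid one lies in no list and is therefore never
    counted, while a valid set has exactly [r] elements. *)
Lemma lst_hit PS : 0 < PS -> forall m, m <= 2 ^ PS ->
  let pk := (hs_run (lst m) n PS xpredT).2 in
  [/\ forall e, e < m -> val e -> 0 < r -> exists2 y, y \in pk & occ r e y,
      all (fun y => y < n) pk & size pk * r <= PS * (2 * n)].
Proof.
move=> PS0 m hm pk.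
have [h1 h2 h3] : [/\ forall e, xpredT e -> member (lst m) n e ->
        exists2 y, y \in pk & e \in lst m y, all (fun y => y < n) pk & size pk * r <= PS * (2 * n)].
  apply: hs_runP => //; first exact: lst_uniq.
    move=> y _; apply: leq_trans (count_size _ _) _; exact: leq_trans (size_lst _ _) hm.
  move=> e _ /hasP[y _]; rewrite mem_lst => /andP[hem /andP[he _]].
  rewrite -{1}(count_occ he) eq_leq //; apply: eq_count => z; by rewrite /= mem_lst hem.
split=> // e hem he r0; have [||y hy] := h1 e; rewrite ?mem_lst ?hem //; last by exists y.
apply/hasP; exists (Y e 0); first by rewrite mem_iota Yn.
by rewrite mem_lst hem /occ he; apply/hasP; exists 0; rewrite ?mem_iota.
Qed.

End Members.

Variables (P : program) (n C WP G : nat) (allowed : nat -> nat -> Prop).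
Hypotheses (n0 : 0 < n) (hG : n * n <= G) (KC : nat)
  (hKC : 2000 <= KC) (hC : n.+1 ^ KC <= C) (hO : oracle P n WP G allowed)
  (hn1 : allowed n 1).
Variable (lam : nat).
Hypotheses (l0 : 0 < lam) (ln : lam <= n) (hln : n < 2 ^ lam) (hnl : 2 ^ lam <= n * 2).

Let env := env n lam.
Notation hoare := (hoare P C WP).
Notation wf := (wf C).
Let smallC := @smallC n C KC hKC hC.
Let G0 := @G0 n G n0 hG.
Let boolC := @boolC n C KC hKC hC.
Let cb_nn := @cb_nn n G hG lam l0.

Lemma cb_n c : c <= 16 -> cb lam G 5 (c * n.+1).
Proof.
move=> h; apply: cb_leq (cb_nn (leqnn 32)); apply: (@leq_trans (16 * n.+1)).
  by rewrite leq_mul2r h orbT.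
by rewrite (_ : 32 * (n * n) = 16 * (2 * (n * n))) ?leq_mul2l /=; nia.
Qed.

(** Distances alone do not reveal the vertices of a path, so a witness is computed for every source,
    every distance from it, every second source and every distance to that one. Both dimensions of
    this product are at most a polylogarithm times [n]. *)
Lemma hoare_next B (Sq : seq nat) r a s (Q : mstate -> Prop) :
  let k := size Sq in
  balls n B -> env s -> vr s 40 = k -> vr s 48 = r -> 0 < r <= n ->
  (forall x, x < k -> ar s aS 0 0 x = nth 0 Sq x /\ nth 0 Sq x < n) ->
  (forall x v, x < k -> v < n -> ar s aDf 0 x v = encd B (4 * r).-1 (nth 0 Sq x) v) ->
  (forall x v, x < k -> v < n ->
     ar s aDb 0 x v = encd (fun c u v => B c v u) (4 * r).-1 (nth 0 Sq x) v) ->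
  k * (4 * r) < a * n -> a < pw lam 12 -> (k * r) * (k * (2 * r)) <= 2 ^ pPS lam ->
  (forall s' Sq', wf s' -> frame (40 :: nxV) (aS :: nxA) s s' -> vr s' 40 = size Sq' ->
     (forall x, x < size Sq' -> ar s' aS 0 0 x = nth 0 Sq' x /\ nth 0 Sq' x < n) ->
     size Sq' * r <= pPS lam * (2 * n) ->
     (forall x x' D, x < k -> x' < k -> isd B D (nth 0 Sq x) (nth 0 Sq x') -> r <= D -> D < 2 * r ->
        exists t d, [/\ t \in Sq', 0 < d <= r, isd B d (nth 0 Sq x) t & isd B (D - d) t (nth 0 Sq x')]) ->
     Q s') ->
  hoare NEXT s (pw lam 400 * G) Q.
Proof.
move=> k hB envs v40 v48 /andP[r0 rn] hS hDf hDb hka ha hPS hQ; have G0' := G0.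
have hB' := balls_rev hB.
have n22 v : 22 < v -> v \notin [:: 20; 21; 22] by rewrite !inE; lia.
have kr4 : k * r <= k * (4 * r) by rewrite leq_mul2l leq_pmull ?orbT.
have kr2 : k * (2 * r) <= k * (4 * r) by rewrite !leq_mul2l leq_mul2r !orbT.
have hNR : k * r < a * n by apply: leq_ltn_trans hka.
have hNC : k * (2 * r) < a * n by apply: leq_ltn_trans hka.
have kan : k < a * n by apply: leq_ltn_trans hNR; rewrite leq_pmulr.
have hkk : k * k <= 2 ^ pPS lam.
  by apply: leq_trans hPS; apply: leq_mul; rewrite leq_pmulr // muln_gt0.
have [aC1 aC2] := areaC n0 hKC hC ln hNR hNC ha ha.
have kkC : k * k <= C by apply: leq_trans aC1; apply: leq_mul; rewrite leq_pmulr // muln_gt0.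
set Z := (a * n) * (a * n).
have cZ : cb lam G 24 Z.
  rewrite /Z mulnACA; apply: (@cb_mul lam G 24 0); last by rewrite /cb mul1n.
  by apply: (@pw_mul lam 12 12); apply: ltnW.
have kkr : k * k * r <= Z.
  by rewrite -mulnA; apply: leq_mul; apply: ltnW => //.
have kkZ : (k * k).+1 <= Z.
  by apply: (@leq_ltn_trans (k * (a * n))); rewrite ?leq_mul2l ?(ltnW kan) ?orbT // ltn_mul2r kan (leq_ltn_trans _ kan).
have nC : n <= C by apply: (@smallC 1) => //; rewrite /xpow expn1.
have PSC : pPS lam * n < C.
  have h : (pPS lam * n).+1 <= xpow n (16 + 1 + 1).
    rewrite -addn1; apply: (@leq_trans (pPS lam * n + pPS lam * n)).
      by rewrite leq_add2l muln_gt0 n0 /pPS addn_gt0 orbT.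
    rewrite addnn -muln2; apply: xpow_mul; last by rewrite /xpow expn1.
    apply: xpow_mul; last by rewrite /xpow expn1.
    by apply: (@pw_xpow n n0 lam ln 8); apply: pw_pPS.
  by apply: smallC h _.
set D := k * k * r.
have cPn c : c <= 32 -> cb lam G (8 + 5) (pPS lam * (c * (n * n))).
  by move=> h; apply: cb_mul (pw_pPS l0) (cb_nn h).
apply: (hoare_weaken (T := 1 + (1 + (1 + (pw lam 380 * G + (16 * n.+1 + (1 +
   ((k * k * (1 + ((r * 4).+1).+1).+1).+1 + (16 * (k * k).+1 + (pPS lam * (5 * D + 20 * n + 10) + 5 +
   (pPS lam * (32 * (n * n)) + 16 * n.+1 + 1))))))))))
  (Q := fun s' => exists Sq', [/\ vr s' 40 = size Sq',
     forall x, x < size Sq' -> ar s' aS 0 0 x = nth 0 Sq' x /\ nth 0 Sq' x < n,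
     size Sq' * r <= pPS lam * (2 * n) &
     (forall x x' D, x < k -> x' < k -> isd B D (nth 0 Sq x) (nth 0 Sq x') -> r <= D -> D < 2 * r ->
        exists t d, [/\ t \in Sq', 0 < d <= r, isd B d (nth 0 Sq x) t & isd B (D - d) t (nth 0 Sq x')])])); last 2 first.
- have c1 : cb lam G 0 1 by apply: cb_const.
  have cL : cb lam G 30 (k * k * (1 + ((r * 4).+1).+1).+1).+1.
    apply: (@cb_leq _ _ _ (2 ^ 4 * Z)); last by apply: (@cb_mono lam l0 G 28) => //; apply: (@cb_mul lam G 4 24) => //; apply: pw_const.
    have -> : (k * k * (1 + ((r * 4).+1).+1).+1).+1 = 4 * (k * k) + 4 * (k * k * r) + 1 by lia.
    rewrite -[2 ^ 4]/16; move: kkr kkZ; set x := k * k; set y := x * r; lia.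
  have cA : cb lam G 28 (16 * (k * k).+1).
    by apply: (@cb_mul lam G 4 24); [apply: pw_const | apply: cb_leq cZ].
  have cD : cb lam G 24 D by apply: cb_leq cZ.
  have cn20 : cb lam G 5 (20 * n).
    by apply: cb_leq (cb_nn (leqnn 32)); nia.
  apply: (@cb_mono lam l0 G 384) => //.
  apply: (cb_add l0 c1 (cb_add l0 c1 (cb_add l0 c1 (cb_add l0 (leqnn _ : cb lam G 380 _)
    (cb_add l0 (cb_n _) (cb_add l0 c1 (cb_add l0 cL (cb_add l0 cA
    (cb_add l0 (cb_add l0 (cb_mul (pw_pPS l0) (cb_add l0 (cb_add l0 (cb_mul (pw_const l0 (k := 3) _) cD) cn20)
       (cb_const l0 G0' (k := 4) _))) (cb_const l0 G0' (k := 3) _))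
      (cb_add l0 (cb_add l0 (cPn _ _) (cb_n _)) c1))))))))) ) => //.
- by move=> s' w' f' [Sq' [h1 h2 h3 h4]]; apply: (hQ s' Sq') => //; apply: frame_all f'.
have krC : k * r <= C by apply: leq_trans aC2; apply: leq_trans (leq_pmulr _ _).
have k2rC : k * (2 * r) <= C by apply: leq_trans aC2; apply: leq_trans (leq_pmull _ _).
have r2C : 2 * r <= C.
  by apply: (@smallC 2) => //; rewrite /xpow expnS expn1; nia.
pose xi e := nth 0 Sq (e %/ k). pose xj e := nth 0 Sq (e %% k).
apply: (hoare_then (Q1 := fun s' => vr s' 62 = k * r)).
  by apply: hoare_asg => [_|s' _ ->]; rewrite /= v40 v48.
move=> s1 w1 f1 v62.
apply: (hoare_then (Q1 := fun s' => vr s' 63 = 2 * r)).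
  by apply: hoare_asg => [_|s' _ ->]; rewrite /= (frv f1) // v48 addnn -mul2n.
move=> s2 w2 f2 v63.
apply: (hoare_then (Q1 := fun s' => vr s' 64 = k * (2 * r))).
  by apply: hoare_asg => [_|s' _ ->]; rewrite /= v63 (frv f2) // (frv f1) // v40.
move=> s3 w3 f3 v64.
have f13 : frame [:: 62; 63; 64] [::] s s3.
  by apply: frame_trans (frame_trans (frame_all _ _ f1) (frame_all _ _ f2)) (frame_all _ _ f3).
have env3 := env_frame envs f13 isT isT.
have v623 : vr s3 62 = k * r by rewrite (frv f3) // (frv f2).
have v633 : vr s3 63 = 2 * r by rewrite (frv f3).
have v483 : vr s3 48 = r by rewrite (frv f13).
(* The tables hold 1 + the distance. Row remainder [d] stands for distance [d + 1] from the first
   source, hence the 2; column remainders are distances to the second source and start at 0, hence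
   the 1. *)
pose fA i y := ar s aDf 0 (i %/ r) y == i %% r + 2.
pose fB y j := ar s aDb 0 (j %/ (2 * r)) y == j %% (2 * r) + 1.
apply: (hoare_then (Q1 := fun s' => frame witV witA s3 s' /\
   (forall i j y, i < k * r -> j < k * (2 * r) -> ar s' aW 0 i j = y.+1 -> [/\ y < n, fA i y & fB y j]) /\
   (forall i j y, i < k * r -> j < k * (2 * r) -> y < n -> fA i y -> fB y j -> ar s' aW 0 i j != 0))).
  apply: (hoare_wit n0 hG hKC hC hO hn1 l0 ln hln hnl _ _ v623 v64 env3 (fA := fA) (fB := fB) _ _ hNR hNC ha ha hPS) => //.
  - by move=> s' er ey f; rewrite /= !(frv f) // !(fra f) // v483 !(fra f13) // eqb0 negbK.
  - by move=> s' ey er f; rewrite /= !(frv f) // !(fra f) // v633 !(fra f13) // eqb0 negbK.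
move=> s4 w4 _ [f4 [W1 W2]].
have F4 : frame nxV nxA s s4 by apply: frame_trans (frame_all _ _ f13) (frame_all _ _ f4).
have env4 := env_frame envs F4 isT isT.
apply: (hoare_then (Q1 := fun s' => forall y, y < n -> ar s' aDeg 0 0 y = 0)).
  apply: (@hoare_fill P C WP (fun _ _ _ => 0)) => //; rewrite (env_one env4) (env_n env4); first by lia.
  by move=> s' w' f' h' y hy; rewrite h' hy.
move=> s5 w5 f5 d5.
have F5 : frame nxV nxA s s5 by apply: frame_trans F4 (frame_all _ _ f5).
apply: (hoare_then (Q1 := fun s' => vr s' 71 = k * k)).
  by apply: hoare_asg => [_|s' _ ->]; rewrite /= (frv F5) // v40.
move=> s6 w6 f6 v71.
have F6 : frame nxV nxA s s6 by apply: frame_trans F5 (frame_all _ _ f6).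
have env6 := env_frame envs F6 isT isT.
pose en e := encd B (4 * r).-1 (xi e) (xj e).
pose val e := (e < k * k) && (r < en e) && (en e < 2 * r + 1).
(* With [en e = D + 1], the column remainder [en e - 2 - d] is [D - (d + 1)], the rest of a shortest
   path. Thus [Y e d] is a vertex at distance [d + 1] on a shortest path; the vertices for different
   [d] need not lie on a common one. *)
pose Y e d := ar s4 aW 0 (e %/ k * r + d) (e %% k * (2 * r) + (en e - 2 - d)) - 1.
have dm e : e < k * k -> e %/ k < k /\ e %% k < k.
  move=> he; have c0 : 0 < k by case: (k) he.
  by rewrite ltn_divLR // ltn_mod.
have Yspec e d : val e -> d < r -> [/\ Y e d < n, isd B d.+1 (xi e) (Y e d) &
    isd B ((en e).-1 - d.+1) (Y e d) (xj e)].
  move=> /andP[/andP[he h1] h2] hd; have [hx hx'] := dm e he.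
  have [D0 eD] : exists D0, en e = D0.+1 by exists (en e).-1; lia.
  have := eqxx (en e); rewrite {2}eD (encdP hB) => /andP[_ hD].
  have hsx : xi e < n by case: (hS _ hx). have hsx' : xj e < n by case: (hS _ hx').
  have hi : e %/ k * r + d < k * r.
    by apply: (@leq_trans ((e %/ k).+1 * r)); [rewrite mulSn addnC ltn_add2r | rewrite leq_mul2r hx orbT].
  have hc : en e - 2 - d < 2 * r by lia.
  have hj : e %% k * (2 * r) + (en e - 2 - d) < k * (2 * r).
    by apply: (@leq_trans ((e %% k).+1 * (2 * r))); [rewrite mulSn addnC ltn_add2r | rewrite leq_mul2r hx' orbT].
  have r20 : 0 < 2 * r by rewrite muln_gt0.
  have eA y : y < n -> fA (e %/ k * r + d) y = isd B d.+1 (xi e) y.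
    move=> hy; rewrite /fA divnMDl // modnMDl (divn_small hd) (modn_small hd) addn0 addn2 hDf // (encdP hB).
    by rewrite (_ : _ <= _) //; lia.
  have eB y : y < n -> fB y (e %% k * (2 * r) + (en e - 2 - d)) = isd B ((en e).-1 - d.+1) y (xj e).
    move=> hy; rewrite /fB divnMDl // modnMDl (divn_small hc) (modn_small hc) addn0 addn1 hDb // (encdP hB').
    rewrite (_ : _ <= _); last by lia.
    by rewrite isd_rev; congr isd; lia.
  have [|y [hy y1 y2]] := isd_split hB (a := d.+1) (b := D0 - d.+1) hsx hsx'; first by rewrite subnKC //; lia.
  have hne : ar s4 aW 0 (e %/ k * r + d) (e %% k * (2 * r) + (en e - 2 - d)) != 0.
    by apply: (W2 _ _ y) => //; rewrite ?eA ?eB // eD.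
  have ey : ar s4 aW 0 (e %/ k * r + d) (e %% k * (2 * r) + (en e - 2 - d)) = (Y e d).+1.
    by rewrite /Y subn1 prednK // lt0n.
  by have [z1 z2 z3] := W1 _ _ _ hi hj ey; rewrite -eA // -eB.
have Yn e d : val e -> d < r -> Y e d < n by move=> h1 h2; case: (Yspec e d h1 h2).
have Yinj e d d' : val e -> d < r -> d' < r -> Y e d = Y e d' -> d = d'.
  move=> h1 h2 h3 h4; have [_ h5 _] := Yspec e d h1 h2; have [_ h6 _] := Yspec e d' h1 h3.
  by rewrite h4 in h5; have := isd_inj hB h5 h6; lia.
pose lists L s' := forall y, y < n -> ar s' aDeg 0 0 y = size (L y) /\
  forall t, t < size (L y) -> ar s' aList 0 y t = nth 0 (L y) t.
have lmov L vs bs s1' s2' : frame vs bs s1' s2' -> aDeg \notin bs -> aList \notin bs ->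
    lists L s1' -> lists L s2'.
  by move=> f hb1 hb2 h y hy; have [h1 h2] := h y hy; split=> [|t ht]; rewrite (fra f) // h2.
apply: (hoare_then (Q1 := lists (lst r val Y (k * k)))).
  rewrite -v71; apply: (hoare_for (I := fun m => lists (lst r val Y m))); last by rewrite v71.
    by move=> y hy; rewrite (fra f6) // d5.
  rewrite v71 => e s7 s8 he w8 f67 I7 f78 _ v66.
  have F8 : frame nxV nxA s s8 by apply: frame_trans F6 (frame_trans (frame_all _ _ f67) (frame_all _ _ f78)).
  have I8 := lmov _ _ _ _ _ f78 isT isT I7.
  have [hx hx'] := dm e he.
  apply: (hoare_weaken (T := 1 + ((r * 4).+1).+1) (Q := lists (lst r val Y e.+1))) => //.
  apply: (hoare_then (Q1 := fun s' => vr s' 68 = en e)).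
    have e40 : vr s8 40 = k by rewrite (frv F8).
    have eS : ar s8 aS 0 0 (e %% k) = xj e by rewrite (fra F8) //; case: (hS _ hx').
    have hjn : xj e < n by case: (hS _ hx').
    have e1 : ev (EArr aDf (ENum 0) (EVar 66 /^ EVar 40) (E1 aS (EVar 66 %^ EVar 40))) s8 = en e.
      by rewrite /= v66 e40 eS (fra F8) // hDf.
    apply: hoare_asg => [_|s' _ ->]; rewrite e1 //.
    by rewrite -e1; case: w8 => _ h; apply: h.
  move=> s9 w9 f9 v68.
  have F9 : frame nxV nxA s s9 by apply: frame_trans F8 (frame_all _ _ f9).
  have I9 := lmov _ _ _ _ _ f9 isT isT I8.
  have v669 : vr s9 66 = e by rewrite (frv f9).
  have v489 : vr s9 48 = r by rewrite (frv F9).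
  have v639 : vr s9 63 = 2 * r.
    by rewrite (frv f9) // (frv f78) // (frv f67) // (frv f6) // (frv f5) // (frv f4).
  have vE : (ev ((EVar 48 <^ EVar 68) *^ (EVar 68 <^ EVar 63 +^ ENum 1)) s9 != 0) = val e.
    by rewrite /= v489 v68 v639 muln_eq0 negb_or !eqb0 !negbK /val he.
  apply: hoare_if => [|/eqP]; last first.
    rewrite -[_ == 0]negbK vE => hv.
    apply: (hoare_weaken (T := 1) (Q := fun s' => s' = s9)) => //; first exact: hoare_nop.
    move=> s' _ _ ->; move=> y hy; rewrite lstS /occ (negbTE hv) /= cats0; exact: I9.
  rewrite vE => hv.
  (* The lists when [d] vertices of the set [e] have been entered. These vertices are distinct, so
     [e] is appended to each list at most once. *)
  pose L d y := lst r val Y e y ++ (if occ val Y d e y then [:: e] else [::]).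
  have e40 : vr s9 40 = k by rewrite (frv F9).
  rewrite -[in (r * 4)%N]v489.
  apply: (hoare_for (I := fun d s' => lists (L d) s')).
  - by move=> y hy; rewrite /L /occ /= andbF cats0; apply: I9.
  - rewrite v489 => d s10 s11 hd w11 f910 I10 f1011 _ v69.
    have I11 := lmov _ _ _ _ _ f1011 isT isT I10.
    have F11 : frame nxV nxA s s11 by apply: frame_trans F9 (frame_trans (frame_all _ _ f910) (frame_all _ _ f1011)).
    have g v : v \in [:: 40; 48; 63; 66; 68] -> vr s11 v = vr s9 v.
      by rewrite !inE => hv'; rewrite (frv f1011) ?(frv f910) //= !inE; lia.
    have hyn := Yn e d hv hd; set y0 := Y e d in hyn.
    apply: (hoare_weaken (T := 1 + (1 + 1)) (Q := lists (L d.+1))) => //.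
    apply: (hoare_then (Q1 := fun s' => vr s' 70 = y0)).
      have e1 : ev (EArr aW (ENum 0) (EVar 66 /^ EVar 40 *^ EVar 48 +^ EVar 69)
          (EVar 66 %^ EVar 40 *^ EVar 63 +^ (EVar 68 -^ ENum 2 -^ EVar 69)) -^ ENum 1) s11 = y0.
        rewrite /= (g 66 isT) (g 40 isT) (g 48 isT) (g 63 isT) (g 68 isT) v669 e40 v489 v639 v68 v69 (fra f1011) // (fra f910) // (fra f9) // (fra f78) //.
        by rewrite (fra f67) // (fra f6) // (fra f5).
      apply: hoare_asg => [_|s' _ ->]; rewrite e1 //.
      by apply: leq_trans nC; apply: ltnW.
    move=> s12 w12 f12 v70; have I12 := lmov _ _ _ _ _ f12 isT isT I11.
    have v6612 : vr s12 66 = e by rewrite (frv f12) // g.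
    have [dg _] := I12 y0 hyn.
    have Lnew : L d.+1 y0 = rcons (L d y0) e.
      rewrite /L occS hv eqxx orbT -cats1.
      by rewrite (occ_new Yinj hv hd) cats0.
    have Lold y : y != y0 -> L d.+1 y = L d y.
      by move=> ne; rewrite /L occS hv -/y0 eq_sym (negbTE ne) orbF.
    have szL : size (L d y0) < k * k.
      rewrite /L (occ_new Yinj hv hd) cats0; apply: leq_ltn_trans he; exact: size_lst.
    apply: (hoare_then (Q1 := fun s' => (forall y, y < n -> ar s' aDeg 0 0 y = size (L d y)) /\
       forall y, y < n -> forall t, t < size (L d.+1 y) -> ar s' aList 0 y t = nth 0 (L d.+1 y) t)).
      apply: hoare_sto => [_|s' f' _ h'].
        by rewrite /= v6612; apply: leq_trans kkC; apply: ltnW.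
      split=> [y hy|y hy t]; first by rewrite (fra f') //; case: (I12 y hy).
      rewrite h' /= v70 v6612 dg; have [->|ne] := eqVneq y y0.
        rewrite Lnew size_rcons nth_rcons ltnS leq_eqVlt; have [->|nt] := eqVneq t (size (L d y0)).
          by rewrite ltnn.
        by rewrite /= => ht; rewrite ht; case: (I12 y0 hyn) => _; apply.
      by rewrite Lold //=; case: (I12 y hy) => _ h; apply: h.
    move=> s13 w13 f13' [K1 K2].
    have v7013 : vr s13 70 = y0 by rewrite (frv f13').
    apply: hoare_sto => [_|s14 f14 _ h14].
      by rewrite /= v7013 K1 // addn1; apply: leq_trans kkC.
    move=> y hy; split; last by move=> t ht; rewrite (fra f14) // K2.
    rewrite h14 /= v7013 K1 //; have [->|ne] := eqVneq y y0.
      by rewrite Lnew size_rcons addn1.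
    by rewrite Lold // K1.
  - rewrite v489 => s' _ _ h' y hy; rewrite lstS; exact: h'.
move=> s7 w7 f7 I7.
have F7 : frame nxV nxA s s7 by apply: frame_trans F6 (frame_all _ _ f7).
have env7 := env_frame envs F7 isT isT.
have v717 : vr s7 71 = k * k by rewrite (frv f7).
apply: (hoare_then (Q1 := fun s' => forall e, e < k * k -> ar s' aAl 0 0 e = 1)).
  apply: (@hoare_fill P C WP (fun _ _ _ => 1)) => //; rewrite (env_one env7) v717.
  - by move=> *; split=> //; exact: (boolC true).
  - by lia.
  - by move=> s' w' f' h' e he; rewrite h' he.
move=> s8 w8 f8 al8.
have F8 : frame nxV nxA s s8 by apply: frame_trans F7 (frame_all _ _ f8).
have env8 := env_frame envs F8 isT isT.
have I8 := lmov _ _ _ _ _ f8 isT isT I7.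
pose inc y := [seq nth 0 (lst r val Y (k * k) y) t | t <- iota 0 (size (lst r val Y (k * k) y)) & true].
have PS0 : 0 < pPS lam by rewrite /pPS addn_gt0 orbT.
have := lst_hit Yn Yinj PS0 hkk; set pk := (hs_run _ _ _ _).2 => -[H1 H2 H3].
have incE y : inc y = lst r val Y (k * k) y.
  by rewrite /inc filter_predT map_nth_iota0 ?take_size.
have pkE : (hs_run inc n (pPS lam) xpredT).2 = pk.
  by congr (_.2); congr hs_run; apply: boolp.funext.
apply: (hoare_then (Q1 := fun s' => vr s' vnp = size pk /\ forall t, t < size pk -> ar s' aPk 0 0 t = nth 0 pk t)).
  apply: (@hoare_hitset P C WP vn _ _ _ n (k * k) (pPS lam) D (fun y => size (lst r val Y (k * k) y))
    (fun y t => nth 0 (lst r val Y (k * k) y) t) (fun _ _ => true) xpredT) => //.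
  - exact: env_n env8.
  - exact: env_ps env8.
  - by move=> j hj; apply: env_pw env8 _.
  - by move=> s' ey f' hy; rewrite /= (fra f') //; case: (I8 _ hy).
  - by move=> s' ey et f' hy ht; split=> //= _; rewrite (fra f') //; case: (I8 _ hy) => _; apply.
  - move=> y t hy ht _; have : nth 0 (lst r val Y (k * k) y) t \in lst r val Y (k * k) y by apply: mem_nth.
    by rewrite mem_lst => /andP[].
  - by move=> y hy; apply: leq_trans kkC; apply: size_lst.
  - exact: sum_size_lst.
  - by move=> s' w' f'; rewrite -/inc pkE.
move=> s9 w9 f9 [np9 pk9].
have F9 : frame nxV nxA s s9 by apply: frame_trans F8 (frame_all _ _ f9).
have env9 := env_frame envs F9 isT isT.
have pkle : size pk <= pPS lam * (2 * n) by apply: leq_trans H3; rewrite leq_pmulr.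
have pkn t : t < size pk -> nth 0 pk t < n by move=> ht; apply: (allP H2); apply: mem_nth.
apply: (hoare_weaken (T := 8 * (size pk).+1 * 2 + 1) (Q := fun s' => vr s' 40 = size pk /\
  forall x, x < size pk -> ar s' aS 0 0 x = nth 0 pk x)); last 2 first.
- rewrite leq_add2r; have : pPS lam * (2 * n) * 16 <= pPS lam * (32 * (n * n)).
    by rewrite -mulnA leq_mul2l; apply/orP; right; nia.
  by lia.
- move=> s' w' f' [h1 h2]; exists pk; split=> // [x hx|x x' D0 hx hx' hD rD D2r].
    by rewrite h2 //; split=> //; apply: pkn.
  have k0 : 0 < k by apply: leq_ltn_trans hx.
  pose e := x * k + x'.
  have ek : e %/ k = x by rewrite /e divnMDl // divn_small // addn0.
  have em : e %% k = x' by rewrite /e modnMDl modn_small.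
  have he : e < k * k.
    by apply: (@leq_trans (x.+1 * k)); [rewrite /e mulSn addnC ltn_add2r | rewrite leq_mul2r hx orbT].
  have een : en e = D0.+1.
    by apply/eqP; rewrite /en (encdP hB) /xi /xj ek em hD andbT; lia.
  have hv : val e by rewrite /val he een; lia.
  have [y hy /andP[_ /hasP[d hd /eqP eY]]] := H1 e he hv r0.
  move: hd; rewrite mem_iota add0n => /andP[_ hd].
  have [y1 y2 y3] := Yspec e d hv hd; rewrite eY een /xi /xj ek em in y2 y3.
  by exists y, d.+1.
have n10 : vr s9 vone = 1 by apply: env_one env9.
apply: (hoare_then (Q1 := fun s' => forall x, x < size pk -> ar s' aS 0 0 x = nth 0 pk x)).
  apply: (@hoare_fill P C WP (fun _ _ x => nth 0 pk x)) => //; rewrite n10 np9.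
  - move=> i j x s' hi hj hx w' f' x20 x21 x22 _; rewrite /= x22 (fra f') // pk9 //; split=> //.
    by apply: leq_trans nC; apply: ltnW; apply: pkn.
  - by lia.
  - by move=> s' w' f' h' x hx; rewrite h' hx.
move=> s10 w10 f10 h10.
have np10 : vr s10 vnp = size pk by rewrite (frv f10).
apply: hoare_asg => [_|s11 f11 ->]; rewrite /= np10.
  by rewrite -np10; case: w10 => h _; apply: h.
by split=> // x hx; rewrite (fra f11) // h10.
Qed.

End Next.

(** * Estimates at one scale *)

(* 0 when there is no estimate, and 1 + the estimate otherwise. *)
Notation aBest := 19.

(* With pn = floor (p n), this is at most i p, and at least i p - 2 for i <= n. *)
Definition deg_exp (n pn i : nat) : nat := i * pn %/ n.
Definition rounding (n pn i : nat) : nat := 2 ^ (deg_exp n pn i).-1.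

Section Final.

(* The array holds 1 + the distance, which is divided by the unit and rounded up. *)
Definition EC (a : nat) (ex ey : expr) : expr :=
  (EArr a (ENum 0) ex ey +^ EVar 74 -^ ENum 2) /^ EVar 74.

(* The offset of the rounded distance in the window [al]; outside it, 2 * W - 1
   exceeds any sum of two offsets. *)
Definition EP (a : nat) (ex ey eal : expr) : expr :=
  let ok := (ex <^ EVar 40) *^ (ENum 0 <^ EArr a (ENum 0) ex ey) *^ (EC a ex ey /^ EVar 75 =^ eal) in
  ok *^ (EC a ex ey %^ EVar 75) +^ (ok =^ ENum 0) *^ (EVar 75 +^ EVar 75 -^ ENum 1).

(** The loop counter is read in base 65: its last two digits are the windows of the two legs and the
    rest is the block of sources. *)
Definition Eal := EVar 78 /^ ENum 65 %^ ENum 65.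
Definition Ebe := EVar 78 %^ ENum 65.
Definition Eblk ey := EVar 78 /^ ENum 65 /^ ENum 65 *^ EVar 76 +^ ey.
Definition Eval := (EArr aC (ENum 0) (EVar 21) (EVar 22) +^ (Eal +^ Ebe) *^ EVar 75) *^ EVar 74 +^ ENum 1.
Definition Egrd :=
  (EArr aC (ENum 0) (EVar 21) (EVar 22) <^ EVar 75 +^ EVar 75 -^ ENum 1) *^
  ((EArr aBest (ENum 0) (EVar 21) (EVar 22) =^ ENum 0) +^ (Eval <^ EArr aBest (ENum 0) (EVar 21) (EVar 22))).

(* The variable 72 holds the index i, and 48 the scale 2 ^ i. *)
Definition FIN : cmd :=
  Asg 73 (EVar 72 *^ EVar vpn /^ EVar vn) ;;
  Asg 74 (E1 aPw (EVar 73 -^ ENum 1)) ;;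
  Asg 75 (E1 aPw (EVar 72 -^ (EVar 73 +^ ENum 2) -^ ENum 1)) ;;
  Asg 76 (EVar vn /^ EVar 48) ;;
  Asg 77 ((EVar 40 /^ EVar 76 +^ ENum 1) *^ ENum 65 *^ ENum 65) ;;
  For 78 77 (
    Fill aA vone vn 76 (EP aDb (Eblk (EVar 22)) (EVar 21) Eal) ;;
    Fill aB vone 76 vn (EP aDf (Eblk (EVar 21)) (EVar 22) Ebe) ;;
    MP 76 ;;
    Fill aBest vone vn vn
      (EArr aBest (ENum 0) (EVar 21) (EVar 22) *^ (Egrd =^ ENum 0) +^ Eval *^ Egrd)).

Section Rounding.

Variable de : nat.
Hypothesis de0 : 0 < de.

Definition ceil (e : nat) : nat := (e + de - 2) %/ de.

Lemma ceil_ge d : d <= ceil d.+1 * de.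
Proof.
rewrite /ceil (_ : d.+1 + de - 2 = d + de.-1); last by lia.
have := ltn_ceil (d + de.-1) de0; rewrite mulSn; lia.
Qed.

Lemma ceil_le d : ceil d.+1 * de <= d + de.-1.
Proof. by rewrite /ceil (_ : d.+1 + de - 2 = d + de.-1) ?leq_trunc_div //; lia. Qed.

Variable W : nat.
Hypothesis W0 : 0 < W.

Definition piece (ok : bool) (al e : nat) : nat :=
  if [&& ok, 0 < e & ceil e %/ W == al] then ceil e %% W else 2 * W - 1.

Lemma piece_le ok al e : piece ok al e <= 2 * W - 1.
Proof.
rewrite /piece; case: ifP => // _.
have := ltn_pmod (ceil e) W0; clear -W0; lia.
Qed.

Lemma piece_fin ok al e : piece ok al e < 2 * W - 1 ->
  [/\ ok, 0 < e & al * W + piece ok al e = ceil e].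
Proof.
rewrite /piece; case: ifP => [/and3P[h1 h2 /eqP <-] _|_]; last by rewrite ltnn.
by split=> //; rewrite -divn_eq.
Qed.

End Rounding.

Variables (P : program) (n C WP G : nat) (allowed : nat -> nat -> Prop).
Hypotheses (n0 : 0 < n) (hG : n * n <= G) (KC : nat)
  (hKC : 2000 <= KC) (hC : n.+1 ^ KC <= C) (hO : oracle P n WP G allowed)
  (hn1 : allowed n 1).
Variable (lam : nat).
Hypotheses (l0 : 0 < lam) (ln : lam <= n) (hln : n < 2 ^ lam) (hnl : 2 ^ lam <= n * 2).

Let env := env n lam.
Notation hoare := (hoare P C WP).
Notation wf := (wf C).
Let smallC := @smallC n C KC hKC hC.
Let pwC := @pwC n C n0 KC hKC hC lam ln.
Let G0 := @G0 n G n0 hG.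
Let cb_nn := @cb_nn n G hG lam l0.

Definition best_sound (B : nat -> nat -> nat -> bool) s := forall u v b, u < n -> v < n ->
  ar s aBest 0 u v = b.+1 -> B b u v.
Definition best_mono s s' := forall u v z, u < n -> v < n ->
  0 < ar s aBest 0 u v <= z -> 0 < ar s' aBest 0 u v <= z.

(** Rounding upwards makes every estimate an upper bound on a distance. [best_mono] guarantees that
    estimates of earlier scales are neither lost nor made worse. In the final bound, each of the two
    legs contributes an error of at most [de.-1]. *)
Lemma hoare_fin B (Sq : seq nat) i pn M a s (Q : mstate -> Prop) :
  let k := size Sq in let r := 2 ^ i in
  let de := rounding n pn i in
  balls n B -> env s -> vr s vpn = pn -> pn <= n -> vr s 40 = k -> vr s 48 = r -> vr s 72 = i ->
  i < lam -> r <= n ->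
  (forall x, x < k -> nth 0 Sq x < n) ->
  (forall x v, x < k -> v < n -> ar s aDf 0 x v = encd B (4 * r).-1 (nth 0 Sq x) v) ->
  (forall x v, x < k -> v < n ->
     ar s aDb 0 x v = encd (fun c u v => B c v u) (4 * r).-1 (nth 0 Sq x) v) ->
  k * (4 * r) < a * n -> a < pw lam 12 ->
  allowed (n %/ r) M -> 2 ^ (i - (deg_exp n pn i + 2)) <= M -> M <= n ->
  best_sound B s ->
  (forall s', wf s' -> frame (mv FIN) [:: aA; aB; aC; aBest] s s' -> best_sound B s' -> best_mono s s' ->
     (forall u v x d1 d2, u < n -> v < n -> x < k -> isd B d1 u (nth 0 Sq x) ->
        isd B d2 (nth 0 Sq x) v -> d1 < 4 * r -> d2 < 4 * r ->
        0 < ar s' aBest 0 u v <= d1 + d2 + 2 * de.-1 + 1) -> Q s') ->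
  hoare FIN s (pw lam 60 * G) Q.
Proof.
move=> k r de hB envs vp hpn v40 v48 v72 hi hr hS hDf hDb hka ha hall hM hMn hbs hQ.
have G0' := G0; have hB' := balls_rev hB; have [_ bs2 bs3 _] := hB.
set e := deg_exp n pn i in hM.
have ei : e <= i by rewrite /e /deg_exp -[X in _ <= X](mulnK i n0) leq_div2r // leq_mul2l hpn orbT.
set g := i - (e + 2) in hM.
pose W := 2 ^ g.-1.
have W0 : 0 < W by rewrite expn_gt0.
have de0 : 0 < de by rewrite expn_gt0.
have r0 : 0 < r by rewrite expn_gt0.
(* The largest entry ever written. It is [2 ^ g - 1] for [g > 0]; for [g = 0] we have [W = 1] and
   the entry is 1. *)
have INFM : 2 * W - 1 <= M.
  apply: leq_trans hM; rewrite /W; case: (g) => [|m] //=.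
  by rewrite expnS; apply: leq_subr.
(* In exponents, [(i - e - 3) + (e - 1) + 4 = i], and truncated subtraction can only help. So a leg
   below [4 * r] spans at most 64 windows of length [W * de], and rounding up may reach one more. *)
have rW : r <= 16 * (W * de).
  rewrite -[16]/(2 ^ 4) /W /de /rounding -/e -!expnD leq_exp2l // /g; lia.
pose kk := n %/ r.
have kk0 : 0 < kk by rewrite divn_gt0.
have kkn : kk <= n by apply: leq_div.
have hak : k < a * kk.
  have h1 : n < kk.+1 * r by apply: ltn_ceil.
  have h2 : n < 2 * kk * r.
    by apply: leq_trans h1 _; rewrite leq_mul2r; apply/orP; right; lia.
  have h3 : k * (4 * r) < a * (2 * kk * r).
    apply: leq_trans hka _; rewrite leq_mul2l (ltnW h2) orbT //.
  have : (k * 4) * r < (a * (2 * kk)) * r by move: h3; rewrite !mulnA.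
  rewrite ltn_mul2r r0 /=; move: h3 => _; rewrite (mulnCA a 2); lia.
have hch : k %/ kk < a by rewrite ltn_divLR.
pose nq := (k %/ kk + 1) * 65 * 65.
have hnq : nq <= pw lam 26.
  rewrite /nq -mulnA; apply: (@pw_mul _ 12 14); last by apply: pw_const.
  by rewrite addn1; apply: leq_trans hch (ltnW ha).
have Wn : W <= n.
  apply: leq_trans hr; rewrite /W /r leq_exp2l // /g; lia.
have den : de <= n.
  apply: leq_trans hr; rewrite /de /rounding /r -/e leq_exp2l //; lia.
have nC : n <= C by apply: (@smallC 1) => //; rewrite /xpow expn1.
have hPS i' : i' <= i -> i' < pPS lam by rewrite /pPS; lia.
apply: (hoare_weaken (T := 1 + (1 + (1 + (1 + (1 + (nq * (32 * (n * n) + (32 * (n * n) + (60 * G + 32 * (n * n)))).+1).+1)))))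
  (Q := fun s' => [/\ best_sound B s', best_mono s s' &
   (forall u v x d1 d2, u < n -> v < n -> x < k -> isd B d1 u (nth 0 Sq x) ->
        isd B d2 (nth 0 Sq x) v -> d1 < 4 * r -> d2 < 4 * r ->
        0 < ar s' aBest 0 u v <= d1 + d2 + 2 * de.-1 + 1)])); last 2 first.
- have c1 : cb lam G 0 1 by apply: cb_const.
  have c60 : cb lam G 6 (60 * G) by apply: (@cb_mul lam G 6 0); [apply: pw_const | apply: cb_G].
  have cN := cb_nn (leqnn 32).
  apply: (@cb_mono lam l0 G 42) => //.
  apply: (cb_add l0 c1 (cb_add l0 c1 (cb_add l0 c1 (cb_add l0 c1 (cb_add l0 c1 (cb_S l0 G0'
    (cb_mul hnq (cb_S l0 G0' (cb_add l0 cN (cb_add l0 cN (cb_add l0 c60 cN))))))))))).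
- by move=> s' w' f' [h1 h2 h3]; apply: hQ => //; apply: frame_all f'.
apply: (hoare_then (Q1 := fun s' => vr s' 73 = e)).
  apply: hoare_asg => [_|s' _ ->]; rewrite /= v72 vp (env_n envs) -/(deg_exp n pn i) -/e //.
  by apply: leq_trans nC; apply: leq_trans ei _; apply: leq_trans ln; apply: ltnW.
move=> s1 w1 f1 v73; have env1 := env_frame envs f1 isT isT.
apply: (hoare_then (Q1 := fun s' => vr s' 74 = de)).
  have he : ev (E1 aPw (EVar 73 -^ ENum 1)) s1 = de.
    by rewrite /= v73 (env_pw env1) ?subn1 //; apply: hPS; lia.
  by apply: hoare_asg => [_|s' _ ->]; rewrite he //; apply: leq_trans nC.
move=> s2 w2 f2 v74; have env2 := env_frame env1 f2 isT isT.
apply: (hoare_then (Q1 := fun s' => vr s' 75 = W)).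
  have he : ev (E1 aPw (EVar 72 -^ (EVar 73 +^ ENum 2) -^ ENum 1)) s2 = W.
    rewrite /= (frv f2) // (frv f2) // (frv f1) // v73 v72 (env_pw env2) ?subn1 //.
    by apply: hPS; lia.
  by apply: hoare_asg => [_|s' _ ->]; rewrite he //; apply: leq_trans nC.
move=> s3 w3 f3 v75; have env3 := env_frame env2 f3 isT isT.
apply: (hoare_then (Q1 := fun s' => vr s' 76 = kk)).
  have he : ev (EVar vn /^ EVar 48) s3 = kk.
    by rewrite /= (env_n env3) (frv f3) // (frv f2) // (frv f1) // v48.
  by apply: hoare_asg => [_|s' _ ->]; rewrite he //; apply: leq_trans nC.
move=> s4 w4 f4 v76; have env4 := env_frame env3 f4 isT isT.
apply: (hoare_then (Q1 := fun s' => vr s' 77 = nq)).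
  have he : ev ((EVar 40 /^ EVar 76 +^ ENum 1) *^ ENum 65 *^ ENum 65) s4 = nq.
    by rewrite [ev _ _]/= v76 (frv f4) // (frv f3) // (frv f2) // (frv f1) // v40.
  by apply: hoare_asg => [_|s' _ ->]; rewrite he //; apply: (pwC hnq).
move=> s5 w5 f5 v77; have env5 := env_frame env4 f5 isT isT.
have f05 : frame [:: 73; 74; 75; 76; 77] [::] s s5.
  apply: frame_trans (frame_all _ _ f1) _ => //; apply: frame_trans (frame_all _ _ f2) _ => //.
  by apply: frame_trans (frame_all _ _ f3) (frame_trans (frame_all _ _ f4) (frame_all _ _ f5)).
have v755 : vr s5 75 = W by rewrite (frv f5) // (frv f4).
have v745 : vr s5 74 = de by rewrite (frv f5) // (frv f4) // (frv f3).
have v765 : vr s5 76 = kk by rewrite (frv f5).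
have v405 : vr s5 40 = k by rewrite (frv f05).
have b05 i' j' k' : ar s5 aBest i' j' k' = ar s aBest i' j' k' by rewrite (fra f05).
pose Db x u := ar s aDb 0 x u. pose Df x v := ar s aDf 0 x v.
pose V := [:: 10; 11; 12; 20; 21; 22; 78]. pose A := [:: aA; aB; aC; aBest].
pose blk q y := q %/ 65 %/ 65 * kk + y.
(* After [q] iterations, a pair with a source of a treated block whose legs fall into the treated
   windows has an estimate no larger than the sum of its rounded legs. *)
pose done q s' := forall q' u v y, q' < q -> u < n -> v < n -> y < kk -> blk q' y < k ->
  0 < Db (blk q' y) u -> 0 < Df (blk q' y) v ->
  ceil de (Db (blk q' y) u) %/ W = q' %/ 65 %% 65 -> ceil de (Df (blk q' y) v) %/ W = q' %% 65 ->
  0 < ar s' aBest 0 u v <= (ceil de (Db (blk q' y) u) + ceil de (Df (blk q' y) v)) * de + 1.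
rewrite -v77.
apply: (hoare_for (I := fun q s' => [/\ frame V A s5 s', best_sound B s', best_mono s s' & done q s'])).
- split=> //; [by move=> u v b; rewrite b05; apply: hbs | by move=> u v z; rewrite b05].
- rewrite v77 => q s6 s7 hq w7 _ [f56 I1 I2 I3] f67 _ v78.
  have f57 : frame V A s5 s7 by apply: frame_trans f56 (frame1 _ _ f67).
  have env7 := env_frame env5 f57 isT isT.
  have D7 x u : ar s7 aDb 0 x u = Db x u by rewrite (fra f57) // (fra f05).
  have F7 x v : ar s7 aDf 0 x v = Df x v by rewrite (fra f57) // (fra f05).
  have v757 : vr s7 75 = W by rewrite (frv f57).
  have v747 : vr s7 74 = de by rewrite (frv f57).
  have v767 : vr s7 76 = kk by rewrite (frv f57).
  have v407 : vr s7 40 = k by rewrite (frv f57).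
  have b67 u v : ar s7 aBest 0 u v = ar s6 aBest 0 u v by rewrite (fra f67).
  set al := q %/ 65 %% 65 in I3; set be := q %% 65 in I3.
  pose pA u y := piece de W (blk q y < k) al (Db (blk q y) u).
  pose pB y v := piece de W (blk q y < k) be (Df (blk q y) v).
  have EPe ad (D : nat -> nat) s' ex ey eal x al' : vr s' 40 = k -> vr s' 74 = de -> vr s' 75 = W ->
      ev ex s' = x -> ev eal s' = al' -> ar s' ad 0 x (ev ey s') = D x ->
      ev (EP ad ex ey eal) s' = piece de W (x < k) al' (D x).
    move=> x1 x2 x3 x4 x5 x6; rewrite /EP /EC /= x1 x2 x3 x4 x5 x6 /piece -/(ceil de (D x)).
    case: (x < k); case: (0 < D x); rewrite ?mul0n ?mul1n ?addn0 ?add0n ?addnn -?mul2n //=.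
    by case: eqP => _; rewrite ?mul0n ?mul1n ?addn0 ?add0n.
  have nn8 : 4 * 2 * n.+1 * kk.+1 <= 32 * (n * n) by clear -kkn n0 kk0; nia.
  have nn8' : 4 * 2 * kk.+1 * n.+1 <= 32 * (n * n) by clear -kkn n0 kk0; nia.
  have nn8'' : 4 * 2 * n.+1 * n.+1 <= 32 * (n * n) by clear -n0; nia.
  have pC x : x <= 2 * W - 1 -> x <= C by move=> h; apply: leq_trans nC; apply: leq_trans h _; apply: leq_trans INFM hMn.
  apply: (hoare_weaken (T := 32 * (n * n) + (32 * (n * n) + (60 * G + 32 * (n * n))))
    (Q := fun s' => [/\ best_sound B s', best_mono s6 s' & forall u v y, u < n -> v < n -> y < kk ->
      pA u y < 2 * W - 1 -> pB y v < 2 * W - 1 ->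
      0 < ar s' aBest 0 u v <= (ceil de (Db (blk q y) u) + ceil de (Df (blk q y) v)) * de + 1])) => //; last first.
    move=> s' w' f' [J1 J2 J3]; split=> //.
    + by apply: frame_trans f57 (frame_all _ _ f').
    + by move=> u v z hu hv h; apply: J2 => //; apply: I2.
    + move=> q' u v y; rewrite ltnS leq_eqVlt => /orP[/eqP->|hlt] hu hv hy; last first.
        by move=> h1 h2 h3 h4 h5; apply: J2 => //; apply: I3.
      move=> h1 h2 h3 h4 h5; apply: J3 => //.
        rewrite /pA /piece h1 h2 h4 eqxx /=.
        have := ltn_pmod (ceil de (Db (blk q y) u)) W0; move: W0; clear; lia.
      rewrite /pB /piece h1 h3 h5 eqxx /=.
      have := ltn_pmod (ceil de (Df (blk q y) v)) W0; move: W0; clear; lia.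
  apply: (hoare_then (Q1 := fun s' => forall u y, u < n -> y < kk -> ar s' aA 0 u y = pA u y)).
    apply: (@hoare_fill P C WP (fun _ u y => pA u y)) => //; rewrite (env_one env7) ?(env_n env7) v767 //.
    + move=> j u y s' _ hu hy _ f' x20 x21 x22 _; split; last by apply: pC; exact: (piece_le _ W0).
      have v78' : vr s' 78 = q by rewrite (frv f').
      have v76' : vr s' 76 = kk by rewrite (frv f').
      apply: (EPe _ (Db ^~ u)); rewrite ?(frv f') //=.
      * by rewrite v78' v76' x22.
      * by rewrite v78'.
      * by rewrite x21 (fra f') // D7.
    + by move=> s' w' f' h' u y hu hy; rewrite h' hu hy.
  move=> s8 w8 f8 a8.
  have f58 : frame V A s5 s8 by apply: frame_trans f57 (frame_all _ _ f8).
  have env8 := env_frame env5 f58 isT isT.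
  have v768 : vr s8 76 = kk by rewrite (frv f58).
  apply: (hoare_then (Q1 := fun s' => forall y v, y < kk -> v < n -> ar s' aB 0 y v = pB y v)).
    apply: (@hoare_fill P C WP (fun _ y v => pB y v)) => //; rewrite (env_one env8) ?(env_n env8) v768 //.
    + move=> j y v s' _ hy hv _ f' x20 x21 x22 _; split; last by apply: pC; exact: (piece_le _ W0).
      have f58' : frame V A s5 s' by apply: frame_trans f58 (frame_all _ _ f').
      have v78' : vr s' 78 = q by rewrite (frv f') // (frv f8).
      apply: (EPe _ (Df ^~ v)); rewrite ?(frv f58') //=.
      * by rewrite v78' (frv f58') // v765 x21.
      * by rewrite v78'.
      * by rewrite x22 (fra f') // (fra f8) // F7.
    + by move=> s' w' f' h' y v hy hv; rewrite h' hy hv.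
  move=> s9 w9 f9 b9.
  have f59 : frame V A s5 s9 by apply: frame_trans f58 (frame_all _ _ f9).
  have env9 := env_frame env5 f59 isT isT.
  have a9 u y : u < n -> y < kk -> ar s9 aA 0 u y = pA u y by move=> *; rewrite (fra f9) // a8.
  have v769 : vr s9 76 = kk by rewrite (frv f59).
  have kkb : 0 < kk <= n by rewrite kk0.
  have pM ok al' e' : piece de W ok al' e' <= M by apply: leq_trans INFM; exact: (piece_le _ W0).
  apply: (hoare_then (Q1 := fun s' => forall u v, u < n -> v < n ->
     is_min kk (fun y => pA u y + pB y v) (ar s' aC 0 u v))).
    apply: (@hoare_MP P n C WP G allowed n0 hG KC hKC hC hO 76 kk M pA pB) => //.
    + exact: env_n env9.
    + by move=> u y hu hy; rewrite a9 //; split=> //; apply: pM.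
    + by move=> y v hy hv; rewrite b9 //; split=> //; apply: pM.
  move=> s10 w10 f10 c10.
  have f510 : frame V A s5 s10 by apply: frame_trans f59 (frame_all _ _ f10).
  have env10 := env_frame env5 f510 isT isT.
  have b10 u v : ar s10 aBest 0 u v = ar s6 aBest 0 u v.
    by rewrite (fra f10) // (fra f9) // (fra f8) // b67.
  have v7810 : vr s10 78 = q by rewrite (frv f10) // (frv f9) // (frv f8).
  pose cv u v := ar s10 aC 0 u v.
  pose nv u v := (cv u v + (al + be) * W) * de + 1.
  pose gd u v := (cv u v < 2 * W - 1) && ((ar s6 aBest 0 u v == 0) || (nv u v < ar s6 aBest 0 u v)).
  pose bn u v := if gd u v then nv u v else ar s6 aBest 0 u v.
  have al65 : al < 65 by apply: ltn_pmod.
  have be65 : be < 65 by apply: ltn_pmod.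
  have nvC u v : cv u v < 2 * W - 1 -> nv u v <= C.
    move=> h; apply: (@leq_trans (n * 132 * n + 1)).
      rewrite leq_add2r; apply: leq_mul den; apply: (@leq_trans (W * 132)); last by rewrite leq_mul2r Wn orbT.
      have h2 : (al + be) * W <= 128 * W by rewrite leq_mul2r; apply/orP; right; lia.
      have ar c z w : c < 2 * w - 1 -> z <= 128 * w -> c + z <= w * 132 by clear; lia.
      exact: ar h h2.
    apply: (@smallC (1 + 8 + 1 + 0 + 1)) => //; apply: xpow_add => //.
    apply: xpow_mul; last by rewrite /xpow expn1.
    apply: xpow_mul; first by rewrite /xpow expn1.
    by apply: (@leq_trans (2 ^ 8)) => //; rewrite /xpow leq_exp2r // ltnS.
  apply: (@hoare_fill P C WP (fun _ u v => bn u v)) => //; rewrite ?(env_one env10) ?(env_n env10) //.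
  + move=> j u v s' hj hu hv w' f' x20 x21 x22 ho; have j0 : j = 0 by lia.
    rewrite j0 in ho; have f5' : frame V A s5 s' by apply: frame_trans f510 (frame_all _ _ f').
    have v78' : vr s' 78 = q by rewrite (frv f').
    have vC : ev (EArr aC (ENum 0) (EVar 21) (EVar 22)) s' = cv u v by rewrite /= x21 x22 (fra f').
    have vB : ev (EArr aBest (ENum 0) (EVar 21) (EVar 22)) s' = ar s6 aBest 0 u v by rewrite /= x21 x22 ho b10.
    have vV : ev Eval s' = nv u v.
      rewrite /Eval [LHS](_ : _ = (ev (EArr aC (ENum 0) (EVar 21) (EVar 22)) s' +
        (vr s' 78 %/ 65 %% 65 + vr s' 78 %% 65) * vr s' 75) * vr s' 74 + 1) //.
      by rewrite vC v78' !(frv f5') // v755 v745.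
    have vG : ev Egrd s' = gd u v.
      rewrite /Egrd [LHS](_ : _ = (ev (EArr aC (ENum 0) (EVar 21) (EVar 22)) s' < vr s' 75 + vr s' 75 - 1) *
        ((ev (EArr aBest (ENum 0) (EVar 21) (EVar 22)) s' == 0) + (ev Eval s' < ev (EArr aBest (ENum 0) (EVar 21) (EVar 22)) s'))) //.
      rewrite vC vB vV !(frv f5') // v755 addnn -mul2n /gd.
      by case: (cv u v < _) => //; rewrite mul1n; case: (ar s6 aBest 0 u v).
    rewrite [ev _ s'](_ : _ = ev (EArr aBest (ENum 0) (EVar 21) (EVar 22)) s' * (ev Egrd s' == 0) + ev Eval s' * ev Egrd s') //.
    rewrite vB vG vV /bn; case hg : (gd u v) => /=; rewrite ?muln0 ?muln1 ?addn0 ?add0n; split=> //.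
      by apply: nvC; case/andP: hg.
    by rewrite -b10; case: w10.
  + move=> s' w' f' h'; have hb' u v : u < n -> v < n -> ar s' aBest 0 u v = bn u v.
      by move=> hu hv; rewrite h' hu hv.
    split.
    * move=> u v b hu hv; rewrite hb' // /bn; case: ifP => [/andP[hc _]|_]; last exact: I1.
      have [[y hy ec] _] := c10 u v hu hv.
      rewrite /nv addn1 => -[<-]; rewrite /cv ec in hc *.
      have pa : pA u y < 2 * W - 1 by apply: leq_ltn_trans hc; apply: leq_addr.
      have pb : pB y v < 2 * W - 1 by apply: leq_ltn_trans hc; apply: leq_addl.
      have [hx da ea] := piece_fin pa. have [_ db eb] := piece_fin pb.
      rewrite (_ : pA u y + pB y v + (al + be) * W = ceil de (Db (blk q y) u) + ceil de (Df (blk q y) v)); last first.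
        by rewrite -ea -eb mulnDl; move: (al * W) (be * W); rewrite /pA /pB; clear; lia.
      case: {ea eb pa pb ec hc} (Db (blk q y) u) da (hDb (blk q y) u hx hu : Db _ _ = _) => // d1 _.
      case: (Df (blk q y) v) db (hDf (blk q y) v hx hv : Df _ _ = _) => // d2 _.
      move=> /esym/eqP; rewrite (encdP hB) => /andP[_ /andP[z2 _]].
      move=> /esym/eqP; rewrite (encdP hB') => /andP[_ /andP[z1 _]].
      apply: (bs2 (d1 + d2)); last exact: bs3 z1 z2.
      by rewrite mulnDl; apply: leq_add; apply: ceil_ge.
    * move=> u v z hu hv /andP[z1 z2]; rewrite hb' // /bn; case: ifP => [/andP[_]|_]; last by rewrite z1.
      rewrite [nv u v]addn1 /= => /orP[/eqP h0|h]; first by rewrite h0 in z1.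
      by apply: leq_trans z2; apply: ltnW.
    * move=> u v y hu hv hy pa pb.
      have [_ cmin] := c10 u v hu hv.
      have [hx da ea] := piece_fin pa. have [_ db eb] := piece_fin pb.
      have hle : nv u v <= (ceil de (Db (blk q y) u) + ceil de (Df (blk q y) v)) * de + 1.
        rewrite /nv leq_add2r leq_mul2r -ea -eb; apply/orP; right.
        have := cmin y hy; rewrite -/(cv u v) mulnDl /pA /pB; move: (al * W) (be * W); clear; lia.
      (* Two offsets inside their windows sum up to at most [2 * W - 2], so the guard accepts the
         minimum. *)
      have hcI : cv u v < 2 * W - 1.
        apply: leq_ltn_trans (cmin y hy) _.
        move: pa pb; rewrite /pA /pB /piece.
        case: ifP => _; last by rewrite ltnn.
        case: ifP => _ _; last by rewrite ltnn.
        have := ltn_pmod (ceil de (Db (blk q y) u)) W0; have := ltn_pmod (ceil de (Df (blk q y) v)) W0.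
        clear; lia.
      rewrite hb' // /bn /gd hcI /=; case: ifP => [_|/negbT].
        by rewrite hle andbT /nv addn1.
      rewrite negb_or -lt0n -leqNgt => /andP[-> h]; exact: leq_trans h hle.
- rewrite v77 => s' _ _ [f' I1 I2 I3]; split=> // u v x d1 d2 hu hv hx z1 z2 l1 l2.
  have e65 d : d < 4 * r -> ceil de d.+1 %/ W < 65.
    move=> hd; rewrite ltn_divLR // -(ltn_pmul2r de0); apply: leq_ltn_trans (ceil_le de0 d) _.
    have : 4 * r <= 64 * (W * de) by move: rW; clear; lia.
    have : de <= W * de by rewrite leq_pmull.
    rewrite -[65 * W * de]mulnA; move: hd; clear -de0; lia.
  have eb : Db x u = d1.+1.
    by apply/eqP; rewrite /Db hDb // (encdP hB') isd_rev z1 andbT; move: l1; clear; lia.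
  have ef : Df x v = d2.+1.
    by apply/eqP; rewrite /Df hDf // (encdP hB) z2 andbT; move: l2; clear; lia.
  set al := ceil de d1.+1 %/ W; set be := ceil de d2.+1 %/ W.
  have al65 : al < 65 by apply: e65. have be65 : be < 65 by apply: e65.
  pose q := (x %/ kk * 65 + al) * 65 + be.
  have q1 : q %/ 65 = x %/ kk * 65 + al by rewrite /q divnMDl // (divn_small be65) addn0.
  have q2 : q %% 65 = be by rewrite /q modnMDl (modn_small be65).
  have q3 : q %/ 65 %/ 65 = x %/ kk by rewrite q1 divnMDl // (divn_small al65) addn0.
  have q4 : q %/ 65 %% 65 = al by rewrite q1 modnMDl (modn_small al65).
  have bx : blk q (x %% kk) = x by rewrite /blk q3 -divn_eq.
  have hlt : q < nq.
    have : x %/ kk <= k %/ kk by rewrite leq_div2r // ltnW.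
    rewrite /q /nq; move: (x %/ kk) (k %/ kk) al65 be65; clear; lia.
  have := I3 q u v (x %% kk) hlt hu hv (ltn_pmod _ kk0).
  rewrite bx eb ef q2 q4 => /(_ hx isT isT erefl erefl) /andP[-> h] /=.
  apply: leq_trans h _; rewrite leq_add2r mulnDl.
  have := ceil_le de0 d1; have := ceil_le de0 d2; clear; lia.
Qed.

End Final.

(** * How the sources of consecutive scales meet the shortest paths *)

Section Hits.

Variable n : nat.

(** The recurrence is the length consumed by one step of [hits_step]: up to [2 ^ i - 1] steps to a
    source and [2 ^ i] further ones, after which the old property must still apply. In closed form
    this is [2 ^ (i + 1) - 2 - i]. *)
Fixpoint reach_thr (i : nat) : nat :=
  if i is i'.+1 then reach_thr i' + (2 ^ i).-1 else 0.

Lemma reach_thr_lt i : reach_thr i < 2 ^ i.+1.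
Proof.
elim: i => [|i IH] //=; have := expn_gt0 2 i.+1; rewrite [2 ^ i.+2]expnS /=.
by move: IH; set x := 2 ^ i.+1; lia.
Qed.

(** Upper bounds on two legs whose sum does not exceed the distance must both be exact. *)
Lemma isd_tight B a b c u y v : balls n B -> isd B c u v -> B a u y -> B b y v -> a + b <= c ->
  isd B a u y /\ isd B b y v.
Proof.
move=> hB hc ha hb hab; have [a' la ia] := isd_ex ha; have [b' lb ib] := isd_ex hb.
have := isd_triangle hB ia ib hc => h.
have ea : a' = a by lia. have eb : b' = b by lia.
by rewrite -ea -eb.
Qed.

(* Every shortest path of length at least [reach_thr i] meets the sources
   within [2 ^ i - 1] steps. *)
Definition hits B i (Sq : seq nat) := forall u v D, u < n -> v < n -> isd B D u v ->
  reach_thr i <= D -> exists t d, [/\ t \in Sq, d <= (2 ^ i).-1, isd B d u t & isd B (D - d) t v].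

(** Put [r = 2 ^ i]. Walk at most [r - 1] steps to a source [s], then [r] steps to [y], then at most
    [r - 1] steps to a source [s']. The distance from [s] to [s'] lies in [[r, 2 r)], so a new
    source lies at most [r] beyond [s], that is, within the first [2 r - 1] steps. It lies on some
    shortest path from [s] to [s'], and replacing the segment by this path keeps the total
    length. *)
Lemma hits_step B i Sq Sq' : balls n B -> (forall x, x < size Sq -> nth 0 Sq x < n) ->
  hits B i Sq ->
  (forall x x' D, x < size Sq -> x' < size Sq -> isd B D (nth 0 Sq x) (nth 0 Sq x') ->
     2 ^ i <= D -> D < 2 * 2 ^ i ->
     exists t d, [/\ t \in Sq', 0 < d <= 2 ^ i, isd B d (nth 0 Sq x) t &
       isd B (D - d) t (nth 0 Sq x')]) ->
  hits B i.+1 Sq'.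
Proof.
move=> hB hS hi hN u v D hu hv hD /= hthr; set r := 2 ^ i in hN *.
have r0 : 0 < r by rewrite expn_gt0.
move: hthr; rewrite expnS -/r => hthr.
have bI d x y : isd B d x y -> B d x y by case/andP.
have [_ _ bc _] := hB.
have thr : reach_thr i <= D by move: hthr r0; set z := reach_thr i; clear; lia.
have [s [d [hs ld id1 id2]]] := hi u v D hu hv hD thr.
rewrite -/r in ld.
have hsn : s < n by have := hS (index s Sq); rewrite index_mem nth_index // => ->.
have [y [hy iy1 iy2]] := isd_split hB (a := r) (b := D - d - r) hsn hv ltac:(rewrite subnKC //; move: ld hthr r0; clear; lia).
have thr2 : reach_thr i <= D - d - r by move: ld hthr r0; clear; lia.
have [s' [d' [hs' ld' id3 id4]]] := hi y v _ hy hv iy2 thr2.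
rewrite -/r in ld'.
(* The subtraction in [hits] is truncated. If [d'] were larger than the remaining distance, [s']
   would be at distance 0 from [v], and [d'] would equal that distance. *)
have hd2' : d' <= D - d - r.
  rewrite leqNgt; apply/negP => hlt; move: id4; rewrite (_ : _ - d' = 0); last by move: hlt; clear; lia.
  have [b0 _ _ _] := hB; rewrite /isd b0 orTb andbT => /eqP es; rewrite es in id3.
  by have := isd_inj hB id3 iy2; move: hlt; clear; lia.
have hd1 : d + r + d' <= D by move: hd2' ld hthr r0; clear; lia.
have [is1 _] : isd B (r + d') s s' /\ isd B (D - d - r - d') s' v.
  by apply: (isd_tight hB id2 (bc _ _ _ _ _ (bI _ _ _ iy1) (bI _ _ _ id3)) (bI _ _ _ id4)); move: hd1; clear; lia.
have [|||||t [d2 [ht hd2 it1 it2]]] := hN (index s Sq) (index s' Sq) (r + d');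
  rewrite ?index_mem ?nth_index // ?leq_addr //; first by move: ld' r0; clear; lia.
rewrite !nth_index // in it1 it2.
have [it3 it4] : isd B (d + d2) u t /\ isd B (r + d' - d2 + (D - d - r - d')) t v.
  by apply: (isd_tight hB hD (bc _ _ _ _ _ (bI _ _ _ id1) (bI _ _ _ it1))
    (bc _ _ _ _ _ (bI _ _ _ it2) (bI _ _ _ id4))); move: hd1 hd2 ld'; clear; lia.
exists t, (d + d2); split=> //; first by move: ld hd2; clear; lia.
by rewrite (_ : D - (d + d2) = r + d' - d2 + (D - d - r - d')) //; move: hd1 hd2; clear; lia.
Qed.

End Hits.

(** * The algorithm *)

Section Main.

(** Loops are counted, so the doubling is tried [vx] times and stops having an effect once the power
    exceeds [vx]. Linear time is affordable. *)
Definition LOG (vx vres : nat) : cmd :=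
  Asg vres (ENum 0) ;; Asg 90 (ENum 1) ;;
  For 91 vx (Ife (EVar vx <^ EVar 90) Nop
    (Asg vres (EVar vres +^ ENum 1) ;; Asg 90 (EVar 90 +^ EVar 90))).

Definition SETUP : cmd :=
  Asg vone (ENum 1) ;;
  LOG vn vlam ;;
  Asg vps (ENum 4 *^ EVar vlam +^ ENum 40) ;;
  Asg 90 (ENum 1) ;;
  For 91 vps (
    Sto aPw (ENum 0) (ENum 0) (EVar 91) (EVar 90) ;;
    Asg 90 (EVar 90 +^ EVar 90)) ;;
  LOG vlam 92 ;;
  Asg 93 (ENum 8 *^ EVar 92 +^ ENum 64) ;;
  Asg vR1 (ENum 1) ;;
  For 91 93 (Asg vR1 (EVar vR1 +^ EVar vR1)) ;;
  Asg vR0 (ENum 1024 *^ (EVar vps *^ (EVar 93 *^ EVar 93 *^ EVar vlam))) ;;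
  Asg vNB (EVar vR1 *^ EVar vR1).

(** The second [DIST] reads the reachability levels transposed and so yields distances to the
    sources. The last [Fill] has to start at cell 0; by truncated subtraction it overwrites the
    input with the entry for the pair (0, 0), and the output begins at cell [n * n]. *)
Definition MAIN : cmd :=
  SETUP ;;
  REACH ;;
  Fill aS vone vone vn (EVar 22) ;;
  Asg 40 (EVar vn) ;;
  Fill aBest vone vn vn (ENum 0) ;;
  For 72 vlam (
    Asg 48 (E1 aPw (EVar 72)) ;;
    Asg 42 (EVar 72 +^ ENum 2) ;;
    DIST aDf (fun ej ey er => EArr aR ej ey er) ;;
    DIST aDb (fun ej ey er => EArr aR ej er ey) ;;
    FIN ;;
    NEXT) ;;
  Asg 95 (EVar vn *^ EVar vn) ;;
  Asg 94 (EVar 95 +^ EVar 95) ;;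
  Fill aIO vone vone 94
    (EArr aBest (ENum 0) ((EVar 22 -^ EVar 95) /^ EVar vn) ((EVar 22 -^ EVar 95) %^ EVar vn)).

Variables (P : program) (n C WP G : nat) (allowed : nat -> nat -> Prop).
Hypotheses (n0 : 0 < n) (hG : n * n <= G) (KC : nat)
  (hKC : 2000 <= KC) (hC : n.+1 ^ KC <= C) (hO : oracle P n WP G allowed)
  (hn1 : allowed n 1).

Let lam := (trunc_log 2 n).+1.
Notation hoare := (hoare P C WP).
Notation wf := (wf C).

Lemma lam_gt0 : 0 < lam. Proof. by []. Qed.

Lemma log_lt x : 0 < x -> trunc_log 2 x < x.
Proof. by move=> x0; apply: leq_trans (ltn_expl _ (leqnn 2)) (trunc_logP (leqnn 2) x0). Qed.

Lemma lam_le : lam <= n. Proof. exact: log_lt. Qed.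
Lemma ltn_exp_lam : n < 2 ^ lam. Proof. exact: trunc_log_ltn. Qed.
Lemma scale_le i : i < lam -> 2 ^ i <= n.
Proof.
by move=> hi; apply: leq_trans (trunc_logP (leqnn 2) n0); rewrite leq_exp2l.
Qed.
Lemma exp_lam_le : 2 ^ lam <= n * 2.
Proof. by rewrite expnSr leq_mul2r scale_le. Qed.

Let env := env n lam.
Let smallC := @smallC n C KC hKC hC.
Let pwC := @pwC n C n0 KC hKC hC lam lam_le.
Let G0 := @G0 n G n0 hG.
Let cb_nn := @cb_nn n G hG lam lam_gt0.
Let cb_n := @cb_n n C G n0 hG KC hKC hC lam lam_gt0 lam_le ltn_exp_lam exp_lam_le.

Lemma hoare_log vx vres x s (Q : mstate -> Prop) :
  vx \notin [:: vres; 90; 91] -> vres \notin [:: 90; 91] -> vr s vx = x -> 0 < x ->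
  2 * x <= C ->
  (forall s', wf s' -> frame [:: vres; 90; 91] [::] s s' ->
     vr s' vres = (trunc_log 2 x).+1 -> Q s') ->
  hoare (LOG vx vres) s (6 * x.+1) Q.
Proof.
rewrite !inE !negb_or => /and3P[na nb nc] /andP[nd ne] hx x0 xC hQ.
set L := (trunc_log 2 x).+1 in hQ *.
have hL : L <= x by apply: log_lt.
have pL j : (2 ^ j <= x) = (j < L).
  apply/idP/idP => h; first by rewrite ltnS trunc_log_max.
  by apply: leq_trans (trunc_logP (leqnn 2) x0); rewrite leq_exp2l.
apply: (hoare_weaken (Q := fun s' => vr s' vres = L) (T := 1 + (1 + (x * (1 + 1).+1.+1).+1))); last 2 first.
- lia.
- move=> s' w' f' h'; apply: hQ => //; apply: frame_sub f' => z //=; rewrite !inE; lia.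
apply: (hoare_then (Q1 := fun s' => vr s' vres = 0)).
  by apply: hoare_asg => // _; apply: leq0n.
move=> s1 w1 f1 v1.
apply: (hoare_then (Q1 := fun s' => vr s' 90 = 1)).
  by apply: hoare_asg => // _ /=; apply: leq_trans xC; lia.
move=> s2 w2 f2 v2.
have hx2 : vr s2 vx = x.
  by rewrite (frv f2) ?inE // (frv f1) ?inE.
rewrite -hx2.
apply: (hoare_for (I := fun m s' => vr s' vres = minn m L /\ vr s' 90 = 2 ^ (minn m L))).
- by rewrite min0n; split=> //; rewrite (frv f2) // inE.
- rewrite hx2 => m s3 s4 hm w4 f3 [h1 h2] f4 _ v91.
  have h1' : vr s4 vres = minn m L by rewrite (frv f4) // inE.
  have h2' : vr s4 90 = 2 ^ minn m L by rewrite (frv f4).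
  have hx4 : vr s4 vx = x.
    rewrite (frv f4) ?inE // (frv f3) //= !inE !negb_or na nb nc //.
  apply: hoare_if; rewrite /= hx4 h2' ltnNge pL.
    rewrite eqb0 negbK => h; apply: (hoare_weaken (T := 1) (Q := fun s' => s' = s4)) => //; first exact: hoare_nop.
    move=> s' _ _ ->; rewrite h1' h2'.
    by have -> : minn m.+1 L = minn m L by lia.
  move/eqP; rewrite eqb0 negbK => h.
  have hmL : minn m L = m by lia. have hmS : minn m.+1 L = m.+1 by lia.
  have p2 : 2 ^ m <= x by rewrite pL -hmL.
  apply: (hoare_then (Q1 := fun s' => vr s' vres = m.+1)).
    apply: hoare_asg => [_|s' _ ->]; rewrite /= h1' hmL addn1 //; lia.
  move=> s5 w5 f5 v5.
  have e5 : vr s5 90 = 2 ^ m by rewrite (frv f5) ?h2' ?hmL // inE eq_sym.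
  apply: hoare_asg => [_|s' f' v']; first by rewrite /= e5; apply: leq_trans xC; lia.
  rewrite hmS (frv f') ?v5 //; last by rewrite inE.
  by split=> //; rewrite v' /= e5 addnn -mul2n -expnS.
- rewrite hx2 => s' _ _ [h _]; rewrite h; exact/minn_idPr.
Qed.

Lemma hoare_setup s (Q : mstate -> Prop) :
  vr s vn = n ->
  (forall s', wf s' -> frame [:: vone; vlam; vps; vR1; vR0; vNB; 90; 91; 92; 93] [:: aPw] s s' ->
     env s' -> Q s') ->
  hoare SETUP s (pw lam 30 * G) Q.
Proof.
move=> hn hQ; have G0' := G0; have l0' := lam_gt0; have hln' := ltn_exp_lam.
have nC2 : 2 * n <= C by apply: (@smallC 2) => //; rewrite /xpow expnS expn1; nia.
have c1C : 1 <= C by apply: leq_trans nC2; lia.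
set PS := pPS lam. set b := pB lam.
have hPS : PS = 4 * lam + 40 by [].
have hb : b = 8 * pll lam + 64 by [].
have P2C : 2 ^ PS <= C.
  have nl := exp_lam_le.
  (* [2 ^ lam] is at most [2 * n], so all tabulated powers are polynomial in [n] and below the
     cap. *)
  have -> : 2 ^ PS = (2 ^ lam) ^ 4 * 2 ^ 40 by rewrite hPS expnD (mulnC 4) expnM.
  apply: (@smallC (8 + 40)) => //; apply: xpow_mul; last by rewrite /xpow leq_exp2r // ltnS.
  rewrite /xpow (expnM _ 2 4) leq_exp2r //; apply: leq_trans nl _.
  by rewrite expnS expn1; nia.
have R1C : pR1 lam <= C by apply: (pwC (pw_pR1 l0')).
have NBC : pNB lam <= C by apply: (pwC (pw_pNB l0')).
have R0C : pR0 lam <= C by apply: (pwC (pw_pR0 l0')).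
have bC : b <= C by apply: (pwC (pw_pB l0')).
have PSC : PS <= C by apply: (pwC (pw_pPS l0')).
have lC : 2 * lam <= C by apply: leq_trans nC2; rewrite leq_mul2l lam_le.
apply: (hoare_weaken (T := 1 + (6 * n.+1 + (1 + (1 + ((PS * (1 + 1).+1).+1 + (6 * lam.+1 + (1 + (1 + ((b * 2).+1 + (1 + 1))))))))))
  (Q := env)); last 2 first.
- have c1 : cb lam G 0 1 by apply: cb_const.
  apply: (@cb_mono lam l0' G 19) => //.
  apply: (cb_add l0' c1 (cb_add l0' (cb_n _) (cb_add l0' c1 (cb_add l0' c1 (cb_add l0'
    (cb_S l0' G0' (cb_mul (pw_pPS l0') (cb_const l0' G0' (k := 2) _))) (cb_add l0'
    (cb_mul (pw_const l0' (k := 3) _) (cb_pw G0' (pw_S l0' (pw_lam lam)))) (cb_add l0' c1 (cb_add l0' c1 (cb_add l0'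
    (cb_S l0' G0' (cb_mul (pw_pB l0') (cb_const l0' G0' (k := 1) _))) (cb_add l0' c1 c1)))))))))) => //.
- by move=> s' w' f' h'; apply: hQ => //; apply: frame_all f'.
apply: (hoare_then (Q1 := fun s' => vr s' vone = 1)); first by apply: hoare_asg.
move=> s1 w1 f1 v1.
apply: (hoare_then (Q1 := fun s' => vr s' vlam = lam)).
  by apply: (hoare_log (x := n)) => //; rewrite (frv f1).
move=> s2 w2 f2 v2.
apply: (hoare_then (Q1 := fun s' => vr s' vps = PS)).
  have e : ev (ENum 4 *^ EVar vlam +^ ENum 40) s2 = PS by rewrite [ev _ _]/= v2.
  by apply: hoare_asg => [_|s' _ ->]; rewrite e.
move=> s3 w3 f3 v3.
apply: (hoare_then (Q1 := fun s' => vr s' 90 = 1)); first by apply: hoare_asg.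
move=> s4 w4 f4 v4.
have v34 : vr s4 vps = PS by rewrite (frv f4).
apply: (hoare_then (Q1 := fun s' => forall k, k < PS -> ar s' aPw 0 0 k = 2 ^ k)).
  rewrite -v34; apply: (hoare_for (I := fun m s' => vr s' 90 = 2 ^ m /\ forall k, k < m -> ar s' aPw 0 0 k = 2 ^ k)).
  - by split.
  - rewrite v34 => m s5 s6 hm w6 _ [h1 h2] f6 _ v91.
    have h1' : vr s6 90 = 2 ^ m by rewrite (frv f6).
    have mC j : j <= PS -> 2 ^ j <= C by move=> h; apply: leq_trans P2C; rewrite leq_exp2l.
    apply: (hoare_then (Q1 := fun s' => forall k, k < m.+1 -> ar s' aPw 0 0 k = 2 ^ k)).
      apply: hoare_sto => [_|s' f' _ h' k]; first by rewrite /= h1'; apply: mC; apply: ltnW.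
      rewrite h' /= v91 h1' ltnS leq_eqVlt; case: eqP => [->//|_] /= hk.
      by rewrite (fra f6) // h2.
    move=> s7 w7 f7 h7.
    have e : ev (EVar 90 +^ EVar 90) s7 = 2 ^ m.+1 by rewrite /= (frv f7) // h1' addnn -mul2n -expnS.
    apply: hoare_asg => [_|s' f' ->]; rewrite e; first exact: mC.
    by split=> // k hk; rewrite (fra f') // h7.
  - by rewrite v34 => s' _ _ [].
move=> s5 w5 f5 h5.
have v25 : vr s5 vlam = lam by rewrite (frv f5) // (frv f4) // (frv f3).
apply: (hoare_then (Q1 := fun s' => vr s' 92 = pll lam)); first exact: (hoare_log (x := lam)).
move=> s6 w6 f6 v92.
apply: (hoare_then (Q1 := fun s' => vr s' 93 = b)).
  have e : ev (ENum 8 *^ EVar 92 +^ ENum 64) s6 = b by rewrite [ev _ _]/= v92.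
  by apply: hoare_asg => [_|s' _ ->]; rewrite e.
move=> s7 w7 f7 v93.
apply: (hoare_then (Q1 := fun s' => vr s' vR1 = 1)); first by apply: hoare_asg.
move=> s8 w8 f8 v8.
have v938 : vr s8 93 = b by rewrite (frv f8).
apply: (hoare_then (Q1 := fun s' => vr s' vR1 = pR1 lam)).
  rewrite -{1}v938; apply: (hoare_for (I := fun m s' => vr s' vR1 = 2 ^ m)) => //; last by rewrite v938.
  rewrite v938 => m s9 s10 hm w10 _ h1 f10 _ _.
  have e : ev (EVar vR1 +^ EVar vR1) s10 = 2 ^ m.+1 by rewrite /= (frv f10) // h1 addnn -mul2n -expnS.
  apply: hoare_asg => [_|s' f' ->]; rewrite e //.
  by apply: leq_trans R1C; rewrite leq_exp2l.
move=> s9 w9 f9 v9.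
have f59 : frame [:: 90; 91; 92; 93; vR1] [::] s5 s9.
  apply: frame_trans (frame_all _ _ f6) _ => //; apply: frame_trans (frame_all _ _ f7) _ => //.
  by apply: frame_trans (frame_all _ _ f8) (frame_all _ _ f9).
have f39 : frame [:: 90; 91; 92; 93; vR1] [:: aPw] s3 s9.
  apply: frame_trans (frame_all _ _ f4) _ => //; apply: frame_trans (frame_all _ _ f5) _ => //.
  exact: (frame_all _ _ f59).
apply: (hoare_then (Q1 := fun s' => vr s' vR0 = pR0 lam)).
  have e : ev (ENum 1024 *^ (EVar vps *^ (EVar 93 *^ EVar 93 *^ EVar vlam))) s9 = pR0 lam.
    rewrite [ev _ _](_ : _ = 1024 * (vr s9 vps * (vr s9 93 * vr s9 93 * vr s9 vlam))) //.
    by rewrite (frv f39) // v3 (frv f9) // v938 (frv f59) // v25.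
  by apply: hoare_asg => [_|s' _ ->]; rewrite e.
move=> s10 w10 f10 v10.
have v910 : vr s10 vR1 = pR1 lam by rewrite (frv f10).
apply: hoare_asg => [_|s11 f11 v11]; first by rewrite [ev _ _]/= v910.
have e11 v : v \in [:: vn; vone; vlam; vps; vR1] -> vr s11 v = vr s9 v.
  by rewrite !inE => h; rewrite (frv f11) ?(frv f10) // !inE; move: h; lia.
split.
- by rewrite e11 // (frv f39) // (frv f3) // (frv f2) // (frv f1).
- by rewrite e11 // (frv f39) // (frv f3) // (frv f2).
- by rewrite e11 // (frv f59).
- by rewrite e11 // (frv f39).
split.
- by rewrite (frv f11).
- by rewrite e11.
- by rewrite v11 [ev _ _]/= v910.
- by move=> k hk; rewrite (fra f11) // (fra f10) // (fra f9) // (fra f8) // (fra f7) // (fra f6) // h5.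
Qed.

(** The index [j] is the scale at which the estimate was made. At [j = 0] the rounding unit is 1 and
    the estimate is exact, which is why no lower bound on [D] is needed there. *)
Definition rounded_ok B pn u v (w : nat) : Prop :=
  forall D, isd B D u v -> exists j, ((j == 0) || (2 ^ j <= D)) /\
    0 < w <= D + 2 * (rounding n pn j).-1 + 1.

Lemma pPS_bounds : 16 * pPS lam + 7 <= pw lam 12.
Proof.
apply: (@leq_trans (2 ^ 11 * lam)).
  have ar l : 0 < l -> 16 * (4 * l + 40) + 7 <= 2048 * l by clear; lia.
  exact: ar.
by apply: (@pw_mul _ 11 1); [exact: (pw_const lam_gt0) | exact: pw_lam].
Qed.

(** Origin of [pPS = 4 * lam + 40]: the number of positions of the witness product is at most
    [2 ^ (4 * lam + 17)], and the first threshold of the hitting set must be at least half the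
    number of sets. *)
Lemma pPS_square m : m <= 4 * (pPS lam * n) -> 2 * (m * m) <= 2 ^ pPS lam.
Proof.
move=> hm; have hp : pPS lam <= 2 ^ (lam + 6).
  have ar l p : l < p -> 4 * l + 40 <= p * 64 by clear; lia.
  by rewrite expnD -[2 ^ 6]/64; apply: ar; apply: ltn_expl.
have h1 : m <= 2 ^ (2 + (lam + 6 + lam)).
  apply: leq_trans hm _; rewrite !expnD; apply: leq_mul => //.
  by rewrite -expnD; apply: leq_mul => //; apply: ltnW; exact: ltn_exp_lam.
apply: (@leq_trans (2 ^ (1 + ((2 + (lam + 6 + lam)) + (2 + (lam + 6 + lam)))))).
  by rewrite [2 ^ (1 + _)]expnD; apply: leq_mul => //; rewrite expnD; apply: leq_mul.
have ar l : 1 + (2 + (l + 6 + l) + (2 + (l + 6 + l))) <= 4 * l + 40 by clear; lia.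
by rewrite leq_exp2l //; apply: ar.
Qed.

Lemma hoare_main (E : nat -> nat -> bool) pn s (Q : mstate -> Prop) :
  let B := dl n E in
  vr s vn = n -> vr s vpn = pn -> pn <= n ->
  (forall u v, u < n -> v < n -> ar s aIO 0 0 (u * n + v) = E u v) ->
  (forall i, i < lam -> exists M, [/\ allowed (n %/ 2 ^ i) M,
     2 ^ (i - (deg_exp n pn i + 2)) <= M & M <= n]) ->
  (forall s', wf s' -> (forall u v, u < n -> v < n ->
     (forall b, ar s' aIO 0 0 (n * n + u * n + v) = b.+1 -> B b u v) /\
     rounded_ok B pn u v (ar s' aIO 0 0 (n * n + u * n + v))) -> Q s') ->
  hoare MAIN s (pw lam 420 * G) Q.
Proof.
move=> B hn hpn pnn hE hall hQ; have G0' := G0; have l0' := lam_gt0.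
have hB : balls n B by apply: balls_dl.
have nC : n <= C by apply: (@smallC 1) => //; rewrite /xpow expn1.
have nnC : 2 * (n * n) <= C by apply: (@smallC 3) => //; rewrite /xpow !expnS expn0; nia.
have lC := @leq_lamC n C n0 KC hKC hC lam lam_gt0 lam_le.
(* Before scale [i] the pairs at distance below [2 ^ (i + 1)] are settled. At [i = 0] nothing is
   claimed; the first scale treats all distances below 4, with every vertex as a source. *)
pose best_done i s' := forall u v D, u < n -> v < n -> isd B D u v -> 0 < i -> D < 2 ^ i.+1 ->
  exists j, ((j == 0) || (2 ^ j <= D)) /\
    0 < ar s' aBest 0 u v <= D + 2 * (rounding n pn j).-1 + 1.
pose LI (Rr : nat -> nat -> nat -> nat) i s' := [/\ env s', vr s' vpn = pn,
  forall j y v, ar s' aR j y v = Rr j y v, best_sound n B s' & best_done i s' /\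
  exists Sq, [/\ vr s' 40 = size Sq, forall x, x < size Sq -> ar s' aS 0 0 x = nth 0 Sq x /\ nth 0 Sq x < n,
    size Sq * 2 ^ i <= 4 * (pPS lam * n) & hits n B i Sq]].
have nn1 : 8 * n.+1 * n.+1 <= 32 * (n * n) by clear -n0; nia.
have nn2 : 16 * n.+1 <= 32 * (n * n) by clear -n0; nia.
apply: (hoare_weaken (T := pw lam 30 * G + (pw lam 70 * G + (32 * (n * n) + (1 + (32 * (n * n) +
   ((lam * (1 + (1 + (pw lam 80 * G + (pw lam 80 * G + (pw lam 60 * G + pw lam 400 * G))))).+1).+1 +
   (1 + (1 + 2 ^ 6 * (n * n)))))))))
  (Q := fun s' => forall u v, u < n -> v < n ->
     (forall b, ar s' aIO 0 0 (n * n + u * n + v) = b.+1 -> B b u v) /\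
     rounded_ok B pn u v (ar s' aIO 0 0 (n * n + u * n + v)))); last 2 first.
- have c1 : cb lam G 0 1 by apply: cb_const.
  have cp k : cb lam G k (pw lam k * G) by exact: leqnn.
  have cn : cb lam G 6 (2 ^ 6 * (n * n)).
    by apply: (@cb_mul lam G 6 0); [exact: (pw_const l0' (leqnn _)) | rewrite /cb mul1n].
  have cN := cb_nn (leqnn 32).
  refine (cb_mono l0' _ (cb_add l0' (cp 30) (cb_add l0' (cp 70) (cb_add l0' cN (cb_add l0' c1 (cb_add l0' cN
   (cb_add l0' (cb_S l0' G0' (cb_mul (pw_lam lam) (cb_S l0' G0' (cb_add l0' c1 (cb_add l0' c1 (cb_add l0' (cp 80)
     (cb_add l0' (cp 80) (cb_add l0' (cp 60) (cp 400)))))))))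
   (cb_add l0' c1 (cb_add l0' c1 cn))))))))).
  by [].
- by move=> s' w' _ h; apply: hQ.
apply: (hoare_then (Q1 := fun s' => frame [:: vone; vlam; vps; vR1; vR0; vNB; 90; 91; 92; 93] [:: aPw] s s' /\ env s')).
  exact: hoare_setup.
move=> s1 w1 _ [f1 env1].
apply: (hoare_then (Q1 := fun s' => forall j u v, j <= lam -> u < n -> v < n -> (ar s' aR j u v != 0) = B (2 ^ j) u v)).
  apply: (hoare_reach n0 hG hKC hC hO hn1 lam_gt0 lam_le ltn_exp_lam exp_lam_le (E := E) env1) => // u v hu hv.
  by rewrite (fra f1) // hE.
move=> s2 w2 f2 hR.
pose Rr j y v := ar s2 aR j y v.
have env2 := env_frame env1 f2 isT isT.
have pn2 : vr s2 vpn = pn by rewrite (frv f2) // (frv f1).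
apply: (hoare_then (Q1 := fun s' => forall x, x < n -> ar s' aS 0 0 x = x)).
  apply: (@hoare_fill P C WP (fun _ _ x => x)) => //; rewrite ?(env_one env2) ?(env_n env2) //.
  - move=> j u x s' _ _ hx _ _ _ _ x22 _; rewrite /= x22; split=> //.
    by apply: leq_trans nC; apply: ltnW.
  - by move=> s' w' f' h' x hx; rewrite h' hx.
move=> s3 w3 f3 hS; have env3 := env_frame env2 f3 isT isT.
apply: (hoare_then (Q1 := fun s' => vr s' 40 = n)).
  by apply: hoare_asg => [_|s' _ ->]; rewrite /= (env_n env3).
move=> s4 w4 f4 v40; have env4 := env_frame env3 f4 isT isT.
apply: (hoare_then (Q1 := fun s' => forall u v, u < n -> v < n -> ar s' aBest 0 u v = 0)).
  apply: (@hoare_fill P C WP (fun _ _ _ => 0)) => //; rewrite ?(env_one env4) ?(env_n env4) //.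
  by move=> s' w' f' h' u v hu hv; rewrite h' hu hv.
move=> s5 w5 f5 hb5; have env5 := env_frame env4 f5 isT isT.
apply: (hoare_then (Q1 := LI Rr lam)).
  have vl5 := env_lam env5; rewrite -vl5; apply: (hoare_for (I := LI Rr)); last by rewrite vl5.
    split=> //.
    - by rewrite (frv f5) // (frv f4) // (frv f3).
    - by move=> j y v; rewrite (fra f5) // (fra f4) // (fra f3).
    - by move=> u v b hu hv; rewrite hb5.
    - split=> //; exists (iota 0 n); rewrite size_iota; split.
      + by rewrite (frv f5).
      + by move=> x hx; rewrite nth_iota // (fra f5) // (fra f4) // hS.
      + rewrite muln1 mulnA leq_pmull // muln_gt0 /= /pPS addn_gt0 orbT //.
      + move=> u v D hu hv hD _; exists u, 0; rewrite mem_iota subn0; split=> //; exact: (isd_refl hB).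
  rewrite vl5 => i s6 s7 hi w7 _ [env6 pn6 R6 bs6 [bd6 [Sq [k6 S6 sz6 h6]]]] f7 _ v72.
  have env7 := env_frame env6 f7 isT isT.
  set r := 2 ^ i in sz6; set k := size Sq in k6 S6 sz6.
  have r0 : 0 < r by rewrite expn_gt0.
  have rn : r <= n by apply: scale_le.
  have iPS : i < pPS lam by have ar l j : j < l -> j < 4 * l + 40 by [clear; lia]; exact: ar.
  apply: (hoare_weaken (T := 1 + (1 + (pw lam 80 * G + (pw lam 80 * G + (pw lam 60 * G + pw lam 400 * G)))))
    (Q := LI Rr i.+1)) => //.
  apply: (hoare_then (Q1 := fun s' => vr s' 48 = r)).
    have e : ev (E1 aPw (EVar 72)) s7 = r by rewrite /= v72 (env_pw env7).
    by apply: hoare_asg => [_|s' _ ->]; rewrite e //; apply: leq_trans nC.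
  move=> s8 w8 f8 v48; have env8 := env_frame env7 f8 isT isT.
  apply: (hoare_then (Q1 := fun s' => vr s' 42 = i.+2)).
    have e : ev (EVar 72 +^ ENum 2) s8 = i.+2 by rewrite /= (frv f8) // v72 addn2.
    by apply: hoare_asg => [_|s' _ ->]; rewrite e //; apply: leq_trans lC.
  move=> s9 w9 f9 v42; have env9 := env_frame env8 f9 isT isT.
  have f69 : frame [:: 72; 48; 42] [::] s6 s9.
    by apply: frame_trans (frame_all _ _ f7) (frame_trans (frame_all _ _ f8) (frame_all _ _ f9)).
  have S9 x : x < k -> ar s9 aS 0 0 x = nth 0 Sq x /\ nth 0 Sq x < n by move=> hx; rewrite (fra f69) //; exact: S6.
  have k9 : vr s9 40 = k by rewrite (frv f69).
  (* From [size Sq * 2 ^ i <= 4 * (pPS lam * n)], multiplied by 4 for the distances below [4 * r];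
     the 1 makes the inequality strict. *)
  pose a := 16 * pPS lam + 1.
  have r4 : 2 ^ i.+2 = 4 * r by rewrite !expnS mulnA.
  have ha : a + 5 < pw lam 12.
    have := pPS_bounds; rewrite /a; move: (pPS lam) (pw lam 12); clear; lia.
  have ha' : a < pw lam 12 by apply: leq_ltn_trans ha; apply: leq_addr.
  have hka : k * (4 * r) < a * n.
    rewrite mulnCA /a mulnDl mul1n; move: sz6 n0; rewrite -mulnA; move: (k * r) (pPS lam * n); clear; lia.
  have i2 : i.+2 <= lam.+1 by [].
  apply: (hoare_then (Q1 := fun s' => frame dV (aDf :: bpA) s9 s' /\
      forall x v, x < k -> v < n -> ar s' aDf 0 x v = encd B (4 * r).-1 (nth 0 Sq x) v)).
    apply: (hoare_dist n0 hG hKC hC hO hn1 lam_gt0 lam_le ltn_exp_lam exp_lam_le (B := B) (Rr := Rr) (S := nth 0 Sq) (k := k) (m := i.+2) (a := a)) => //.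
    - by move=> s' ej ey er f; rewrite /= (fra f) // (fra f69) // R6.
    - by move=> j y v hj hy hv; apply: hR => //; apply: leq_trans hi.
    - by rewrite r4.
    - by move=> s' _ f'; rewrite r4.
  move=> s10 w10 _ [f10 D10]; have env10 := env_frame env9 f10 isT isT.
  apply: (hoare_then (Q1 := fun s' => frame dV (aDb :: bpA) s10 s' /\
      forall x v, x < k -> v < n -> ar s' aDb 0 x v = encd (fun c u v => B c v u) (4 * r).-1 (nth 0 Sq x) v)).
    apply: (hoare_dist n0 hG hKC hC hO hn1 lam_gt0 lam_le ltn_exp_lam exp_lam_le (B := fun c u v => B c v u) (Rr := fun j y v => Rr j v y) (S := nth 0 Sq) (k := k) (m := i.+2) (a := a)) => //.
    - exact: balls_rev.
    - by rewrite (frv f10).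
    - by rewrite (frv f10).
    - by move=> x hx; rewrite (fra f10) //; apply: S9.
    - by move=> s' ej ey er f; rewrite /= (fra f) // (fra f10) // (fra f69) // R6.
    - by move=> j y v hj hy hv; apply: hR => //; apply: leq_trans hi.
    - by rewrite r4.
    - by move=> s' _ f'; rewrite r4.
  move=> s11 w11 _ [f11 D11]; have env11 := env_frame env10 f11 isT isT.
  have f911 : frame dV (aDf :: aDb :: bpA) s9 s11.
    by apply: frame_trans (frame_all _ _ f10) (frame_all _ _ f11).
  have D10' x v : x < k -> v < n -> ar s11 aDf 0 x v = encd B (4 * r).-1 (nth 0 Sq x) v.
    by move=> hx hv; rewrite (fra f11) // D10.
  have [M [al1 al2 al3]] := hall i hi.
  have b611 u v w : ar s11 aBest u v w = ar s6 aBest u v w by rewrite (fra f911) // (fra f69).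
  apply: (hoare_then (Q1 := fun s' => [/\ frame (mv FIN) [:: aA; aB; aC; aBest] s11 s', best_sound n B s' & best_mono n s11 s' /\
     (forall u v x d1 d2, u < n -> v < n -> x < k -> isd B d1 u (nth 0 Sq x) ->
        isd B d2 (nth 0 Sq x) v -> d1 < 4 * r -> d2 < 4 * r ->
        0 < ar s' aBest 0 u v <= d1 + d2 + 2 * (rounding n pn i).-1 + 1)])).
    apply: (hoare_fin n0 hG hKC hC hO lam_gt0 lam_le ltn_exp_lam exp_lam_le (B := B) (Sq := Sq) (i := i) (pn := pn) (M := M) (a := a)) => //.
    - by rewrite (frv f911) // (frv f69).
    - by rewrite (frv f911) // k9.
    - by rewrite (frv f911) // (frv f9).
    - by rewrite (frv f911) // (frv f9) // (frv f8).
    - by move=> x /S9[].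
    - by move=> u v b; rewrite b611; apply: bs6.
  move=> s12 w12 _ [f12 bs12 [mo12 co12]]; have env12 := env_frame env11 f12 isT isT.
  have g12 v : v \in [:: 40; 48; vpn] -> vr s12 v = vr s9 v.
    by rewrite !inE => hv; rewrite (frv f12) ?(frv f911) //= !inE; move: hv; clear; lia.
  have hPSq : (k * r) * (k * (2 * r)) <= 2 ^ pPS lam.
    by rewrite (mulnCA k 2) mulnCA; apply: pPS_square.
  have rr : 0 < r <= n by rewrite r0.
  apply: (hoare_next n0 hG hKC hC hO hn1 lam_gt0 lam_le ltn_exp_lam exp_lam_le (B := B) (Sq := Sq) (r := r) (a := a)) => //.
  - by rewrite g12.
  - by rewrite g12 // (frv f9).
  - by move=> x hx; rewrite (fra f12) // (fra f911) //; apply: S9.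
  - by move=> x v hx hv; rewrite (fra f12) // D10'.
  - by move=> x v hx hv; rewrite (fra f12) // D11.
  move=> s13 Sq' w13 f13 k13 S13 sz13 n13.
  have env13 := env_frame env12 f13 isT isT.
  have b13 u v w : ar s13 aBest u v w = ar s12 aBest u v w by rewrite (fra f13).
  split=> //.
  - by rewrite (frv f13) // g12 // (frv f69).
  - by move=> j y v; rewrite (fra f13) // (fra f12) // (fra f911) // (fra f69).
  - by move=> u v b; rewrite b13; apply: bs12.
  split.
    move=> u v D hu hv hD _ hlt; rewrite b13.
    (* A pair settled before keeps its estimate. Otherwise [i = 0] or
       [D >= 2 ^ (i + 1) > reach_thr i], so a source splits a shortest path; both legs are at most
       [D], hence below [4 * r]. *)
    case: (boolP ((0 < i) && (D < 2 ^ i.+1))) => [/andP[i0 hD2]|hn2].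
      have [j [j1 j2]] := bd6 u v D hu hv hD i0 hD2; exists j; split=> //.
      by apply: mo12 => //; rewrite b611.
    have rD : (i == 0) || (r <= D).
      move: hn2; rewrite negb_and -leqNgt -leqNgt expnS -/r leqn0 => /orP[->//|h].
      by rewrite (leq_trans _ h) ?orbT // leq_pmull.
    have thD : reach_thr i <= D.
      move: hn2; rewrite negb_and -leqNgt -leqNgt leqn0 => /orP[/eqP->//|h].
      by apply: leq_trans h; apply: ltnW; apply: reach_thr_lt.
    exists i; split=> //.
    have [t [d [ht ld i1 i2']]] := h6 u v D hu hv hD thD.
    have htk : index t Sq < k by rewrite index_mem.
    have dD : d <= D.
      case/orP: rD => [/eqP i0|h].
        by move: ld; rewrite i0 /= leqn0 => /eqP->.
      by apply: leq_trans h; apply: leq_trans ld _; exact: leq_pred.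
    have := co12 u v (index t Sq) d (D - d) hu hv htk; rewrite nth_index // subnKC //.
    by apply=> //; rewrite -r4; [apply: leq_ltn_trans dD hlt | apply: leq_ltn_trans (leq_subr _ _) hlt].
  exists Sq'; split=> //.
    by rewrite expnS mulnCA; move: sz13; rewrite -/r mulnCA; move: (size Sq' * r) (pPS lam * n); clear; lia.
  by apply: (hits_step hB _ h6) => // x /S6[].
move=> s6 w6 _ [env6 pn6 R6 bs6 [bd6 _]].
apply: (hoare_then (Q1 := fun s' => vr s' 95 = n * n)).
  apply: hoare_asg => [_|s' _ ->]; rewrite /= (env_n env6) //.
  by apply: leq_trans nnC; apply: leq_pmull.
move=> s7 w7 f7 v95; have env7 := env_frame env6 f7 isT isT.
apply: (hoare_then (Q1 := fun s' => vr s' 94 = 2 * (n * n))).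
  by apply: hoare_asg => [_|s' _ ->]; rewrite /= v95 addnn -mul2n.
move=> s8 w8 f8 v94; have env8 := env_frame env7 f8 isT isT.
have v958 : vr s8 95 = n * n by rewrite (frv f8).
apply: (@hoare_fill P C WP (fun _ _ x => ar s6 aBest 0 ((x - n * n) %/ n) ((x - n * n) %% n))) => //;
  rewrite ?(env_one env8) v94.
- move=> j y x s' hj hy hx w' f' x20 x21 x22 _; have env' := env_frame env8 f' isT isT.
  rewrite /= x22 (frv f') // v958 (env_n env') (fra f') // (fra f8) // (fra f7) //; split=> //.
  by case: w6.
- by have := n0; rewrite -[2 ^ 6]/64; clear; nia.
- move=> s' w' f' h' u v hu hv.
  have idx : n * n + u * n + v < 2 * (n * n) by move: hu hv; clear; nia.
  have e1 : (n * n + u * n + v - n * n) %/ n = u by rewrite -addnA addKn divnMDl // divn_small // addn0.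
  have e2 : (n * n + u * n + v - n * n) %% n = v by rewrite -addnA addKn modnMDl modn_small.
  rewrite h' idx /= e1 e2; split=> [b|D hD]; first exact: bs6.
  apply: bd6 => //; apply: (ltn_trans (isd_lt hB hu hv hD)); apply: (ltn_trans ltn_exp_lam).
  by rewrite ltn_exp2l.
Qed.

End Main.

(** * Link with the statement *)

(* Each step changes at most one memory cell. *)
Lemma exec_changes w c s t s' : exec w c s t s' ->
  forall X, uniq X -> all (fun x => memory s' x != memory s x) X -> size X <= t.
Proof.
have none (s0 : state) t0 X : all (fun x => memory s0 x != memory s0 x) X -> size X <= t0.
  by case: X => //= x X; rewrite eqxx.
have cat (s0 s1 s2 : state) t1 t2 :
    (forall X, uniq X -> all (fun x => memory s1 x != memory s0 x) X -> size X <= t1) ->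
    (forall X, uniq X -> all (fun x => memory s2 x != memory s1 x) X -> size X <= t2) ->
    forall X, uniq X -> all (fun x => memory s2 x != memory s0 x) X -> size X <= t1 + t2.
  move=> h1 h2 X uX /allP aX.
  rewrite -(count_predC (fun x => memory s1 x != memory s0 x)) -!size_filter.
  apply: leq_add; [apply: h1 | apply: h2]; rewrite ?filter_uniq ?filter_all //.
  apply/allP => x; rewrite mem_filter /= negbK => /andP[/eqP e hx].
  by rewrite e; apply: aX.
elim=> {c s t s'}.
- by move=> s X _; apply: none.
- by move=> s x a _ X _; apply: (none s).
- by move=> s o x y z _ X _; apply: (none s).
- by move=> s x y _ _ X _; apply: (none s).
- move=> s x y _ _ X uX /allP aX; rewrite -[1]/(size [:: reg s x]).
  apply: uniq_leq_size => // z hz; rewrite inE; have := aX z hz.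
  by rewrite /= /update; case: (z =P reg s x) => //; rewrite eqxx.
- by move=> s s1 s2 c1 c2 t1 t2 _ h1 _ h2; apply: cat h1 h2.
- by move=> s s' x c1 c2 t _ _ h X uX aX; apply: leqW; apply: h.
- by move=> s s' x c1 c2 t _ _ h X uX aX; apply: leqW; apply: h.
- by move=> s s1 s2 x c t1 t2 _ _ h1 _ h2 X uX aX; apply: leqW; apply: (cat _ _ _ _ _ h1 h2).
- by move=> s x c _ X _; apply: none.
Qed.

Lemma size_row_major m n (A : 'M[nat]_(m, n)) : size (row_major A) = m * n.
Proof. by rewrite size_allpairs !size_enum_ord. Qed.

Lemma nth_row_major m n (A : 'M[nat]_(m, n)) (i : 'I_m) (j : 'I_n) :
  nth 0 (row_major A) (i * n + j) = A i j.
Proof.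
have -> : row_major A = flatten [seq [seq A i j | j <- enum 'I_n] | i <- enum 'I_m] by [].
have sh : shape [seq [seq A i j | j <- enum 'I_n] | i <- enum 'I_m] = nseq m n.
  rewrite /shape -map_comp -[in RHS](size_enum_ord m).
  by elim: (enum 'I_m) => //= x l ->; rewrite size_map size_enum_ord.
have := nth_flatten 0 [seq [seq A i j | j <- enum 'I_n] | i <- enum 'I_m] (i * n + j).
move=> ->; rewrite sh.
have gen q r : q < m -> r < n -> reshape_index (nseq m n) (q * n + r) = q /\
    reshape_offset (nseq m n) (q * n + r) = r.
  move=> hq hr; have e : flatten_index (nseq m n) q r = q * n + r.
    rewrite /flatten_index; congr (_ + _).
    by rewrite (_ : take q (nseq m n) = nseq q n) ?sumn_nseq 1?mulnC // take_nseq // ltnW.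
  have hn : r < nth 0 (nseq m n) q by rewrite nth_nseq hq.
  by rewrite -e flatten_indexKl ?flatten_indexKr.
have [-> ->] := gen i j (ltn_ord i) (ltn_ord j).
rewrite (nth_map i) ?size_enum_ord // (nth_map j) ?size_enum_ord //.
by rewrite !nth_ord_enum.
Qed.

(** * Walks and distances of the given graph in terms of balls *)

Section Graph.

Variables (n : nat) (e : rel 'I_n).

Definition edge (x y : nat) : bool :=
  [exists a : 'I_n, exists b : 'I_n, [&& val a == x, val b == y & e a b]].

Lemma edgeE (a b : 'I_n) : edge a b = e a b.
Proof.
apply/existsP/idP => [[a' /existsP[b' /and3P[/eqP/val_inj-> /eqP/val_inj->]]]|h] //.
by exists a; apply/existsP; exists b; rewrite !eqxx.
Qed.

Lemma walk_dl (u v : 'I_n) k : walk e u v k -> dl n edge k u v.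
Proof.
case/existsP => q /andP[hq /eqP hl].
elim: k q v hq hl => [|k IH] q v hq hl.
  by move: hl; rewrite tuple0 /= => ->; rewrite eqxx.
move: hq hl; case: q => q /= /eqP; case/lastP: q => // q z; rewrite size_rcons => -[sz].
rewrite rcons_path last_rcons => /andP[h1 h2] <-.
have sz' : size q == k by apply/eqP.
have h := IH (Tuple sz') (last u q) h1 erefl.
by apply/orP; right; apply/hasP; exists (val (last u q)); rewrite ?mem_iota ?ltn_ord // h edgeE.
Qed.

Lemma walk_connect u v k : walk e u v k -> connect e u v.
Proof. by case/existsP => q /andP[h1 /eqP h2]; apply/connectP; exists q. Qed.

(** [dl] bounds the number of edges while [walk] prescribes it, so only some [j <= k] can be
    expected; the minimum over all lengths is not affected. *)
Lemma dl_walk_le (u : 'I_n) (v : 'I_n) k : dl n edge k u v -> exists2 j, j <= k & walk e u v j.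
Proof.
elim: k v => [|k IH] v /=.
  by move=> /eqP/val_inj <-; exists 0 => //; apply/existsP; exists [tuple]; rewrite /= eqxx.
case/orP=> [/IH[j hj h]|/hasP[y]]; first by exists j => //; apply: leqW.
rewrite mem_iota add0n => /= hy /andP[].
rewrite -[y]/(val (Ordinal hy)) edgeE => /IH[j hj /existsP[q /andP[h1 /eqP h2]]] h3.
exists j.+1 => //; apply/existsP; exists [tuple of rcons q v].
by rewrite /= rcons_path h1 h2 h3 last_rcons eqxx.
Qed.

Lemma dist_isd (u v : 'I_n) D : dist e u v = Some D -> isd (dl n edge) D u v.
Proof.
rewrite /dist; case: {-}_ / idP => // h [<-].
case: ex_minnP => m hm hmin; rewrite /isd walk_dl //=.
case: m hm hmin => // m _ hmin; apply/orP; right; apply/negP => /dl_walk_le[j hj /hmin]; lia.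
Qed.

Lemma dist_none (u v : 'I_n) : dist e u v = None -> forall k, ~~ dl n edge k u v.
Proof.
rewrite /dist; case: {-}_ / idP => // h _ k; apply/negP => /dl_walk_le[j _ /walk_connect] //.
Qed.

End Graph.

(** * Real exponents: the rounding error and the bound on the entries *)

Section Exponents.

Import Order.TTheory GRing.Theory Num.Theory.

Variables (R : realType) (p : R).
Hypotheses (hp0 : (0 <= p)%R) (hp1 : (p <= 1)%R).
Variable n : nat.
Hypothesis n0 : 0 < n.

Let pn : nat := Num.truncn (p * n%:R)%R.

Lemma pn_le : (pn%:R <= p * n%:R :> R)%R.
Proof. by rewrite truncn_le mulr_ge0. Qed.

Lemma pn_gt : (p * n%:R < pn.+1%:R :> R)%R.
Proof. exact: truncnS_gt. Qed.

Lemma pn_n : pn <= n.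
Proof.
rewrite -(ler_nat R); apply: le_trans pn_le _.
by rewrite -[X in (_ <= X)%R]mul1r ler_wpM2r.
Qed.

Lemma deg_exp_le i : ((deg_exp n pn i)%:R <= i%:R * p :> R)%R.
Proof.
have nR : (0 < n%:R :> R)%R by rewrite ltr0n.
rewrite -(ler_pM2r nR) -natrM; apply: (@le_trans _ _ (i * pn)%:R%R).
  by rewrite ler_nat; apply: leq_trunc_div.
by rewrite natrM -mulrA ler_wpM2l // pn_le.
Qed.

(** One unit is lost in the division by [n]; the truncation of [p n] loses at most [i / n <= 1],
    another unit. *)
Lemma deg_exp_ge i : i <= n -> (i%:R * p <= (deg_exp n pn i + 2)%:R :> R)%R.
Proof.
move=> hi; have nR : (0 < n%:R :> R)%R by rewrite ltr0n.
rewrite -(ler_pM2r nR) -mulrA; apply: (@le_trans _ _ (i%:R * pn.+1%:R)%R).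
  by rewrite ler_wpM2l // ltW // pn_gt.
rewrite -!natrM ler_nat mulnS mulnDl.
have : i * pn < (deg_exp n pn i).+1 * n by apply: ltn_ceil.
rewrite mulSn; lia.
Qed.

Lemma natr_exp2 j : ((2 ^ j)%:R = 2%:R `^ j%:R :> R)%R.
Proof. by rewrite natrX powR_mulrn // ler0n. Qed.

(** For [e = deg_exp n pn i], twice the loss per leg is at most [2 ^ e <= (2 ^ i) ^ p <= D ^ p]. At
    [i = 0] there is no loss, so [D] may be 0. *)
Lemma rounding_le i D : (i == 0) || (2 ^ i <= D) ->
  ((2 * (rounding n pn i).-1)%:R <= D%:R `^ p :> R)%R.
Proof.
rewrite /rounding => /orP[/eqP->|hD].
  by rewrite /deg_exp mul0n div0n /= muln0 powR_ge0.
have h : ((2 ^ deg_exp n pn i)%:R <= D%:R `^ p :> R)%R.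
  apply: (@le_trans _ _ ((2 ^ i)%:R `^ p)%R).
    by rewrite !natr_exp2 -powRrM ler_powR ?deg_exp_le // ler1n.
  by apply: ge0_ler_powR; rewrite ?nnegrE ?ler0n // ler_nat.
apply: le_trans h; rewrite ler_nat; case: (deg_exp n pn i) => [|e] //=.
by rewrite expnS leq_mul2l /= leq_pred.
Qed.

Definition budget (l : nat) : nat := Num.truncn (l%:R `^ (1 - p) : R)%R.

Lemma budget_le l : 0 < l -> budget l <= l.
Proof.
move=> hl; rewrite -(ler_nat R); apply: (@le_trans _ _ (l%:R `^ (1 - p))%R); first by rewrite truncn_le powR_ge0.
by rewrite -[X in (_ <= X)%R]powRr1 ?ler0n // ler_powR ?ler1n // gerDl oppr_le0.
Qed.

(** Since [deg_exp + 2] is at least [i p], the exponent on the left is at most [i (1 - p)]; when the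
    truncated difference is 0 it suffices that [1 - p] is nonnegative. *)
Lemma budget_ge i : i <= n -> 2 ^ (i - (deg_exp n pn i + 2)) <= budget (2 ^ i).
Proof.
move=> hi; rewrite /budget truncn_ge_nat ?powR_ge0 // !natr_exp2 -powRrM.
apply: ler_powR; first by rewrite ler1n.
case: (leqP (deg_exp n pn i + 2) i) => h.
  rewrite natrB // mulrBr mulr1 lerD2l lerN2; exact: deg_exp_ge.
have -> : i - (deg_exp n pn i + 2) = 0 by lia.
by rewrite mulr_ge0 ?ler0n ?subr_ge0.
Qed.

Lemma budget_gt0 l : 0 < l -> 0 < budget l.
Proof.
move=> hl; rewrite /budget truncn_ge_nat ?powR_ge0 //.
by rewrite -[X in (X <= _)%R](powRr0 l%:R) ler_powR ?ler1n ?subr_ge0.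
Qed.

End Exponents.

Definition ones (m n : nat) : 'M[nat]_(m, n) := (\matrix_(i, j) 1)%R.

(** * The given program as an oracle for the allowed shapes *)

Section Oracle.

Variables (R : realType) (p : R) (P : program) (T : nat -> nat -> nat -> nat -> nat) (c n : nat).
Hypotheses (hp0 : (0 <= p)%R) (hp1 : (p <= 1)%R) (n0 : 0 < n).
Hypothesis hP : forall (n1 n2 n3 M : nat) (A : 'M[nat]_(n1, n2)) (B : 'M[nat]_(n2, n3)),
  0 < n1 -> 0 < n2 -> 0 < n3 -> entries_le A M -> entries_le B M ->
  exists (t : nat) (s : state) (C : 'M[nat]_(n1, n3)),
    [/\ exec (word_length c (n1 + n2 + n3 + M)) P
          (initial [:: n1; n2; n3] (row_major A ++ row_major B)) t s,
        t <= T n1 n2 n3 M, is_minplus A B C &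
        forall (i : 'I_n1) (j : 'I_n3), memory s (n1 * n2 + n2 * n3 + i * n3 + j) = C i j].

Definition total : nat := \max_(1 <= l < n.+1) T n (n %/ l) n (budget p l).

Definition allowed (k M : nat) : Prop :=
  exists l, [/\ 0 < l <= n, k = n %/ l & M = budget p l].

Lemma total_ge l : 0 < l <= n -> T n (n %/ l) n (budget p l) <= total.
Proof.
move=> hl; rewrite /total (bigD1_seq l) ?iota_uniq ?mem_index_iota //=.
exact: leq_maxl.
Qed.

(* On matrices of ones the program has to change n * n cells. *)
Lemma total_square : n * n <= total.
Proof.
(* At [l = n] the inner dimension is 1. All entries of the product are 2, whereas the output cells
   are initially 0, so each of them has to be changed. *)
have hl : 0 < n <= n by rewrite n0 leqnn.
apply: leq_trans (total_ge hl).
have kk : n %/ n = 1 by rewrite divnn n0.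
have M0 : 0 < budget p n by apply: budget_gt0.
have le1 a b : entries_le (ones a b) (budget p n) by move=> i j; rewrite mxE.
have k0 : 0 < n %/ n by rewrite kk.
have [t [s [D [he ht hD hm]]]] := @hP n _ n _ (ones n (n %/ n)) (ones (n %/ n) n) n0 k0 n0 (le1 _ _) (le1 _ _).
apply: leq_trans ht; set off := n * (n %/ n) + n %/ n * n in hm.
rewrite -(size_iota off (n * n)); apply: (exec_changes he); first exact: iota_uniq.
apply/allP => x; rewrite mem_iota => /andP[h1 h2].
have hi : (x - off) %/ n < n by rewrite ltn_divLR //; lia.
have hj : (x - off) %% n < n by rewrite ltn_mod.
have := hm (Ordinal hi) (Ordinal hj); rewrite -addnA /= -divn_eq subnKC // => ->.
have [[k ->] _] := hD (Ordinal hi) (Ordinal hj); rewrite !mxE /= nth_default //.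
by rewrite size_cat !size_row_major.
Qed.

(** The private memory coincides with the initial memory of the specification as a function: the two
    matrices, then zeros. The exponent [4 * c] bounds the words of [P], as [n + k + n + M <= 4 * n]
    and [2 * (4 * n) <= (n + 1) ^ 4]. *)
Lemma oracle_of : oracle P n (n.+1 ^ (4 * c)) total allowed.
Proof.
move=> k M m f g [l [hl ek eM]] k0 hf hg hz.
have /andP[l0 ln] := hl.
have Mn : M <= n by rewrite eM; apply: leq_trans ln; apply: budget_le.
have kn : k <= n by rewrite ek leq_div.
pose A : 'M[nat]_(n, k) := (\matrix_(i, j) f i j)%R.
pose B : 'M[nat]_(k, n) := (\matrix_(i, j) g i j)%R.
have hA : entries_le A M by move=> i j; rewrite mxE; case: (hf i j (ltn_ord i) (ltn_ord j)).
have hB : entries_le B M by move=> i j; rewrite mxE; case: (hg i j (ltn_ord i) (ltn_ord j)).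
have [t [s [D [he ht hD hm]]]] := hP n0 k0 n0 hA hB.
have em : nth 0 (row_major A ++ row_major B) = m.
  apply: boolp.funext => x; rewrite nth_cat size_row_major.
  case: (ltnP x (n * k)) => h1.
    have hi : x %/ k < n by rewrite ltn_divLR.
    have hj : x %% k < k by rewrite ltn_mod.
    have := nth_row_major A (Ordinal hi) (Ordinal hj); rewrite /= -divn_eq mxE /= => ->.
    by have [<- _] := hf _ _ hi hj; rewrite -divn_eq.
  case: (ltnP (x - n * k) (k * n)) => h2.
    have hi : (x - n * k) %/ n < k by rewrite ltn_divLR.
    have hj : (x - n * k) %% n < n by rewrite ltn_mod.
    have := nth_row_major B (Ordinal hi) (Ordinal hj); rewrite /= -divn_eq mxE /= => ->.
    by have [<- _] := hg _ _ hi hj; rewrite -addnA -divn_eq subnKC.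
  by rewrite nth_default ?size_row_major // hz //; lia.
exists (word_length c (n + k + n + M)), t, s; split.
- rewrite /word_length mulnC [X in _ <= X]expnM expnM.
  have hN : 0 < n + k + n + M by lia.
  have h : 2 ^ (trunc_log 2 (n + k + n + M)).+1 <= n.+1 ^ 4.
    rewrite expnS; apply: (@leq_trans (2 * (4 * n))).
      rewrite leq_mul2l /=; apply: leq_trans (trunc_logP (leqnn 2) hN) _.
      by move: kn Mn; clear; lia.
    by rewrite !expnS expn0; clear -n0; nia.
  by case: (c) => [|c'] //; rewrite leq_exp2r.
- by rewrite -em.
- by apply: leq_trans ht _; rewrite ek eM; apply: total_ge.
move=> i j hi hj; have := hm (Ordinal hi) (Ordinal hj); rewrite -addnA /= => ->.
have [[y ->] hmin] := hD (Ordinal hi) (Ordinal hj); split.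
  by exists (val y); rewrite ?ltn_ord // !mxE.
by move=> z hz'; have := hmin (Ordinal hz'); rewrite !mxE.
Qed.

(** At [l = 1] the entry bound is [1 ^ (1 - p) = 1], just enough for boolean products. *)
Lemma allowed_one : allowed n 1.
Proof.
exists 1; rewrite n0 divn1; split=> //; apply/esym/eqP.
by rewrite eqn_leq budget_le // budget_gt0.
Qed.

Lemma allowed_scale pn i : pn = Num.truncn (p * n%:R)%R -> 2 ^ i <= n ->
  exists M, [/\ allowed (n %/ 2 ^ i) M, 2 ^ (i - (deg_exp n pn i + 2)) <= M & M <= n].
Proof.
move=> -> hi; have p2 : 0 < 2 ^ i by rewrite expn_gt0.
exists (budget p (2 ^ i)); split.
- by exists (2 ^ i); rewrite p2.
- by apply: budget_ge => //; apply: leq_trans hi; apply: ltnW; apply: ltn_expl.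
- by apply: leq_trans hi; apply: budget_le.
Qed.

End Oracle.

Theorem theorem3 (R : realType) (p : R) (hp0 : (0 <= p)%R) (hp1 : (p <= 1)%R)
    (P : program) (Mstar : nat -> nat -> nat -> nat -> nat)
    (hP : minplus_in_time P Mstar) :
  exists (Q : program) (F : nat -> nat),
    approx_apsp_in_time p Q F /\
    soft_bigO F (fun n : nat =>
      \max_(1 <= l < n.+1)
        Mstar n (n %/ l) n (Num.truncn (l%:R `^ (1 - p) : R)%R)).
Proof.
(* The exponent of the cap is hidden behind an existential so that its power is never computed. The
   number 2000 generously exceeds all exponents with which values are compared to the cap;
   polylogarithmic exponents count twice there, because [2 * lam <= (n + 1) ^ 2]. *)
have [c hc] := hP; have [KC hKC] : exists KC, 2000 <= KC by exists 2000.
have KC0 : 0 < KC by apply: leq_trans hKC.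
have [Q [cw [T hQ]]] := compile_cmd P MAIN (4 * c) KC0.
pose lam n := (trunc_log 2 n).+1.
exists Q, (fun n => T * (pw (lam n) 420 * total p Mstar n).+1); split; last first.
  (* The power [(2 * lam) ^ 420] is split into a constant and a polylogarithm; as the maximum is
     positive, the additional step is absorbed by the factor 2. *)
  exists (2 * T * 2 ^ 420), 420 => n n0; rewrite -[X in _ <= _ * X]/(total p Mstar n).
  have G0 : 0 < total p Mstar n.
    by apply: leq_trans (total_square hp0 hp1 n0 hc); rewrite muln_gt0 n0.
  have h : 0 < pw (lam n) 420 * total p Mstar n by rewrite muln_gt0 G0 pw_gt0.
  apply: (@leq_trans (T * (2 * (pw (lam n) 420 * total p Mstar n)))).
    by rewrite leq_mul2l; apply/orP; right; move: h; clear; lia.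
  rewrite /pw expnMn; rewrite -/(lam n); move: (2 ^ 420) (lam n ^ 420) (total _ _ _) => x y z.
  by rewrite !mulnA (mulnC T 2).
exists cw => n e n0.
set pn := Num.truncn (p * n%:R)%R.
have pnn : pn <= n by apply: pn_n.
pose E := edge e; pose data := row_major (adjacency e).
have dE (u v : 'I_n) : nth 0 data (u * n + v) = e u v by rewrite nth_row_major mxE.
have data1 k : nth 0 data k <= 1.
  case: (ltnP k (n * n)) => hk; last by rewrite nth_default // size_row_major.
  have hi : k %/ n < n by rewrite ltn_divLR.
  have hj : k %% n < n by rewrite ltn_mod.
  have := dE (Ordinal hi) (Ordinal hj); rewrite /= -divn_eq => ->; exact: leq_b1.
have nC : n <= n.+1 ^ KC.
  by (have h := leq_pexp2l (ltn0Sn n) KC0; apply: leq_trans h; rewrite expn1).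
have wf0 : wf (n.+1 ^ KC) (start n pn data).
  have C1 : 1 <= n.+1 ^ KC by rewrite expn_gt0.
  split=> [x|b i j k] /=; first by case: x => [|[|x]] //=; [apply: leq_trans nC | rewrite nth_nil].
  by case: ifP => // _; apply: leq_trans C1.
have [t [s' [he ht hs']]] : exists t s', [/\ mexec P (n.+1 ^ KC) (n.+1 ^ (4 * c)) MAIN (start n pn data) t s',
    t <= pw (lam n) 420 * total p Mstar n &
    forall u v, u < n -> v < n ->
     (forall b, ar s' 0 0 0 (n * n + u * n + v) = b.+1 -> dl n E b u v) /\
     rounded_ok n (dl n E) pn u v (ar s' 0 0 0 (n * n + u * n + v))].
  apply: (hoare_main n0 (total_square hp0 hp1 n0 hc) hKC (leqnn _) (oracle_of hp0 hp1 n0 hc)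
    (allowed_one hp0 hp1 n0) (E := E) (pn := pn)) => //.
  - by move=> u v hu hv /=; rewrite (dE (Ordinal hu) (Ordinal hv)) /E -edgeE.
  - by move=> i hi; apply: allowed_scale => //; apply: scale_le.
have [|t' [st [h1 h2 h3]]] := hQ n pn data t s' n0 pnn _ data1 he.
  by rewrite size_row_major.
pose w (u v : 'I_n) := ar s' 0 0 0 (n * n + u * n + v).
exists t', st, (fun u v => if w u v is b.+1 then Some b else None); split=> //.
- by apply: leq_trans h2 _; rewrite leq_mul2l ltnS ht orbT.
- move=> u v; have [g1 g2] := hs' u v (ltn_ord u) (ltn_ord v).
  rewrite -/(w u v) in g1 g2; case hD: (dist e u v) => [D|] /=; last first.
    case ew: (w u v) g1 => [|b] //= /(_ b erefl) hb.
    by have := dist_none hD b; rewrite hb.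
  have iD := dist_isd hD; have [j [hj]] := g2 D iD.
  case ew: (w u v) g1 => [|b] //= /(_ b erefl) hb hle; split.
    by rewrite -(isd_B (balls_dl n E) b iD).
  apply: (@Order.POrderTheory.le_trans _ _ (D + 2 * (rounding n pn j).-1)%:R%R).
    by rewrite Num.Theory.ler_nat; move: hle; clear; lia.
  by rewrite GRing.natrD Num.Theory.lerD2l; apply: rounding_le.
- move=> u v; rewrite h3; first by rewrite /= -/(w u v); case: (w u v).
  by have := ltn_ord u; have := ltn_ord v; clear; nia.
Qed.
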